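(* Let $\mathcal{F}$ be an admissable family of rational maps and let $S=S(\mathcal{F})$ be the semigroup generated by $\mathcal{F}$ under composition. Assume that the Lyubich representation of $S$ is right amenable. Then there exists a unique non-atomic Lyubich probability measure $m_S$ for $S$. Moreover, $m_S=m_s$ for every $s\in S$ with $\deg(s)>1$, where $m_s$ is the measure of maximal entropy of $s$.
   Context: Rational maps are non-constant. $S(\mathcal{F})$ consists of all finite non-empty compositions of elements of $\mathcal{F}$. A rational map is exceptional if it has degree $1$ or is Möbius conjugate to $z^n$ ($n\in\mathbb{Z}$), to a Chebyshev polynomial, or to a Lattès map. A collection $\mathcal{F}$ of rational maps is admissable if it contains a non-exceptional element $g$ and either (i) $g$ is not Möbius conjugate to a polynomial; or (ii) $g$ is conjugate to a polynomial but there is another element $g_1\in\mathcal{F}$ such that no Möbius map simultaneously conjugates $g$ and $g_1$ to polynomials; or (iii) $\mathcal{F}$ consists of rational maps simultaneously Möbius conjugate to a family of polynomials $\mathcal{F}'$ and there is a disk $D_{\mathcal{F}}$ centered at $\infty$ with $P(D_{\mathcal{F}})\subset D_{\mathcal{F}}$ for every $P\in\mathcal{F}'$. For a rational map $f$, the Lyubich operator on $C(\overline{\mathbb{C}})$ is $L_f(\phi)(y)=\frac{1}{\deg f}\sum_{f(x)=y}\phi(x)$ (with multiplicity). The Lyubich representation is $\rho:f\mapsto L_f\in End(C(\overline{\mathbb{C}}))$. A complex valued measure $\nu$ on $\overline{\mathbb{C}}$ is a Lyubich measure for $S$ if $\int L_f(\phi)\,d\nu=\int\phi\,d\nu$ for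 all $\phi\in C(\overline{\mathbb{C}})$ and all $f\in S$. Every rational map of degree $>1$ has a unique measure of maximal entropy. For a semigroup $S$, let $L_\infty(S)$ be the Banach space of bounded complex functions on $S$ with sup norm; a mean is a continuous linear functional $M$ with $M(\phi)\ge0$ for $\phi\ge0$ and $\|M\|=M(\chi_S)=1$, where $\chi_S$ is the constant function $1$; $r_s(\phi)(x)=\phi(xs)$. For a bounded homomorphism $\rho:S\to End(B)$, $B$ a Banach space, put $f_{(b,b^* )}(s)=b^*(\rho(s)(b))$ for $(b,b^* )\in B\times B^*$; let $Y_\rho\subset L_\infty(S)$ be the closure of the linear span of all these functions and $X_\rho$ the space generated by $Y_\rho$ and the constants. $\rho$ is right amenable if there is a mean $M$ on $L_\infty(S)$ with $M(r_s\phi)=M(\phi)$ for all $\phi\in X_\rho$, $s\in S$. *)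

(* Defs.v *)
From HB Require Import structures.
From mathcomp Require Import all_boot all_order all_algebra.
From mathcomp Require Import complex.
From mathcomp Require Import all_classical all_reals all_analysis.

Set Implicit Arguments.
Unset Strict Implicit.
Unset Printing Implicit Defensive.

Import Order.TTheory GRing.Theory Num.Theory.
Import numFieldNormedType.Exports.

Local Open Scope classical_set_scope.
Local Open Scope ring_scope.

(* The complex numbers R[i], packaged so that the topology and the normed
   structure of a numFieldType are found. *)
Definition Cx (R : realType) : numClosedFieldType := R[i].

Definition modulus (R : realType) (z : Cx R) : R := Normc.normc z.

Definition sphere (R : realType) := one_point_compactification (Cx R).
HB.instance Definition _ (R : realType) := Choice.on (sphere R).
HB.instance Definition _ (R : realType) := Pointed.on (sphere R).
HB.instance Definition _ (R : realType) := Topological.on (sphere R).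

Definition borel_sphere (R : realType) :=
  g_sigma_algebraType (@open (sphere R)).
HB.instance Definition _ (R : realType) := Measurable.on (borel_sphere R).

Local Notation infty := (@None _) (only parsing).

Section RationalMaps.
Context {R : realType}.
Local Notation C := (Cx R).
Local Notation X := (sphere R).
Implicit Types (p q : {poly C}) (f g : X -> X).

Definition frac_size p q : nat := (maxn (size p) (size q)).-1.

(* The extension of z |-> p(z) / q(z) to the sphere, for coprime p and q. The
   value at infinity is the quotient of the coefficients in the top degree. *)
Definition frac_map p q (x : X) : X :=
  if x is Some z then
    if q.[z] == 0 then infty else Some (p.[z] / q.[z])
  else
    let d := frac_size p q in
    if q`_d == 0 then infty else Some (p`_d / q`_d).

(* Since p and q are coprime, the last condition says that p / q is not
   constant. *)
Definition represents f (pq : {poly C} * {poly C}) : Prop :=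
  [/\ coprimep pq.1 pq.2, f = frac_map pq.1 pq.2 & (0 < frac_size pq.1 pq.2)%N].

Definition rational_map f : Prop := exists pq, represents f pq.

(* A representing pair is unique up to a common scalar factor, and nothing
   below depends on the choice. *)
Definition fraction_of f : {poly C} * {poly C} := xget (0, 0) (represents f).

Definition rat_degree f : nat := frac_size (fraction_of f).1 (fraction_of f).2.

Definition mobius_map f : Prop := rational_map f /\ rat_degree f = 1%N.

Definition conj_by (m f g : X -> X) : Prop := m \o f = g \o m.

Definition mobius_conjugate f g : Prop := exists2 m, mobius_map m & conj_by m f g.

Definition polynomial_map f : Prop :=
  exists p : {poly C}, (1 < size p)%N /\ f = frac_map p 1.

Definition power_map (n : int) : X -> X :=
  match n with
  | Posz k => frac_map 'X^k 1
  | Negz k => frac_map 1 'X^(k.+1)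
  end.

Fixpoint chebyshev (n : nat) : {poly C} :=
  match n with
  | 0 => 1
  | 1 => 'X
  | (m.+1 as k).+1 => 'X *+ 2 * chebyshev k - chebyshev m
  end.

Definition R_independent (w1 w2 : C) : Prop :=
  forall a b : R, (a%:C%C : C) * w1 + (b%:C%C : C) * w2 = 0 ->
    a = 0 /\ b = 0.

Definition period_lattice (w1 w2 : C) : set C :=
  [set z | exists m n : int, z = w1 *~ m + w2 *~ n].

Definition inv_sphere (u : C) : X := if u == 0 then infty else Some u^-1.

(* Holomorphy of a map into the sphere, read in one of the two charts z and
   1 / z of the target. *)
Definition holomorphic_at (T : C -> X) (z : C) : Prop :=
  exists2 h : C^o -> C^o,
    (\forall w \near z, derivable h w 1) &
    (\forall w \near z, T w = Some (h w)) \/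
    (\forall w \near z, T w = inv_sphere (h w)).

(* f is a quotient of the affine map z |-> a z + b of the complex torus C / L,
   where L is the lattice spanned by w1 and w2; the projection of the torus onto
   the sphere is given as an L-periodic map T on C. *)
Definition lattes f : Prop :=
  [/\ rational_map f, (1 < rat_degree f)%N &
    exists (w1 w2 a b : C) (T : C -> X),
      [/\ R_independent w1 w2,
          (forall l, period_lattice w1 w2 l -> period_lattice w1 w2 (a * l)),
          (forall z l, period_lattice w1 w2 l -> T (z + l) = T z),
          (forall z, holomorphic_at T z) /\ (exists z z', T z <> T z') &
          forall z, T (a * z + b) = f (T z)]].

Definition exceptional f : Prop :=
  [\/ rat_degree f = 1%N,
      exists n : int, mobius_conjugate f (power_map n),
      exists n : nat, mobius_conjugate f (frac_map (chebyshev n) 1) |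
      exists2 g, lattes g & mobius_conjugate f g].

Definition disk_at_infty (r : R) : set X :=
  [set x | if x is Some z then r < modulus z else True].

Definition conj_to_poly_by (m f : X -> X) : Prop :=
  exists2 P, polynomial_map P & conj_by m f P.

Definition admissible (F : set (X -> X)) : Prop :=
  exists g, [/\ F g, ~ exceptional g &
   [\/ ~ (exists2 m, mobius_map m & conj_to_poly_by m g),
       (exists2 m, mobius_map m & conj_to_poly_by m g) /\
       (exists g1, [/\ F g1, g1 <> g &
          ~ exists m, [/\ mobius_map m, conj_to_poly_by m g
                        & conj_to_poly_by m g1]]) |
       exists m (r : R), [/\ mobius_map m, 0 < r &
         forall f, F f -> exists P, [/\ polynomial_map P, conj_by m f P &
           P @` disk_at_infty r `<=` disk_at_infty r]]]].

Inductive generated (F : set (X -> X)) : (X -> X) -> Prop :=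
| generated_in f : F f -> generated F f
| generated_comp f g : generated F f -> generated F g -> generated F (f \o g).

Definition semigroup (F : set (X -> X)) : Type := {f | generated F f}.

Definition semigroup_mul (F : set (X -> X)) (s t : semigroup F) :
    semigroup F :=
  exist _ (sval s \o sval t) (generated_comp (svalP s) (svalP t)).

(* For f = p / q, the multiplicity of x as a solution of f x = y: the order of
   vanishing at x of p - y q (of q if y is infinity), seen as a polynomial of
   formal degree deg f. *)
Definition fiber_poly f (y : X) : {poly C} :=
  let: (p, q) := fraction_of f in if y is Some w then p - w *: q else q.

Definition multiplicity f (y x : X) : nat :=
  if x is Some z then mup z (fiber_poly f y)
  else (rat_degree f - (size (fiber_poly f y)).-1)%N.

Definition lyubich f (phi : X -> C) (y : X) : C :=
  (rat_degree f)%:R^-1 *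
    \sum_(x \in f @^-1` [set y]) (multiplicity f y x)%:R * phi x.

Definition lyubich_rep (F : set (X -> X)) (s : semigroup F) :
    (X -> C) -> (X -> C) :=
  lyubich (sval s).

End RationalMaps.

(* Spaces of functions U -> C with the sup norm, given by their carrier D; only
   the values on D of a functional matter. *)
Section Amenability.
Context {R : realType}.
Local Notation C := (Cx R).

Section SupNorm.
Context {U : Type}.
Implicit Types (D A : set (U -> C)) (phi : U -> C) (b : (U -> C) -> C).

Definition unit_ball D : set (U -> C) :=
  [set phi | D phi /\ forall u, modulus (phi u) <= 1].

Definition functional_norms D b : set R :=
  [set modulus (b phi) | phi in unit_ball D].

Definition linear_on D b : Prop :=
  forall (a : C) phi psi, D phi -> D psi ->
    b (fun u => a * phi u + psi u) = a * b phi + b psi.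

Definition dual_space D : set ((U -> C) -> C) :=
  [set b | linear_on D b /\ has_ubound (functional_norms D b)].

Definition bounded_functions : set (U -> C) :=
  [set phi | exists K : R, forall u, modulus (phi u) <= K].

Definition lin_span A : set (U -> C) :=
  [set phi | exists n (a : 'I_n -> C) (v : 'I_n -> U -> C),
     (forall i, A (v i)) /\ phi = (fun u => \sum_(i < n) a i * v i u)].

Definition uniform_closure A : set (U -> C) :=
  [set phi | forall e : R, 0 < e ->
     exists2 psi, A psi & forall u, modulus (phi u - psi u) <= e].

(* The order of Cx R is partial: 0 <= z means that z is real and
   nonnegative. *)
Definition mean (M : (U -> C) -> C) : Prop :=
  [/\ dual_space bounded_functions M,
      forall phi, bounded_functions phi -> (forall u, 0 <= phi u) ->
        0 <= M phi,
      sup (functional_norms bounded_functions M) = 1 &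
      M (fun=> 1) = 1].

End SupNorm.

Context {S T : Type} (mul : S -> S -> S) (B : set (T -> C))
  (rho : S -> (T -> C) -> (T -> C)).

Definition matrix_coefficients : set (S -> C) :=
  [set h | exists b b', [/\ B b, dual_space B b' & h = (fun s => b' (rho s b))]].

Definition Y_space : set (S -> C) :=
  uniform_closure (lin_span matrix_coefficients).

Definition X_space : set (S -> C) :=
  lin_span (Y_space `|` [set h | exists c : C, h = (fun=> c)]).

Definition right_translate (s : S) (h : S -> C) : S -> C :=
  fun x => h (mul x s).

Definition right_amenable : Prop :=
  exists2 M, mean M &
    forall h s, X_space h -> M (right_translate s h) = M h.

End Amenability.

Section Measures.
Context {R : realType}.
Local Notation C := (Cx R).
Local Notation X := (sphere R).
Local Notation bX := (borel_sphere R).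
Implicit Types (mu nu : probability bX R) (f : X -> X).

Definition continuous_functions : set (X -> C) :=
  [set phi | continuous phi].

Definition complex_integral mu (phi : X -> C) : C :=
  (\int[mu]_(x in setT) complex.Re (phi x) +i*
   \int[mu]_(x in setT) complex.Im (phi x))%C.

Definition lyubich_measure (S : set (X -> X)) mu : Prop :=
  forall phi f, continuous phi -> S f ->
    complex_integral mu (lyubich f phi) = complex_integral mu phi.

Definition non_atomic mu : Prop := forall x : X, mu [set x] = 0%E.

Definition same_measure mu nu : Prop :=
  forall A : set bX, measurable A -> mu A = nu A.

Definition invariant_measure f mu : Prop :=
  forall A : set bX, measurable A -> mu (f @^-1` A) = mu A.

Definition measurable_partition k (P : 'I_k -> set bX) : Prop :=
  [/\ forall i, measurable (P i), trivIset setT P & \bigcup_i P i = setT].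

(* The atoms of the join of the partitions f^-i P, for i < n, are indexed by
   words of length n. *)
Definition cylinder f k (P : 'I_k -> set bX) n (w : {ffun 'I_n -> 'I_k}) :
    set bX :=
  [set x | forall i : 'I_n, P (w i) (iter i f x)].

Definition join_entropy mu f k (P : 'I_k -> set bX) (n : nat) : R :=
  - \sum_(w : {ffun 'I_n -> 'I_k})
      fine (mu (cylinder f P w)) * ln (fine (mu (cylinder f P w))).

Definition partition_entropy mu f k (P : 'I_k -> set bX) : R :=
  limn (fun n => n%:R^-1 * join_entropy mu f P n).

Definition entropy mu f : \bar R :=
  ereal_sup [set h | exists k (P : 'I_k -> set bX),
    measurable_partition P /\ h = (partition_entropy mu f P)%:E].

Definition entropy_maximizing f mu : Prop :=
  invariant_measure f mu /\ forall nu, invariant_measure f nu -> (entropy nu f <= entropy mu f)%E.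

(* "The" measure of maximal entropy: uniqueness is part of the notion. *)
Definition max_entropy_measure f mu : Prop :=
  entropy_maximizing f mu /\
  forall nu, entropy_maximizing f nu -> same_measure nu mu.

End Measures.

(* Main.v *)
(* A probability is a Lyubich measure exactly when it is balanced: [int L_s phi = int phi] for all [s] in [S].

   Existence. For an invariant mean [M] the functional [phi |-> M (s |-> L_s phi (x0))] is positive and balanced, so Riesz
   representation gives a balanced measure. An atom of a balanced measure is a point all of whose iterates are totally
   ramified; admissibility, with a suitable [x0], excludes such atoms.

   Uniqueness. For a map [f] of degree [d > 1] one has [ch (f a) y * T a = c y * prod_(f x = y) ch a x], so the logarithmic
   potential [U] of a balanced measure satisfies [U (f a) = d * U a - ln (T a) + cst]. Nonatomic balanced measures give Hoelder
   small mass to small balls, hence have bounded potentials; the potentials of two of them differ by a constant, and averages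
   of logarithmic kernels over circles recover the measures.

   Maximal entropy. Uniqueness makes the Cesaro means of [L^k phi] converge uniformly away from the exceptional points, whence
   [L^n (exp (th * S_n phi)) <= C exp (n * th * (int phi dnu + e))]. A discrete energy estimate gives grid lines whose images
   under [f^k] have length [O (d^(k/2))], so that orbits of length [n] are shadowed by preimages of points of nets of size
   [(6/5 * sqrt d)^m], and [h_mu (f) + th * int phi dmu <= ln d + th * (int phi dnu + e)] for every invariant [mu]
   and small [th]. A partition on whose pieces [f] is injective has cylinders of [nu]-mass at most [d^-n], so [h_nu (f) = ln d]; a maximizing [mu] then
   satisfies [int phi dmu <= int phi dnu] for all [phi], that is [mu = nu]. *)
From HB Require Import structures.
From mathcomp Require Import all_boot all_order all_algebra.
From mathcomp Require Import complex.
From mathcomp Require Import all_classical all_reals all_analysis.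
From mathcomp Require Import measurable_realfun.
From mathcomp Require Import ring lra zify.
Require Import Defs.

Set Implicit Arguments.
Unset Strict Implicit.
Unset Printing Implicit Defensive.
Import Order.TTheory GRing.Theory Num.Theory.
Import numFieldNormedType.Exports.
Local Open Scope classical_set_scope.
Local Open Scope ring_scope.

(** * Complex numbers and the chordal metric *)

(** The tilt by [th * phi] is what identifies the maximizing measure: the bound [h <= ln d] alone
    says nothing about the measures that attain it, whereas a fixed positive [th] turns equality
    into an inequality between integrals, used for [phi] and for [- phi]. The obstacle is that
    orbits of an arbitrary invariant measure must be counted with weights that are controlled only
    along backward orbits of points away from the exceptional ones; shadowing orbits are therefore
    made to pass through net points. A net point met at time [j] costs [d^j] weighted preimages, and
    the net serving the remaining [n - j] steps has size about [(6/5 sqrt d)^(n - j)], less than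
    [d^(n - j)] because [6/5 < sqrt 2]. The factor [6/5] pays for arcs that shrink like [(5/6)^m],
    which makes the successive displacements of the shadowing point summable. No inverse branch is
    chosen anywhere: fibres are lists with multiplicity, and what is known of them is a product
    formula for the chordal distance with bounded factors, which also gives continuity, openness and
    superattraction. *)

Section Modulus.
Context {R : realType}.
Local Notation C := (Cx R).
Implicit Types z w : C.

Definition ofR (r : R) : C := (r%:C)%C.

Lemma normE z : `|z| = ofR (modulus z). Proof. by []. Qed.
Lemma modM z w : modulus (z * w) = modulus z * modulus w.
Proof. exact: Normc.normcM. Qed.
Lemma mod_ge0 z : 0 <= modulus z.
Proof. by case: z => a b; exact: sqrtr_ge0. Qed.
Lemma mod0 : modulus (0 : C) = 0. Proof. exact: Normc.normc0. Qed.
Lemma mod1 : modulus (1 : C) = 1. Proof. exact: Normc.normc1. Qed.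
Lemma mod_eq0 z : (modulus z == 0) = (z == 0).
Proof.
apply/eqP/eqP => [|->]; last exact: mod0.
exact: Normc.eq0_normc.
Qed.
Lemma mod_gt0 z : (0 < modulus z) = (z != 0).
Proof. by rewrite lt_def mod_ge0 mod_eq0 andbT. Qed.
Lemma modD z w : modulus (z + w) <= modulus z + modulus w.
Proof. exact: le_normcD. Qed.
Lemma modN z : modulus (- z) = modulus z.
Proof. exact: normcN. Qed.
Lemma modBC z w : modulus (z - w) = modulus (w - z).
Proof. by rewrite -modN opprB. Qed.
Lemma modV z : modulus (z^-1) = (modulus z)^-1.
Proof. exact: Normc.normcV. Qed.
Lemma modX z n : modulus (z ^+ n) = modulus z ^+ n.
Proof. by elim: n => [|n IH]; rewrite ?expr0 ?mod1// !exprS modM IH. Qed.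
Lemma mod_prod (I : Type) (s : seq I) (P : pred I) (F : I -> C) :
  modulus (\prod_(i <- s | P i) F i) = \prod_(i <- s | P i) modulus (F i).
Proof. by apply: (big_morph (@modulus R)); [exact: modM | exact: mod1]. Qed.
Lemma mod_sum (I : Type) (s : seq I) (P : pred I) (F : I -> C) :
  modulus (\sum_(i <- s | P i) F i) <= \sum_(i <- s | P i) modulus (F i).
Proof.
elim/big_ind2 : _ => [|x a y b xa yb|//]; first by rewrite mod0.
exact: le_trans (modD _ _) (lerD xa yb).
Qed.
Lemma modB_ge z w : modulus z - modulus w <= modulus (z - w).
Proof. by rewrite lerBlDr -{1}(subrK w z) modD. Qed.
Lemma sqr_mod z : modulus z ^+ 2 = complex.Re z ^+ 2 + complex.Im z ^+ 2.
Proof. by case: z => a b; rewrite sqr_sqrtr// addr_ge0// sqr_ge0. Qed.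
Lemma mod_ofR r : modulus (ofR r) = `|r|.
Proof. by rewrite /modulus /= expr0n /= addr0 sqrtr_sqr. Qed.
Lemma Re_le_mod z : `|complex.Re z| <= modulus z.
Proof.
rewrite -(@ler_pXn2r _ 2)// ?nnegrE ?mod_ge0// real_normK ?num_real// sqr_mod.
by rewrite lerDl sqr_ge0.
Qed.
Lemma Im_le_mod z : `|complex.Im z| <= modulus z.
Proof.
rewrite -(@ler_pXn2r _ 2)// ?nnegrE ?mod_ge0// real_normK ?num_real// sqr_mod.
by rewrite lerDr sqr_ge0.
Qed.
Lemma mod_le_ReIm z : modulus z <= `|complex.Re z| + `|complex.Im z|.
Proof.
rewrite -(@ler_pXn2r _ 2)// ?nnegrE ?mod_ge0// ?addr_ge0//.
rewrite sqr_mod sqrrD !real_normK ?num_real// -addrA (addrC (_ *+ 2)) addrA.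
by rewrite lerDl mulrn_wge0// mulr_ge0.
Qed.
(** The norm of [Cx R] takes its values in [Cx R], so balls have complex radii; a positive radius
    there is real, and every later estimate can work with [modulus] and radii in [R]. *)
Lemma nbhs_modP z (A : set C) :
  nbhs z A <-> exists2 r : R, 0 < r & forall w, modulus (w - z) < r -> A w.
Proof.
split => [[e /= e0 zA]|[r r0 H]].
  move: e0; rewrite ltcE/= => /andP[/eqP e1 e2].
  exists (complex.Re e) => // w wz; apply: zA; rewrite /ball_/= distrC.
  by rewrite normE ltcE /= e1 eqxx.
exists (ofR r); first by rewrite /= ltcR.
by move=> w; rewrite /ball_/= distrC normE ltcR => /H.
Qed.

Lemma modulus_continuous : continuous (@modulus R : C -> R).
Proof.
move=> z A /nbhs_ballP[e /= e0 H]; apply/nbhs_modP; exists e => // w wz.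
apply: H; rewrite /ball/=; apply: le_lt_trans wz.
rewrite ler_norml -(modN (w - z)) opprB modB_ge andbT.
by rewrite lerNl opprB modBC modB_ge.
Qed.

Definition mkC (p : R * R) : C := (p.1 +i* p.2)%C.

Lemma mkC_continuous : continuous mkC.
Proof.
move=> -[a b] A /nbhs_modP[r r0 H]; rewrite /nbhs /=.
exists (ball a (r / 2), ball b (r / 2)) => /=.
  by split; apply: nbhsx_ballx; rewrite divr_gt0.
move=> [c d] [/= ac bd]; apply: H; apply: le_lt_trans (mod_le_ReIm _) _.
move: ac bd; rewrite /ball/= => ac bd; rewrite [ltRHS](splitr r).
by rewrite distrC ltrD// distrC.
Qed.

Lemma compact_disc (M : R) : compact [set z : C | modulus z <= M].
Proof.
have cl : closed [set z : C | modulus z <= M].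
  rewrite (_ : [set _ | _] = (@modulus R : C -> R) @^-1` [set x | x <= M])//.
  by apply: closed_comp => [x _|]; [exact: modulus_continuous|exact: closed_le].
apply: (subclosed_compact cl (B := mkC @` (`[- M, M] `*` `[- M, M]))).
  apply: continuous_compact; first exact/continuous_subspaceT/mkC_continuous.
  exact: compact_setX (@segment_compact _ _ _) (@segment_compact _ _ _).
move=> z /= zM; exists (complex.Re z, complex.Im z); last by case: (z).
split; rewrite /= in_itv /= -ler_norml.
  exact: le_trans (Re_le_mod _) zM.
exact: le_trans (Im_le_mod _) zM.
Qed.

Lemma compact_mod_bounded (K : set C) : compact K ->
  exists M, forall z, K z -> modulus z <= M.
Proof.
move=> cK; have := continuous_compact (continuous_subspaceT modulus_continuous) cK.
move=> /compact_bounded[M [_ MP]]; exists (M + 1) => z Kz.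
apply: le_trans (MP _ (ltr_pwDr ltr01 (lexx M)) _ _); last by exists z.
exact: ler_norm.
Qed.
End Modulus.

Section Chordal.
Context {R : realType}.
Local Notation C := (Cx R).
Local Notation X := (sphere R).
Implicit Types (z w : C) (u v : C * C) (x y : X).

Definition vec x : C * C := if x is Some z then (z, 1) else (1, 0).
Definition wedge u v : C := u.1 * v.2 - u.2 * v.1.
Definition nrm u : R := Num.sqrt (modulus u.1 ^+ 2 + modulus u.2 ^+ 2).
(** The sine of the angle between two complex lines of [C^2], a metric of diameter 1. Numerator and
    denominator scale alike, so any lift of a point may replace [vec]. *)
Definition ch x y : R := modulus (wedge (vec x) (vec y)) / (nrm (vec x) * nrm (vec y)).
Definition proj v : X := if v.2 == 0 then None else Some (v.1 / v.2).
Definition scalev (c : C) v : C * C := (c * v.1, c * v.2).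

Lemma vec1S z : (vec (Some z)).1 = z. Proof. by []. Qed.
Lemma vec2S z : (vec (Some z)).2 = 1. Proof. by []. Qed.
Lemma vec1N : (vec None).1 = 1. Proof. by []. Qed.
Lemma vec2N : (vec None).2 = 0. Proof. by []. Qed.
Definition vecE := (vec1S, vec2S, vec1N, vec2N).
Lemma nrm_ge0 u : 0 <= nrm u. Proof. exact: sqrtr_ge0. Qed.
Lemma sqr_nrm u : nrm u ^+ 2 = modulus u.1 ^+ 2 + modulus u.2 ^+ 2.
Proof. by rewrite sqr_sqrtr// addr_ge0// sqr_ge0. Qed.
Lemma nrm_eq0 u : (nrm u == 0) = (u == (0, 0)).
Proof.
rewrite -(sqrf_eq0 (nrm u)) sqr_nrm paddr_eq0 ?sqr_ge0// !sqrf_eq0 !mod_eq0.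
by case: u => a b /=; rewrite xpair_eqE.
Qed.
Lemma nrm_gt0 u : (0 < nrm u) = (u != (0, 0)).
Proof. by rewrite lt_def nrm_ge0 nrm_eq0 andbT. Qed.
Lemma vec_neq0 x : vec x != (0, 0).
Proof. by case: x => [z|]; rewrite /vec xpair_eqE oner_eq0 ?andbF. Qed.
Lemma nrm_vec_gt0 x : 0 < nrm (vec x).
Proof. by rewrite nrm_gt0 vec_neq0. Qed.
Lemma nrm_scale c u : nrm (scalev c u) = modulus c * nrm u.
Proof.
apply/eqP; rewrite -(@eqrXn2 _ 2)// ?mulr_ge0 ?mod_ge0 ?nrm_ge0//.
by rewrite exprMn !sqr_nrm /= !modM !exprMn mulrDr.
Qed.
Lemma nrm_vec_ge1 x : 1 <= nrm (vec x).
Proof.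
rewrite -(@ler_pXn2r _ 2)// ?nnegrE ?nrm_ge0// expr1n sqr_nrm.
by case: x => [z|]; rewrite !vecE mod1 expr1n ?lerDl ?lerDr sqr_ge0.
Qed.
Lemma mod1_le_nrm u : modulus u.1 <= nrm u.
Proof. by rewrite -(@ler_pXn2r _ 2)// ?nnegrE ?nrm_ge0 ?mod_ge0// sqr_nrm lerDl sqr_ge0. Qed.
Lemma mod2_le_nrm u : modulus u.2 <= nrm u.
Proof. by rewrite -(@ler_pXn2r _ 2)// ?nnegrE ?nrm_ge0 ?mod_ge0// sqr_nrm lerDr sqr_ge0. Qed.
Lemma nrm_le u : nrm u <= modulus u.1 + modulus u.2.
Proof.
rewrite -(@ler_pXn2r _ 2)// ?nnegrE ?nrm_ge0// ?addr_ge0 ?mod_ge0//.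
by rewrite sqr_nrm sqrrD -addrA (addrC (_ *+ 2)) addrA lerDl mulrn_wge0// mulr_ge0 ?mod_ge0.
Qed.

Lemma nrmS_le z : nrm (z, 1) <= modulus z + 1.
Proof. by apply: le_trans (nrm_le _) _; rewrite lerD2l le_eqVlt; apply/orP; left; apply/eqP; exact: mod1. Qed.
Lemma mod_le_nrmS z : modulus z <= nrm (z, 1).
Proof. exact: (mod1_le_nrm (z, 1)). Qed.

Definition herm u v : C := u.1 * (v.1^*)%C + u.2 * (v.2^*)%C.

(** The squares of sine and cosine add up to 1. This gives both Cauchy-Schwarz bounds at once, and
    later converts the modulus of the polynomial [<F(w), F(z)>] into a chordal distance. *)
Lemma lagrange_id u v :
  modulus (wedge u v) ^+ 2 + modulus (herm u v) ^+ 2 = nrm u ^+ 2 * nrm v ^+ 2.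
Proof.
rewrite !sqr_nrm !sqr_mod; case: u v => [[a b] [c d]] [[e f] [g h]] /=; ring.
Qed.
Lemma wedge_le u v : modulus (wedge u v) <= nrm u * nrm v.
Proof.
rewrite -(@ler_pXn2r _ 2)// ?nnegrE ?mulr_ge0 ?nrm_ge0 ?mod_ge0//.
by rewrite exprMn -lagrange_id lerDl sqr_ge0.
Qed.
Lemma herm_le u v : modulus (herm u v) <= nrm u * nrm v.
Proof.
rewrite -(@ler_pXn2r _ 2)// ?nnegrE ?mulr_ge0 ?nrm_ge0 ?mod_ge0//.
by rewrite exprMn -lagrange_id lerDr sqr_ge0.
Qed.
Lemma herm_self v : modulus (herm v v) = nrm v ^+ 2.
Proof.
rewrite sqr_nrm !sqr_mod; case: v => [[a b] [c d]] /=.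
rewrite /modulus /herm /=.
transitivity (Num.sqrt ((a ^+ 2 + b ^+ 2 + (c ^+ 2 + d ^+ 2)) ^+ 2)); first by congr Num.sqrt; ring.
by rewrite sqrtr_sqr ger0_norm// !addr_ge0// sqr_ge0.
Qed.
(** Bounding the two [herm] factors on the right by Cauchy-Schwarz, with [|herm v v| = |v|^2] on the
    left, yields the triangle inequality for [ch]. *)
Lemma wedge_tri_id u v (w : C * C) :
  wedge u w * herm v v = wedge u v * herm w v + wedge v w * herm u v.
Proof. rewrite /wedge /herm; ring. Qed.

Lemma chC x y : ch x y = ch y x.
Proof.
rewrite /ch (mulrC (nrm (vec x))) -modN; congr (modulus _ / _).
by rewrite /wedge opprB (mulrC (vec y).2) (mulrC (vec y).1).
Qed.
Lemma ch_ge0 x y : 0 <= ch x y.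
Proof. by rewrite divr_ge0// ?mod_ge0// mulr_ge0// nrm_ge0. Qed.
Lemma ch_le1 x y : ch x y <= 1.
Proof. by rewrite ler_pdivrMr ?mul1r ?wedge_le// mulr_gt0// nrm_vec_gt0. Qed.
Lemma wedge_ch x y : modulus (wedge (vec x) (vec y)) = ch x y * (nrm (vec x) * nrm (vec y)).
Proof. by rewrite divfK// mulf_neq0// gt_eqF// nrm_vec_gt0. Qed.
Lemma chxx x : ch x x = 0.
Proof. by rewrite /ch /wedge (mulrC (vec x).1) subrr mod0 mul0r. Qed.
Lemma ch_eq0 x y : (ch x y == 0) = (x == y).
Proof.
apply/idP/eqP => [|->]; last by rewrite chxx.
rewrite /ch mulf_eq0 invr_eq0 mulf_eq0 !(gt_eqF (nrm_vec_gt0 _)) /= orbF mod_eq0.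
case: x y => [z|] [w|]; rewrite /wedge !vecE ?mulr1 ?mul1r ?mulr0 ?mul0r ?subr0 ?sub0r ?oppr_eq0 ?oner_eq0//.
by rewrite subr_eq0 => /eqP ->.
Qed.
Lemma ch_gt0 x y : (0 < ch x y) = (x != y).
Proof. by rewrite lt_def ch_ge0 ch_eq0 andbT. Qed.
Lemma ch_tri y x (z : X) : ch x z <= ch x y + ch y z.
Proof.
have px := nrm_vec_gt0 x; have py := nrm_vec_gt0 y; have pz := nrm_vec_gt0 z.
rewrite /ch ler_pdivrMr ?mulr_gt0//.
rewrite -(@ler_pM2r _ (nrm (vec y) ^+ 2)) ?exprn_gt0// -herm_self -modM wedge_tri_id.
apply: le_trans (modD _ _) _; rewrite !modM mulrDl mulrDl; apply: lerD.
  rewrite -[leRHS]mulrA -mulrA ler_wpM2l ?mod_ge0// herm_self.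
  apply: le_trans (herm_le _ _) _; rewrite le_eqVlt; apply/orP; left; apply/eqP.
  by field; rewrite !gt_eqF.
rewrite -[leRHS]mulrA -mulrA ler_wpM2l ?mod_ge0// herm_self.
apply: le_trans (herm_le _ _) _; rewrite le_eqVlt; apply/orP; left; apply/eqP.
by field; rewrite !gt_eqF.
Qed.
Lemma ch_ge_sub y x (z : X) : ch x z - ch y z <= ch x y.
Proof. by rewrite lerBlDr ch_tri. Qed.
Lemma ch_dist x y (z : X) : `|ch x z - ch y z| <= ch x y.
Proof. by rewrite ler_norml ch_ge_sub andbT lerNl opprB (chC x y) ch_ge_sub. Qed.
Lemma ch_Some z w : ch (Some z) (Some w) = modulus (z - w) / (nrm (z, 1) * nrm (w, 1)).
Proof. by rewrite /ch /wedge !vecE mulr1 mul1r. Qed.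
Lemma ch_None w : ch None (Some w) = (nrm (w, 1))^-1.
Proof.
rewrite /ch /wedge !vecE mul1r mul0r subr0 mod1.
have -> : nrm (1, 0) = 1 by rewrite /nrm (mod1 : modulus 1 = 1) mod0 expr1n expr0n addr0 sqrtr1.
by rewrite !mul1r.
Qed.
Lemma ch_Some_le z w : ch (Some z) (Some w) <= modulus (z - w).
Proof.
rewrite ch_Some ler_pdivrMr ?mulr_gt0 ?(nrm_vec_gt0 (Some _))//.
rewrite ler_peMr ?mod_ge0//.
by rewrite -[1]mulr1 ler_pM// (nrm_vec_ge1 (Some _)).
Qed.

Lemma vec_proj v : v != (0, 0) -> exists2 c : C, c != 0 & v = scalev c (vec (proj v)).
Proof.
case: v => a b; rewrite /proj /= => ab.
have [b0|b0] := eqVneq b 0.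
  move: ab; rewrite b0 xpair_eqE eqxx andbT => a0.
  by exists a => //; rewrite /scalev /= mulr1 mulr0.
by exists b => //; rewrite /scalev /= mulr1 mulrCA mulfV// mulr1.
Qed.
Lemma proj_vec x : proj (vec x) = x.
Proof. by case: x => [z|]; rewrite /proj /= ?oner_eq0 ?eqxx// divr1. Qed.
Lemma proj_scale c v : c != 0 -> proj (scalev c v) = proj v.
Proof.
move=> c0; rewrite /proj /scalev /= mulf_eq0 (negPf c0) /=.
by case: ifPn => // v0; congr Some; field; rewrite v0 c0.
Qed.
Lemma ch_proj v y : v != (0, 0) ->
  ch (proj v) y * (nrm v * nrm (vec y)) = modulus (wedge v (vec y)).
Proof.
move=> /vec_proj[c c0 e]; have en : nrm v = modulus c * nrm (vec (proj v)).
  by rewrite {1}e nrm_scale.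
have -> : wedge v (vec y) = c * wedge (vec (proj v)) (vec y).
  by rewrite {1}e /wedge /scalev; cbn [fst snd]; ring.
rewrite en.
rewrite modM wedge_ch; ring.
Qed.

Lemma nbhs_chP x (A : set X) :
  nbhs x A <-> exists2 r : R, 0 < r & forall y, ch x y < r -> A y.
Proof.
split; last first.
  case=> r r0 H; case: x H => [z|] H.
    rewrite /nbhs /=; apply/nbhs_modP; exists r => // w wz; apply: H.
    by apply: le_lt_trans (ch_Some_le _ _) _; rewrite modBC.
  exists [set z : C | modulus z <= r^-1] => /=.
    split; first exact: compact_disc.
    rewrite (_ : [set _ | _] = (@modulus R : C -> R) @^-1` [set x | x <= r^-1])//.
    by apply: closed_comp => [x _|]; [exact: modulus_continuous|exact: closed_le].
  move=> [w|] /= [[w' w'r]|//]; last by move=> _; apply: H; rewrite chxx.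
    move=> [<-]; apply: H; rewrite ch_None invf_plt ?posrE ?(nrm_vec_gt0 (Some _))//.
    by apply: lt_le_trans (mod1_le_nrm (w', 1)); rewrite ltNge; apply/negP.
  by [].
case: x => [z|] /=.
  move=> /nbhs_modP[r r0 H]; rewrite /= in H.
  set n := nrm (z, 1); have n0 : 0 < n by exact: (nrm_vec_gt0 (Some z)).
  (* The first bound keeps [y] at distance at least [1 / (2 n)] from infinity, so that its lift has
     norm at most [2 n]; the second then turns chordal closeness into [modulus (w - z) < r]. *)
  exists (Num.min (n^-1 / 2) (r / (2 * n ^+ 2))).
    by rewrite lt_min !divr_gt0 ?invr_gt0// mulr_gt0// exprn_gt0.
  move=> y; rewrite lt_min => /andP[y1 y2].
  have : n^-1 / 2 <= ch None y.
    have := ch_tri y None (Some z); rewrite ch_None -/n (chC y); lra.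
  case: y y1 y2 => [w|] y1 y2; last first.
    by rewrite chxx leNgt divr_gt0// invr_gt0.
  rewrite ch_None => nw; apply: H => /=.
  have w0 : 0 < nrm (w, 1) by exact: (nrm_vec_gt0 (Some w)).
  have nw2 : nrm (w, 1) <= 2 * n.
    rewrite -lef_pV2 ?posrE ?mulr_gt0// invfM mulrC.
    exact: nw.
  rewrite modBC; move: y2; rewrite ch_Some ltr_pdivrMr ?mulr_gt0// => /lt_le_trans; apply.
  rewrite -/n; apply: (@le_trans _ _ (r / (2 * n ^+ 2) * (n * (2 * n)))).
    rewrite ler_wpM2l//; first by rewrite divr_ge0 ?ltW// mulr_gt0// exprn_gt0.
    by rewrite ler_wpM2l// ltW.
  by rewrite le_eqVlt; apply/orP; left; apply/eqP; field; rewrite gt_eqF.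
case=> K [cK _] KA; have [M MP] := compact_mod_bounded cK.
set m := Num.max M 0 + 1.
have M0 : 0 <= Num.max M 0 by rewrite le_max lexx orbT.
have m0 : 0 < m by rewrite /m; lra.
have m1 : 0 < m + 1 by rewrite addr_gt0.
exists (m + 1)^-1; first by rewrite invr_gt0.
move=> [w|] yr; last by apply: KA; right.
apply: KA; left; exists w => // Kw; have := MP _ Kw.
move: yr; rewrite ch_None ltf_pV2 ?posrE ?(nrm_vec_gt0 (Some w)) ?m1//.
move=> mw; have := le_trans (ltW mw) (nrmS_le w); rewrite lerD2r => mw2.
have MM : M <= Num.max M 0 by rewrite le_max lexx.
by rewrite leNgt => /negP; apply; apply: lt_le_trans mw2; rewrite /m; lra.
Qed.
End Chordal.

(** * Topology of the sphere through chordal balls *)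

Section SphereTopology.
Context {R : realType}.
Local Notation C := (Cx R).
Local Notation X := (sphere R).
Implicit Types (x y : X) (r e : R).

Lemma open_chP (A : set X) :
  open A <-> forall x, A x -> exists2 r : R, 0 < r & forall y, ch x y < r -> A y.
Proof.
rewrite openE; split => [H x Ax|H x Ax].
  by apply/nbhs_chP; exact: H.
by apply/nbhs_chP; exact: H.
Qed.

Lemma open_ball_ch x r : open [set y | ch x y < r].
Proof.
apply/open_chP => y /= xy; exists (r - ch x y); first by rewrite subr_gt0.
move=> z yz; apply: le_lt_trans (ch_tri y _ _) _; lra.
Qed.

Lemma closed_chP (A : set X) :
  closed A <-> forall x, (forall r, 0 < r -> exists2 y, A y & ch x y < r) -> A x.
Proof.
split => [cA x H|H]; last first.
  move=> x cx; apply: H => r r0.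
  have /cx[y [Ay xy]] : nbhs x [set y | ch x y < r] by apply/nbhs_chP; exists r.
  by exists y.
apply: cA => B /nbhs_chP[r r0 rB]; have [y Ay xy] := H r r0.
by exists y; split => //; exact: rB.
Qed.

Lemma closed_ball_ch x r : closed [set y | ch x y <= r].
Proof.
apply/closed_chP => y H /=; rewrite leNgt; apply/negP => ry.
have [z /= xz yz] := H (ch x y - r) ltac:(by rewrite subr_gt0).
have := ch_tri z x y; rewrite (chC z); lra.
Qed.

Lemma continuous_chP (f : X -> X) :
  continuous f <-> forall x e, 0 < e ->
    exists2 d : R, 0 < d & forall y, ch x y < d -> ch (f x) (f y) < e.
Proof.
split => [cf x e e0|H x A /nbhs_chP[e e0 eA]].
  have /nbhs_chP : nbhs (f x) [set y | ch (f x) y < e] by apply/nbhs_chP; exists e.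
  by move=> /nbhs_chP/(cf x)/nbhs_chP.
by have [d d0 dH] := H x e e0; apply/nbhs_chP; exists d => // y /dH/eA.
Qed.

Lemma continuousR_chP (f : X -> R) :
  continuous f <-> forall x e, 0 < e ->
    exists2 d : R, 0 < d & forall y, ch x y < d -> `|f x - f y| < e.
Proof.
split => [cf x e e0|H x A /nbhs_ballP[e /= e0 eA]].
  by have /(cf x)/nbhs_chP : nbhs (f x) (ball (f x) e) by apply: nbhsx_ballx.
by have [d d0 dH] := H x e e0; apply/nbhs_chP; exists d => // y /dH/eA.
Qed.

Lemma continuous_ch x : continuous (ch x : X -> R).
Proof.
apply/continuousR_chP => y e e0; exists e => // z yz.
by apply: le_lt_trans yz; rewrite (chC x) (chC x) ch_dist.
Qed.

Lemma lipschitz_continuous (f : X -> X) (L : R) :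
  (forall x y, ch (f x) (f y) <= L * ch x y) -> continuous f.
Proof.
move=> H; apply/continuous_chP => x e e0.
have L0 : 0 < `|L| + 1 by rewrite ltr_pwDr.
exists (e / (`|L| + 1)); first by rewrite divr_gt0.
move=> y xy; apply: le_lt_trans (H x y) _.
apply: (@le_lt_trans _ _ ((`|L| + 1) * ch x y)).
  by rewrite ler_wpM2r ?ch_ge0// (le_trans (ler_norm L))// lerDl.
by rewrite mulrC -ltr_pdivlMr.
Qed.

Lemma sphere_compact : compact [set: X].
Proof. exact: one_point_compactification_compact. Qed.

Lemma closed_sphere_compact (A : set X) : closed A -> compact A.
Proof. by move=> cA; exact: (subclosed_compact cA sphere_compact). Qed.

Lemma sphere_hausdorff : hausdorff_space X.
Proof.
move=> x y cxy; apply/eqP; apply: contrapT => /negP; rewrite -ch_gt0 => xy.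
have e0 : 0 < ch x y / 2 by rewrite divr_gt0.
have Nx z : nbhs z [set w | ch z w < ch x y / 2] by apply/nbhs_chP; exists (ch x y / 2).
have [z [/= xz yz]] := cxy _ _ (Nx x) (Nx y).
by have := ch_tri z x y; rewrite (chC z y); lra.
Qed.

Lemma finite_ball_cover (K : set X) (r : X -> R) : closed K ->
  (forall x, K x -> 0 < r x) ->
  exists s : seq X, (forall x, x \in s -> K x) /\
    forall y, K y -> exists2 x, x \in s & ch x y < r x.
Proof.
move=> cK r0; have := closed_sphere_compact cK; rewrite compact_cover.
move=> /(_ X K (fun x => [set y | ch x y < r x])).
case=> [x _|x Kx|D DK KD]; first exact: open_ball_ch.
  by exists x => //=; rewrite chxx r0.
exists (finmap.enum_fset D); split => [x xD|y Ky].
  by apply/set_mem/DK.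
by have [x /= xD xy] := KD _ Ky; exists x.
Qed.

Lemma continuous_bounded (f : X -> R) : continuous f -> exists M, forall x, `|f x| <= M.
Proof.
move=> cf; have := continuous_compact (continuous_subspaceT cf) sphere_compact.
move=> /compact_bounded[M [_ MP]]; exists (M + 1) => x.
by apply: (MP _ (ltr_pwDr ltr01 (lexx M)) _); exists x.
Qed.

Lemma unif_continuousR (f : X -> R) : continuous f -> forall e, 0 < e ->
  exists2 d : R, 0 < d & forall x y, ch x y < d -> `|f x - f y| < e.
Proof.
move=> /continuousR_chP cf e e0.
have e20 : 0 < e / 2 by rewrite divr_gt0.
pose r x := xget 1 [set d | 0 < d /\ forall y, ch x y < d -> `|f x - f y| < e / 2].
have rP x : 0 < r x /\ forall y, ch x y < r x -> `|f x - f y| < e / 2.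
  rewrite /r; case: xgetP => [d -> //|/=] H.
  by have [d d0 dH] := cf x _ e20; case: (H d).
have [s [_ sP]] : exists s : seq X, (forall x, x \in s -> [set: X] x) /\
    forall y, [set: X] y -> exists2 x, x \in s & ch x y < r x / 2.
  by apply: (finite_ball_cover (r := fun x => r x / 2)) => // x _; rewrite divr_gt0//; case: (rP x).
have [d d0 ds] : exists2 d : R, 0 < d & forall x, x \in s -> d <= r x / 2.
  elim: s {sP} => [|a s [d d0 IH]]; first by exists 1.
  exists (Num.min d (r a / 2)); first by rewrite lt_min d0 divr_gt0//; case: (rP a).
  move=> x; rewrite inE => /orP[/eqP->|/IH xd]; first by rewrite ge_min lexx orbT.
  by rewrite ge_min xd.
exists d => // x y xy; have [z zs zx] := sP x I; have [r0 rH] := rP z.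
have zxr : ch z x < r z by lra.
have zyr : ch z y < r z by have := ch_tri x z y; have := ds _ zs; lra.
rewrite -(subrK (f z) (f x)) -addrA; apply: le_lt_trans (ler_normD _ _) _.
rewrite (splitr e) ltrD ?rH// distrC rH//.
Qed.

Lemma lipR_continuous (f : X -> R) (L : R) :
  (forall x y, `|f x - f y| <= L * ch x y) -> continuous f.
Proof.
move=> H; apply/continuousR_chP => x e e0.
have L0 : 0 < `|L| + 1 by rewrite ltr_pwDr.
exists (e / (`|L| + 1)); first by rewrite divr_gt0.
move=> y xy; apply: le_lt_trans (H x y) _.
apply: (@le_lt_trans _ _ ((`|L| + 1) * ch x y)).
  by rewrite ler_wpM2r ?ch_ge0// (le_trans (ler_norm L))// lerDl.
by rewrite mulrC -ltr_pdivlMr.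
Qed.

(** The plane is a union of segments issuing from 0, and infinity lies in its closure. Connectedness
    will exclude isolated points and drive the clopen argument of shadowing. *)
Lemma sphere_connected : connected [set: X].
Proof.
have cS : continuous (Some : C -> X) by exact: one_point_compactification_some_continuous.
pose seg z : set X := (fun t : R => Some (ofR t * z) : X) @` `[0, 1].
have segc z : connected (seg z).
  apply: connected_continuous_connected; first exact: segment_connected.
  apply: continuous_subspaceT => t; apply: (@continuous_comp R C X); last exact: cS.
  move=> A /nbhs_modP[r r0 H]; apply/nbhs_ballP.
  have z0 : 0 < modulus z + 1 by rewrite ltr_pwDr// mod_ge0.
  exists (r / (modulus z + 1)); first by rewrite /= divr_gt0.
  move=> u; rewrite /ball /= => tu; apply: H.
  rewrite -mulrBl modM -[ofR u - ofR t](rmorphB (@real_complex_def R _)) mod_ofR distrC.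
  apply: (@le_lt_trans _ _ (`|t - u| * (modulus z + 1))).
    by rewrite ler_wpM2l// lerDl.
  by rewrite -ltr_pdivlMr.
have cA : connected (\bigcup_(z in [set: C]) seg z).
  apply: bigcup_connected => //; exists (Some 0) => z _ /=; exists 0 => /=.
    by rewrite in_itv /= lexx ler01.
  by rewrite (_ : ofR 0 = 0)// mul0r.
rewrite (_ : setT = closure (\bigcup_(z in [set: C]) seg z)); first exact: connected_closure.
apply/esym; rewrite -subTset => x _ A /nbhs_chP[r r0 rA].
have zA z : (\bigcup_(z in [set: C]) seg z) (Some z).
  by exists z => //=; exists 1; [rewrite /= in_itv /= lexx ler01|rewrite (_ : ofR 1 = 1)// mul1r].
case: x rA => [z|] rA; first by exists (Some z); split => //; apply: rA; rewrite chxx.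
exists (Some (ofR (r^-1 + 1))); split => //; apply: rA.
have r1 : 0 < r^-1 + 1 by rewrite addr_gt0 ?invr_gt0.
rewrite ch_None invf_plt ?posrE ?(nrm_vec_gt0 (Some _))//.
apply: (@lt_le_trans _ _ (modulus (ofR (r^-1 + 1)))); last exact: mod_le_nrmS.
by rewrite mod_ofR ger0_norm ?ltW// ltrDl.
Qed.

Lemma sphere_clopen (W : set X) : open W -> closed W -> W !=set0 -> W = setT.
Proof.
move=> oW cW W0; have := sphere_connected; rewrite /connected => /(_ W W0); apply.
  by exists W => //; rewrite setTI.
by exists W => //; rewrite setTI.
Qed.

(** Limits along ultrafilters replace the extraction of subsequences: one ultrafilter makes all
    bounded quantities converge simultaneously. *)
Lemma ultra_map_cvg (T : Type) (Y : topologicalType) (F : set_system T) (u : T -> Y)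
    (K : set Y) : UltraFilter F -> compact K -> (forall t, K (u t)) ->
  exists2 y, K y & u @ F --> y.
Proof.
move=> UF cK uK; have PF : ProperFilter F by exact: ultra_proper.
have FK : (u @ F) K by rewrite /fmap /=; apply: (@filterS _ F _ setT (u @^-1` K)) => // [t _|]; [exact: uK|exact: (@filterT _ F _)].
have [y [Ky cy]] := cK (u @ F) _ FK.
exists y => // A yA; have [//|nA] := in_ultra_setVsetC (u @^-1` A) UF.
by have [z [/= zA]] := cy (~` A) A nA yA.
Qed.

Lemma ultra_sphere_cvg (T : Type) (F : set_system T) (u : T -> X) :
  UltraFilter F -> exists x, u @ F --> x.
Proof.
by move=> UF; have [x _ ux] := ultra_map_cvg UF sphere_compact (u := u) (fun=> I); exists x.
Qed.

Lemma ultra_bounded_cvg (T : Type) (F : set_system T) (u : T -> R) (M : R) :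
  UltraFilter F -> (forall t, `|u t| <= M) -> exists x : R, u @ F --> x.
Proof.
move=> UF uM; have [|x _ ux] := ultra_map_cvg UF (@segment_compact R (- M) M) (u := u); last by exists x.
by move=> t; rewrite /= in_itv /= -ler_norml.
Qed.
End SphereTopology.

Section RealContinuous.
Context {R : realType}.
Local Notation X := (sphere R).
Implicit Types (f g : X -> R).

Lemma cont_cst (c : R) : continuous ((fun=> c) : X -> R).
Proof. by apply/continuousR_chP => x e e0; exists 1 => // y _; rewrite subrr normr0. Qed.
Lemma contD f g : continuous f -> continuous g -> continuous (fun x => f x + g x).
Proof. by move=> cf cg a; exact: (@cvgD R R X (nbhs a) _ f g _ _ (cf a) (cg a)). Qed.
Lemma contN f : continuous f -> continuous (fun x => - f x).
Proof. by move=> cf a; exact: (@cvgN R R X (nbhs a) _ f _ (cf a)). Qed.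
Lemma contB f g : continuous f -> continuous g -> continuous (fun x => f x - g x).
Proof. by move=> cf cg; apply: contD => //; exact: contN. Qed.
Lemma contM f g : continuous f -> continuous g -> continuous (fun x => f x * g x).
Proof. by move=> cf cg a; exact: (@cvgM R X (nbhs a) _ f g _ _ (cf a) (cg a)). Qed.
Lemma cont_comp (h : R -> R) f : continuous f -> (forall x, {for f x, continuous h}) ->
  continuous (fun x => h (f x)).
Proof. by move=> cf ch_ a; apply: (@continuous_comp X R R f h a); [exact: cf|exact: ch_]. Qed.
Lemma cont_pre (h : X -> X) f : continuous h -> continuous f -> continuous (fun x => f (h x)).
Proof. by move=> ch_ cf a; apply: (@continuous_comp X X R h f a); [exact: ch_|exact: cf]. Qed.
Lemma cont_sum (I : Type) (s : seq I) (F : I -> X -> R) :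
  (forall i, continuous (F i)) -> continuous (fun x => \sum_(i <- s) F i x).
Proof.
move=> cF; elim: s => [|i s IH].
  by rewrite (_ : (fun=> _) = fun=> 0); [exact: cont_cst|apply/funext => x; rewrite big_nil].
rewrite (_ : (fun=> _) = fun x => F i x + \sum_(j <- s) F j x); first exact: contD.
by apply/funext => x; rewrite big_cons.
Qed.
Lemma cont_prod (I : Type) (s : seq I) (F : I -> X -> R) :
  (forall i, continuous (F i)) -> continuous (fun x => \prod_(i <- s) F i x).
Proof.
move=> cF; elim: s => [|i s IH].
  by rewrite (_ : (fun=> _) = fun=> 1); [exact: cont_cst|apply/funext => x; rewrite big_nil].
rewrite (_ : (fun=> _) = fun x => F i x * \prod_(j <- s) F j x); first exact: contM.
by apply/funext => x; rewrite big_cons.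
Qed.
Lemma cont_norm f : continuous f -> continuous (fun x => `|f x|).
Proof. by move=> cf; apply: (cont_comp cf) => x; exact: norm_continuous. Qed.
Lemma cont_max f g : continuous f -> continuous g -> continuous (fun x => Num.max (f x) (g x)).
Proof.
move=> cf cg; rewrite (_ : (fun=> _) = fun x => (f x + g x + `|f x - g x|) * 2^-1); last first.
  by apply/funext => x; rewrite maxr_absE.
apply: contM; last exact: cont_cst.
apply: contD; first exact: contD.
by apply: cont_norm; exact: contB.
Qed.
Lemma cont_min f g : continuous f -> continuous g -> continuous (fun x => Num.min (f x) (g x)).
Proof.
move=> cf cg; rewrite (_ : (fun=> _) = fun x => (f x + g x - `|f x - g x|) * 2^-1); last first.
  by apply/funext => x; rewrite minr_absE.
apply: contM; last exact: cont_cst.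
apply: contB; first exact: contD.
by apply: cont_norm; exact: contB.
Qed.
Lemma cont_expR f : continuous f -> continuous (fun x => expR (f x)).
Proof. by move=> cf; apply: (cont_comp cf) => x; exact: continuous_expR. Qed.
End RealContinuous.

(** * Rational maps, fibres and the transfer operator *)

Section SeqSeparation.
Context {R : realType}.
Local Notation X := (sphere R).
Implicit Types (s t : seq X).

Lemma seq_separated s t : (forall x, x \in s -> x \in t -> False) ->
  exists2 r : R, 0 < r & forall x y, x \in s -> y \in t -> r <= ch x y.
Proof.
elim: s => [|a s IH] st; first by exists 1.
have [|r r0 H] := IH; first by move=> x xs; apply: st; rewrite inE xs orbT.
have [r' r'0 H'] : exists2 r : R, 0 < r & forall y, y \in t -> r <= ch a y.
  have : forall y, y \in t -> a != y.
    by move=> y yt; apply/eqP => ay; apply: (st a); rewrite ?inE ?eqxx// ay.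
  elim: t {st H IH} => [|b t IHt] at_; first by exists 1.
  have [|q q0 Hq] := IHt; first by move=> y yt; apply: at_; rewrite inE yt orbT.
  exists (Num.min q (ch a b)); first by rewrite lt_min q0 ch_gt0 at_// inE eqxx.
  move=> y; rewrite inE => /orP[/eqP->|/Hq yt]; first by rewrite ge_min lexx orbT.
  by rewrite ge_min yt.
exists (Num.min r r'); first by rewrite lt_min r0.
move=> x y; rewrite inE => /orP[/eqP->|xs] yt.
  by rewrite ge_min H' ?orbT.
by rewrite ge_min H.
Qed.

(** Pigeonhole: when [d + 1] points are pairwise separated, each point of [s] can be close to at
    most one of them. The radius depends on [d] alone, which makes the bounds on fibres uniform. *)
Lemma far_point (d : nat) : exists2 r : R, 0 < r &
  forall s, (size s <= d)%N -> exists a : X, forall x, x \in s -> r <= ch a x.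
Proof.
pose pt (k : 'I_d.+1) : X := Some (k%:R : Cx R).
have [r r0 H] : exists2 r : R, 0 < r & forall k l, k != l -> r <= ch (pt k) (pt l).
  have : forall (s : seq ('I_d.+1 * 'I_d.+1)), exists2 r : R, 0 < r &
     forall kl, kl \in s -> kl.1 != kl.2 -> r <= ch (pt kl.1) (pt kl.2).
    elim => [|[a b] s [r r0 IH]]; first by exists 1.
    have [<-|ab] := eqVneq a b.
      by exists r => // kl; rewrite inE => /orP[/eqP->|/IH//]; rewrite /= eqxx.
    exists (Num.min r (ch (pt a) (pt b))).
      rewrite lt_min r0 ch_gt0; apply: contraNneq ab => -[] /eqP.
      by rewrite eqr_nat => /eqP/ord_inj ->.
    move=> kl; rewrite inE => /orP[/eqP->|/IH kls] n; first by rewrite ge_min lexx orbT.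
    by rewrite ge_min kls.
  move=> /(_ (enum {: 'I_d.+1 * 'I_d.+1}))[r r0 H]; exists r => // k l kl.
  by apply: (H (k, l)) => //; rewrite mem_enum.
exists (r / 2); first by rewrite divr_gt0.
move=> s sd; apply: contrapT => nex.
have near (k : 'I_d.+1) : exists i : 'I_d, ch (pt k) (nth None s i) < r / 2.
  apply: contrapT => nk; apply: nex; exists (pt k) => x xs.
  rewrite leNgt; apply/negP => kx; apply: nk.
  have xi : (index x s < d)%N by apply: leq_trans sd; rewrite index_mem.
  by exists (Ordinal xi); rewrite /= nth_index.
pose h k := xget (Ordinal (ltn0Sn d)) [set i : 'I_d.+1 | (i < d)%N /\ ch (pt k) (nth None s i) < r / 2].
have hP k : (h k < d)%N /\ ch (pt k) (nth None s (h k)) < r / 2.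
  rewrite /h; case: xgetP => [i _ //|/= n]; have [i ik] := near k.
  by case: (n (widen_ord (leqnSn d) i)); split => //=; exact: ltn_ord.
pose g (k : 'I_d.+1) : 'I_d := Ordinal (hP k).1.
have : ~ injective g.
  by move=> /leq_card; rewrite !card_ord ltnn.
apply => k l kl; apply: contrapT => /eqP nkl; have := H _ _ nkl.
have e : h k = h l by apply: val_inj; exact: (congr1 val kl).
have := (hP k).2; have := (hP l).2; rewrite e => a b.
by have := ch_tri (nth None s (h l)) (pt k) (pt l); rewrite (chC (nth _ _ _) (pt l)); lra.
Qed.

Lemma prod_ch_ge0 (a : X) s : 0 <= \prod_(x <- s) ch a x.
Proof. by apply: prodr_ge0 => x _; exact: ch_ge0. Qed.

Lemma prod_ch_le1 (a : X) s : \prod_(x <- s) ch a x <= 1.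
Proof.
elim: s => [|b s IH]; rewrite ?big_nil// big_cons.
by apply: mulr_ile1; rewrite ?ch_ge0 ?prod_ch_ge0 ?ch_le1.
Qed.

Lemma prod_ch_ge (a : X) s (r : R) : 0 <= r -> (forall x, x \in s -> r <= ch a x) ->
  r ^+ size s <= \prod_(x <- s) ch a x.
Proof.
move=> r0; elim: s => [|b s IH] H; first by rewrite big_nil expr0.
rewrite big_cons exprS; apply: ler_pM; rewrite ?exprn_ge0//.
  by apply: H; rewrite inE eqxx.
by apply: IH => x xs; apply: H; rewrite inE xs orbT.
Qed.

Lemma prod_ch_le (a b : X) s : b \in s -> \prod_(x <- s) ch a x <= ch a b.
Proof.
elim: s => // c s IH; rewrite inE big_cons => /orP[/eqP->|/IH H].
  by rewrite ler_piMr ?ch_ge0// prod_ch_le1.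
apply: le_trans H; rewrite ler_piMl ?ch_le1//; exact: prod_ch_ge0.
Qed.
End SeqSeparation.

(** * Homogeneous forms on [C^2] and their roots on the sphere *)

Section Homogeneous.
Context {R : realType}.
Local Notation C := (Cx R).
Local Notation X := (sphere R).
Implicit Types (p q : {poly C}) (v : C * C) (d : nat).

Definition hom d p v : C := \sum_(i < d.+1) p`_i * v.1 ^+ i * v.2 ^+ (d - i).

Lemma homD d p q v : hom d (p + q) v = hom d p v + hom d q v.
Proof. by rewrite /hom -big_split /=; apply: eq_bigr => i _; rewrite coefD !mulrDl. Qed.
Lemma homZ d c p v : hom d (c *: p) v = c * hom d p v.
Proof. by rewrite /hom mulr_sumr; apply: eq_bigr => i _; rewrite coefZ !mulrA. Qed.
Lemma homN d p v : hom d (- p) v = - hom d p v.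
Proof. by rewrite -scaleN1r homZ mulN1r. Qed.
Lemma hom_scale d p c v : hom d p (scalev c v) = c ^+ d * hom d p v.
Proof.
rewrite /hom mulr_sumr; apply: eq_bigr => i _ /=.
have id_ : (i <= d)%N by rewrite -ltnS.
have -> : c ^+ d = c ^+ i * c ^+ (d - i) by rewrite -exprD subnKC.
rewrite !exprMn; ring.
Qed.
Lemma hom_Some d p z : (size p <= d.+1)%N -> hom d p (vec (Some z)) = p.[z].
Proof.
move=> sp; rewrite (horner_coef_wide _ sp); apply: eq_bigr => i _.
by rewrite !vecE expr1n mulr1.
Qed.
Lemma hom_None d p : hom d p (vec None) = p`_d.
Proof.
rewrite /hom big_ord_recr /= big1 ?add0r => [|i _].
  by rewrite !expr1n subnn expr0 !mulr1.
by rewrite expr0n subn_eq0 leqNgt ltn_ord /= mulr0.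
Qed.
Lemma hom_le d p : exists2 B : R, 0 < B & forall v, modulus (hom d p v) <= B * nrm v ^+ d.
Proof.
exists (\sum_(i < d.+1) modulus p`_i + 1).
  by rewrite ltr_wpDl// sumr_ge0// => i _; exact: mod_ge0.
move=> v; apply: (@le_trans _ _ ((\sum_(i < d.+1) modulus p`_i) * nrm v ^+ d)).
  apply: le_trans (mod_sum _ _ _) _; rewrite mulr_suml; apply: ler_sum => i _.
  rewrite !modM !modX -mulrA ler_wpM2l ?mod_ge0//.
  have id_ : (i <= d)%N by rewrite -ltnS.
  have -> : nrm v ^+ d = nrm v ^+ i * nrm v ^+ (d - i) by rewrite -exprD subnKC.
  rewrite ler_pM ?exprn_ge0 ?mod_ge0// lerXn2r ?nnegrE ?mod_ge0 ?nrm_ge0//.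
    exact: mod1_le_nrm.
  exact: mod2_le_nrm.
by rewrite ler_wpM2r ?exprn_ge0 ?nrm_ge0// lerDl.
Qed.

Definition roots p : seq C := sval (closed_field_poly_normal p).
Lemma rootsE p : p = lead_coef p *: \prod_(z <- roots p) ('X - z%:P).
Proof. exact: (svalP (closed_field_poly_normal p)). Qed.
Lemma size_roots p : p != 0 -> (size (roots p)).+1 = size p.
Proof.
move=> p0; rewrite {2}(rootsE p) size_scale ?lead_coef_eq0//.
by rewrite size_prod_XsubC.
Qed.

(* A polynomial of formal degree [d] vanishes at infinity to the order of its degree defect. *)
Definition hroots d p : seq X :=
  map (@Some C) (roots p) ++ nseq (d - size (roots p)) None.

Lemma size_hroots d p : p != 0 -> (size p <= d.+1)%N -> size (hroots d p) = d.
Proof.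
move=> p0 sp; rewrite size_cat size_map size_nseq subnKC//.
by rewrite -ltnS size_roots.
Qed.

Lemma prod_nseq (K : comNzRingType) (T : Type) (F : T -> K) (n : nat) (a : T) :
  \prod_(x <- nseq n a) F x = F a ^+ n.
Proof. by elim: n => [|n IH]; rewrite ?big_nil// big_cons IH exprS. Qed.

Lemma prod_const_seq (K : comNzRingType) (T : Type) (s : seq T) (a : K) :
  \prod_(x <- s) a = a ^+ size s.
Proof. by elim: s => [|b s IH]; rewrite ?big_nil// big_cons IH exprS. Qed.

(** The sign compensates [wedge v (vec None) = - v.2], once for every root at infinity. *)
Definition hcst d p : C := lead_coef p * (-1) ^+ (d - size (roots p)).

Lemma mod_hcst d p : modulus (hcst d p) = modulus (lead_coef p).
Proof. by rewrite modM modX modN mod1 expr1n mulr1. Qed.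

Lemma hcst_neq0 d p : p != 0 -> hcst d p != 0.
Proof. by move=> p0; rewrite -mod_gt0 mod_hcst mod_gt0 lead_coef_eq0. Qed.

Lemma hom_prod d p v : p != 0 -> (size p <= d.+1)%N ->
  hom d p v = hcst d p * \prod_(x <- hroots d p) wedge v (vec x).
Proof.
move=> p0 sp; have rd : (size (roots p) <= d)%N by rewrite -ltnS size_roots.
have wN : wedge v (vec None) = - v.2 by rewrite /wedge !vecE mulr0 mulr1 sub0r.
have wS z : wedge v (vec (Some z)) = v.1 - v.2 * z by rewrite /wedge !vecE mulr1.
rewrite big_cat /= big_map prod_nseq wN (eq_bigr _ (fun z _ => wS z)) /hcst.
rewrite mulrACA -exprMn mulrN mulN1r opprK.
have [v2|v2] := eqVneq v.2 0.
  have -> : v = scalev v.1 (vec None) by case: v v2 {wN wS} => a b /= ->; rewrite /scalev /= mulr1 mulr0.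
  rewrite hom_scale hom_None [scalev _ _]/scalev !vecE mulr0; cbn [fst snd].
  have [rd'|rd'] := ltnP (size (roots p)) d.
    rewrite nth_default; last by rewrite -size_roots.
    by rewrite mulr0 expr0n subn_eq0 leqNgt rd' /= !mulr0.
  have ed : size (roots p) = d by apply/eqP; rewrite eqn_leq rd rd'.
  rewrite ed subnn expr0 mulr1 mulrC /lead_coef -size_roots//= ed.
  congr (_ * _); rewrite (eq_bigr (fun=> v.1)) => [|z _].
    by rewrite big_const_seq count_predT ed -Monoid.iteropE.
  by rewrite mul0r subr0 mulr1.
set t := v.1 / v.2.
have -> : v = scalev v.2 (vec (Some t)).
  by case: (v) @t v2 => a b t /= b0; rewrite /scalev /= mulr1 mulrCA mulfV// mulr1.
rewrite hom_scale hom_Some// {1}(rootsE p) hornerZ horner_prod [scalev _ _]/scalev !vecE; cbn [fst snd].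
rewrite -{1}(subnK rd) exprD mulr1 mulrCA -!mulrA; congr (_ * _); rewrite (mulrC (v.2 ^+ (d - _))).
rewrite mulrA; congr (_ * _).
transitivity (\prod_(z <- roots p) (v.2 * (t - z))).
  rewrite big_split /= big_const_seq count_predT -Monoid.iteropE; congr (_ * _).
  by apply: eq_bigr => z _; rewrite !hornerE.
by apply: eq_bigr => z _; rewrite mulrBr /t mulrA.
Qed.
End Homogeneous.

(** * Lifts of rational maps and the chordal product formula *)

Section Pairs.
Context {R : realType}.
Local Notation C := (Cx R).
Local Notation X := (sphere R).
Implicit Types (pq rs : {poly C} * {poly C}) (v : C * C) (x y a : X).

Definition deg pq : nat := frac_size pq.1 pq.2.
Definition Fhat pq v : C * C := (hom (deg pq) pq.1 v, hom (deg pq) pq.2 v).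
Definition pmap pq : X -> X := frac_map pq.1 pq.2.
Definition good pq : Prop := coprimep pq.1 pq.2 /\ (0 < deg pq)%N.

Lemma size1_deg pq : (size pq.1 <= (deg pq).+1)%N.
Proof. by rewrite (leq_trans (leq_maxl _ (size pq.2)))// leqSpred. Qed.
Lemma size2_deg pq : (size pq.2 <= (deg pq).+1)%N.
Proof. by rewrite (leq_trans (leq_maxr (size pq.1) _))// leqSpred. Qed.

Lemma pmapE pq x : pmap pq x = proj (Fhat pq (vec x)).
Proof.
case: x => [z|]; rewrite /pmap /proj /Fhat; cbn [fst snd].
  by rewrite !hom_Some ?size1_deg ?size2_deg.
by rewrite !hom_None.
Qed.

Lemma Fhat_scale pq c v : Fhat pq (scalev c v) = scalev (c ^+ deg pq) (Fhat pq v).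
Proof. by rewrite /Fhat !hom_scale. Qed.

Lemma Fhat_vec_neq0 pq x : good pq -> Fhat pq (vec x) != (0, 0).
Proof.
case=> cpq d0; case: x => [z|]; rewrite /Fhat xpair_eqE.
  rewrite !hom_Some ?size1_deg ?size2_deg//; apply/negP => /andP[p0 q0].
  by have := coprimep_root cpq p0; rewrite q0.
rewrite !hom_None; apply/negP => /andP[/eqP p0 /eqP q0].
have lt (r : {poly C}) : (size r <= (deg pq).+1)%N -> r`_(deg pq) = 0 -> (size r <= deg pq)%N.
  move=> s1 r0; rewrite leqNgt; apply/negP => s2.
  have e : size r = (deg pq).+1 by apply/eqP; rewrite eqn_leq s1 s2.
  have : lead_coef r == 0 by rewrite /lead_coef e /= r0.
  by rewrite lead_coef_eq0 -size_poly_eq0 e.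
have : (maxn (size pq.1) (size pq.2) <= deg pq)%N.
  by rewrite geq_max !lt ?size1_deg ?size2_deg.
by move: d0; rewrite /deg /frac_size; case: maxn => //= n _; rewrite ltnn.
Qed.

Lemma Fhat_neq0 pq v : good pq -> v != (0, 0) -> Fhat pq v != (0, 0).
Proof.
move=> g /vec_proj[c c0 ->]; rewrite Fhat_scale -nrm_eq0 nrm_scale mulf_eq0.
by rewrite mod_eq0 expf_eq0 (negPf c0) andbF /= nrm_eq0 Fhat_vec_neq0.
Qed.

Definition fibpoly pq y : {poly C} := if y is Some w then pq.1 - w *: pq.2 else pq.2.

Lemma size_fibpoly pq y : (size (fibpoly pq y) <= (deg pq).+1)%N.
Proof.
case: y => [w|]; last exact: size2_deg.
rewrite (leq_trans (size_polyD _ _))// geq_max size1_deg size_polyN.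
by rewrite (leq_trans (size_scale_leq _ _))// size2_deg.
Qed.

Lemma fibpoly_neq0 pq y : good pq -> fibpoly pq y != 0.
Proof.
move=> [cpq d0]; apply/negP => /eqP h0; move: d0; rewrite lt0n => /negP; apply.
have q1 : size pq.2 = 1 /\ (size pq.1 <= 1)%N \/ pq.2 = 0 /\ size pq.1 = 1.
  case: y h0 => [w|] /= h0; last first.
    by right; split => //; move: cpq; rewrite h0 coprimep0 -size_poly_eq1 => /eqP.
  have s1 : size pq.2 = 1.
    apply/eqP; have := cpq; move/eqP: h0; rewrite subr_eq0 => /eqP ->.
    have [->|w0] := eqVneq w 0; last by rewrite coprimepZl// coprimepp.
    by rewrite scale0r coprime0p -size_poly_eq1.
  left; split => //; move/eqP: h0; rewrite subr_eq0 => /eqP ->.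
  by apply: leq_trans (size_scale_leq _ _) _; rewrite s1.
rewrite /deg /frac_size; case: q1 => [[-> sp]|[-> ->]]; last by rewrite size_poly0.
by move: sp; case: (size pq.1) => [|[|]].
Qed.

Definition fibl pq y : seq X := hroots (deg pq) (fibpoly pq y).
(** Norm distortion of the lift [Fhat]. Both norms have degree [deg pq] in the chosen lift of [a],
    so this is a function on the sphere. *)
Definition Tf pq a : R := nrm (Fhat pq (vec a)) / nrm (vec a) ^+ deg pq.
Definition cst pq y : R := modulus (lead_coef (fibpoly pq y)) *
  \prod_(x <- fibl pq y) nrm (vec x) / nrm (vec y).

Lemma size_fibl pq y : good pq -> size (fibl pq y) = deg pq.
Proof. by move=> g; rewrite size_hroots ?size_fibpoly ?fibpoly_neq0. Qed.

Lemma wedge_Fhat pq y : good pq -> exists2 c : C, c != 0 /\ modulus c = modulus (lead_coef (fibpoly pq y)) &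
  forall v, wedge (Fhat pq v) (vec y) = c * \prod_(x <- fibl pq y) wedge v (vec x).
Proof.
move=> g; have h0 := fibpoly_neq0 y g; have sh := size_fibpoly pq y.
have E v : wedge (Fhat pq v) (vec y) = (if y is Some _ then 1 else -1) * hom (deg pq) (fibpoly pq y) v.
  rewrite /wedge /Fhat; case: y {h0 sh} => [w|]; rewrite !vecE /=.
    rewrite homD homN homZ mul1r; ring.
  by rewrite mulr0 mulr1 sub0r mulN1r.
pose e : C := if y is Some _ then 1 else -1.
have me : modulus e = 1 by rewrite /e; case: (y) => [_|]; rewrite ?modN; exact: mod1.
exists (e * hcst (deg pq) (fibpoly pq y)).
  split; last by rewrite modM mod_hcst me mul1r.
  by rewrite mulf_neq0 ?hcst_neq0// -mod_gt0 me.
by move=> v; rewrite E (hom_prod _ h0 sh) mulrA.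
Qed.

Lemma nrm_Fhat_gt0 pq a : good pq -> 0 < nrm (Fhat pq (vec a)).
Proof. by move=> g; rewrite nrm_gt0 Fhat_vec_neq0. Qed.

Lemma Tf_gt0 pq a : good pq -> 0 < Tf pq a.
Proof. by move=> g; rewrite divr_gt0 ?nrm_Fhat_gt0// exprn_gt0// nrm_vec_gt0. Qed.

Lemma cst_gt0 pq y : good pq -> 0 < cst pq y.
Proof.
move=> g; rewrite /cst mulr_gt0//; last by rewrite invr_gt0 nrm_vec_gt0.
rewrite mulr_gt0//; first by rewrite mod_gt0 lead_coef_eq0 fibpoly_neq0.
by apply: prodr_gt0 => x _; exact: nrm_vec_gt0.
Qed.

(** Both sides are the normalized modulus of [wedge (Fhat pq v) (vec y)], a form of degree [deg pq]
    in [v] whose zeros are the fibre over [y]. *)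
Lemma key_id pq a y : good pq ->
  ch (pmap pq a) y * Tf pq a = cst pq y * \prod_(x <- fibl pq y) ch a x.
Proof.
move=> g; have [c [_ cl] E] := wedge_Fhat y g.
have := ch_proj y (Fhat_vec_neq0 a g); rewrite -pmapE E modM cl mod_prod.
have -> : \prod_(i <- fibl pq y) modulus (wedge (vec a) (vec i)) =
  (\prod_(i <- fibl pq y) ch a i) * (nrm (vec a) ^+ deg pq * \prod_(i <- fibl pq y) nrm (vec i)).
  rewrite -[in X in _ ^+ X](size_fibl y g).
  elim: (fibl pq y) => [|b s IH]; first by rewrite !big_nil expr0 !mulr1.
  rewrite !big_cons IH wedge_ch exprS; ring.
move=> H.
have y0 : nrm (vec y) != 0 by rewrite gt_eqF ?nrm_vec_gt0.
have a0 : nrm (vec a) ^+ deg pq != 0 by rewrite gt_eqF ?exprn_gt0 ?nrm_vec_gt0.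
rewrite /Tf /cst; apply: (mulIf y0); apply: (mulIf a0).
move: H y0 a0; move: (ch _ y) (nrm (Fhat _ _)) (nrm (vec a) ^+ _) (nrm (vec y))
  (\prod_(i <- _) nrm _) (\prod_(i <- _) ch _ _) (modulus _) => u f A N P Q m H y0 a0.
transitivity (u * (f * N)); first by field.
by rewrite H; field.
Qed.

Lemma fiblP pq a y : good pq -> (a \in fibl pq y) = (pmap pq a == y).
Proof.
move=> g; rewrite -ch_eq0 -(mulIr_eq0 _ (mulIf (lt0r_neq0 (Tf_gt0 a g)))) key_id//.
rewrite mulf_eq0 (gt_eqF (cst_gt0 y g)) /= prodf_seq_eq0.
apply/idP/hasP => [ay|[x xs /=]]; last by rewrite ch_eq0 => /eqP ->.
by exists a => //=; rewrite chxx.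
Qed.

(** For the lower bound: the fibres over 0 and over infinity are disjoint, so every [a] is at
    distance at least [r / 2] from one of them, and the product formula over that base point,
    together with [ch <= 1], bounds [Tf] from below. *)
Lemma Tf_bound pq : good pq -> exists2 b : R, 0 < b & forall a, b <= Tf pq a <= b^-1.
Proof.
have half (u v w t : R) : t <= w -> w <= u + v -> u < t / 2 -> t / 2 <= v by move=> *; lra.
move=> g; have [B1 B10 H1] := hom_le (deg pq) pq.1; have [B2 B20 H2] := hom_le (deg pq) pq.2.
have up a : Tf pq a <= B1 + B2.
  rewrite ler_pdivrMr ?exprn_gt0 ?nrm_vec_gt0//; apply: le_trans (nrm_le _) _.
  by rewrite mulrDl lerD//; [exact: H1|exact: H2].
have [r r0 sep] : exists2 r : R, 0 < r & forall x y, x \in fibl pq (Some 0) -> y \in fibl pq None -> r <= ch x y.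
  by apply: seq_separated => x; rewrite !fiblP// => /eqP ->.
have low a y : (forall x, x \in fibl pq y -> r / 2 <= ch a x) -> cst pq y * (r / 2) ^+ deg pq <= Tf pq a.
  move=> H; have := key_id a y g; have c0 := cst_gt0 y g.
  have h : (r / 2) ^+ deg pq <= \prod_(x <- fibl pq y) ch a x.
    by rewrite -(size_fibl y g) prod_ch_ge// divr_ge0// ltW.
  move=> E; apply: (@le_trans _ _ (ch (pmap pq a) y * Tf pq a)).
    by rewrite E ler_wpM2l// ltW.
  by rewrite ler_piMl ?ch_le1// ltW// Tf_gt0.
pose l := Num.min (cst pq (Some 0)) (cst pq None) * (r / 2) ^+ deg pq.
have l0 : 0 < l by rewrite mulr_gt0 ?exprn_gt0 ?divr_gt0// lt_min !cst_gt0.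
have down a : l <= Tf pq a.
  have p0 : 0 <= (r / 2) ^+ deg pq by rewrite exprn_ge0// divr_ge0// ltW.
  have [H|/existsNP[x /not_implyP[xs /negP]]] := pselect (forall x, x \in fibl pq (Some 0) -> r / 2 <= ch a x).
    by apply: le_trans (low _ _ H); rewrite ler_wpM2r// ge_min lexx.
  rewrite -ltNge => ax; apply: (le_trans _ (low a None _)).
    by rewrite ler_wpM2r// ge_min lexx orbT.
  move=> y ys; rewrite chC in ax; exact: half (sep _ _ xs ys) (ch_tri a x y) ax.
have B0 : 0 < B1 + B2 by rewrite addr_gt0.
exists (Num.min l (B1 + B2)^-1); first by rewrite lt_min l0 invr_gt0.
move=> a; rewrite ge_min down /=; apply: le_trans (up a) _.
by rewrite -[leLHS]invrK lef_pV2 ?posrE ?invr_gt0// ?lt_min ?l0 ?invr_gt0// ge_min lexx orbT.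
Qed.

Lemma exists_far_ch (x y z : X) : ch x y <= 2 * Num.max (ch x z) (ch y z).
Proof.
have := ch_tri z x y; rewrite (chC z y) => h; apply: le_trans h _.
by rewrite mulrDl mul1r lerD// le_max lexx ?orbT.
Qed.

(** The product formula is evaluated at a well chosen [a]: for the upper bound a point far from the
    whole fibre, for the lower bound a preimage of whichever of 0 and infinity is farther from
    [y]. *)
Lemma cst_bound pq : good pq -> exists2 b : R, 0 < b & forall y, b <= cst pq y <= b^-1.
Proof.
move=> g; have [b b0 bT] := Tf_bound g; have [r r0 far] := @far_point R (deg pq).
have up y : cst pq y * r ^+ deg pq <= b^-1.
  have [|a ar] := far (fibl pq y); first by rewrite size_fibl.
  apply: (@le_trans _ _ (cst pq y * \prod_(x <- fibl pq y) ch a x)).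
    by rewrite ler_wpM2l ?(ltW (cst_gt0 _ _))// -(size_fibl y g) prod_ch_ge// ltW.
  rewrite -key_id//; apply: (@le_trans _ _ (1 * Tf pq a)).
    by rewrite ler_wpM2r ?ch_le1// ltW// Tf_gt0.
  by rewrite mul1r; case/andP: (bT a).
have dn a y : b * ch (pmap pq a) y <= cst pq y.
  apply: (@le_trans _ _ (ch (pmap pq a) y * Tf pq a)).
    by rewrite mulrC ler_wpM2l ?ch_ge0//; case/andP: (bT a).
  rewrite key_id// ler_piMr ?(ltW (cst_gt0 _ _))//.
  exact: prod_ch_le1.
have g0 : (0 < deg pq)%N by case: g.
have sur y : exists a, pmap pq a = y.
  have sy := size_fibl y g; exists (nth None (fibl pq y) 0).
  by apply/eqP; rewrite -fiblP// mem_nth// sy.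
have [a0 e0] := sur (Some 0); have [a1 e1] := sur None.
have c01 : ch (Some 0 : X) None = 1.
  by rewrite chC ch_None (_ : nrm _ = 1) ?invr1// /nrm; cbn [fst snd]; rewrite (mod1 : modulus 1 = 1) mod0 expr1n expr0n add0r sqrtr1.
have low y : b / 2 <= cst pq y.
  have := exists_far_ch (Some 0) None y; rewrite c01 -{1}e0 -e1 => h.
  have h0 := dn a0 y; have h1 := dn a1 y.
  have : b * Num.max (ch (pmap pq a0) y) (ch (pmap pq a1) y) <= cst pq y.
    by rewrite maxEle; case: ifP.
  by apply: le_trans; rewrite ler_pM2l//; move: h; rewrite -/(pmap pq a0); lra.
have B0 : 0 < b^-1 / r ^+ deg pq by rewrite divr_gt0 ?invr_gt0 ?exprn_gt0.
exists (Num.min (b / 2) (b^-1 / r ^+ deg pq)^-1); first by rewrite lt_min divr_gt0//= invr_gt0.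
move=> y; rewrite ge_min low /=; apply: (@le_trans _ _ (b^-1 / r ^+ deg pq)).
  by rewrite ler_pdivlMr ?exprn_gt0.
by rewrite -[leLHS]invrK lef_pV2 ?posrE ?invr_gt0// ?lt_min ?divr_gt0 ?invr_gt0// ge_min lexx orbT.
Qed.

(** Substitution into the homogenization of degree [d], so that the lift of a composite is the
    composite of the lifts. *)
Definition comp1 (d : nat) (p : {poly C}) rs : {poly C} :=
  \sum_(i < d.+1) p`_i *: (rs.1 ^+ i * rs.2 ^+ (d - i)).
Definition cpair pq rs := (comp1 (deg pq) pq.1 rs, comp1 (deg pq) pq.2 rs).

Lemma size_expr_le (p : {poly C}) e n : (size p <= e.+1)%N -> (size (p ^+ n) <= (n * e).+1)%N.
Proof.
move=> sp; apply: leq_trans (size_poly_exp_leq _ _) _; rewrite ltnS mulnC leq_mul//.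
by case: (size p) sp.
Qed.

Lemma size_comp1 d p rs : (size (comp1 d p rs) <= (d * deg rs).+1)%N.
Proof.
apply: leq_trans (size_sum _ _ _) _; apply/bigmax_leqP => i _.
apply: leq_trans (size_scale_leq _ _) _; apply: leq_trans (size_polyMleq _ _) _.
have id_ : (i <= d)%N by rewrite -ltnS.
have := size_expr_le i (size1_deg rs); have := size_expr_le (d - i) (size2_deg rs).
have : (i * deg rs + (d - i) * deg rs = d * deg rs)%N by rewrite -mulnDl subnKC.
lia.
Qed.

Lemma coefM_top (p q : {poly C}) m n : (size p <= m.+1)%N -> (size q <= n.+1)%N ->
  (p * q)`_(m + n) = p`_m * q`_n.
Proof.
move=> sp sq; rewrite coefM (bigD1 (inord m)) //= inordK ?ltnS ?leq_addr// addKn.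
rewrite big1 ?addr0// => i; rewrite -val_eqE /= inordK ?ltnS ?leq_addr// => im.
have [mi|mi] := ltnP m i; first by rewrite [p`_i]nth_default ?mul0r// (leq_trans sp).
rewrite [q`__]nth_default ?mulr0//; apply: leq_trans sq _.
have : (i < m)%N by rewrite ltn_neqAle im.
lia.
Qed.

Lemma coefX_top (p : {poly C}) m n : (size p <= m.+1)%N -> (p ^+ n)`_(n * m) = p`_m ^+ n.
Proof.
move=> sp; elim: n => [|n IH]; first by rewrite !expr0 mul0n coef1.
by rewrite !exprS mulSn coefM_top ?size_expr_le// IH.
Qed.

Lemma hom_comp1 d p rs x :
  hom (d * deg rs) (comp1 d p rs) (vec x) = hom d p (Fhat rs (vec x)).
Proof.
case: x => [z|].
  rewrite hom_Some ?size_comp1// /comp1 horner_sum /hom; apply: eq_bigr => i _.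
  rewrite hornerZ hornerM !horner_exp /Fhat; cbn [fst snd].
  by rewrite !hom_Some ?size1_deg ?size2_deg// mulrA.
rewrite hom_None /comp1 coef_sum /hom; apply: eq_bigr => i _.
have id_ : (i <= d)%N by rewrite -ltnS.
have e : (d * deg rs = i * deg rs + (d - i) * deg rs)%N by rewrite -mulnDl subnKC.
rewrite coefZ e coefM_top ?size_expr_le ?size1_deg ?size2_deg//.
by rewrite !coefX_top ?size1_deg ?size2_deg// /Fhat; cbn [fst snd]; rewrite !hom_None mulrA.
Qed.

(** No degree is lost: the two coefficients of formal top degree are the coordinates of the composed
    lift at infinity, and that vector is nonzero. *)
Lemma deg_cpair pq rs : good pq -> good rs -> deg (cpair pq rs) = (deg pq * deg rs)%N.
Proof.
move=> g h; have s1 := size_comp1 (deg pq) pq.1 rs; have s2 := size_comp1 (deg pq) pq.2 rs.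
have : Fhat pq (Fhat rs (vec None)) != (0, 0) by rewrite Fhat_neq0// Fhat_neq0// vec_neq0.
rewrite /Fhat xpair_eqE -!hom_comp1 !hom_None negb_and => n0.
have big (p : {poly C}) (k : nat) : p`_k != 0 -> (k < size p)%N.
  by move=> pk; rewrite ltnNge; apply: contraNN pk => sp; rewrite nth_default.
rewrite /deg /frac_size /cpair; cbn [fst snd].
have m1 : (maxn (size (comp1 (deg pq) pq.1 rs)) (size (comp1 (deg pq) pq.2 rs)) <= (deg pq * deg rs).+1)%N.
  by rewrite geq_max s1 s2.
have m2 : (deg pq * deg rs < maxn (size (comp1 (deg pq) pq.1 rs)) (size (comp1 (deg pq) pq.2 rs)))%N.
  by case/orP: n0 => /big h0; rewrite leq_max h0 ?orbT.
have -> : maxn (size (comp1 (deg pq) pq.1 rs)) (size (comp1 (deg pq) pq.2 rs)) = (deg pq * deg rs).+1.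
  by apply/eqP; rewrite eqn_leq m1 m2.
by [].
Qed.

Lemma Fhat_cpair pq rs x : good pq -> good rs ->
  Fhat (cpair pq rs) (vec x) = Fhat pq (Fhat rs (vec x)).
Proof. by move=> g h; rewrite [LHS]/Fhat deg_cpair//= !hom_comp1. Qed.

Lemma good_cpair pq rs : good pq -> good rs -> good (cpair pq rs).
Proof.
move=> g h; split; last by rewrite deg_cpair// muln_gt0 g.2 h.2.
apply/Pdiv.ClosedField.coprimepP => z /eqP p0; apply/negP => /eqP q0.
have : Fhat (cpair pq rs) (vec (Some z)) = (0, 0).
  by rewrite /Fhat !hom_Some ?size1_deg ?size2_deg// p0 q0.
by rewrite Fhat_cpair// => /eqP; rewrite (negPf (Fhat_neq0 g (Fhat_neq0 h (vec_neq0 _)))).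
Qed.

Lemma Fhat_vecE rs x : good rs -> exists2 c : C, c != 0 &
  Fhat rs (vec x) = scalev c (vec (pmap rs x)).
Proof. by move=> h; rewrite pmapE; apply: vec_proj; exact: Fhat_vec_neq0. Qed.

Lemma pmap_cpair pq rs : good pq -> good rs -> pmap (cpair pq rs) = pmap pq \o pmap rs.
Proof.
move=> g h; apply/funext => x; rewrite /= pmapE Fhat_cpair//.
by have [c c0 ->] := Fhat_vecE x h; rewrite Fhat_scale proj_scale ?expf_neq0// -pmapE.
Qed.

Lemma Tf_cpair pq rs x : good pq -> good rs ->
  Tf (cpair pq rs) x = Tf pq (pmap rs x) * Tf rs x ^+ deg pq.
Proof.
move=> g h; rewrite /Tf Fhat_cpair// deg_cpair//.
have [c c0 ->] := Fhat_vecE x h; rewrite Fhat_scale !nrm_scale modX expr_div_n exprMn -exprM mulnC.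
have n0 : nrm (vec (pmap rs x)) ^+ deg pq != 0 by rewrite expf_neq0// gt_eqF// nrm_vec_gt0.
have n1 : nrm (vec x) ^+ (deg rs * deg pq) != 0 by rewrite expf_neq0// gt_eqF// nrm_vec_gt0.
move: n0 n1; move: (nrm (vec (pmap rs x)) ^+ _) (nrm (vec x) ^+ _) (nrm (Fhat _ _)) (modulus c ^+ _).
by move=> N M A B n0 n1; field; rewrite n0 n1.
Qed.

End Pairs.

(** * Fibres as multisets determined by chordal products *)

Section FiberUniqueness.
Context {R : realType}.
Local Notation C := (Cx R).
Local Notation X := (sphere R).
Implicit Types (s t u : seq X) (a b x y : X).

Lemma continuous_prod_ch s : continuous (fun a : X => \prod_(x <- s) ch a x : R).
Proof.
rewrite (_ : (fun _ => _) = fun a => \prod_(x <- s) ch x a); last first.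
  by apply/funext => a; apply: eq_bigr => x _; exact: chC.
by apply: cont_prod => x; exact: continuous_ch.
Qed.

Lemma no_isolated_point b (r : R) : 0 < r -> exists2 a, a != b & ch b a < r.
Proof.
move=> r0; apply: contrapT => H.
have E : [set b] = [set x | ch b x < r].
  apply/seteqP; split => [x /= ->|x /= xr]; first by rewrite chxx.
  by apply: contrapT => /eqP xb; apply: H; exists x.
have cl : closed [set b].
  rewrite (_ : [set b] = [set x | ch b x <= 0]); first exact: closed_ball_ch.
  apply/seteqP; split => [x /= ->|x /=]; first by rewrite chxx.
  by move=> h; apply/esym/eqP; rewrite -ch_eq0 eq_le h ch_ge0.
have : [set b] = [set: X].
  by apply: sphere_clopen => //; [rewrite E; exact: open_ball_ch|exists b].
move=> ET; have h0 : [set b] (Some (0 : C) : X) by rewrite ET.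
have h1 : [set b] (Some (1 : C) : X) by rewrite ET.
by move: h1; rewrite /= -h0 => -[] /eqP; rewrite oner_eq0.
Qed.

(** Evaluation at a point [b] of [t] puts [b] in [s]. The common factor [ch a b] cancels for [a]
    distinct from [b], and at [b] itself by continuity, because [b] is not isolated. *)
Lemma prod_ch_sub s t (c : R) : 0 < c ->
  (forall a, c * \prod_(x <- s) ch a x <= \prod_(x <- t) ch a x) ->
  exists u, perm_eq s (t ++ u).
Proof.
move=> c0; elim: t s => [|b t IH] s H; first by exists s.
have bs : b \in s.
  have : \prod_(x <- s) ch b x == 0.
    rewrite eq_le prod_ch_ge0 andbT -(ler_pM2l c0) mulr0.
    by apply: le_trans (H b) _; rewrite big_cons chxx mul0r.
  by rewrite prodf_seq_eq0 => /hasP[x xs /=]; rewrite ch_eq0 => /eqP ->.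
have ps := perm_to_rem bs.
suff H0 : forall a, c * \prod_(x <- rem b s) ch a x <= \prod_(x <- t) ch a x.
  have [u pu] := IH _ H0.
  by exists u; apply: perm_trans ps _; rewrite /= perm_cons.
have H1 a : a != b -> c * \prod_(x <- rem b s) ch a x <= \prod_(x <- t) ch a x.
  move=> ab; have := H a; rewrite (perm_big _ ps) /= !big_cons mulrCA.
  by rewrite ler_pM2l// ch_gt0.
move=> a; have [->|/H1//] := eqVneq a b.
rewrite -subr_ge0 leNgt; apply/negP => neg.
pose g a : R := \prod_(x <- t) ch a x - c * \prod_(x <- rem b s) ch a x.
have /continuousR_chP cg : continuous g.
  apply: contB; first exact: continuous_prod_ch.
  by apply: contM; [exact: cont_cst|exact: continuous_prod_ch].
have [d d0 gd] := cg b (- g b) ltac:(by rewrite oppr_gt0).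
have [e eb be] := no_isolated_point b d0.
have := gd _ be; rewrite ltr_norml => /andP[h _].
have := H1 _ eb; rewrite -subr_ge0 -/(g e) => h'; move: h h'; rewrite /=; lra.
Qed.

Lemma prod_ch_perm s t (c c' : R) : 0 < c -> 0 < c' ->
  (forall a, c * \prod_(x <- s) ch a x <= \prod_(x <- t) ch a x) ->
  (forall a, c' * \prod_(x <- t) ch a x <= \prod_(x <- s) ch a x) ->
  perm_eq s t.
Proof.
move=> c0 c'0 /(prod_ch_sub c0)[u pu] /(prod_ch_sub c'0)[v pv].
have := perm_size pu; have := perm_size pv; rewrite !size_cat => e1 e2.
have u0 : u = [::].
  move: e2; rewrite e1 -addnA => /eqP; rewrite -{1}[size s]addn0 eqn_add2l eq_sym addn_eq0.
  by move=> /andP[_ /eqP/size0nil].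
by move: pu; rewrite u0 cats0.
Qed.
End FiberUniqueness.

Section Fibers.
Context {R : realType}.
Local Notation C := (Cx R).
Local Notation X := (sphere R).
Implicit Types (f g : X -> X) (a b x y : X).

Definition fib f y : seq X := fibl (fraction_of f) y.

Lemma representsE f pq : represents f pq <-> good pq /\ f = pmap pq.
Proof. by split => [[]|[[]]]. Qed.

Lemma rational_spec f : rational_map f ->
  good (fraction_of f) /\ f = pmap (fraction_of f).
Proof.
by move=> [pq rf]; apply/representsE; rewrite /fraction_of; case: xgetP => [? _ //|/(_ pq)].
Qed.

Lemma rat_degree_gt0 f : rational_map f -> (0 < rat_degree f)%N.
Proof. by move=> /rational_spec[[]]. Qed.

Lemma size_fib f y : rational_map f -> size (fib f y) = rat_degree f.
Proof. by move=> /rational_spec[g _]; exact: size_fibl. Qed.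

Lemma fibP f a y : rational_map f -> (a \in fib f y) = (f a == y).
Proof. by move=> /rational_spec[g e]; rewrite [in RHS]e; exact: fiblP. Qed.

(* The whole theory of a rational map that is used below flows from this
   factorization of the chordal distance. *)
Definition factorizes f (fb : X -> seq X) (T c : X -> R) (m : R) : Prop :=
  [/\ 0 < m, (forall a, m <= T a <= m^-1), (forall y, m <= c y <= m^-1) &
      forall a y, ch (f a) y * T a = c y * \prod_(x <- fb y) ch a x].

Lemma good_factorizes pq : good pq ->
  exists m, factorizes (pmap pq) (fibl pq) (Tf pq) (cst pq) m.
Proof.
move=> g; have [b b0 bT] := Tf_bound g; have [c c0 cT] := cst_bound g.
have m0 : 0 < Num.min b c by rewrite lt_min b0.
exists (Num.min b c); split => //.
- move=> a; have /andP[h1 h2] := bT a; rewrite (le_trans _ h1) ?ge_min ?lexx//=.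
  by apply: le_trans h2 _; rewrite lef_pV2 ?posrE// ge_min lexx.
- move=> a; have /andP[h1 h2] := cT a; rewrite (le_trans _ h1) ?ge_min ?lexx ?orbT//=.
  by apply: le_trans h2 _; rewrite lef_pV2 ?posrE// ge_min lexx orbT.
- by move=> a y; exact: key_id.
Qed.

Lemma factorizes_bounds f fb T c m : factorizes f fb T c m -> forall a y,
  m ^+ 2 * \prod_(x <- fb y) ch a x <= ch (f a) y <= m ^- 2 * \prod_(x <- fb y) ch a x.
Proof.
move=> [m0 HT Hc H] a y; have /andP[T1 T2] := HT a; have /andP[c1 c2] := Hc y.
have T0 : 0 < T a by apply: lt_le_trans T1.
have -> : ch (f a) y = c y * \prod_(x <- fb y) ch a x / T a by rewrite -H mulfK// gt_eqF.
have c0 : 0 < c y by apply: lt_le_trans c1.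
have p0 := prod_ch_ge0 a (fb y).
have -> : c y * \prod_(x <- fb y) ch a x / T a = c y / T a * \prod_(x <- fb y) ch a x by rewrite mulrAC.
apply/andP; split; rewrite ler_wpM2r//.
  rewrite expr2 ler_pM ?(ltW m0)// -[leLHS]invrK lef_pV2// posrE// invr_gt0//.
rewrite -exprVn expr2 ler_pM ?(ltW c0) ?invr_ge0 ?(ltW T0)//.
by rewrite lef_pV2// posrE.
Qed.

(** A fibre with multiplicities is thereby attached to the map and not to a representing pair; this
    also identifies the fibre of a composite. *)
Lemma factorizes_uniq f fb fb' T T' c c' m m' :
  factorizes f fb T c m -> factorizes f fb' T' c' m' -> forall y, perm_eq (fb y) (fb' y).
Proof.
move=> F F' y; have m0 : 0 < m by case: F. have m'0 : 0 < m' by case: F'.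
apply: (@prod_ch_perm _ _ _ (m ^+ 2 * m' ^+ 2) (m ^+ 2 * m' ^+ 2)); rewrite ?mulr_gt0 ?exprn_gt0//.
  move=> a; have /andP[_ h2] := factorizes_bounds F' a y; have /andP[h1 _] := factorizes_bounds F a y.
  rewrite -mulrA mulrCA -ler_pdivlMl ?exprn_gt0//; exact: le_trans h1 h2.
move=> a; have /andP[_ h2] := factorizes_bounds F a y; have /andP[h1 _] := factorizes_bounds F' a y.
rewrite -mulrA -ler_pdivlMl ?exprn_gt0//; exact: le_trans h1 h2.
Qed.

Lemma fib_perm f pq y : good pq -> f = pmap pq -> perm_eq (fib f y) (fibl pq y).
Proof.
move=> g e; have rf : rational_map f by exists pq; apply/representsE.
have [g' e'] := rational_spec rf.
have [m F] := good_factorizes g; have [m' F'] := good_factorizes g'.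
by move: F F'; rewrite -e -e' => F F'; exact: (factorizes_uniq F' F).
Qed.

Lemma rat_degreeE f pq : good pq -> f = pmap pq -> rat_degree f = deg pq.
Proof.
move=> g e; have rf : rational_map f by exists pq; apply/representsE.
by rewrite -(size_fib None rf) -(size_fibl None g); apply: perm_size; exact: fib_perm.
Qed.

Lemma rational_factorizes f : rational_map f -> exists T c m, factorizes f (fib f) T c m.
Proof.
move=> /rational_spec[g e]; have [m F] := good_factorizes g.
by exists (Tf (fraction_of f)), (cst (fraction_of f)), m; rewrite {1}e.
Qed.

Lemma rational_comp f g : rational_map f -> rational_map g -> rational_map (f \o g).
Proof.
move=> /rational_spec[gf ef] /rational_spec[gg eg].
exists (cpair (fraction_of f) (fraction_of g)); apply/representsE; split; first exact: good_cpair.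
by rewrite pmap_cpair// -ef -eg.
Qed.

Lemma rat_degree_comp f g : rational_map f -> rational_map g ->
  rat_degree (f \o g) = (rat_degree f * rat_degree g)%N.
Proof.
move=> /rational_spec[gf ef] /rational_spec[gg eg]; rewrite -(deg_cpair gf gg).
by apply: rat_degreeE; [exact: good_cpair|rewrite pmap_cpair// -ef -eg].
Qed.

Lemma factorizes_comp f g fb gb Tf_ Tg cf cg m m' (d : nat) :
  factorizes f fb Tf_ cf m -> (forall y, size (fb y) = d) -> factorizes g gb Tg cg m' ->
  exists T c m'', factorizes (f \o g) (fun y => flatten [seq gb x | x <- fb y]) T c m''.
Proof.
move=> [m0 HT Hc H] sd [m'0 HT' Hc' H'].
exists (fun a => Tf_ (g a) * Tg a ^+ d), (fun y => cf y * \prod_(x <- fb y) cg x), (m * m' ^+ d).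
have pw u : m' <= u <= m'^-1 -> m' ^+ d <= u ^+ d <= (m' ^+ d)^-1.
  move=> /andP[u1 u2]; have u0 : 0 <= u by apply: le_trans u1; exact: ltW.
  by rewrite -exprVn !lerXn2r ?nnegrE ?invr_ge0 ?(ltW m'0).
have mulb (u v p q : R) : 0 < p -> 0 < q -> p <= u <= p^-1 -> q <= v <= q^-1 -> p * q <= u * v <= (p * q)^-1.
  move=> p0 q0 /andP[u1 u2] /andP[v1 v2]; rewrite invfM !ler_pM ?(ltW p0) ?(ltW q0)//.
    by apply: le_trans u1; exact: ltW.
  by apply: le_trans v1; exact: ltW.
split; first by rewrite mulr_gt0// exprn_gt0.
- by move=> a; apply: (mulb); rewrite ?exprn_gt0//; exact: pw.
- move=> y; apply: (mulb); rewrite ?exprn_gt0// -(sd y).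
  elim: (fb y) => [|b s /andP[I1 I2]]; first by rewrite big_nil expr0 invr1 lexx.
  by rewrite big_cons exprS; apply: (mulb); rewrite ?exprn_gt0 ?I1//.
- move=> a y /=; rewrite mulrA H -!mulrA; congr (_ * _); rewrite -(sd y).
  elim: (fb y) => [|b s IH]; first by rewrite !big_nil expr0 mulr1.
  rewrite /= big_cat /= !big_cons exprS.
  transitivity (ch (g a) b * Tg a * (\prod_(x <- s) ch (g a) x * Tg a ^+ size s)); first by ring.
  by rewrite IH H'; ring.
Qed.

Lemma fib_comp f g y : rational_map f -> rational_map g ->
  perm_eq (fib (f \o g) y) (flatten [seq fib g x | x <- fib f y]).
Proof.
move=> rf rg; have [T [c [m F]]] := rational_factorizes rf.
have [T' [c' [m' F']]] := rational_factorizes rg.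
have [T2 [c2 [m2 F2]]] := factorizes_comp F (fun y => size_fib y rf) F'.
have [T3 [c3 [m3 F3]]] := rational_factorizes (rational_comp rf rg).
exact: (factorizes_uniq F3 F2).
Qed.
End Fibers.

Section Lyubich.
Context {R : realType}.
Local Notation C := (Cx R).
Local Notation X := (sphere R).
Implicit Types (f g : X -> X) (a b x y : X) (phi psi : X -> R).

Definition Lr f phi y : R := (rat_degree f)%:R^-1 * \sum_(x <- fib f y) phi x.

(** Links orders of vanishing to the list [fib], so that weighted sums over fibres become sums over
    lists of constant length [rat_degree f]. *)
Lemma multiplicityE f y x : rational_map f -> multiplicity f y x = count_mem x (fib f y).
Proof.
move=> rf; have [g _] := rational_spec rf; have h0 := fibpoly_neq0 y g.
have Eh : fiber_poly f y = fibpoly (fraction_of f) y by rewrite /fiber_poly; case: (fraction_of f) => p q; case: y {h0}.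
rewrite /multiplicity Eh /fib /fibl /hroots count_cat count_map count_nseq.
case: x => [z|].
  rewrite /= mul0n addn0 {1}(rootsE (fibpoly _ _)) -mul_polyC mupMr; last first.
    by rewrite rootC lead_coef_eq0.
  by rewrite mu_prod_XsubC; apply: eq_count => w /=.
rewrite /= mul1n -size_roots//= /rat_degree (_ : count _ _ = 0%N) ?add0n//.
by rewrite (eq_count (a2 := pred0)) ?count_pred0.
Qed.

Lemma lyubichE f (phi : X -> C) y : rational_map f ->
  lyubich f phi y = (rat_degree f)%:R^-1 * \sum_(x <- fib f y) phi x.
Proof.
move=> rf; rewrite /lyubich; congr (_ * _).
have -> : f @^-1` [set y] = [set` undup (fib f y)].
  by apply/seteqP; split => x /=; rewrite mem_undup fibP// => /eqP.
rewrite -fsbig_seq ?undup_uniq// -[RHS]big_undup_iterop_count /=.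
by apply: eq_bigr => x _; rewrite multiplicityE// mulr_natl.
Qed.

Lemma Re_sum (I : Type) (s : seq I) (F : I -> C) :
  complex.Re (\sum_(i <- s) F i) = \sum_(i <- s) complex.Re (F i).
Proof. by elim: s => [|i s IH]; rewrite ?big_nil// !big_cons -IH; case: (F i) (\sum_(_ <- _) _) => ? ? []. Qed.
Lemma Im_sum (I : Type) (s : seq I) (F : I -> C) :
  complex.Im (\sum_(i <- s) F i) = \sum_(i <- s) complex.Im (F i).
Proof. by elim: s => [|i s IH]; rewrite ?big_nil// !big_cons -IH; case: (F i) (\sum_(_ <- _) _) => ? ? []. Qed.
Lemma natr_ofR n : (n%:R : C) = ofR n%:R.
Proof. by rewrite /ofR rmorph_nat. Qed.
Lemma invr_ofR (r : R) : (ofR r)^-1 = ofR r^-1 :> C.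
Proof. by rewrite /ofR fmorphV. Qed.
Lemma Re_ofRM (r : R) (z : C) : complex.Re (ofR r * z) = r * complex.Re z.
Proof. by case: z => a b /=; rewrite mul0r subr0. Qed.
Lemma Im_ofRM (r : R) (z : C) : complex.Im (ofR r * z) = r * complex.Im z.
Proof. by case: z => a b /=; rewrite mul0r addr0. Qed.

Lemma Re_lyubich f (phi : X -> C) y : rational_map f ->
  complex.Re (lyubich f phi y) = Lr f (fun x => complex.Re (phi x)) y.
Proof. by move=> rf; rewrite lyubichE// natr_ofR invr_ofR Re_ofRM Re_sum. Qed.
Lemma Im_lyubich f (phi : X -> C) y : rational_map f ->
  complex.Im (lyubich f phi y) = Lr f (fun x => complex.Im (phi x)) y.
Proof. by move=> rf; rewrite lyubichE// natr_ofR invr_ofR Im_ofRM Im_sum. Qed.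
Lemma ofR_lyubich f phi y : rational_map f ->
  lyubich f (fun x => ofR (phi x)) y = ofR (Lr f phi y).
Proof.
move=> rf; have := Re_lyubich (fun x => ofR (phi x)) y rf.
have : complex.Im (lyubich f (fun x => ofR (phi x)) y) = 0.
  by rewrite Im_lyubich// /Lr big1 ?mulr0.
move=> h1 h2; by move: h1 h2; case: (lyubich _ _ _) => a b /= -> ->.
Qed.

Lemma degR_neq0 f : rational_map f -> (rat_degree f)%:R != 0 :> R.
Proof. by move=> rf; rewrite pnatr_eq0 -lt0n rat_degree_gt0. Qed.

Lemma Lr_comp f g phi y : rational_map f -> rational_map g ->
  Lr (f \o g) phi y = Lr f (Lr g phi) y.
Proof.
move=> rf rg; rewrite /Lr (perm_big _ (fib_comp y rf rg)) /= big_flatten /= big_map.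
by rewrite rat_degree_comp// natrM invfM -mulrA mulr_sumr.
Qed.

Lemma LrD f phi psi y : Lr f (fun x => phi x + psi x) y = Lr f phi y + Lr f psi y.
Proof. by rewrite /Lr big_split mulrDr. Qed.
Lemma LrZ f c phi y : Lr f (fun x => c * phi x) y = c * Lr f phi y.
Proof. by rewrite /Lr -mulr_sumr mulrCA. Qed.
Lemma Lr_le f phi psi y : (forall x, x \in fib f y -> phi x <= psi x) -> Lr f phi y <= Lr f psi y.
Proof.
move=> H; rewrite /Lr ler_wpM2l ?invr_ge0// big_seq [leRHS]big_seq.
by apply: ler_sum => x; exact: H.
Qed.
Lemma Lr_eq f phi psi y : (forall x, x \in fib f y -> phi x = psi x) -> Lr f phi y = Lr f psi y.
Proof. by move=> H; apply/eqP; rewrite eq_le !Lr_le// => x /H ->. Qed.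
Lemma sum_const_seq (T : Type) (s : seq T) (c : R) : \sum_(x <- s) c = c *+ size s.
Proof. by elim: s => [|b s IH]; rewrite ?big_nil// big_cons IH -mulrS. Qed.
Lemma Lr_cst f c y : rational_map f -> Lr f (fun=> c) y = c.
Proof.
move=> rf; rewrite /Lr sum_const_seq size_fib// -(mulr_natl c) mulrA mulVf ?mul1r// degR_neq0//.
Qed.
Lemma Lr_pull f phi psi y : rational_map f -> Lr f (fun x => phi (f x) * psi x) y = phi y * Lr f psi y.
Proof. by move=> rf; rewrite -LrZ; apply: Lr_eq => x; rewrite fibP// => /eqP ->. Qed.
Lemma Lr_abs_le f phi (B : R) y : rational_map f -> (forall x, `|phi x| <= B) -> `|Lr f phi y| <= B.
Proof.
move=> rf H; rewrite ler_norml -{1}(Lr_cst (- B) y rf) -[X in _ && (_ <= X)](Lr_cst B y rf).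
by rewrite !Lr_le// => x _; have := H x; rewrite ler_norml => /andP[].
Qed.

Lemma cvg_prod_seq (T : Type) (F : set_system T) (FF : Filter F) (I : Type) (r : seq I)
    (u : I -> T -> R) (l : I -> R) : (forall i, u i @ F --> l i) ->
  (fun t => \prod_(i <- r) u i t) @ F --> \prod_(i <- r) l i.
Proof.
move=> H; elim: r => [|i r IH].
  by rewrite big_nil (_ : (fun _ => _) = fun=> 1); [exact: cvg_cst|apply/funext => t; rewrite big_nil].
rewrite big_cons (_ : (fun _ => _) = fun t => u i t * \prod_(j <- r) u j t); first exact: cvgM.
by apply/funext => t; rewrite big_cons.
Qed.
Lemma cvg_sum_seq (T : Type) (F : set_system T) (FF : Filter F) (I : Type) (r : seq I)
    (u : I -> T -> R) (l : I -> R) : (forall i, u i @ F --> l i) ->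
  (fun t => \sum_(i <- r) u i t) @ F --> \sum_(i <- r) l i.
Proof.
move=> H; elim: r => [|i r IH].
  by rewrite big_nil (_ : (fun _ => _) = fun=> 0); [exact: cvg_cst|apply/funext => t; rewrite big_nil].
rewrite big_cons (_ : (fun _ => _) = fun t => u i t + \sum_(j <- r) u j t); first exact: cvgD.
by apply/funext => t; rewrite big_cons.
Qed.

(* Along an ultrafilter the points of a fibre converge; by the factorization the multiset of limits is the limit fibre. *)
Lemma fib_ultra f (F : set_system X) y : rational_map f -> UltraFilter F -> F --> y ->
  exists2 s : nat -> X, (forall i, (fun z => nth None (fib f z) i) @ F --> s i) &
    perm_eq (mkseq s (rat_degree f)) (fib f y).
Proof.
move=> rf UF Fy; have PF : ProperFilter F by exact: ultra_proper.
pose s i : X := xget (None : X) [set x : X | (fun z => nth None (fib f z) i) @ F --> x].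
have sP i : (fun z => nth None (fib f z) i) @ F --> s i.
  rewrite /s; case: xgetP => [x _ //|H]; exfalso.
  by have [x xP] := @ultra_sphere_cvg R _ F (fun z => nth None (fib f z) i) UF; exact: (H x).
exists s => //; have [T [c [m Hf]]] := rational_factorizes rf; have m0 : 0 < m by case: Hf.
set d := rat_degree f.
have eprod a z : \prod_(x <- fib f z) ch a x = \prod_(i <- iota 0 d) ch a (nth None (fib f z) i).
  by rewrite (big_nth None) size_fib// /index_iota subn0.
have L a : (fun z => \prod_(x <- fib f z) ch a x) @ F --> \prod_(x <- mkseq s d) ch a x.
  rewrite big_map (_ : (fun _ => _) = fun z => \prod_(i <- iota 0 d) ch a (nth None (fib f z) i)).
    apply: cvg_prod_seq => i; apply: (@cvg_comp _ _ _ (fun z => nth None (fib f z) i) (ch a) _ (nbhs (s i))).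
      exact: sP.
    exact: (@continuous_ch R a (s i)).
  by apply/funext => z; exact: eprod.
have Lz a : (fun z => ch (f a) z) @ F --> ch (f a) y.
  by apply: (@cvg_comp _ _ _ id (ch (f a)) _ (nbhs y)) => //; exact: (@continuous_ch R (f a) y).
have c1 a : m ^+ 2 * \prod_(x <- mkseq s d) ch a x <= ch (f a) y.
  apply: (@ler_cvg_to X F PF R (fun z => m ^+ 2 * \prod_(x <- fib f z) ch a x) (fun z => ch (f a) z)).
  - by apply: cvgM; [exact: cvg_cst|exact: L].
  - exact: Lz.
  - by apply: nearW => z; case/andP: (factorizes_bounds Hf a z).
have c2 a : ch (f a) y <= m ^- 2 * \prod_(x <- mkseq s d) ch a x.
  apply: (@ler_cvg_to X F PF R (fun z => ch (f a) z) (fun z => m ^- 2 * \prod_(x <- fib f z) ch a x)).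
  - exact: Lz.
  - by apply: cvgM; [exact: cvg_cst|exact: L].
  - by apply: nearW => z; case/andP: (factorizes_bounds Hf a z).
apply: (@prod_ch_perm _ _ _ (m ^+ 2 * m ^+ 2) (m ^+ 2 * m ^+ 2)); rewrite ?mulr_gt0 ?exprn_gt0//.
  move=> a; rewrite -mulrA -ler_pdivlMl ?exprn_gt0//; apply: le_trans (c1 a) _.
  by case/andP: (factorizes_bounds Hf a y).
move=> a; rewrite -mulrA -ler_pdivlMl ?exprn_gt0//; apply: le_trans (c2 a).
by case/andP: (factorizes_bounds Hf a y).
Qed.

(** If continuity failed at [y], the neighbourhoods of [y] traced on the bad set would extend to an
    ultrafilter; along it the fibres converge to the fibre of [y] with multiplicities, and so do the
    sums. *)
Lemma Lr_continuous f phi : rational_map f -> continuous phi -> continuous (Lr f phi).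
Proof.
move=> rf cphi y A LA; apply: contrapT => nB.
have PF : ProperFilter (within (~` (Lr f phi @^-1` A)) (nbhs y)).
  apply: Build_ProperFilter_ex => P /nbhs_chP[r r0 Pr]; apply: contrapT => nP; apply: nB.
  apply/nbhs_chP; exists r => // z yz; apply: contrapT => nz; apply: nP.
  by exists z; exact: Pr.
have [G [UG FG]] := ultraFilterLemma PF.
have Gy : G --> y by move=> B By; apply: FG; rewrite /within /=; apply: filterS By => z Bz _.
have PG : ProperFilter G by exact: ultra_proper.
have [s sP ps] := fib_ultra rf UG Gy.
have : Lr f phi @ G --> Lr f phi y.
  have -> : Lr f phi y = (rat_degree f)%:R^-1 * \sum_(i <- iota 0 (rat_degree f)) phi (s i).
    by rewrite /Lr -(perm_big _ ps) /= big_map.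
  rewrite (_ : Lr f phi = fun z => (rat_degree f)%:R^-1 * \sum_(i <- iota 0 (rat_degree f)) phi (nth None (fib f z) i)).
    apply: cvgM; first exact: cvg_cst.
    apply: cvg_sum_seq => i; apply: (@cvg_comp _ _ _ (fun z => nth None (fib f z) i) phi _ (nbhs (s i))).
      exact: sP.
    exact: cphi.
  by apply/funext => z; rewrite /Lr (big_nth None) size_fib// /index_iota subn0.
move=> /(_ A LA) GA.
have GnA : G (~` (Lr f phi @^-1` A)) by apply: FG; exact: withinT.
have GA' : G (Lr f phi @^-1` A) by exact: GA.
have [z [z1 z2]] := filter_ex (filterI GA' GnA).
exact: z2.
Qed.
End Lyubich.

(** * Measures on the sphere and Riesz representation *)

Section BoundedIntegrals.
Context d {T : measurableType d} {R : realType}.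
Implicit Types (mu : probability T R) (f g : T -> R) (A B : set T).

Definition bmf f : Prop := measurable_fun setT f /\ exists M, forall x, `|f x| <= M.

Lemma bmf_integrable mu f : bmf f -> mu.-integrable setT (EFin \o f).
Proof.
move=> [mf [M fM]]; apply: measurable_bounded_integrable => //.
  by apply: (@le_lt_trans _ _ 1%E); rewrite ?ltry//; exact: probability_le1.
by exists M; split; [exact: num_real|move=> N MN x _; apply: le_trans (fM x) _; exact: ltW].
Qed.

Lemma bmf_cst (c : R) : bmf (fun=> c).
Proof. by split; [exact: measurable_cst|exists `|c|]. Qed.
Lemma bmfD f g : bmf f -> bmf g -> bmf (fun x => f x + g x).
Proof.
move=> [mf [M fM]] [mg [N gN]]; split; first exact: measurable_funD.
by exists (M + N) => x; rewrite (le_trans (ler_normD _ _))// lerD.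
Qed.
Lemma bmfM f g : bmf f -> bmf g -> bmf (fun x => f x * g x).
Proof.
move=> [mf [M fM]] [mg [N gN]]; split; first exact: measurable_funM.
by exists (M * N) => x; rewrite normrM ler_pM.
Qed.
Lemma bmfN f : bmf f -> bmf (fun x => - f x).
Proof.
move=> [mf [M fM]]; split; first exact: measurableT_comp.
by exists M => x; rewrite normrN.
Qed.
Lemma bmfB f g : bmf f -> bmf g -> bmf (fun x => f x - g x).
Proof. by move=> bf bg; apply: bmfD => //; exact: bmfN. Qed.
Lemma bmf_indic A : measurable A -> bmf (\1_A : T -> R).
Proof.
move=> mA; split; first exact: measurable_indic.
by exists 1 => x; rewrite indicE; case: (x \in A); rewrite ?normr1 ?normr0.
Qed.
Lemma bmf_sum (I : Type) (s : seq I) (F : I -> T -> R) :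
  (forall i, bmf (F i)) -> bmf (fun x => \sum_(i <- s) F i x).
Proof.
move=> H; elim: s => [|i s IH].
  by rewrite (_ : (fun=> _) = fun=> 0); [exact: bmf_cst|apply/funext => x; rewrite big_nil].
rewrite (_ : (fun=> _) = fun x => F i x + \sum_(j <- s) F j x); first exact: bmfD.
by apply/funext => x; rewrite big_cons.
Qed.

Definition I_ mu f : R := \int[mu]_(x in setT) f x.

Lemma I_EFin mu f : bmf f -> (\int[mu]_(x in setT) (f x)%:E)%E = (I_ mu f)%:E.
Proof.
move=> bf; rewrite /I_ /Rintegral fineK//.
exact: (integrable_fin_num measurableT (bmf_integrable mu bf)).
Qed.

Lemma I_D mu f g : bmf f -> bmf g -> I_ mu (fun x => f x + g x) = I_ mu f + I_ mu g.
Proof. by move=> bf bg; rewrite /I_ RintegralD//; exact: bmf_integrable. Qed.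
Lemma I_Z mu c f : bmf f -> I_ mu (fun x => c * f x) = c * I_ mu f.
Proof. by move=> bf; rewrite /I_ RintegralZl//; exact: bmf_integrable. Qed.
Lemma I_N mu f : bmf f -> I_ mu (fun x => - f x) = - I_ mu f.
Proof.
move=> bf; rewrite -mulN1r -I_Z//; congr I_; apply/funext => x; by rewrite mulN1r.
Qed.
Lemma I_B mu f g : bmf f -> bmf g -> I_ mu (fun x => f x - g x) = I_ mu f - I_ mu g.
Proof. by move=> bf bg; rewrite I_D ?I_N//; exact: bmfN. Qed.
Lemma I_cst mu c : I_ mu (fun=> c) = c.
Proof. have e : mu setT = 1%E by exact: probability_setT.
rewrite /I_ Rintegral_cst//; suff -> : fine (mu setT) = 1 by rewrite mulr1.
by rewrite -[1]/(fine 1%E); congr fine; exact: e. Qed.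
Lemma I_le mu f g : bmf f -> bmf g -> (forall x, f x <= g x) -> I_ mu f <= I_ mu g.
Proof. by move=> bf bg H; apply: le_Rintegral => //; exact: bmf_integrable. Qed.
Lemma I_abs_le mu f c : bmf f -> (forall x, `|f x| <= c) -> `|I_ mu f| <= c.
Proof.
move=> bf H; rewrite ler_norml -{1}(I_cst mu (- c)) -{2}(I_cst mu c).
by rewrite !I_le//; try exact: bmf_cst; move=> x; have := H x; rewrite ler_norml => /andP[].
Qed.
Lemma I_sum mu (I : Type) (s : seq I) (F : I -> T -> R) :
  (forall i, bmf (F i)) -> I_ mu (fun x => \sum_(i <- s) F i x) = \sum_(i <- s) I_ mu (F i).
Proof.
move=> H; elim: s => [|i s IH].
  rewrite big_nil (_ : (fun=> _) = fun=> 0); first exact: I_cst.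
  by apply/funext => x; rewrite big_nil.
rewrite big_cons -IH -I_D//; last exact: bmf_sum.
by congr I_; apply/funext => x; rewrite big_cons.
Qed.

Definition prob mu A : R := fine (mu A).
Lemma probE mu A : measurable A -> mu A = (prob mu A)%:E.
Proof.
move=> mA; rewrite /prob fineK// ge0_fin_numE//.
by apply: le_lt_trans (probability_le1 mu mA) _; rewrite ltry.
Qed.
Lemma I_indic mu A : measurable A -> I_ mu \1_A = prob mu A.
Proof. by move=> mA; rewrite /I_ /Rintegral integral_indic// setIT. Qed.
Lemma prob_ge0 mu A : 0 <= prob mu A. Proof. by rewrite /prob fine_ge0. Qed.
Lemma prob_le mu A B : measurable A -> measurable B -> A `<=` B -> prob mu A <= prob mu B.
Proof. by move=> mA mB AB; rewrite -lee_fin -!probE// le_measure// inE. Qed.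
Lemma prob_le1 mu A : measurable A -> prob mu A <= 1.
Proof. by move=> mA; rewrite -lee_fin -probE// probability_le1. Qed.
Lemma prob_set0 mu : prob mu set0 = 0.
Proof. by rewrite /prob measure0. Qed.
Lemma prob_setC mu A : measurable A -> prob mu (~` A) = 1 - prob mu A.
Proof.
move=> mA; rewrite -I_indic; last exact: measurableC.
rewrite -(I_indic mu mA) -(I_cst mu 1) -I_B; [|exact: bmf_cst|exact: bmf_indic].
by congr I_; apply/funext => x; rewrite !indicE in_setC; case: (x \in A); rewrite /= ?subr0 ?subrr.
Qed.
Lemma prob_setU_le mu A B : measurable A -> measurable B -> prob mu (A `|` B) <= prob mu A + prob mu B.
Proof.
move=> mA mB; have mAB := measurableU _ _ mA mB.
rewrite -(I_indic mu mA) -(I_indic mu mB) -(I_indic mu mAB) -I_D; [|exact: bmf_indic..].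
apply: I_le; [exact: bmf_indic|by apply: bmfD; exact: bmf_indic|].
move=> x; rewrite !indicE in_setU; case: (x \in A); case: (x \in B) => /=; lra.
Qed.

Lemma I_dominated mu (f_ : nat -> T -> R) f M :
  (forall n, measurable_fun setT (f_ n)) -> (forall n x, `|f_ n x| <= M) ->
  (forall x, f_ ^~ x @ \oo --> f x) ->
  bmf f /\ (fun n => I_ mu (f_ n)) @ \oo --> I_ mu f.
Proof.
move=> mf fM fl.
have mlim : measurable_fun setT f by apply: (measurable_fun_cvg (h := f_)) => // x _; exact: fl.
have bf : bmf f.
  split=> //; exists M => x; rewrite ler_norml; apply/andP; split.
    apply: (@ler_cvg_to _ \oo _ R (fun=> - M) (f_ ^~ x)); [exact: cvg_cst|exact: fl|].
    by apply: nearW => n; have := fM n x; rewrite ler_norml => /andP[].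
  apply: (@ler_cvg_to _ \oo _ R (f_ ^~ x) (fun=> M)); [exact: fl|exact: cvg_cst|].
  by apply: nearW => n; have := fM n x; rewrite ler_norml => /andP[].
split=> //.
have [||||| _ _ H] := @dominated_convergence _ T R mu setT measurableT
  (fun n x => (f_ n x)%:E) (fun x => (f x)%:E) (fun=> M%:E).
- by move=> n; exact/measurable_EFinP.
- exact/measurable_EFinP.
- by apply: aeW => x _; apply: cvg_EFin; [exact: nearW|exact: fl].
- exact: (bmf_integrable mu (bmf_cst M)).
- by apply: aeW => x n _; rewrite lee_fin.
by apply: fine_cvg; rewrite -I_EFin//; move: H; apply: cvg_trans.
Qed.

Lemma prob_bigcup_nonincr mu (A : nat -> set T) : (forall n, measurable (A n)) ->
  (forall n, A n.+1 `<=` A n) ->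
  (fun n => prob mu (A n)) @ \oo --> prob mu (\bigcap_n A n).
Proof.
move=> mA dA; have mI : measurable (\bigcap_n A n) by exact: bigcap_measurable.
rewrite -I_indic// (_ : (fun n => prob mu (A n)) = fun n => I_ mu \1_(A n)); last first.
  by apply/funext => n; rewrite I_indic.
apply: (@I_dominated mu (fun n => \1_(A n)) _ 1 _ _ _).2.
- by move=> n; exact: measurable_indic.
- by move=> n x; rewrite indicE; case: (x \in _); rewrite ?normr1 ?normr0.
have mono n m : (n <= m)%N -> A m `<=` A n.
  by elim: m => [|m IH]; rewrite leq_eqVlt => /predU1P[->//|//]; rewrite ltnS => /IH h; exact: subset_trans (dA m) h.
move=> x; have [Ix|/existsNP[k /not_implyP[_ nk]]] := pselect ((\bigcap_n A n) x).
  rewrite indicE mem_set//= (_ : (fun n => _) = fun=> 1); first exact: cvg_cst.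
  by apply/funext => n; rewrite indicE mem_set//; exact: Ix.
rewrite indicE memNset/=; last by move=> h; apply: nk; exact: h.
apply/cvgrPdist_lt => e e0; exists k => // n /= kn.
by rewrite indicE memNset ?subrr ?normr0// => h; apply: nk; exact: mono h.
Qed.
End BoundedIntegrals.

Section SphereMeasures.
Context {R : realType}.
Local Notation X := (sphere R).
Local Notation bX := (borel_sphere R).
Implicit Types (mu nu : probability bX R) (f g : X -> R) (A B : set X).

Lemma open_meas (U : set X) : open U -> measurable (U : set bX).
Proof. by move=> oU; apply: sub_sigma_algebra. Qed.
Lemma closed_meas (F : set X) : closed F -> measurable (F : set bX).
Proof. by move=> cF; rewrite -(setCK F); apply: measurableC; apply: open_meas; exact: closed_openC. Qed.
Lemma point_closed (x : X) : closed [set x].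
Proof.
rewrite (_ : [set x] = [set y | ch x y <= 0]); first exact: closed_ball_ch.
apply/seteqP; split => [y /= ->|y /= h]; first by rewrite chxx.
by apply/esym/eqP; rewrite -ch_eq0 eq_le h ch_ge0.
Qed.
Lemma point_meas (x : X) : measurable ([set x] : set bX).
Proof. exact: (closed_meas (@point_closed x)). Qed.

Lemma cont_meas f : continuous f -> measurable_fun setT (f : bX -> R).
Proof.
move=> cf; apply: (@measurability _ _ bX _ setT f _ (RGenOpens.measurableE R)).
move=> _ [B /= [a [b ->]] <-]; rewrite setTI; apply: open_meas.
by apply: open_comp => // x _; exact: cf.
Qed.
Lemma cont_bmf f : continuous f -> bmf (f : bX -> R).
Proof. by move=> cf; split; [exact: cont_meas|exact: continuous_bounded]. Qed.
Lemma contX_meas (h : X -> X) : continuous h -> measurable_fun setT (h : bX -> bX).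
Proof.
move=> ch_; apply: (@measurability _ _ bX bX setT h (@open X) (erefl _)).
move=> _ [B /= oB <-]; rewrite setTI; apply: open_meas.
by apply: open_comp => // x _; exact: ch_.
Qed.

(* Truncated distance to a set; the truncation makes it meaningful for the
   empty set. *)
Definition dset (A : set X) (x : X) : R := inf ([set 1] `|` [set ch x a | a in A]).
Lemma dset_lb A x : has_inf ([set 1] `|` [set ch x a | a in A] : set R).
Proof. by split; [exists 1; left|exists 0 => _ [->//|[a _ <-]]; exact: ch_ge0]. Qed.
Lemma dset_ge0 A x : 0 <= dset A x.
Proof. by apply: lb_le_inf; [exists 1; left|move=> _ [->//|[a _ <-]]; exact: ch_ge0]. Qed.
Lemma dset_le1 A x : dset A x <= 1.
Proof. by apply: ge_inf; [case: (dset_lb A x)|left]. Qed.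
Lemma dset_le A x a : A a -> dset A x <= ch x a.
Proof. by move=> Aa; apply: ge_inf; [case: (dset_lb A x)|right; exists a]. Qed.
Lemma dset_lip A x y : `|dset A x - dset A y| <= 1 * ch x y.
Proof.
have H u v : dset A u <= dset A v + ch u v.
  rewrite -lerBlDr; apply: lb_le_inf; first by exists 1; left.
  move=> _ [->|[a Aa <-]]; rewrite lerBlDr.
    by rewrite (le_trans (dset_le1 A u))// lerDl ch_ge0.
  by rewrite (le_trans (dset_le u Aa))// addrC ch_tri.
have h1 := H x y; have h2 := H y x; move: h2; rewrite (chC y) => h2.
by rewrite mul1r ler_norml; apply/andP; split; lra.
Qed.
Lemma dset_cont A : continuous (dset A).
Proof. exact: (lipR_continuous (dset_lip A)). Qed.
Lemma dset_eq0 A x : closed A -> dset A x = 0 -> A x.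
Proof.
move=> /closed_chP cA d0; apply: cA => r r0.
have [|_ [->|[a Aa <-]] h] := @inf_adherent R _ (Num.min r 1) _ (dset_lb A x).
- by rewrite lt_min r0 ltr01.
- by move: h; rewrite -/(dset A x) d0 add0r lt_min ltxx andbF.
- by exists a => //; move: h; rewrite -/(dset A x) d0 add0r lt_min => /andP[].
Qed.
Lemma dset_mem A x : A x -> dset A x = 0.
Proof. by move=> Ax; apply/eqP; rewrite eq_le dset_ge0 andbT; have := dset_le x Ax; rewrite chxx. Qed.

Definition bump (A : set X) (n : nat) (x : X) : R := Num.max 0 (1 - n%:R * dset A x).
Lemma bump_cont A n : continuous (bump A n).
Proof.
apply: cont_max; first exact: cont_cst.
apply: contB; first exact: cont_cst.
by apply: contM; [exact: cont_cst|exact: dset_cont].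
Qed.
Lemma bump_ge0 A n x : 0 <= bump A n x.
Proof. by rewrite le_max lexx. Qed.
Lemma bump_le1 A n x : bump A n x <= 1.
Proof. by rewrite ge_max ler01 /= lerBlDr lerDl mulr_ge0// dset_ge0. Qed.
Lemma bump_mem A n x : A x -> bump A n x = 1.
Proof. by move=> Ax; rewrite /bump dset_mem// mulr0 subr0; apply/max_idPr; exact: ler01. Qed.
Lemma bump_cvg A x : closed A -> bump A ^~ x @ \oo --> (\1_A x : R).
Proof.
move=> cA; have [Ax|nAx] := pselect (A x).
  rewrite indicE mem_set//= (_ : (fun n => _) = fun=> 1); first exact: cvg_cst.
  by apply/funext => n; rewrite bump_mem.
rewrite indicE memNset//=; have d0 : 0 < dset A x.
  by rewrite lt_def dset_ge0 andbT; apply: contra_notN nAx => /eqP; exact: dset_eq0.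
apply/cvgrPdist_lt => e e0; near=> n.
rewrite /bump; have -> : Num.max 0 (1 - n%:R * dset A x) = 0.
  apply/max_idPl; rewrite subr_le0 -ler_pdivrMr// mul1r.
  by near: n; exact: nbhs_infty_ger.
by rewrite subrr normr0.
Unshelve. all: by end_near. Qed.
Lemma I_bump_cvg mu A : closed A -> (fun n => I_ mu (bump A n)) @ \oo --> prob mu A.
Proof.
move=> cA; rewrite -I_indic; last exact: closed_meas.
apply: (@I_dominated _ _ _ mu (bump A) _ 1 _ _ _).2.
- by move=> n; exact: (cont_meas (@bump_cont A n)).
- by move=> n x; rewrite ger0_norm ?bump_ge0// bump_le1.
- by move=> x; exact: bump_cvg.
Qed.

Lemma closed_same_measure mu nu :
  (forall A : set X, closed A -> prob mu A = prob nu A) -> same_measure mu nu.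
Proof.
move=> H A mA.
apply: (@measure_unique _ R bX (@closed X) (fun=> setT)) => //.
- rewrite /measurable /= /borel_sphere; apply/seteqP; split.
    apply: smallest_sub; first exact: smallest_sigma_algebra.
    move=> U oU; have [_ sC _] := smallest_sigma_algebra setT (@closed X).
    by rewrite -(setCK U) -setTD; apply: sC; apply: sub_sigma_algebra; exact: open_closedC.
  apply: smallest_sub; first exact: smallest_sigma_algebra.
  by move=> F cF; exact: (closed_meas cF).
- by move=> U V; exact: closedI.
- by rewrite bigcup_const.
- move=> B cB; have mB : measurable (B : set bX) by exact: closed_meas.
  by have e := congr1 EFin (H B cB); rewrite -!probE// in e; exact: e.
- by move=> k; apply: (@le_lt_trans _ _ 1%E); rewrite ?ltry//; exact: probability_le1.
Qed.

Lemma cont_same_measure mu nu :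
  (forall f, continuous f -> I_ mu f = I_ nu f) -> same_measure mu nu.
Proof.
move=> H; apply: closed_same_measure => A cA.
rewrite -(cvg_lim (@Rhausdorff R) (I_bump_cvg (mu := mu) cA)) -(cvg_lim (@Rhausdorff R) (I_bump_cvg (mu := nu) cA)).
have -> // : (fun n => I_ mu (bump A n)) = (fun n => I_ nu (bump A n)).
by apply/funext => n; apply: H; exact: bump_cont.
Qed.

(** Sets squeezed between a closed and an open set of nearly the same mass form a sigma-algebra. It
    contains the open sets, since these are increasing unions of the closed sets where [dset] of the
    complement is at least [1 / (n + 1)]. *)
Lemma prob_regular mu A (e0 : R) : measurable (A : set bX) -> 0 < e0 ->
  exists2 F : set X, closed F & F `<=` A /\ prob mu A - prob mu F < e0.
Proof.
pose G : set (set bX) := [set A : set bX | measurable A /\ forall e : R, 0 < e -> exists FU : set X * set X,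
  [/\ closed FU.1, open FU.2, FU.1 `<=` A, A `<=` FU.2 & prob mu FU.2 - prob mu FU.1 < e]].
suff mG : measurable `<=` G.
  move=> /mG[mA H] e00; have [[F U] [cF oU FA AU h]] := H e0 e00; exists F => //; split=> //.
  by apply: le_lt_trans h; rewrite lerB// prob_le//; exact: open_meas.
apply: smallest_sub.
  split.
  - by split=> // e e_0; exists (set0, set0); split=> //=; rewrite ?subrr//; first [exact: closed0|exact: open0].
  - move=> B [mB H]; split; first by rewrite setTD; exact: measurableC.
    move=> e e_0; have [[F U] [cF oU FB BU h]] := H e e_0.
    exists (~` U, ~` F); split; [exact: open_closedC|exact: closed_openC| | |].
    + by rewrite setTD; exact: subsetC.
    + by rewrite setTD; exact: subsetC.
    + by rewrite !prob_setC; [|exact: open_meas|exact: closed_meas]; move: h => /=; lra.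
  - move=> B HB; have mB n : measurable (B n : set bX) by case: (HB n).
    split; first exact: bigcup_measurable.
    move=> e e_0; have e20 : 0 < e / 2 by rewrite divr_gt0.
    (* Half of [e] is distributed geometrically over the countable union; the other half pays for
       keeping only finitely many closed pieces. *)
    have /choice[FU HFU] n := (HB n).2 (e / 2 / (2 ^ n.+1)%:R) ltac:(by rewrite divr_gt0// ltr0n expn_gt0).
    pose F n := (FU n).1; pose U n := (FU n).2.
    have mF n : measurable (F n : set bX) by apply: closed_meas; case: (HFU n).
    have mU n : measurable (U n : set bX) by apply: open_meas; case: (HFU n).
    have mUU : measurable (\bigcup_n U n : set bX) by exact: bigcup_measurable.
    pose FN N : set X := \big[setU/set0]_(n < N) F n.
    have mFN N : measurable (FN N : set bX) by apply: bigsetU_measurable => n _.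
    pose D N : set bX := (\bigcup_n U n) `\` FN N.
    have mD N : measurable (D N) by exact: measurableD.
    have dD N : D N.+1 `<=` D N.
      by apply: setDS; rewrite /FN big_ord_recr; exact: subsetUl.
    have lim1 := prob_bigcup_nonincr (mu := mu) mD dD.
    have small : prob mu (\bigcap_N D N) <= e / 2.
      have sub : \bigcap_N D N `<=` \bigcup_n (U n `\` F n).
        move=> x Dx; have [[n _ Un] _] := Dx 0%N I; exists n => //; split=> // Fn.
        by have [_] := Dx n.+1 I; apply; rewrite /FN big_ord_recr; right.
      have mb : measurable (\bigcup_n (U n `\` F n) : set bX).
        by apply: bigcup_measurable => n _; exact: measurableD.
      rewrite -lee_fin -probE; last exact: bigcap_measurable.
      apply: (@le_trans _ _ (mu (\bigcup_n (U n `\` F n)))); first by rewrite le_measure ?inE//; exact: bigcap_measurable.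
      apply: le_trans (@measure_sigma_subadditive _ _ _ mu _ (fun n => U n `\` F n) _ mb (@subset_refl _ _)) _.
        by move=> n; exact: measurableD.
      apply: (@le_trans _ _ (\big[+%E/0%E]_(0 <= i <oo) (0%E + (e / 2 / (2 ^ i.+1)%:R)%:E))%E).
        apply: lee_nneseries => // n _; rewrite add0e.
        suff : ((prob mu (U n `\` F n))%:E <= (e / 2 / (2 ^ n.+1)%:R)%:E)%E.
          by move=> h; apply: le_trans h; rewrite -probE//; exact: measurableD.
        rewrite lee_fin; apply: ltW; have [_ _ FB BU h] := HFU n.
        apply: le_lt_trans h; rewrite lerBrDr.
        rewrite -(I_indic mu (mU n)) -(I_indic mu (mF n)) -I_indic; last exact: measurableD.
        rewrite -I_D; [|by apply: bmf_indic; exact: measurableD|exact: bmf_indic].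
        apply: I_le; [|exact: bmf_indic|].
          by apply: bmfD; apply: bmf_indic => //; exact: measurableD.
        move=> x; rewrite !indicE in_setD; have : x \in F n -> x \in U n.
          by rewrite !inE => /FB/BU.
        by case: (x \in F n) => [/(_ isT) ->|_] /=; rewrite ?andbT ?addr0 ?add0r.
      apply: le_trans (@epsilon_trick R (fun=> 0%E) _ xpredT (fun=> lexx _) (ltW e20)) _.
      by rewrite eseries0// add0e.
    have [N _ HN] : \forall N \near \oo, prob mu (D N) < e.
      apply: (cvgr_lt _ lim1); apply: le_lt_trans small _; lra.
    have HNN := HN N (leqnn N).
    have FNU : FN N `<=` \bigcup_n U n.
      move=> x; rewrite /FN -bigcup_mkord => -[n _ Fx]; exists n => //.
      by have [_ _ FB BU _] := HFU n; exact/BU/FB.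
    exists (FN N, \bigcup_n U n); split=> /=.
    + by rewrite /FN; elim/big_ind: _ => // [|A1 A2 c1 c2|n _]; [exact: closed0|exact: closedU|case: (HFU n)].
    + by apply: bigcup_open => n _; case: (HFU n).
    + by move=> x; rewrite /FN -bigcup_mkord => -[n _ Fx]; exists n => //; have [_ _ FB _ _] := HFU n; exact: FB.
    + by move=> x [n _ Bx]; exists n => //; have [_ _ _ BU _] := HFU n; exact: BU.
    + apply: le_lt_trans HNN; rewrite lerBlDr.
      rewrite -(I_indic mu mUU) -(I_indic mu (mFN N)) -(I_indic mu (mD N)) -I_D; [|exact: bmf_indic..].
      apply: I_le; [exact: bmf_indic|by apply: bmfD; exact: bmf_indic|].
      move=> x; rewrite !indicE in_setD.
      by case: (x \in FN N); case: (x \in _) => /=; lra.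
move=> U oU; split; first exact: open_meas.
move=> e e_0; pose D n : set bX := U `&` [set x | dset (~` U) x <= n.+1%:R^-1].
have cD n : closed ([set x | dset (~` U) x <= n.+1%:R^-1] : set X).
  rewrite (_ : [set _ | _] = dset (~` U) @^-1` [set r | r <= n.+1%:R^-1])//.
  by apply: closed_comp => [x _|]; [exact: dset_cont|exact: closed_le].
have oC n : open ([set x | n.+1%:R^-1 < dset (~` U) x] : set X).
  rewrite (_ : [set _ | _] = dset (~` U) @^-1` [set r | n.+1%:R^-1 < r])//.
  by apply: open_comp => [x _|]; [exact: dset_cont|exact: open_gt].
have mD n : measurable (D n) by apply: measurableI; [exact: open_meas|exact: closed_meas].
have dD n : D n.+1 `<=` D n.
  move=> x [Ux /= h]; split=> //=; apply: le_trans h _.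
  by rewrite lef_pV2 ?posrE// ler_nat.
have lim1 := prob_bigcup_nonincr (mu := mu) mD dD.
have z : \bigcap_n D n = set0.
  rewrite -subset0 => x Dx; have [Ux _] := Dx 0%N I.
  have : (~` U) x; last by [].
  apply: dset_eq0; first exact: open_closedC.
  apply/eqP; rewrite eq_le dset_ge0 andbT; apply/ler_addgt0Pr => r r0; rewrite add0r.
  have [n nr] := ltr_add_invr r0; rewrite add0r in nr.
  by have [_ /= h] := Dx n I; apply: le_trans h (ltW nr).
rewrite z prob_set0 in lim1.
have [N _ HN] : \forall N \near \oo, prob mu (D N) < e by exact: (cvgr_lt _ lim1).
have HNN := HN N (leqnn N).
exists ([set x | N.+1%:R^-1 <= dset (~` U) x], U); split=> //=.
+ rewrite (_ : [set _ | _] = dset (~` U) @^-1` [set r | N.+1%:R^-1 <= r])//.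
  by apply: closed_comp => [x _|]; [exact: dset_cont|exact: closed_ge].
+ move=> x /= h; apply: contrapT => nU; move: h; rewrite dset_mem//.
  by rewrite leNgt invr_gt0 ltr0n.
apply: le_lt_trans HNN; rewrite lerBlDr.
have mF : measurable ([set x | N.+1%:R^-1 <= dset (~` U) x] : set bX).
  apply: closed_meas; rewrite (_ : [set _ | _] = dset (~` U) @^-1` [set r | N.+1%:R^-1 <= r])//.
  by apply: closed_comp => [x _|]; [exact: dset_cont|exact: closed_ge].
apply: le_trans (prob_setU_le mu (mD N) mF); apply: prob_le => //; first exact: open_meas.
  exact: measurableU.
by move=> x Ux; have [h|h] := leP (dset (~` U) x) N.+1%:R^-1; [left|right; exact: ltW].
Qed.
End SphereMeasures.

Section Riesz.
Context {R : realType}.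
Local Notation X := (sphere R).
Local Notation bX := (borel_sphere R).
Variable Lam : (X -> R) -> R.
Hypothesis LamD : forall (f g : X -> R), continuous f -> continuous g -> Lam (fun x => f x + g x) = Lam f + Lam g.
Hypothesis LamZ : forall (c : R) (f : X -> R), continuous f -> Lam (fun x => c * f x) = c * Lam f.
Hypothesis Lam_ge0 : forall f : X -> R, continuous f -> (forall x, 0 <= f x) -> 0 <= Lam f.
Hypothesis Lam1 : Lam (fun=> 1) = 1.
Implicit Types (f g : X -> R) (U V : set X).

Lemma LamN f : continuous f -> Lam (fun x => - f x) = - Lam f.
Proof. by move=> cf; rewrite -mulN1r -LamZ//; congr Lam; apply/funext => x; rewrite mulN1r. Qed.
Lemma LamB f g : continuous f -> continuous g -> Lam (fun x => f x - g x) = Lam f - Lam g.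
Proof. by move=> cf cg; rewrite LamD ?LamN//; exact: contN. Qed.
Lemma Lam_le f g : continuous f -> continuous g -> (forall x, f x <= g x) -> Lam f <= Lam g.
Proof.
move=> cf cg fg; rewrite -subr_ge0 -LamB//; apply: Lam_ge0; first exact: contB.
by move=> x; rewrite subr_ge0.
Qed.
Lemma Lam_cst c : Lam (fun=> c) = c.
Proof.
rewrite (_ : (fun=> c) = fun x : X => c * (fun=> 1) x); last by apply/funext => x; rewrite mulr1.
by rewrite LamZ ?Lam1 ?mulr1//; exact: cont_cst.
Qed.
Lemma Lam_sum (I : Type) (s : seq I) (F : I -> X -> R) : (forall i, continuous (F i)) ->
  Lam (fun x => \sum_(i <- s) F i x) = \sum_(i <- s) Lam (F i).
Proof.
move=> cF; elim: s => [|i s IH].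
  rewrite big_nil (_ : (fun=> _) = fun=> 0); first exact: Lam_cst.
  by apply/funext => x; rewrite big_nil.
rewrite big_cons -IH -LamD//; last exact: cont_sum.
by congr Lam; apply/funext => x; rewrite big_cons.
Qed.

(** Test functions have to vanish off [U] but need not have their support in [U]; compactness is
    recovered by cutting them at a small height [e]. *)
Definition below U f : Prop :=
  [/\ continuous f, forall x, 0 <= f x <= 1 & forall x, ~ U x -> f x = 0].
Definition vol U : R := sup [set Lam f | f in below U].

Lemma below0 U : below U (fun=> 0).
Proof. by split => //; [exact: cont_cst|move=> x; rewrite lexx ler01]. Qed.
Lemma has_sup_below U : has_sup [set Lam f | f in below U].
Proof.
split; first by exists (Lam (fun=> 0)); exists (fun=> 0) => //; exact: below0.
exists 1 => _ [f [cf f01 _] <-]; rewrite -(Lam_cst 1); apply: Lam_le => //; first exact: cont_cst.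
by move=> x; case/andP: (f01 x).
Qed.
Lemma vol_ub U f : below U f -> Lam f <= vol U.
Proof. by move=> Uf; apply: sup_upper_bound; [exact: has_sup_below|exists f]. Qed.
Lemma vol_adh U (e : R) : 0 < e -> exists2 f, below U f & vol U - e < Lam f.
Proof. by move=> e0; have [_ [f Uf <-] h] := sup_adherent e0 (has_sup_below U); exists f. Qed.
Lemma vol_ge0 U : 0 <= vol U.
Proof. by have := vol_ub (below0 U); rewrite Lam_cst. Qed.
Lemma vol_le1 U : vol U <= 1.
Proof.
apply: sup_le_ub; first by case: (has_sup_below U).
move=> _ [f [cf f01 _] <-]; rewrite -(Lam_cst 1); apply: Lam_le => //; first exact: cont_cst.
by move=> x; case/andP: (f01 x).
Qed.
Lemma vol_le U V : U `<=` V -> vol U <= vol V.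
Proof.
move=> UV; apply: sup_le_ub; first by case: (has_sup_below U).
by move=> _ [f [cf f01 f0] <-]; apply: vol_ub; split => // x nV; apply: f0 => /UV.
Qed.
Lemma vol_setT : vol setT = 1.
Proof.
apply/eqP; rewrite eq_le vol_le1 -{1}(Lam_cst 1); apply: vol_ub; split; [exact: cont_cst|by move=> x; rewrite lexx ler01|by move=> x; case].
Qed.
Lemma vol_set0 : vol set0 = 0.
Proof.
apply/eqP; rewrite eq_le vol_ge0 andbT; apply: sup_le_ub; first by case: (has_sup_below set0).
move=> _ [f [cf f01 f0] <-]; rewrite (_ : f = fun=> 0) ?Lam_cst//.
by apply/funext => x; exact: f0.
Qed.

Lemma vol_bigcup (U : nat -> set X) f : (forall n, open (U n)) -> below (\bigcup_n U n) f ->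
  forall e : R, 0 < e -> exists N, Lam f <= \sum_(n < N) vol (U n) + e.
Proof.
move=> oU [cf f01 f0] e e0.
have cK : closed [set x | e <= f x].
  rewrite (_ : [set _ | _] = f @^-1` [set r | e <= r])//.
  by apply: closed_comp => [x _|]; [exact: cf|exact: closed_ge].
have [N NP] : exists N, forall x, e <= f x -> exists2 n, (n < N)%N & U n x.
  have := closed_sphere_compact cK; rewrite compact_cover => /(_ nat setT U).
  case=> [n _|x /= fx|D _ KD]; first exact: oU.
    apply: contrapT => nU; have : f x = 0 by apply: f0.
    by move=> fx0; move: fx; rewrite fx0 leNgt e0.
  exists (\max_(i <- finmap.enum_fset D) i).+1 => x fx; have [n /= nD Un] := KD x fx.
  by exists n => //; rewrite ltnS; apply: (@leq_bigmax_seq _ (finmap.enum_fset D) xpredT id).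
exists N.
pose u n x : R := dset (~` U n) x.
pose g x : R := Num.max 0 (f x - e).
(* Denominator of a partition of [g], the part of [f] above [e]: the extra term keeps it positive
   everywhere and vanishes where [g] does not. *)
pose s x : R := \sum_(n < N) u n x + Num.max 0 (e - f x).
have cu n : continuous (u n) by exact: dset_cont.
have cg : continuous g by apply: cont_max; [exact: cont_cst|apply: contB => //; exact: cont_cst].
have cs : continuous s.
  apply: contD; first by apply: cont_sum => n; exact: cu.
  by apply: cont_max; [exact: cont_cst|apply: contB => //; exact: cont_cst].
have u0 n x : 0 <= u n x by exact: dset_ge0.
have s0 x : 0 < s x.
  have [fe|ef] := ltP (f x) e.
    apply: ltr_wpDl; first exact: sumr_ge0.
    by rewrite lt_max subr_gt0 fe orbT.
  have [n nN Unx] := NP x ef.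
  apply: ltr_pwDl; last by rewrite le_max lexx.
  rewrite (bigD1 (Ordinal nN)) //=; apply: ltr_pwDl; last exact: sumr_ge0.
  rewrite lt_def u0 andbT; apply/eqP => /dset_eq0; apply; [exact: open_closedC|exact: Unx].
pose psi n x : R := g x * u n x / s x.
have cpsi n : continuous (psi n).
  apply: contM; first exact: contM.
  by apply: (cont_comp cs) => x; apply: inv_continuous; rewrite gt_eqF.
have bpsi (n : 'I_N) : below (U n) (psi n).
  split; [exact: cpsi| |].
    move=> x; have g01 : 0 <= g x <= 1.
      rewrite le_max lexx /= ge_max ler01 /=; have /andP[_ h] := f01 x; lra.
    have us : u n x <= s x.
      rewrite /s (bigD1 n) //= -addrA lerDl addr_ge0//; first exact: sumr_ge0.
      by rewrite le_max lexx.
    case/andP: g01 => g0 g1; rewrite /psi -mulrA mulr_ge0//=; last by rewrite divr_ge0// ltW.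
    by apply: mulr_ile1 => //; [rewrite divr_ge0// ltW|rewrite ler_pdivrMr// mul1r].
  by move=> x nU; rewrite /psi /u dset_mem// mulr0 mul0r.
have sumpsi x : \sum_(n < N) psi n x = g x.
  rewrite /psi -mulr_suml -mulr_sumr; have [fe|ef] := leP (f x) e.
    have -> : g x = 0 by apply/max_idPl; rewrite subr_le0.
    by rewrite !mul0r.
  have -> : s x = \sum_(n < N) u n x.
    by rewrite /s (_ : Num.max 0 (e - f x) = 0) ?addr0//; apply/max_idPl; rewrite subr_le0 ltW.
  rewrite mulfK// gt_eqF//; have := s0 x; rewrite /s (_ : Num.max 0 (e - f x) = 0) ?addr0//.
  by apply/max_idPl; rewrite subr_le0 ltW.
apply: (@le_trans _ _ (Lam (fun x => g x + e))).
  apply: Lam_le => //; first by apply: contD => //; exact: cont_cst.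
  by move=> x; rewrite -lerBlDr le_max lexx orbT.
rewrite LamD//; last exact: cont_cst.
rewrite Lam_cst lerD2r.
rewrite (_ : g = fun x => \sum_(n <- index_enum 'I_N) psi n x); last by apply/funext => x; rewrite sumpsi.
by rewrite Lam_sum; [apply: ler_sum => n _; exact: vol_ub|move=> i; exact: cpsi].
Qed.

Definition outer (A : set X) : R := inf [set vol U | U in [set U | open U /\ A `<=` U]].
Lemma has_inf_outer A : has_inf [set vol U | U in [set U | open U /\ A `<=` U]].
Proof.
split; first by exists (vol setT); exists setT => //; split => //; exact: openT.
by exists 0 => _ [U _ <-]; exact: vol_ge0.
Qed.
Lemma outer_lb A U : open U -> A `<=` U -> outer A <= vol U.
Proof. by move=> oU AU; apply: ge_inf; [case: (has_inf_outer A)|exists U]. Qed.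
Lemma outer_adh A (e : R) : 0 < e -> exists U, [/\ open U, A `<=` U & vol U < outer A + e].
Proof. by move=> e0; have [_ [U [oU AU] <-] h] := inf_adherent e0 (has_inf_outer A); exists U. Qed.
Lemma outer_ge0 A : 0 <= outer A.
Proof. by apply: lb_le_inf; [case: (has_inf_outer A)|move=> _ [U _ <-]; exact: vol_ge0]. Qed.
Lemma outer_open U : open U -> outer U = vol U.
Proof.
move=> oU; apply/eqP; rewrite eq_le outer_lb//=; apply: lb_le_inf; first by case: (has_inf_outer U).
by move=> _ [V [oV UV] <-]; exact: vol_le.
Qed.
Lemma outer_le A B : A `<=` B -> outer A <= outer B.
Proof.
move=> AB; apply: lb_le_inf; first by case: (has_inf_outer B).
by move=> _ [U [oU BU] <-]; apply: outer_lb => //; exact: subset_trans BU.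
Qed.

Definition eouter (A : set X) : \bar R := (outer A)%:E.

Lemma eouter0 : eouter set0 = 0%E.
Proof. by rewrite /eouter outer_open ?vol_set0//; exact: open0. Qed.
Lemma eouter_ge0 A : (0 <= eouter A)%E.
Proof. by rewrite lee_fin outer_ge0. Qed.
Lemma eouter_le : {homo eouter : A B / A `<=` B >-> (A <= B)%E}.
Proof. by move=> A B AB; rewrite lee_fin outer_le. Qed.
Lemma eouter_sub : sigma_subadditive eouter.
Proof.
move=> A; apply/lee_addgt0Pr => e e0.
have e20 : 0 < e / 2 by rewrite divr_gt0.
apply: (@le_trans _ _ ((\sum_(0 <= n <oo) (eouter (A n) + (e / 2 / (2 ^ n.+1)%:R)%:E)) + (e / 2)%:E)%E); last first.
  have := @epsilon_trick R (fun n => eouter (A n)) _ xpredT (fun n => eouter_ge0 _) (ltW e20).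
  move=> /(leeD2r (e / 2)%:E) h; apply: le_trans h _.
  by rewrite -addeA -EFinD -splitr.
have pe n : 0 < e / 2 / (2 ^ n.+1)%:R :> R by rewrite divr_gt0// ltr0n expn_gt0.
have /choice[U HU] n := outer_adh (A n) (pe n).
have oU n : open (U n) by case: (HU n).
have oUU : open (\bigcup_n U n) by apply: bigcup_open.
have h1 : outer (\bigcup_n A n) <= vol (\bigcup_n U n).
  by apply: outer_lb => // x [n _ Ax]; exists n => //; have [_ AU _] := HU n; exact: AU.
apply: (@le_trans _ _ (vol (\bigcup_n U n))%:E); first by rewrite lee_fin.
rewrite -leeBlDr// -EFinB.
have e40 : 0 < e / 2 / 2 by rewrite divr_gt0.
have [f bf hf] := vol_adh (\bigcup_n U n) e40.
have [N HN] := vol_bigcup oU bf e40.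
apply: (@le_trans _ _ (\sum_(0 <= n < N) (eouter (A n) + (e / 2 / (2 ^ n.+1)%:R)%:E))%E).
  rewrite (_ : \sum_(0 <= n < N) _ = (\sum_(0 <= n < N) (outer (A n) + e / 2 / (2 ^ n.+1)%:R))%:E)%E; last first.
    by rewrite sumEFin.
  rewrite lee_fin; apply: (@le_trans _ _ (\sum_(n < N) vol (U n))); first lra.
  rewrite big_mkord; apply: ler_sum => n _; apply: ltW.
  by have [_ _ h] := HU n.
by apply: nneseries_lim_ge => n *; apply: adde_ge0; [exact: eouter_ge0|rewrite lee_fin; exact/ltW/pe].
Qed.

HB.instance Definition _ := isOuterMeasure.Build R X eouter eouter0 eouter_ge0 eouter_le eouter_sub.

Lemma outerU A B : outer (A `|` B) <= outer A + outer B.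
Proof. by have := outer_measureU2 [the {outer_measure set X -> \bar R} of eouter] A B; rewrite -EFinD lee_fin. Qed.

Lemma open_cara U : open U -> caratheodory_measurable eouter U.
Proof.
move=> oU A; apply/eqP; rewrite eq_le; apply/andP; split.
  rewrite -EFinD lee_fin; apply: le_trans (outerU _ _); apply: outer_le.
  by rewrite -setIUr setUv setIT.
rewrite -EFinD lee_fin.
(* Here [f] nearly fills [V] inside [U], and [g] nearly fills the open set [W], which contains [A]
   minus [U] and on which [f < e]. Hence [(f + g) / (1 + e)] is a test function for [V], and the
   errors add up to at most [5 * e]. *)
have key (e : R) : 0 < e -> e < 1 -> outer (A `&` U) + outer (A `&` ~` U) <= outer A + 5 * e.
  move=> e0 e1; have [V [oV AV hV]] := outer_adh A e0.
  have [f [cf f01 f0] hf] := vol_adh (V `&` U) e0.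
  pose W := V `&` [set x | f x < e].
  have oW : open W.
    apply: openI => //; rewrite (_ : [set _ | _] = f @^-1` [set r | r < e])//.
    by apply: open_comp => [x _|]; [exact: cf|exact: open_lt].
  have [g [cg g01 g0] hg] := vol_adh W e0.
  have h1 : outer (A `&` U) <= vol (V `&` U).
    by apply: outer_lb; [exact: openI|exact: setSI].
  have h2 : outer (A `&` ~` U) <= vol W.
    apply: outer_lb => // x [Ax nUx]; split; first exact: AV.
    by rewrite /= f0// => -[].
  have e10 : 0 < 1 + e by lra.
  have h3 : Lam f + Lam g <= (1 + e) * vol V.
    rewrite -LamD//.
    have -> : (fun x => f x + g x) = (fun x => (1 + e) * ((1 + e)^-1 * (f x + g x))).
      by apply/funext => x; rewrite mulrA mulfV ?mul1r// gt_eqF.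
    have cfg : continuous (fun x => (1 + e)^-1 * (f x + g x)).
      by apply: contM; [exact: cont_cst|exact: contD].
    rewrite LamZ// ler_pM2l//; apply: vol_ub; split => //.
      move=> x; have /andP[fx0 fx1] := f01 x; have /andP[gx0 gx1] := g01 x.
      rewrite mulr_ge0 ?invr_ge0 ?addr_ge0 ?(ltW e10)//=; last lra.
      rewrite mulrC ler_pdivrMr// mul1r.
      have [fe|ef] := ltP (f x) e; first lra.
      by rewrite (g0 x) ?addr0; [lra|move=> [_ /=]; rewrite ltNge ef].
    move=> x nV; rewrite f0; last by move=> [].
    by rewrite g0 ?addr0 ?mulr0//; move=> [].
  have v1 := vol_le1 V; have v0 := vol_ge0 V.
  have h4 : e * vol V <= e by rewrite ler_piMr// ltW.
  rewrite mulrDl mul1r in h3; lra.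
apply/ler_addgt0Pr => e e0.
have m0 : 0 < Num.min (e / 5) (1 / 2) by rewrite lt_min !divr_gt0.
apply: le_trans (key _ m0 _) _.
  by rewrite gt_min; apply/orP; right; lra.
by rewrite lerD2l mulrC -ler_pdivlMr// ge_min lexx.
Qed.

Lemma cara_borel (A : set bX) : measurable A -> caratheodory_measurable eouter A.
Proof.
move: A; apply: smallest_sub; last by move=> U oU; exact: open_cara.
split.
- exact: (@caratheodory_measurable_set0 R X [the {outer_measure set X -> \bar R} of eouter]).
- move=> A cA; rewrite setTD.
  exact: (@caratheodory_measurable_setC R X [the {outer_measure set X -> \bar R} of eouter]).
- move=> A cA.
  exact: (@caratheodory_measurable_bigcup R X [the {outer_measure set X -> \bar R} of eouter]).
Qed.

Definition riesz (A : set bX) : \bar R := eouter A.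

Lemma riesz0 : riesz set0 = 0%E. Proof. exact: eouter0. Qed.
Lemma riesz_ge0 A : (0 <= riesz A)%E. Proof. exact: eouter_ge0. Qed.
Lemma riesz_sigma : semi_sigma_additive riesz.
Proof.
move=> F mF tF mUF.
have := @caratheodory_measure_sigma_additive R X [the {outer_measure set X -> \bar R} of eouter] F.
apply => //; first by move=> n; exact: cara_borel (mF n).
exact: cara_borel mUF.
Qed.
HB.instance Definition _ := isMeasure.Build _ bX R riesz riesz0 riesz_ge0 riesz_sigma.

Lemma rieszT : riesz setT = 1%E.
Proof. by rewrite /riesz /eouter outer_open ?vol_setT//; exact: openT. Qed.
HB.instance Definition _ := Measure_isProbability.Build _ bX R riesz rieszT.

Definition riesz_prob : probability bX R := riesz.

Lemma riesz_open U : open U -> prob riesz_prob U = vol U.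
Proof. by move=> oU; rewrite /prob /= /riesz /eouter /= outer_open. Qed.

(** Slice [f] into layers [phi k] of height [h]: [Lam (phi k)] is at most [h] times the mass of
    [f > k h], the integral of [phi k] is at least [h] times the mass of [f > (k + 1) h], and the
    two sums differ by a shift of one layer, hence by at most [h]. The converse inequality will come
    from [1 - f]. *)
Lemma riesz_le f : continuous f -> (forall x, 0 <= f x <= 1) -> Lam f <= I_ riesz_prob f.
Proof.
move=> cf f01; apply/ler_addgt0Pr => e e0.
have [N Ne] : exists N : nat, N.+1%:R^-1 < e.
  by have [n] := ltr_add_invr e0; rewrite add0r => h; exists n.
pose h : R := N.+1%:R^-1; have h0 : 0 < h by rewrite invr_gt0.
pose phi (k : nat) x : R := Num.min (Num.max (f x - k%:R * h) 0) h.
have cphi k : continuous (phi k).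
  apply: cont_min; last exact: cont_cst.
  by apply: cont_max; [apply: contB => //; exact: cont_cst|exact: cont_cst].
have psum x n : \sum_(k < n) phi k x = Num.min (f x) (n%:R * h).
  elim: n => [|n IH]; first by rewrite big_ord0 mul0r; apply/esym/min_idPr; case/andP: (f01 x).
  rewrite big_ord_recr /= IH /phi -natr1 mulrDl mul1r.
  rewrite !minEle maxEle; have /andP[? ?] := f01 x.
  have nh : 0 <= n%:R * h by rewrite mulr_ge0// ltW.
  by case: (leP (f x) (n%:R * h)) => ?; case: (leP (f x - n%:R * h) 0) => ?; (case: ifP => ?); (try case: ifP => ?); lra.
have fsum : f = fun x => \sum_(k <- index_enum 'I_N.+1) phi k x.
  apply/funext => x; rewrite psum mulfV ?pnatr_eq0//; apply/esym/min_idPl.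
  by case/andP: (f01 x).
pose O k : set X := [set x | k%:R * h < f x].
have oO k : open (O k).
  rewrite (_ : O k = f @^-1` [set r | k%:R * h < r])//.
  by apply: open_comp => [x _|]; [exact: cf|exact: open_gt].
have up k : Lam (phi k) <= h * prob riesz_prob (O k).
  rewrite riesz_open// -ler_pdivrMl// -LamZ//; apply: vol_ub; split.
  - by apply: contM => //; exact: cont_cst.
  - move=> x; rewrite mulr_ge0 ?invr_ge0 ?(ltW h0)//=; last by rewrite le_min le_max lexx orbT ltW.
    by rewrite ler_pdivrMl// mulr1 ge_min lexx orbT.
  - move=> x /negP; rewrite -leNgt => fx; rewrite /phi.
    have -> : Num.max (f x - k%:R * h) 0 = 0 by apply/max_idPr; rewrite subr_le0.
    by rewrite (_ : Num.min 0 h = 0) ?mulr0//; apply/min_idPl; exact: ltW.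
have dn k : h * prob riesz_prob (O k.+1) <= I_ riesz_prob (phi k).
  rewrite -I_indic; last exact: open_meas.
  have bi : bmf (\1_(O k.+1) : bX -> R) by apply: bmf_indic; exact: open_meas.
  rewrite -I_Z//; apply: I_le; [exact: bmfM (bmf_cst _) bi|exact: cont_bmf|].
  move=> x; rewrite indicE; case: (boolP (x \in O k.+1)) => [|_]; last first.
    by rewrite mulr0 le_min le_max lexx orbT ltW.
  rewrite inE /O /= -natr1 mulrDl mul1r => Ox; rewrite mulr1 le_min lexx andbT le_max.
  by apply/orP; left; lra.
rewrite [in leLHS]fsum Lam_sum// {1}fsum I_sum; last by move=> k; exact: cont_bmf.
apply: (@le_trans _ _ (\sum_(k < N.+1) h * prob riesz_prob (O k))).
  by apply: ler_sum => k _; exact: up.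
apply: (@le_trans _ _ (\sum_(k < N.+1) h * prob riesz_prob (O k.+1) + e)); last first.
  by rewrite lerD2r; apply: ler_sum => k _; exact: dn.
rewrite big_ord_recl [X in _ <= X + _]big_ord_recr /=.
have a0 : h * prob riesz_prob (O 0%N) <= h.
  by rewrite ler_piMr ?(ltW h0)//; apply: prob_le1; exact: open_meas.
have a1 : 0 <= h * prob riesz_prob (O N.+1) by rewrite mulr_ge0 ?prob_ge0 ?ltW.
under eq_bigr do rewrite /fintype.bump /= add1n.
set T := \sum_(i < N) _; have he : h < e by []; clearbody h T; lra.
Qed.

Theorem riesz_representation : exists nu : probability bX R,
  forall f, continuous f -> I_ nu f = Lam f.
Proof.
exists riesz_prob => f cf.
have unit g : continuous g -> (forall x, 0 <= g x <= 1) -> I_ riesz_prob g = Lam g.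
  move=> cg g01; apply/eqP; rewrite eq_le riesz_le// andbT.
  have c1 : continuous (fun x => 1 - g x) by apply: contB => //; exact: cont_cst.
  have := riesz_le c1; rewrite LamB//; last exact: cont_cst.
  rewrite I_B; [|exact: bmf_cst|exact: cont_bmf].
  rewrite Lam_cst I_cst lerD2l lerN2; apply => x.
  by have /andP[? ?] := g01 x; apply/andP; split; lra.
have [M fM] := continuous_bounded cf.
pose B := `|M| + 1; have B0 : 0 < B by rewrite ltr_pwDr.
have fB x : - B <= f x <= B.
  rewrite -ler_norml; apply: le_trans (fM x) _; apply: le_trans (ler_norm M) _; rewrite lerDl; exact: ler01.
pose g x := (2 * B)^-1 * (f x + B).
have cg : continuous g by apply: contM; [exact: cont_cst|apply: contD => //; exact: cont_cst].
have fg : f = fun x => 2 * B * g x - B.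
  by apply/funext => x; rewrite /g mulrA mulfV ?mul1r ?addrK// gt_eqF// mulr_gt0.
have B20 : 0 < 2 * B by rewrite mulr_gt0.
have ug := unit g cg _.
have cBg : continuous (fun x => 2 * B * g x) by apply: contM => //; exact: cont_cst.
rewrite fg LamB//; last exact: cont_cst.
rewrite (LamZ _ cg).
rewrite I_B; [|exact: cont_bmf|exact: bmf_cst].
rewrite I_Z; last exact: cont_bmf.
rewrite I_cst Lam_cst unit// => x; have /andP[? ?] := fB x.
by rewrite /g mulr_ge0 ?invr_ge0 ?(ltW B20)//=; [rewrite mulrC ler_pdivrMr// mul1r; lra|lra].
Qed.
End Riesz.

(** * Exceptional points *)

Section Mobius.
Context {R : realType}.
Local Notation C := (Cx R).
Local Notation X := (sphere R).
Implicit Types (pq rs : {poly C} * {poly C}) (v : C * C) (f m n : X -> X).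

Definition lin (a b c d : C) : {poly C} * {poly C} := (a%:P * 'X + b%:P, c%:P * 'X + d%:P).

Lemma lin_good a b c d : a * d - b * c != 0 -> good (lin a b c d) /\ deg (lin a b c d) = 1%N.
Proof.
move=> D.
have d1 : deg (lin a b c d) = 1%N.
  rewrite /deg /frac_size /= !size_MXaddC !polyC_eq0 !size_polyC.
  move: D; have [->|a0] /= := eqVneq a 0; have [->|c0] /= := eqVneq c 0 => D.
  - by move: D; rewrite mul0r mulr0 subrr eqxx.
  - by case: ifP.
  - by case: ifP.
  - by [].
split => //; split; last by rewrite d1.
apply/Bezout_coprimepP; exists (c%:P, - a%:P) => /=.
have -> : c%:P * (a%:P * 'X + b%:P) + - a%:P * (c%:P * 'X + d%:P) = (- (a * d - b * c))%:P.
  rewrite polyCN polyCB !polyCM; ring.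
by rewrite -size_poly_eq1 size_polyC oppr_eq0 D.
Qed.

Lemma Fhat_lin a b c d v : a * d - b * c != 0 ->
  Fhat (lin a b c d) v = (a * v.1 + b * v.2, c * v.1 + d * v.2).
Proof.
move=> /lin_good[_ d1]; rewrite /Fhat d1 /hom !big_ord_recl !big_ord0 /=.
rewrite !coefD !coefCM !coefX !coefC /= !expr1 !expr0 !mulr0 !mulr1 !add0r !addr0.
by congr pair; rewrite addrC.
Qed.

Lemma mobius_linP m : mobius_map m <->
  exists a b c d, a * d - b * c != 0 /\ m = pmap (lin a b c d).
Proof.
split=> [[/rational_spec[g e] d1]|[a [b [c [d [D ->]]]]]]; last first.
  have [g d1] := lin_good D; split; last by rewrite (rat_degreeE g).
  by exists (lin a b c d); apply/representsE.
have E (p : {poly C}) : (size p <= 2)%N -> p = (p`_1)%:P * 'X + (p`_0)%:P.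
  move=> sp; apply/polyP => i; rewrite coefD coefCM coefX coefC.
  case: i => [|[|i]] /=; rewrite ?mulr0 ?mulr1 ?add0r ?addr0//.
  by rewrite nth_default// (leq_trans sp).
move: g d1 e; rewrite /rat_degree; case: (fraction_of m) => p q g; rewrite -/(deg (p, q)) => d1 e.
have sp := size1_deg (p, q); have sq := size2_deg (p, q); rewrite d1 /= in sp sq.
exists p`_1, p`_0, q`_1, q`_0.
have e' : (p, q) = lin p`_1 p`_0 q`_1 q`_0 by rewrite /lin -!E.
split; last by rewrite -e'.
apply/negP => /eqP D.
have F v : Fhat (p, q) v = (p`_1 * v.1 + p`_0 * v.2, q`_1 * v.1 + q`_0 * v.2).
  rewrite /Fhat d1 /hom !big_ord_recl !big_ord0 /= !expr1 !expr0 !addr0.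
  by congr pair; rewrite addrC mulr1 mulr1.
have [/andP[/eqP q10 /eqP q00]|nz] := boolP ((q`_1 == 0) && (q`_0 == 0)).
  have := fibpoly_neq0 None g; rewrite /= (E q sq) q10 q00 mul0r add0r eqxx.
  by [].
(* With determinant zero this nonzero vector would be killed by the lift, which has no nontrivial
   zero. *)
have v0 : (q`_0, - q`_1) != (0, 0) :> C * C by rewrite xpair_eqE oppr_eq0 andbC.
have := Fhat_neq0 g v0; rewrite F /= xpair_eqE => /negP; apply; apply/andP; split; apply/eqP.
  by rewrite -[RHS]D; ring.
by ring.
Qed.

Lemma pmap_proj pq v : good pq -> v != (0, 0) -> pmap pq (proj v) = proj (Fhat pq v).
Proof.
move=> g v0; have [c c0 {2}->] := vec_proj v0.
by rewrite Fhat_scale proj_scale ?pmapE// expf_neq0.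
Qed.

Lemma mobius_inv m : mobius_map m -> exists n, [/\ mobius_map n, cancel m n & cancel n m].
Proof.
move=> /mobius_linP[a [b [c [d [D ->]]]]].
have D' : d * a - (- b) * (- c) != 0 by rewrite mulrNN mulrC.
have [g _] := lin_good D; have [g' _] := lin_good D'.
exists (pmap (lin d (- b) (- c) a)); split.
- by apply/mobius_linP; exists d, (- b), (- c), a.
- move=> x; rewrite [pmap (lin a b c d) x]pmapE pmap_proj ?Fhat_vec_neq0// !Fhat_lin//=.
  rewrite -[RHS]proj_vec -(proj_scale (vec x) D) /scalev; congr proj; congr pair; ring.
- move=> x; rewrite [X in pmap _ X]pmapE pmap_proj ?Fhat_vec_neq0// !Fhat_lin//=.
  rewrite -[RHS]proj_vec -(proj_scale (vec x) D) /scalev; congr proj; congr pair; ring.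
Qed.

Lemma wedge_neq0 (x y : X) : x != y -> wedge (vec x) (vec y) != 0.
Proof. by move=> xy; rewrite -mod_gt0 wedge_ch; apply: mulr_gt0; [rewrite ch_gt0|apply: mulr_gt0; exact: nrm_vec_gt0]. Qed.

Lemma mobius_points (a b : X) : a != b -> exists m, [/\ mobius_map m, m a = None & m b = Some 0].
Proof.
move=> ab; have w := wedge_neq0 ab.
have D : (vec b).2 * (- (vec a).1) - (- (vec b).1) * (vec a).2 != 0.
  by rewrite (_ : _ - _ = - wedge (vec a) (vec b)) ?oppr_eq0// /wedge; ring.
exists (pmap (lin (vec b).2 (- (vec b).1) (vec a).2 (- (vec a).1))); split.
- by apply/mobius_linP; exists (vec b).2, (- (vec b).1), (vec a).2, (- (vec a).1).
- rewrite pmapE Fhat_lin//= /proj /= ifT//; apply/eqP; ring.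
- rewrite pmapE Fhat_lin//= /proj /= ifF.
    by congr Some; rewrite (_ : _ + _ = 0) ?mul0r//; ring.
  apply/negbTE; move: w; rewrite /wedge -oppr_eq0; congr (_ != 0); ring.
Qed.

Lemma rational_conj m n f : mobius_map m -> mobius_map n -> rational_map f ->
  rational_map (m \o f \o n) /\ rat_degree (m \o f \o n) = rat_degree f.
Proof.
move=> [rm dm] [rn dn] rf; have rmf := rational_comp rm rf.
split; first exact: (rational_comp rmf rn).
by rewrite (rat_degree_comp rmf rn) (rat_degree_comp rm rf) dm dn mul1n muln1.
Qed.

Lemma mobius_comp m n : mobius_map m -> mobius_map n -> mobius_map (m \o n).
Proof.
move=> [rm dm] [rn dn]; split; first exact: (rational_comp rm rn).
by rewrite (rat_degree_comp rm rn) dm dn.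
Qed.

Lemma rational_pair f : rational_map f -> exists p q : {poly C},
  [/\ coprimep p q, f = frac_map p q, (0 < frac_size p q)%N & rat_degree f = frac_size p q].
Proof. by move=> [[p q] r]; exists p, q; have [a b c] := r; split => //; apply: (@rat_degreeE _ _ (p, q)). Qed.

Lemma frac_SomeE (p q : {poly C}) z : frac_map p q (Some z) = if q.[z] == 0 then None else Some (p.[z] / q.[z]).
Proof. by []. Qed.
Lemma frac_NoneE (p q : {poly C}) d : frac_size p q = d ->
  frac_map p q None = if q`_d == 0 then None else Some (p`_d / q`_d).
Proof. by move=> <-. Qed.

Lemma no_root_cst (q : {poly C}) : q != 0 -> (forall z, q.[z] != 0) -> exists2 c : C, c != 0 & q = c%:P.
Proof.
move=> q0 nr; have [/closed_rootP[z /eqP]|] := boolP (size q != 1%N).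
  by have := nr z => /eqP.
by rewrite negbK => /size_poly1P[c c0 ->]; exists c.
Qed.

Lemma root0_monomial (q : {poly C}) : q != 0 -> (forall z, q.[z] = 0 -> z = 0) ->
  q = lead_coef q *: 'X^((size q).-1).
Proof.
move=> q0 nr; rewrite {1}[q]rootsE -(size_roots q0) /=; congr (_ *: _).
have : all (pred1 0) (roots q).
  apply/allP => z zr; apply/eqP/nr; rewrite [q]rootsE hornerZ horner_prod.
  by apply/eqP; rewrite mulf_eq0 prodf_seq_eq0; apply/orP; right; apply/hasP; exists z; rewrite //= !hornerE subrr.
elim: (roots q) => [|z s IH] /=; first by rewrite big_nil expr0.
by case/andP => /eqP -> /IH; rewrite big_cons subr0 exprS => ->.
Qed.

Lemma cst_frac (p : {poly C}) (c : C) : c != 0 -> (1 < size p)%N ->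
  frac_map p c%:P = frac_map (c^-1 *: p) 1.
Proof.
move=> c0 sp; have c1 : c^-1 != 0 by rewrite invr_eq0.
have E1 : frac_size p c%:P = (size p).-1.
  by rewrite /frac_size size_polyC c0 (maxn_idPl (ltnW sp)).
have E2 : frac_size (c^-1 *: p) 1 = (size p).-1.
  by rewrite /frac_size size_poly1 (size_scale _ c1) (maxn_idPl (ltnW sp)).
apply/funext => -[z|].
  by rewrite !frac_SomeE hornerC hornerZ hornerC (negPf c0) oner_eq0 divr1 mulrC.
have E0 : ((size p).-1 == 0%N) = false by move: sp; case: (size p) => [|[|]].
rewrite (frac_NoneE E1) (coefC c) E0 eqxx (frac_NoneE E2) coef1 E0 eqxx.
by [].
Qed.

Lemma tot_ram_poly f : rational_map f -> (forall x, f x = None <-> x = None) -> polynomial_map f.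
Proof.
move=> /rational_pair[p [q [cpq -> d0 _]]] H.
have q0 : q != 0.
  by have := @fibpoly_neq0 R (p, q) None (conj cpq d0).
have [c c0 qc] : exists2 c : C, c != 0 & q = c%:P.
  apply: no_root_cst => // z; apply/negP => z0.
  by have := (H (Some z)).1; rewrite frac_SomeE z0 => /(_ erefl).
have sp : (1 < size p)%N.
  by move: d0; rewrite /frac_size qc size_polyC c0; case: (size p) => [|[|]].
by rewrite qc cst_frac//; exists (c^-1 *: p); split => //; rewrite size_scale ?invr_eq0.
Qed.

Lemma scale_mobius (l : C) : l != 0 -> exists m, [/\ mobius_map m, m None = None & forall z, m (Some z) = Some (l * z)].
Proof.
move=> l0; have D : l * 1 - 0 * 0 != 0 by rewrite mulr1 mulr0 subr0.
exists (pmap (lin l 0 0 1)); split.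
- by apply/mobius_linP; exists l, 0, 0, 1.
- by rewrite pmapE Fhat_lin//= /proj /= mul0r mulr0 addr0 eqxx.
- by move=> z; rewrite pmapE Fhat_lin//= /proj /= !mul0r !mul1r add0r addr0 oner_eq0 divr1.
Qed.

Lemma exists_root (n : nat) (c : C) : (0 < n)%N -> c != 0 -> exists2 l : C, l != 0 & l ^+ n = c.
Proof.
move=> n0 c0; exists (n.-root c); last by rewrite rootCK.
by apply: contra_neq c0 => e; rewrite -(rootCK n0 c) e expr0n gtn_eqF.
Qed.

Lemma power_fixed f : rational_map f -> (1 < rat_degree f)%N ->
  (forall x, f x = None <-> x = None) -> (forall x, f x = Some 0 <-> x = Some 0) ->
  exists2 l, [/\ mobius_map l, l None = None & l (Some 0) = Some 0] & conj_by l f (power_map (rat_degree f)).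
Proof.
move=> rf d1 Hi H0; have [p [q [cpq fE d0 dE]]] := rational_pair rf.
have q0 : q != 0 by have := @fibpoly_neq0 R (p, q) None (conj cpq d0).
have [c c0 qc] : exists2 c : C, c != 0 & q = c%:P.
  apply: no_root_cst => // z; apply/negP => z0.
  by have := (Hi (Some z)).1; rewrite fE frac_SomeE z0 => /(_ erefl).
have sp : (1 < size p)%N.
  by move: d0; rewrite /frac_size qc size_polyC c0; case: (size p) => [|[|]].
have p0 : p != 0 by rewrite -size_poly_gt0 ltnW.
have pz z : p.[z] = 0 -> z = 0.
  move=> z0; have := (H0 (Some z)).1; rewrite fE frac_SomeE qc hornerC (negPf c0) z0 mul0r.
  by move=> /(_ erefl) [].
have dp : (size p).-1 = rat_degree f.
  by rewrite dE /frac_size qc size_polyC c0 (maxn_idPl _)// ltnW.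
have pE := root0_monomial p0 pz; set a := lead_coef p in pE.
have a0 : a != 0 by rewrite lead_coef_eq0.
(* Here [f z = (a / c) z^D], and conjugation by [z |-> l z] normalizes the coefficient when
   [l^(D - 1) = a / c]. *)
have [l l0 le] : exists2 l : C, l != 0 & l ^+ (rat_degree f).-1 = a / c.
  by apply: exists_root; [move: d1; case: (rat_degree f) => [|[|]]|rewrite mulf_neq0 ?invr_eq0].
have [m [mm mi mz]] := scale_mobius l0.
exists m; first by split => //; rewrite mz mulr0.
have dq : (0 < rat_degree f)%N by exact: ltnW.
move: (rat_degree f) d1 dp le dq {dE} => D d1 dp le dq.
have E1 : frac_size ('X^D : {poly C}) 1 = D by rewrite /frac_size size_polyXn size_poly1 (maxn_idPl _).
have E0 : (D == 0%N) = false by case: (D) dq.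
apply/funext => -[z|]; rewrite /comp; last first.
  by rewrite (Hi None).2// mi /power_map (frac_NoneE E1) coef1 E0 eqxx.
rewrite mz fE frac_SomeE qc hornerC (negPf c0) mz /power_map frac_SomeE hornerC oner_eq0 divr1; congr Some.
rewrite pE dp hornerZ !hornerXn exprMn -[in RHS](prednK dq) [l ^+ _]exprS le prednK//.
by move: (z ^+ D) => w; field.
Qed.

Lemma power_swapped f : rational_map f ->
  (forall x, f x = None <-> x = Some 0) -> (forall x, f x = Some 0 <-> x = None) ->
  exists2 l, mobius_map l & conj_by l f (power_map (Negz (rat_degree f).-1)).
Proof.
move=> rf Hi H0; have [p [q [cpq fE d0 dE]]] := rational_pair rf.
have q0 : q != 0 by have := @fibpoly_neq0 R (p, q) None (conj cpq d0).
have fz z : f (Some z) = if q.[z] == 0 then None else Some (p.[z] / q.[z]) by rewrite fE.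
have qz z : q.[z] = 0 -> z = 0.
  by move=> z0; have := (Hi (Some z)).1; rewrite fz z0 eqxx => /(_ erefl) [].
have p0 : p != 0.
  by have := @fibpoly_neq0 R (p, q) (Some 0) (conj cpq d0); rewrite /= scale0r subr0.
have [c c0 pc] : exists2 c : C, c != 0 & p = c%:P.
  apply: no_root_cst => // z; apply/negP => /eqP z0.
  have := (H0 (Some z)).1; rewrite fz z0 mul0r; case: eqP => [e|_ /(_ erefl)//].
  by have := coprimep_root cpq (introT eqP z0); rewrite e eqxx.
have sq : (1 < size q)%N.
  by move: d0; rewrite /frac_size pc size_polyC c0; case: (size q) => [|[|]].
have dq : (size q).-1 = rat_degree f.
  by rewrite dE /frac_size pc size_polyC c0 (maxn_idPr _)// ltnW.
have qE := root0_monomial q0 qz; set a := lead_coef q in qE.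
have a0 : a != 0 by rewrite lead_coef_eq0.
have dg : (0 < rat_degree f)%N by exact: rat_degree_gt0.
(* Here [f z = c / (a z^D)], and the scaling has to satisfy [l * c / a = l^(- D)]. *)
have [l l0 le] : exists2 l : C, l != 0 & l ^+ (rat_degree f).+1 = a / c.
  by apply: exists_root => //; rewrite mulf_neq0 ?invr_eq0.
have [m [mm mi mz]] := scale_mobius l0.
exists m => //; move: (rat_degree f) dq le dg {dE} => D dq le dg.
have E1 : frac_size (1 : {poly C}) 'X^D = D by rewrite /frac_size size_polyXn size_poly1 (maxn_idPr _).
have E0 : (D == 0%N) = false by case: (D) dg.
apply/funext => -[z|]; rewrite /comp; last first.
  rewrite (H0 None).2// mi mz mulr0 /power_map prednK// (frac_NoneE E1) coefXn coef1 eqxx oner_eq0 E0.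
  by rewrite mul0r.
have qzE : q.[z] = a * z ^+ D by rewrite qE dq hornerZ hornerXn.
rewrite mz /power_map prednK// fz frac_SomeE qzE hornerXn hornerC.
rewrite mulf_eq0 (negPf a0) expf_eq0 dg expf_eq0 dg mulf_eq0 (negPf l0) /=.
have [//|z0] := eqVneq z 0; rewrite mz pc hornerC; congr Some.
have la : l * c = a / l ^+ D.
  apply: (mulIf (expf_neq0 D l0)); rewrite mulrAC -exprS le; field.
  by rewrite c0 expf_neq0.
rewrite exprMn mulrA la; move: (expf_neq0 D z0) (expf_neq0 D l0); move: (z ^+ D) (l ^+ D) => u w u0 w0; field.
by rewrite a0 u0 w0.
Qed.
End Mobius.

Section TotallyRamified.
Context {R : realType}.
Local Notation C := (Cx R).
Local Notation X := (sphere R).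
Implicit Types (f g m : X -> X) (x y e : X).

Definition TR f x : Prop := forall a, f a = f x -> a = x.
(** Phrased along forward orbits, the form in which atoms of balanced measures produce it. In degree
    greater than 1 such a point satisfies [f (f x) = x] or [f x = x], so its backward orbit is
    finite as well. *)
Definition exc f x : Prop := forall n, TR f (iter n f x).

Lemma TR_fib f x : rational_map f -> TR f x -> fib f (f x) = nseq (rat_degree f) x.
Proof.
move=> rf tx; rewrite -(size_fib (f x) rf); apply/all_pred1P/allP => a.
by rewrite fibP// => /eqP /tx ->; rewrite /= eqxx.
Qed.

Lemma plucker (u a b c : C * C) :
  wedge a b * wedge u c + wedge b c * wedge u a + wedge c a * wedge u b = 0.
Proof. by rewrite /wedge; ring. Qed.

(** The Plucker relation between the three values becomes a linear relation between the [d]-th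
    powers of three pairwise independent linear forms. Along the line [x1 + t x2] two of these
    powers are multiples of [t^d] and of 1, so for [d >= 2] the coefficient of [t] comes from the
    third alone, where it is nonzero. *)
Lemma TR_three f x1 x2 x3 : rational_map f -> (1 < rat_degree f)%N ->
  TR f x1 -> TR f x2 -> TR f x3 -> x1 != x2 -> x2 != x3 -> x3 != x1 -> False.
Proof.
move=> rf d1 t1 t2 t3 n12 n23 n31.
have [g fE] := rational_spec rf; set pq := fraction_of f in g fE.
have W x : TR f x -> exists2 c : C, c != 0 &
    forall v, wedge (Fhat pq v) (vec (f x)) = c * wedge v (vec x) ^+ rat_degree f.
  move=> tx; have [c [c0 _] H] := wedge_Fhat (f x) g; exists c => // v.
  by rewrite H -/(fib f (f x)) TR_fib// prod_nseq.
have inj a b : TR f a -> a != b -> wedge (vec (f a)) (vec (f b)) != 0.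
  by move=> ta ab; apply: wedge_neq0; apply: contra ab => /eqP e; apply/eqP/esym/ta.
have [c1 c10 H1] := W _ t1; have [c2 c20 H2] := W _ t2; have [c3 c30 H3] := W _ t3.
have d0 := ltnW d1; move: (rat_degree f) d1 d0 H1 H2 H3 => d d1 d0 H1 H2 H3.
pose A1 := wedge (vec (f x2)) (vec (f x3)) * c1.
pose A2 := wedge (vec (f x3)) (vec (f x1)) * c2.
pose A3 := wedge (vec (f x1)) (vec (f x2)) * c3.
have A30 : A3 != 0 by rewrite mulf_neq0 ?inj.
have rel v : A3 * wedge v (vec x3) ^+ d + A1 * wedge v (vec x1) ^+ d + A2 * wedge v (vec x2) ^+ d = 0.
  rewrite -[RHS](plucker (Fhat pq v) (vec (f x1)) (vec (f x2)) (vec (f x3))).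
  by rewrite H1 H2 H3 /A1 /A2 /A3; ring.
pose a := wedge (vec x1) (vec x3); pose b := wedge (vec x2) (vec x3).
pose P : {poly C} := A3 *: (a%:P + b *: 'X) ^+ d + (A1 * wedge (vec x2) (vec x1) ^+ d) *: 'X^d
  + (A2 * wedge (vec x1) (vec x2) ^+ d)%:P.
have P0 : P = 0.
  apply/eqP/negPn/negP => /closed_nonrootP[t] /negP; apply; apply/rootP.
  rewrite !hornerE /=.
  have := rel ((vec x1).1 + t * (vec x2).1, (vec x1).2 + t * (vec x2).2).
  have -> : wedge ((vec x1).1 + t * (vec x2).1, (vec x1).2 + t * (vec x2).2) (vec x3) = a + b * t.
    by rewrite /a /b /wedge /=; ring.
  have -> : wedge ((vec x1).1 + t * (vec x2).1, (vec x1).2 + t * (vec x2).2) (vec x1) = wedge (vec x2) (vec x1) * t.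
    by rewrite /wedge /=; ring.
  have -> : wedge ((vec x1).1 + t * (vec x2).1, (vec x1).2 + t * (vec x2).2) (vec x2) = wedge (vec x1) (vec x2).
    by rewrite /wedge /=; ring.
  by rewrite exprMn => <-; rewrite !mulrA.
have : (P^`()).[0] = 0 by rewrite P0 deriv0 horner0.
rewrite /P derivD derivD derivC !derivZ derivXn deriv_exp derivD derivC derivZ derivX addr0 add0r.
rewrite alg_polyC hornerD !hornerZ !hornerMn hornerXn hornerM horner_exp hornerD !hornerC hornerZ hornerX mulr0 addr0.
have -> : 0 ^+ d.-1 = 0 :> C by rewrite expr0n; case: (d) d1 => [|[|]].
rewrite mul0rn mulr0 addr0.
move/eqP; rewrite mulf_eq0 (negPf A30) /= mulrn_eq0 -leqn0 leqNgt d0 /= mulf_eq0 expf_eq0.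
have nz u v : u != v -> wedge (vec u) (vec v : C * C) == 0 = false by move=> uv; exact/negbTE/wedge_neq0.
by rewrite /b /a !nz ?andbF// eq_sym.
Qed.

Section Deg2.
Variable f : X -> X.
Hypotheses (rf : rational_map f) (d1 : (1 < rat_degree f)%N).

Lemma exc_step x : exc f x -> exc f (f x).
Proof. by move=> ex n; rewrite -iterSr; exact: ex. Qed.

Lemma exc_period x : exc f x -> f x = x \/ f (f x) = x.
Proof.
move=> ex; have t0 : TR f x := ex 0%N; have t1 : TR f (f x) := ex 1%N; have t2 : TR f (f (f x)) := ex 2%N.
have [e|n1] := eqVneq x (f x); first by left.
have [e|n3] := eqVneq (f (f x)) x; first by right.
have [e|n2] := eqVneq (f x) (f (f x)); first by left; apply: t0; rewrite -e.
by have := TR_three rf d1 t0 t1 t2 n1 n2 n3.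
Qed.

Lemma exc_seq : exists es : seq X, forall x, exc f x <-> x \in es.
Proof.
have [[a ea]|na] := pselect (exists a, exc f a); last first.
  by exists [::] => x; split => // ex; case: na; exists x.
have [[b [eb ab]]|nb] := pselect (exists b, exc f b /\ b != a); last first.
  exists [:: a] => x; rewrite inE; split => [ex|/eqP -> //].
  by apply/negPn/negP => xa; apply: nb; exists x.
exists [:: a; b] => x; rewrite !inE; split => [ex|/orP[] /eqP -> //].
apply/negPn/negP; rewrite negb_or => /andP[xa xb].
by apply: (TR_three rf d1 (ea 0%N) (eb 0%N) (ex 0%N)) => //=; rewrite eq_sym.
Qed.

Lemma TR_contract e : TR f e -> exists2 M : R, 0 < M & forall a, ch (f a) (f e) <= M * ch a e ^+ rat_degree f.
Proof.
move=> te; have [T [c [m H]]] := rational_factorizes rf; have [m0 _ _ _] := H.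
exists (m ^- 2); first by rewrite invr_gt0 exprn_gt0.
move=> a; have /andP[_] := factorizes_bounds H a (f e).
by rewrite TR_fib// prod_nseq.
Qed.

Definition near (es : seq X) (r : R) : set X := [set a | exists2 e, e \in es & ch a e < r].

Lemma near_le (es : seq X) (r r' : R) : r <= r' -> near es r `<=` near es r'.
Proof. by move=> rr a [e ee ae]; exists e => //; exact: lt_le_trans rr. Qed.

Lemma near_open (es : seq X) (r : R) : open (near es r).
Proof.
rewrite (_ : near es r = \bigcup_(e in [set` es]) [set a | ch e a < r]); last first.
  by apply/seteqP; split=> a [e /= ee ae]; exists e; rewrite //= chC.
by apply: bigcup_open => e _; exact: open_ball_ch.
Qed.

(** The fibre over the image of an exceptional point [e] is [d] copies of [e], so [f] contracts
    distances to [e] like a [d]-th power with [d >= 2]; below [(2 * M)^-1] distances are at least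
    halved. *)
Lemma near_basin (es : seq X) : (forall x, exc f x <-> x \in es) ->
  exists2 r0 : R, 0 < r0 & forall r, 0 < r -> r <= r0 -> near es r `<=` f @^-1` near es (r / 2).
Proof.
move=> E.
have [M M0 HM] : exists2 M : R, 0 < M & forall e a, e \in es -> ch (f a) (f e) <= M * ch a e ^+ rat_degree f.
  have : forall e, e \in es -> TR f e by move=> e /E ex; exact: (ex 0%N).
  elim: {E} es => [|e s IH] H; first by exists 1.
  have [M M0 HM] := IH (fun e' es => H e' (@mem_behead _ (e :: s) e' es)).
  have [N N0 HN] := TR_contract (H e (mem_head _ _)).
  exists (Num.max M N); first by rewrite lt_max M0.
  move=> e' a; rewrite inE => /orP[/eqP ->|es].
    by apply: le_trans (HN a) _; rewrite ler_wpM2r ?exprn_ge0 ?ch_ge0// le_max lexx orbT.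
  by apply: le_trans (HM _ a es) _; rewrite ler_wpM2r ?exprn_ge0 ?ch_ge0// le_max lexx.
exists (2 * M)^-1; first by rewrite invr_gt0 mulr_gt0.
move=> r r0 rr a [e ee ae]; exists (f e); first by apply/E/exc_step/E.
apply: le_lt_trans (HM e a ee) _.
have a0 := ch_ge0 a e; have a1 := ch_le1 a e.
apply: (@le_lt_trans _ _ (M * ch a e ^+ 2)).
  by rewrite ler_pM2l// -(subnKC d1) exprD ler_piMr ?exprn_ge0// exprn_ile1.
have Mr : M * r <= 2^-1.
  by move: rr; rewrite invfM mulrC -ler_pdivlMl// mulrC.
apply: (@le_lt_trans _ _ (M * r * ch a e)).
  by rewrite expr2 mulrA ler_wpM2r// ler_pM2l// ltW.
apply: (@le_lt_trans _ _ (2^-1 * ch a e)); first by rewrite ler_wpM2r.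
by rewrite mulrC ltr_pM2r// invr_gt0.
Qed.
End Deg2.

Section Conjugation.
Variables (g m n : X -> X).
Hypotheses (rg : rational_map g) (mm : mobius_map m) (mn : mobius_map n).
Hypotheses (mK : cancel m n) (nK : cancel n m).
Let P := m \o g \o n.

Lemma conj_tot a b : g a = b -> TR g a -> forall z, P z = m b <-> z = m a.
Proof.
move=> gab ta z; split => [|->]; last by rewrite /P /= mK gab.
move=> /(can_inj mK) e; apply: (can_inj nK); rewrite mK; apply: ta.
by rewrite gab.
Qed.

Lemma conjP : m \o g = P \o m.
Proof. by apply/funext => x; rewrite /P /= mK. Qed.

Lemma conj_lift (l h : X -> X) : l \o P = h \o l -> (l \o m) \o g = h \o (l \o m).
Proof.
move=> H; apply/funext => x; have /(congr1 (fun k => k (m x))) := H.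
by rewrite /P /= mK.
Qed.
End Conjugation.

Lemma fixed_poly g e m : rational_map g -> mobius_map m -> m e = None ->
  g e = e -> TR g e -> conj_to_poly_by m g.
Proof.
move=> rg mm me ge te; have [n [mn mK nK]] := mobius_inv mm.
exists (m \o g \o n); last exact: conjP.
apply: tot_ram_poly; first by case: (rational_conj mm mn rg).
by move=> x; have := conj_tot mK nK ge te x; rewrite me.
Qed.

Lemma poly_fixed g m : mobius_map m -> conj_to_poly_by m g ->
  exists e, [/\ m e = None, g e = e & exc g e].
Proof.
move=> mm [P [p [sp PE]] cP]; have [n [_ mK nK]] := mobius_inv mm.
have PN : P None = None.
  have E1 : frac_size p 1 = (size p).-1 by rewrite /frac_size size_poly1 (maxn_idPl (ltnW sp)).
  rewrite PE (frac_NoneE E1) coef1.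
  have -> : ((size p).-1 == 0%N) = false by move: sp; case: (size p) => [|[|]].
  by rewrite eqxx.
have PS z : P (Some z) <> None by rewrite PE frac_SomeE hornerC oner_eq0.
have gx x : m (g x) = P (m x) by have /(congr1 (fun k => k x)) := cP.
have ge : g (n None) = n None by apply: (can_inj mK); rewrite gx nK PN.
exists (n None); split => // k; have -> : iter k g (n None) = n None by elim: k => //= k ->.
move=> a; rewrite ge => /(congr1 m); rewrite gx nK => h; apply: (can_inj mK); rewrite nK.
by case: (m a) h => // z /PS.
Qed.

(** Two exceptional points, fixed or exchanged, can be moved to 0 and infinity, where the map is
    conjugate to a power [z^n] with [n] positive or negative. A nonexceptional map thus has at most
    one, necessarily fixed. *)
Lemma exc_nonexceptional g : rational_map g -> ~ exceptional g ->
  (1 < rat_degree g)%N /\ ((forall x, ~ exc g x) \/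
  exists e, [/\ g e = e, TR g e & forall x, exc g x -> x = e]).
Proof.
move=> rg ng; have d1 : (1 < rat_degree g)%N.
  have := rat_degree_gt0 rg; rewrite leq_eqVlt => /orP[/eqP e|//].
  by exfalso; apply: ng; constructor 1.
split => //; have [[x ex]|nx] := pselect (exists x, exc g x); last first.
  by left=> x ex; apply: nx; exists x.
right; have tx : TR g x := ex 0%N.
have [gx|/eqP gx] := pselect (g x = x); last first.
  exfalso; have ggx : g (g x) = x by case: (exc_period rg d1 ex) => // e; rewrite e eqxx in gx.
  have [m [mm mx my]] : exists m, [/\ mobius_map m, m x = None & m (g x) = Some 0].
    by apply: mobius_points; rewrite eq_sym.
  have [n [mn mK nK]] := mobius_inv mm; have [rP dP] := rational_conj mm mn rg.
  have H1 z : (m \o g \o n) z = None <-> z = Some 0.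
    by have := conj_tot mK nK ggx (ex 1%N) z; rewrite mx my.
  have H2 z : (m \o g \o n) z = Some 0 <-> z = None.
    by have := conj_tot mK nK erefl tx z; rewrite mx my.
  have [l ml cl] := power_swapped rP H1 H2; apply: ng; constructor 2.
  exists (Negz (rat_degree (m \o g \o n)).-1); exists (l \o m); first exact: mobius_comp.
  exact: (conj_lift mK cl).
exists x; split => // y ey; apply/eqP/negPn/negP => yx.
have ty : TR g y := ey 0%N.
have [gy|/eqP gy] := pselect (g y = y); last first.
  apply: (TR_three rg d1 tx ty (ey 1%N)); rewrite //= 1?eq_sym//.
  by apply: contra yx => /eqP e; apply/eqP/tx; rewrite gx.
have [m [mm mx my]] : exists m, [/\ mobius_map m, m x = None & m y = Some 0].
  by apply: mobius_points; rewrite eq_sym.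
have [n [mn mK nK]] := mobius_inv mm; have [rP dP] := rational_conj mm mn rg.
have H1 z : (m \o g \o n) z = None <-> z = None.
  by have := conj_tot mK nK gx tx z; rewrite mx.
have H2 z : (m \o g \o n) z = Some 0 <-> z = Some 0.
  by have := conj_tot mK nK gy ty z; rewrite my.
have [|l [ml _ _] cl] := power_fixed rP _ H1 H2; first by rewrite dP.
apply: ng; constructor 2; exists (Posz (rat_degree (m \o g \o n))).
exists (l \o m); first exact: mobius_comp.
exact: (conj_lift mK cl).
Qed.
End TotallyRamified.

(** * Balanced measures *)

Section Balanced.
Context {R : realType}.
Local Notation C := (Cx R).
Local Notation X := (sphere R).
Local Notation bX := (borel_sphere R).
Implicit Types (f g : X -> X) (x y e : X) (nu mu : probability bX R) (phi : X -> R).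

Definition balanced f nu : Prop := forall phi, continuous phi -> I_ nu (Lr f phi) = I_ nu phi.

Lemma ofR_continuous phi : continuous phi -> continuous (fun x => ofR (phi x)).
Proof.
move=> cp x A /nbhs_modP[r r0 H]; have /nbhs_chP[d d0 Hd] : nbhs x [set y | `|phi y - phi x| < r].
  by have /cvgrPdist_lt/(_ r r0) := cp x; apply: filterS => y /=; rewrite distrC.
apply/nbhs_chP; exists d => // y xy; apply: H; rewrite -[_ - _](_ : ofR (phi y - phi x) = _).
  by rewrite mod_ofR; exact: Hd.
by rewrite /ofR rmorphB.
Qed.

Lemma comp_lip_continuous (h : C -> R) (psi : X -> C) :
  (forall z w, `|h z - h w| <= modulus (z - w)) -> continuous psi -> continuous (h \o psi).
Proof.
move=> hl cp x; apply: continuous_comp; first exact: cp.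
move=> A /nbhs_ballP[e /= e0 H]; apply/nbhs_modP; exists e => // w wz.
by apply: H; rewrite /ball/=; apply: le_lt_trans wz; rewrite modBC.
Qed.

Lemma lyubich_measureP (S : set (X -> X)) nu : S `<=` rational_map ->
  lyubich_measure S nu <-> forall f, S f -> balanced f nu.
Proof.
move=> rS; split => [H f Sf phi cp|H psi f cp Sf].
  have := H _ f (ofR_continuous cp) Sf; rewrite /complex_integral => -[E _].
  move: E; rewrite /I_ => <-; congr Rintegral; apply/funext => x.
  by rewrite (ofR_lyubich _ _ (rS _ Sf)).
have cR : continuous ((fun z : C => complex.Re z) \o psi).
  apply: comp_lip_continuous => // z w; rewrite -[_ - _](_ : complex.Re (z - w) = _) ?Re_le_mod//.
  by case: z w => ? ? [? ?].
have cI : continuous ((fun z : C => complex.Im z) \o psi).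
  apply: comp_lip_continuous => // z w; rewrite -[_ - _](_ : complex.Im (z - w) = _) ?Im_le_mod//.
  by case: z w => ? ? [? ?].
have := H f Sf _ cR; have := H f Sf _ cI; rewrite /complex_integral /I_ => <- <-.
have rf := rS _ Sf; congr Complex; congr Rintegral; apply/funext => x.
  exact: Re_lyubich.
exact: Im_lyubich.
Qed.

Lemma indic1 x y : \1_[set x] y = (y == x)%:R :> R.
Proof.
rewrite indicE; congr (nat_of_bool _)%:R; have [->|yx] := eqVneq y x; first exact: mem_set.
by apply: memNset => /eqP; rewrite (negPf yx).
Qed.

Section OneMap.
Variables (f : X -> X) (nu : probability bX R).
Hypotheses (rf : rational_map f) (bal : balanced f nu).

Lemma rational_continuous : continuous f.
Proof.
have [T [c [m H]]] := rational_factorizes rf; have [m0 _ _ _] := H.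
apply: (@lipschitz_continuous _ f (m ^- 2)) => a b.
have /andP[_ h] := factorizes_bounds H a (f b); apply: le_trans h _.
rewrite ler_wpM2l ?invr_ge0 ?exprn_ge0 ?(ltW m0)//; apply: prod_ch_le.
by rewrite fibP.
Qed.

(** Balancedness is a statement about continuous functions; decreasing bumps carry it to closed
    sets, the form needed for atoms and for pieces on which [f] is injective. *)
Lemma Lr_bmf_indic (B : set X) : closed B -> bmf (Lr f \1_B : bX -> R) /\ I_ nu (Lr f \1_B) = prob nu B.
Proof.
move=> cB.
have [||| b c] := @I_dominated _ _ R nu (fun n => Lr f (bump B n)) (Lr f \1_B) 1.
- by move=> n; apply: cont_meas; apply: Lr_continuous => //; exact: bump_cont.
- move=> n x; apply: Lr_abs_le => // y.
  by rewrite ger0_norm ?bump_ge0// bump_le1.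
- move=> x; apply: cvgM; first exact: cvg_cst.
  by apply: cvg_sum_seq => y; exact: bump_cvg.
split => //; apply: (@cvg_unique _ (@Rhausdorff R) _ _ _ _ c).
rewrite (_ : (fun n => _) = fun n => I_ nu (bump B n)); first exact: I_bump_cvg.
by apply/funext => n; apply: bal; exact: bump_cont.
Qed.

Lemma balanced_closed_le (B : set X) (h : bX -> R) : closed B -> bmf h ->
  (forall y, Lr f \1_B y <= h y) -> prob nu B <= I_ nu h.
Proof. by move=> cB bh H; have [b <-] := Lr_bmf_indic cB; exact: I_le. Qed.

(** Since [Lr f (g \o f) = g], integrals of continuous functions are invariant, hence masses of
    closed sets. Inner regularity gives one inequality for measurable sets, and complements give the
    other. *)
Lemma balanced_invariant : invariant_measure f nu.
Proof.
have cf := rational_continuous.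
have pm (A : set X) : measurable (A : set bX) -> measurable (f @^-1` A : set bX).
  by move=> mA; have := contX_meas cf; rewrite /measurable_fun => /(_ measurableT A mA); rewrite setTI.
have H0 (A : set X) : closed A -> prob nu (f @^-1` A) = prob nu A.
  move=> cA; have b (g : X -> R) : continuous g -> I_ nu (fun x => g (f x)) = I_ nu g.
    move=> cg; rewrite -bal; last exact: cont_pre.
    congr (I_ nu); apply/funext => y.
    rewrite -[RHS]mulr1 -(Lr_cst 1 y rf) -Lr_pull//; apply: Lr_eq => x _; by rewrite mulr1.
  have cA' : closed (f @^-1` A) by apply: closed_comp => // x _; exact: cf.
  have [|||_ c] := @I_dominated _ _ R nu (fun n x => bump A n (f x)) (\1_(f @^-1` A)) 1.
  - by move=> n; apply: cont_meas; apply: cont_pre => //; exact: bump_cont.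
  - by move=> n x; rewrite ger0_norm ?bump_ge0// bump_le1.
  - by move=> x; have := @bump_cvg R A (f x) cA; rewrite !indicE /in_mem.
  rewrite -I_indic; last exact: closed_meas.
  apply: (@cvg_unique _ (@Rhausdorff R) _ _ _ _ c).
  rewrite (_ : (fun n => _) = fun n => I_ nu (bump A n)); first exact: I_bump_cvg.
  by apply/funext => n; rewrite b//; exact: bump_cont.
have le (A : set X) : measurable (A : set bX) -> prob nu A <= prob nu (f @^-1` A).
  move=> mA; apply/ler_addgt0Pr => e e0; have [F cF [FA h]] := prob_regular nu mA e0.
  apply: (@le_trans _ _ (prob nu F + e)); first by rewrite -lerBlDl ltW.
  rewrite lerD2r -H0//; apply: prob_le; [by apply: pm; exact: closed_meas|exact: pm|].
  by move=> x; exact: FA.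
move=> A mA; rewrite !probE//; last exact: pm.
congr EFin; apply/eqP; rewrite eq_le le// andbT.
have := le (~` A) (measurableC mA); rewrite preimage_setC !prob_setC//; last exact: pm.
by rewrite lerD2l lerN2.
Qed.

Lemma Lr_ge_term phi x y : (forall z, 0 <= phi z) -> x \in fib f y ->
  (rat_degree f)%:R^-1 * phi x <= Lr f phi y.
Proof.
move=> p0 xy; rewrite ler_wpM2l ?invr_ge0// (perm_big _ (perm_to_rem xy)) big_cons lerDl.
by rewrite big_seq sumr_ge0.
Qed.

Lemma Lr_indic1_le1 x y : Lr f \1_[set x] y <= \1_[set f x] y.
Proof.
rewrite indic1; have [->|yx] := eqVneq y (f x).
  rewrite -[leRHS](Lr_cst 1 (f x) rf); apply: Lr_le => z _.
  by rewrite indic1; case: eqP => _; rewrite ?ler01.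
rewrite -[leRHS](Lr_cst 0 y rf); apply: Lr_le => z; rewrite fibP// => /eqP fz.
by rewrite indic1; case: eqP => // zx; move: yx; rewrite -fz zx eqxx.
Qed.

Lemma atom_le x : prob nu [set x] <= prob nu [set f x].
Proof.
rewrite -(I_indic nu (point_meas (f x))); apply: balanced_closed_le; first exact: point_closed.
  by apply: bmf_indic; exact: point_meas.
exact: Lr_indic1_le1.
Qed.

(** A second preimage of [f x] would take at least the share [1 / d] of the fibre, leaving to [x] at
    most [1 - 1 / d] of the mass of [f x]. *)
Lemma atom_TR x : prob nu [set f x] <= prob nu [set x] -> 0 < prob nu [set x] -> TR f x.
Proof.
move=> h p0 a fa; apply/eqP/negPn/negP => ax.
pose t : R := (rat_degree f)%:R^-1; have t0 : 0 < t by rewrite invr_gt0 ltr0n rat_degree_gt0.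
have : prob nu [set x] <= (1 - t) * prob nu [set f x].
  rewrite -(I_indic nu (point_meas (f x))) -I_Z; last by apply: bmf_indic; exact: point_meas.
  apply: balanced_closed_le; first exact: point_closed.
    by apply: bmfM; [exact: bmf_cst|apply: bmf_indic; exact: point_meas].
  move=> y; have := Lr_indic1_le1 x y; rewrite !indic1; have [->|yx] := eqVneq y (f x); last by rewrite mulr0.
  rewrite mulr1 => _.
  have h2 : Lr f (fun z => \1_[set x] z + \1_[set a] z) (f x) <= 1.
    rewrite -[leRHS](Lr_cst 1 (f x) rf); apply: Lr_le => z _; rewrite !indic1.
    have [->|zx] := eqVneq z x; first by rewrite eq_sym (negPf ax) addr0.
    by case: eqP => _; rewrite add0r ?ler01.
  have : t * \1_[set a] a <= Lr f \1_[set a] (f x).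
    apply: Lr_ge_term; last by rewrite fibP// fa.
    by move=> z; rewrite indic1 ler0n.
  rewrite LrD in h2; rewrite indic1 eqxx mulr1; lra.
move=> h1; have tp : 0 < t * prob nu [set f x] by rewrite mulr_gt0// (lt_le_trans p0)// atom_le.
by rewrite mulrBl mul1r in h1; lra.
Qed.

(** Masses do not decrease along the orbit of an atom, so the orbit is finite. A point with at least
    the mass of its image is totally ramified; this injectivity removes the preperiodic part one
    step at a time, and on the resulting cycle all masses agree. *)
Lemma atom_exc x : 0 < prob nu [set x] -> exc f x.
Proof.
move=> p0; pose p n := prob nu [set iter n f x].
have mono i j : (i <= j)%N -> p i <= p j.
  by move=> /subnK <-; elim: (j - i)%N => [|k IH]; rewrite ?add0n// addSn (le_trans IH)// /p iterS atom_le.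
have pp n : 0 < p n by apply: lt_le_trans (mono 0%N n (leq0n n)).
have [i [j [ij e]]] : exists i j, (i < j)%N /\ iter i f x = iter j f x.
  apply: contrapT => H; have [N Np] : exists N : nat, 1 < N%:R * prob nu [set x].
    have [n hn] := ltr_add_invr p0; exists n.+1; rewrite add0r in hn.
    by rewrite -ltr_pdivrMl ?ltr0n// mulr1.
  have bi k : bmf (\1_[set iter k f x] : bX -> R) by apply: bmf_indic; exact: point_meas.
  have : \sum_(k <- iota 0 N) p k <= 1.
    rewrite /p; under eq_bigr do rewrite -(I_indic nu (point_meas _)).
    rewrite -I_sum// -[leRHS](I_cst nu); apply: I_le; [exact: bmf_sum|exact: bmf_cst|].
    move=> y; have [[k ek]|nk] := pselect (exists k, y = iter k f x); last first.
      rewrite big1 ?ler01// => k _; rewrite indicE memNset// => e; apply: nk; by exists k.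
    have [kN|kN] := boolP (k \in iota 0 N).
      rewrite (bigD1_seq k) ?iota_uniq//= big1 ?addr0; first by rewrite indicE; case: (_ \in _); rewrite ?ler01.
      move=> l lk; rewrite indicE memNset//= => e; apply: H; rewrite ek in e.
      by case: (ltngtP l k) lk => // lk _; [exists l, k|exists k, l].
    rewrite big1_seq ?ler01// => l /= ln; rewrite indicE memNset//= => e; apply: H; rewrite ek in e.
    case: (ltngtP l k) => lk; [by exists l, k|by exists k, l|by move: kN; rewrite -lk ln].
  apply/negP; rewrite -ltNge; apply: lt_le_trans Np _.
  apply: (@le_trans _ _ (\sum_(k <- iota 0 N) p 0%N)); first by rewrite sum_const_seq size_iota mulr_natl.
  by apply: ler_sum => k _; exact: mono.
elim: i j e ij => [|i IH] j e ij.
  move=> n; apply: atom_TR; last exact: pp.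
  have ej k : iter (k * j) f x = x by elim: k => // k IH; rewrite mulSn iterD IH -e.
  have e0 : p (n.+1 * j)%N = p 0%N by rewrite /p ej.
  apply: (@le_trans _ _ (p 0%N)); last exact: mono.
  by rewrite -e0; apply: (mono n.+1); rewrite leq_pmulr.
case: j e ij => // j e ij; apply: (IH j) => //.
apply: (@atom_TR (iter j f x)) => //; last exact: pp.
rewrite -/(iter j.+1 f x) -e; apply: (mono i.+1 j); exact: ij.
Qed.
End OneMap.

End Balanced.

(** * Nonatomic balanced measures from an invariant mean *)

Section Existence.
Context {R : realType}.
Local Notation C := (Cx R).
Local Notation X := (sphere R).
Local Notation bX := (borel_sphere R).
Implicit Types (f g : X -> X) (x y e : X) (nu mu : probability bX R) (phi : X -> R).

Lemma generated_rational (F : set (X -> X)) : F `<=` rational_map -> generated F `<=` rational_map.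
Proof. by move=> rF f; elim=> [h /rF//|h k _ rh _ rk]; exact: rational_comp. Qed.

Lemma sup_norm_bounded phi : continuous phi -> exists2 K : R, 0 <= K & forall x, `|phi x| <= K.
Proof.
move=> /continuous_bounded[M HM]; exists `|M| => // x.
exact: le_trans (HM x) (ler_norm M).
Qed.

Lemma Re_ge0 (z : C) : 0 <= z -> 0 <= complex.Re z.
Proof. by rewrite lecE => /andP[]. Qed.

Section Mean.
Variables (F : set (X -> X)) (x0 : X).
Hypothesis rF : F `<=` rational_map.
Let rep phi : semigroup F -> C := fun s => ofR (Lr (sval s) phi x0).
Let rs (s : semigroup F) : rational_map (sval s).
Proof. by apply: (generated_rational rF); exact: svalP. Qed.

Let rep_bounded phi : continuous phi -> bounded_functions (rep phi).
Proof.
move=> /sup_norm_bounded[K K0 HK]; exists K => s.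
by rewrite mod_ofR; apply: Lr_abs_le.
Qed.

Let rep_X phi : continuous phi ->
  X_space continuous_functions (@lyubich_rep R F) (rep phi).
Proof.
move=> cp; exists 1%N, (fun=> 1), (fun=> rep phi); split; last first.
  by apply/funext => s; rewrite big_ord1 mul1r.
move=> _; left=> e e0; exists (rep phi); last by move=> s; rewrite subrr mod0 ltW.
exists 1%N, (fun=> 1), (fun=> rep phi); split; last first.
  by apply/funext => s; rewrite big_ord1 mul1r.
move=> _; exists (fun x => ofR (phi x)), (fun psi => psi x0); split.
- exact: ofR_continuous.
- by split=> //; exists 1 => _ [psi [_ h] <-]; exact: h.
- by apply/funext => s; rewrite /lyubich_rep ofR_lyubich.
Qed.

(** Right translation by [s] turns [L_t phi (x0)] into [L_t (L_s phi) (x0)], so invariance of the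
    mean is balancedness for [s]. The last clause locates the measure on the closure of the backward
    orbit of [x0], which is why [x0] is left free. *)
Lemma amenable_balanced :
  right_amenable (@semigroup_mul R F) continuous_functions (@lyubich_rep R F) ->
  exists nu, (forall s, generated F s -> balanced s nu) /\
    forall phi, continuous phi ->
      (forall s x, generated F s -> s x = x0 -> phi x = 0) -> I_ nu phi = 0.
Proof.
case=> M [[linM _] posM _ M1] invM.
pose Lam phi := complex.Re (M (rep phi)).
have b0 : bounded_functions ((fun=> 0) : semigroup F -> C) by exists 0 => s; rewrite mod0.
have M0 : M (fun=> 0) = 0.
  have h : M (fun=> 0) = 1 * M (fun=> 0) + M (fun=> 0).
    by rewrite -(linM 1 _ _ b0 b0); congr M; apply/funext => s; rewrite mulr0 addr0.
  have {h} : M (fun=> 0) = M (fun=> 0) + M (fun=> 0) by rewrite {1}h mul1r.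
  by move/eqP; rewrite -subr_eq0 opprD addrA subrr sub0r oppr_eq0 => /eqP.
have LamD phi psi : continuous phi -> continuous psi -> Lam (fun x => phi x + psi x) = Lam phi + Lam psi.
  move=> cp cq; rewrite /Lam; have -> : rep (fun x => phi x + psi x) = fun s => 1 * rep phi s + rep psi s.
    by apply/funext => s; rewrite mul1r /rep LrD /ofR rmorphD.
  rewrite linM; [|exact: rep_bounded|exact: rep_bounded].
  by rewrite mul1r; case: (M (rep phi)) (M (rep psi)) => ? ? [].
have LamZ c phi : continuous phi -> Lam (fun x => c * phi x) = c * Lam phi.
  move=> cp; rewrite /Lam; have -> : rep (fun x => c * phi x) = fun s => ofR c * rep phi s + (fun=> 0) s.
    by apply/funext => s; rewrite addr0 /rep LrZ /ofR rmorphM.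
  rewrite linM; [|exact: rep_bounded|by []].
  by rewrite M0 addr0 Re_ofRM.
have Lam_ge0 phi : continuous phi -> (forall x, 0 <= phi x) -> 0 <= Lam phi.
  move=> cp p0; apply: Re_ge0; apply: posM; first exact: rep_bounded.
  move=> s; rewrite /rep /ofR lecR -(Lr_cst 0 x0 (rs s)); exact: Lr_le.
have Lam1 : Lam (fun=> 1) = 1.
  rewrite /Lam (_ : rep (fun=> 1) = fun=> 1) ?M1//.
  by apply/funext => s; rewrite /rep Lr_cst.
have [nu H] := riesz_representation LamD LamZ Lam_ge0 Lam1.
exists nu; split=> [s gs phi cp|phi cp p0]; last first.
  rewrite H// /Lam (_ : rep phi = fun=> 0) ?M0//; apply/funext => s.
  have -> : 0 = ofR (Lr (sval s) (fun=> 0) x0) :> C by rewrite Lr_cst.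
  congr ofR; apply: Lr_eq => x; rewrite fibP// => /eqP sx; apply: p0 sx; exact: svalP.
have rsm : rational_map s by exact: (generated_rational rF).
have cL : continuous (Lr s phi) by exact: Lr_continuous.
rewrite !H// /Lam -(invM (rep phi) (exist _ s gs)); last exact: rep_X.
congr (complex.Re (M _)); apply/funext => t.
by rewrite /right_translate /rep /= Lr_comp.
Qed.
End Mean.

Lemma nrmSE (z : C) : nrm (z, 1) = Num.sqrt (modulus z ^+ 2 + 1).
Proof. by rewrite /nrm; cbn [fst snd]; rewrite mod1 expr1n. Qed.

Lemma zero_notin_disk (r : R) : 0 < r -> ~ disk_at_infty r (Some 0).
Proof. by move=> r0; change (~ (r < modulus (0 : C))); rewrite mod0 ltNge ltW. Qed.

Lemma disk_at_inftyE (r : R) : 0 < r ->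
  disk_at_infty r = [set y : X | ch None y < (Num.sqrt (r ^+ 2 + 1))^-1].
Proof.
move=> r0; have s0 : 0 < Num.sqrt (r ^+ 2 + 1) by rewrite sqrtr_gt0 ltr_wpDl// exprn_ge0// ltW.
apply/seteqP; split => -[z|] /=.
- rewrite ch_None => rz; rewrite ltf_pV2 ?posrE//; last exact: (nrm_vec_gt0 (Some z)).
  rewrite nrmSE ltr_sqrt ?ltrD2r ?ltr_sqr ?nnegrE ?mod_ge0 ?(ltW r0)//.
  by rewrite ltr_wpDl// exprn_ge0// mod_ge0.
- by rewrite chxx invr_gt0.
- rewrite ch_None ltf_pV2 ?posrE//; last exact: (nrm_vec_gt0 (Some z)).
  rewrite nrmSE ltr_sqrt ?ltrD2r ?ltr_sqr ?nnegrE ?mod_ge0 ?(ltW r0)//.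
  by rewrite ltr_wpDl// exprn_ge0// mod_ge0.
- by [].
Qed.

Lemma seq_null nu (es : seq X) : non_atomic nu -> measurable ([set` es] : set bX) /\ prob nu [set` es] = 0.
Proof.
move=> na; elim: es => [|e s [ms IH]].
  by rewrite (_ : [set` [::]] = set0) ?prob_set0//; apply/seteqP; split.
have -> : [set` (e :: s)] = [set e] `|` [set` s].
  apply/seteqP; split => x /=; rewrite inE; first by case/orP => [/eqP|]; [left|right].
  by case=> [->|->]; rewrite ?eqxx ?orbT.
split; first by apply: measurableU => //; exact: point_meas.
apply/eqP; rewrite eq_le prob_ge0 andbT; apply: le_trans (prob_setU_le _ _ _) _ => //; first exact: point_meas.
by rewrite IH addr0 /prob na.
Qed.

(** The neighbourhoods of radius [r / 2^n] shrink to the null set [es], while invariance together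
    with the inclusions in preimages prevents their masses from decreasing with [n]. *)
Lemma near_null f nu (es : seq X) (r : R) : continuous f -> invariant_measure f nu -> non_atomic nu -> 0 < r ->
  (forall s, 0 < s -> s <= r -> near es s `<=` f @^-1` near es (s / 2)) -> prob nu (near es r) = 0.
Proof.
move=> cf inv na r0 H; pose A n := near es (r / 2 ^+ n).
have p2 n : 0 < r / 2 ^+ n by rewrite divr_gt0// exprn_gt0.
have r2 n : r / 2 ^+ n.+1 = r / 2 ^+ n / 2 by rewrite exprS invfM mulrA mulrAC.
have mA n : measurable (A n : set bX) by apply: open_meas; exact: near_open.
have sA n : A n.+1 `<=` A n by apply: near_le; rewrite r2 ler_pdivrMr// ler_peMr ?(ltW (p2 n))// ler1n.
have le1 n : r / 2 ^+ n <= r by rewrite ler_pdivrMr ?exprn_gt0// ler_peMr ?(ltW r0)// exprn_ege1// ler1n.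
have up n : prob nu (A 0%N) <= prob nu (A n).
  elim: n => // n IH; apply: (le_trans IH).
  have := H _ (p2 n) (le1 n); rewrite -r2 => sub.
  have := inv (A n.+1) (mA n.+1) => /(congr1 fine); rewrite -!/(prob _ _) => <-.
  apply: prob_le => //.
  by have := contX_meas cf; rewrite /measurable_fun => /(_ measurableT (A n.+1) (mA _)); rewrite setTI.
have c := @prob_bigcup_nonincr _ _ R nu _ mA sA.
have I0 : prob nu (\bigcap_n A n) = 0.
  have [ms s0] := seq_null es na; apply/eqP; rewrite eq_le prob_ge0 andbT -s0; apply: prob_le => //.
    by apply: bigcap_measurable => // n _; exact: mA.
  move=> a Aa; apply: contrapT => /= aes.
  have [d d0 sep] := @seq_separated R [:: a] es ltac:(by move=> x; rewrite inE => /eqP -> /aes).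
  have [n hn] : exists n, r / 2 ^+ n < d.
    have [n hn] := ltr_add_invr (divr_gt0 d0 r0); exists n.
    have r20 : 0 < 2 ^+ n :> R by rewrite exprn_gt0.
    rewrite ltr_pdivrMr// mulrC -ltr_pdivrMr// -[r / d]invrK invf_div.
    rewrite -[X in _ < X]invrK ltf_pV2 ?posrE ?invr_gt0 ?divr_gt0//; apply: le_lt_trans hn.
    by rewrite add0r lef_pV2 ?posrE// -natrX ler_nat ltn_expl.
  have [e ee ae] := Aa n I; have := sep a e (mem_head _ _) ee.
  by rewrite leNgt (lt_trans ae hn).
rewrite I0 in c; apply/eqP; rewrite eq_le prob_ge0 andbT.
have A0 : A 0%N = near es r by rewrite /A expr0 divr1.
by rewrite -A0; apply: (cvgr_to_ge c); exact: nearW.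
Qed.

Theorem nonatomic_balanced (F : set (X -> X)) : F `<=` rational_map -> admissible F ->
  right_amenable (@semigroup_mul R F) continuous_functions (@lyubich_rep R F) ->
  exists g nu, [/\ F g, (1 < rat_degree g)%N, non_atomic nu &
    forall s, generated F s -> balanced s nu].
Proof.
move=> rF [g [Fg ng cases]] am; have rg := rF _ Fg.
have gg : generated F g by exact: generated_in.
have [d1 E] := exc_nonexceptional rg ng.
have na nu : (forall x, 0 < prob nu [set x] -> False) -> non_atomic nu.
  move=> H x; rewrite (probE nu (point_meas x)); congr EFin.
  by apply/eqP; rewrite eq_le prob_ge0 andbT leNgt; apply/negP => /H.
have polyE m : mobius_map m -> conj_to_poly_by m g ->
    exists e, [/\ g e = e, TR g e, (forall x, exc g x -> x = e) & m e = None].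
  move=> mm cp; have [e [me ge ee]] := poly_fixed mm cp.
  case: E => [/(_ e)//|[e' [ge' te' H]]]; exists e; split => //.
    exact: (ee 0%N).
  by move=> x /H ->; rewrite (H e).
case: cases => [C1|[[m mm cp] [g1 [Fg1 _ C2]]]|[m [r [mm r0 C3]]]].
(* Condition (i): an atom would sit at a totally ramified fixed point of [g], and sending that point
   to infinity makes [g] a polynomial. *)
- have [nu [bal _]] := amenable_balanced None rF am; exists g, nu; split => //.
  apply: na => x px; have ex := atom_exc rg (bal _ gg) px.
  case: E => [/(_ x)//|[e [ge te _]]]; apply: C1.
  have [b be _] := @no_isolated_point R e 1 ltr01.
  have [m [mm me _]] : exists m, [/\ mobius_map m, m e = None & m b = Some 0] by apply: mobius_points; rewrite eq_sym.
  by exists m => //; exact: fixed_poly te.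
(* Condition (ii): [g1] sends the atom [e] to an atom of at least the same mass, which must be [e]
   again; so [g1] is totally ramified there and becomes a polynomial in the same coordinate as
   [g]. *)
- have [nu [bal _]] := amenable_balanced None rF am; exists g, nu; split => //.
  have [e [ge te ue me]] := polyE _ mm cp.
  apply: na => x px; have xe := ue _ (atom_exc rg (bal _ gg) px); rewrite {x}xe in px.
  have rg1 := rF _ Fg1; have b1 : balanced g1 nu by apply: bal; exact: generated_in.
  have le1 := atom_le rg1 b1 e.
  have g1e : g1 e = e by apply: ue; apply: (atom_exc rg (bal _ gg)); exact: lt_le_trans le1.
  apply: C2; exists m; split => //; apply: (fixed_poly rg1 mm me g1e).
  by apply: (atom_TR rg1 b1) => //; rewrite g1e.
(* Condition (iii): the base point has coordinate 0, outside the invariant disk. Its backward orbit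
   avoids the forward invariant set [V], so the measure does not charge [V], which contains the only
   possible atom. *)
- have [n [mn mK nK]] := mobius_inv mm.
  have [nu [bal sup]] := amenable_balanced (n (Some 0)) rF am; exists g, nu; split => //.
  have [P [polyP cP _]] := C3 _ Fg.
  have [e [ge te ue me]] := polyE _ mm (ex_intro2 _ _ P polyP cP).
  apply: na => x px; have xe := ue _ (atom_exc rg (bal _ gg) px); rewrite {x}xe in px.
  pose V : set X := m @^-1` disk_at_infty r.
  have VF s : generated F s -> forall x, V x -> V (s x).
    elim=> [f Ff x Vx|f h _ Hf _ Hh x Vx]; last exact/Hf/Hh.
    have [Q [_ cQ sub]] := C3 _ Ff; have /(congr1 (fun k => k x)) /= E1 := cQ.
    by rewrite /V /= E1; apply: sub; exists (m x).
  have oV : open V.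
    apply: open_comp; first by move=> x _; apply: rational_continuous; case: mm.
    by rewrite disk_at_inftyE//; exact: open_ball_ch.
  have cV : closed (~` V) by exact: open_closedC.
  pose phi := dset (~` V).
  have phi0 : I_ nu phi = 0.
    apply: sup; first exact: dset_cont.
    move=> s x gs sx; apply: dset_mem => Vx; have := VF _ gs _ Vx.
    by rewrite sx /V /= nK; exact: zero_notin_disk.
  have phie : 0 < phi e.
    rewrite lt_def dset_ge0 andbT; apply/eqP => /(dset_eq0 cV); apply.
    by rewrite /V /= me.
  have : phi e * prob nu [set e] <= I_ nu phi.
    rewrite -I_indic; last exact: point_meas.
    have bi : bmf (\1_[set e] : bX -> R) by apply: bmf_indic; exact: point_meas.
    rewrite -I_Z//; apply: I_le; [exact: bmfM (bmf_cst _) bi|apply: cont_bmf; exact: dset_cont|].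
    move=> y; rewrite indic1; case: eqP => [->|_]; first by rewrite mulr1.
    by rewrite mulr0 dset_ge0.
  by rewrite phi0 leNgt mulr_gt0.
Qed.
End Existence.

(** * Uniqueness of nonatomic balanced measures *)

Section SmallBalls.
Context {R : realType}.
Local Notation C := (Cx R).
Local Notation X := (sphere R).
Local Notation bX := (borel_sphere R).
Implicit Types (f g G : X -> X) (a b x y e : X) (nu mu : probability bX R) (phi : X -> R) (K : set X).

Lemma le_geometric (t B q c : R) : 0 <= q -> q < 1 -> (forall n, t <= B + q ^+ n * c) -> t <= B.
Proof.
move=> q0 q1 H; have q1' : `|q| < 1 by rewrite ger0_norm.
have cv : (fun n => B + q ^+ n * c) @ \oo --> B + 0 * c.
  by apply: cvgD; [exact: cvg_cst|apply: cvgM; [exact: cvg_expr|exact: cvg_cst]].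
by rewrite mul0r addr0 in cv; apply: (cvgr_to_ge cv); exact: nearW.
Qed.

Lemma rational_lip f : rational_map f -> exists2 L : R, 1 <= L & forall a b, ch (f a) (f b) <= L * ch a b.
Proof.
move=> rf; have [T [c [m H]]] := rational_factorizes rf; have [m0 _ _ _] := H.
exists (Num.max 1 (m ^- 2)); first by rewrite le_max lexx.
move=> a b; have /andP[_ h] := factorizes_bounds H a (f b); apply: le_trans h _.
apply: ler_pM; rewrite ?prod_ch_ge0 ?invr_ge0 ?exprn_ge0 ?(ltW m0)//.
  by rewrite le_max lexx orbT.
by apply: prod_ch_le; rewrite fibP.
Qed.

(** Truncation at scale [d] keeps the logarithmic kernel continuous and bounded, so that
    balancedness applies to it directly. *)
Definition ld (d : R) a x : R := ln (Num.max d (ch a x)).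

Lemma max_gt0 (d : R) a x : 0 < d -> 0 < Num.max d (ch a x).
Proof. by move=> d0; rewrite lt_max d0. Qed.

Lemma ld_cont d a : 0 < d -> continuous (ld d a).
Proof.
move=> d0; apply: cont_comp; first by apply: cont_max; [exact: cont_cst|exact: continuous_ch].
by move=> x; apply: continuous_ln; exact: max_gt0.
Qed.

Lemma ld_ge d a x : 0 < d -> ln d <= ld d a x.
Proof. by move=> d0; rewrite ler_ln ?posrE ?max_gt0// le_max lexx. Qed.

Lemma ld_le0 d a x : 0 < d -> d <= 1 -> ld d a x <= 0.
Proof. by move=> d0 d1; rewrite -ln1 ler_ln ?posrE ?max_gt0// ge_max d1 ch_le1. Qed.

(** If the whole fibre over [y] lay very close to [a], then [y] would be close to [G a = G b],
    whereas the factorization at the other preimage [b] bounds [ch (G b) y] below by the distances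
    from [b] to that fibre. Compactness of [K] makes the radius uniform. *)
Lemma fiber_spread G K : rational_map G -> closed K ->
  (forall a, K a -> exists2 b, b != a & G b = G a) ->
  exists2 r : R, 0 < r & forall a y, K a -> exists2 x, x \in fib G y & r <= ch a x.
Proof.
move=> rG cK HK; have [L L1 HL] := rational_lip rG.
have L0 : 0 < L by apply: lt_le_trans L1.
have [T [c [m H]]] := rational_factorizes rG; have [m0 _ _ _] := H.
have loc a : exists t : R, K a -> 0 < t /\ forall a' y, ch a a' < t -> exists2 x, x \in fib G y & t <= ch a' x.
  have [Ka|nK] := pselect (K a); last by exists 0.
  have [b ba Gb] := HK _ Ka.
  have [s s0 sE] : exists2 s : R, 0 < s & s = ch a b by exists (ch a b); rewrite // ch_gt0 eq_sym.
  pose k := m ^+ 2 * (s / 2) ^+ rat_degree G.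
  have k0 : 0 < k by rewrite /k mulr_gt0 ?exprn_gt0 ?divr_gt0.
  pose t := Num.min (s / 4) (k / (4 * L)).
  have t0 : 0 < t by rewrite /t lt_min (divr_gt0 s0)//= divr_gt0// mulr_gt0.
  have ts : t <= s / 4 by rewrite ge_min lexx.
  have tk : t * (4 * L) <= k by rewrite -ler_pdivlMr ?mulr_gt0// ge_min lexx orbT.
  exists t => _; split => // a' y aa'; apply: contrapT => nx.
  have far x : x \in fib G y -> ch a' x < t.
    by move=> xy; rewrite ltNge; apply/negP => h; apply: nx; exists x.
  have [x xy] : exists x, x \in fib G y.
    have := size_fib y rG; have := rat_degree_gt0 rG.
    by case: (fib G y) => [|x s']; [move=> /[swap] <-|exists x; rewrite mem_head].
  have Gx : G x = y by apply/eqP; rewrite -fibP.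
  have h1 : ch (G b) y <= L * (2 * t).
    rewrite Gb -Gx; apply: le_trans (HL _ _) _; rewrite ler_pM2l//.
    by have := ch_tri a' a x; have := far x xy; lra.
  have /andP[h2 _] := factorizes_bounds H b y.
  have h3 : (s / 2) ^+ rat_degree G <= \prod_(z <- fib G y) ch b z.
    rewrite -(size_fib y rG) prod_ch_ge ?divr_ge0 ?(ltW s0)// => z zy.
    have := ch_tri z a b; rewrite (chC z b) -sE => h4.
    by have := ch_tri a' a z; have := far z zy; lra.
  have : k <= L * (2 * t).
    by apply: le_trans h1; apply: le_trans h2; rewrite ler_pM2l ?exprn_gt0.
  by move: (mulr_gt0 L0 t0) tk; clearbody t k; clear => h1 h2 h3; lra.
have /choice[t Ht] := loc.
have [s [sK cov]] := finite_ball_cover cK (fun x Kx => (Ht x Kx).1).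
have [r r0 Hr] : exists2 r : R, 0 < r & forall a, a \in s -> r <= t a.
  elim: s sK {cov} => [|a s IH] sK; first by exists 1.
  have [|r r0 Hr] := IH; first by move=> x xs; apply: sK; rewrite inE xs orbT.
  have ta : 0 < t a by apply: (Ht a _).1; apply: sK; rewrite mem_head.
  exists (Num.min r (t a)); first by rewrite lt_min r0.
  move=> b; rewrite inE => /orP[/eqP ->|/Hr h]; first by rewrite ge_min lexx orbT.
  by apply: le_trans h; rewrite ge_min lexx.
exists r => // a y Ka; have [b bs ab] := cov a Ka.
have [x xy h] := (Ht b (sK b bs)).2 a y ab.
by exists x => //; apply: le_trans h; exact: Hr.
Qed.

(* Applying balancedness to a truncated [ch a ^ -al]: in each fibre some point is at distance at least [r] from [a], so one of
   the terms is bounded, and the integral contracts by a fixed factor up to a constant. *)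
Lemma holder_of_spread G nu K (r1 : R) : rational_map G -> balanced G nu -> closed K ->
  (forall a, K a -> exists2 b, b != a & G b = G a) -> 0 < r1 ->
  (forall a, ~ K a -> prob nu [set x | ch a x < r1] = 0) ->
  exists al B : R, [/\ 0 < al, 0 < B & forall a d, 0 < d -> d <= 1 ->
    prob nu [set x | ch a x <= d] <= B * expR (al * ln d)].
Proof.
move=> rG bG cK HK r10 HN; have [L L1 HL] := rational_lip rG.
have [r r0 Hr] := fiber_spread rG cK HK.
have L0 : 0 < L by apply: lt_le_trans L1.
have lnL : 0 <= ln L by rewrite ln_ge0.
pose D : R := (rat_degree G)%:R; have D1 : 1 <= D by rewrite ler1n rat_degree_gt0.
have D0 : 0 < D by apply: lt_le_trans D1.
(* Small enough that [L^al <= 2 D / (2 D - 1)]; the [D - 1] other points of a fibre then contribute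
   at most [(D - 1) / D] times this, which is the factor [q < 1]. *)
pose al := (2 * D * (1 + ln L))^-1.
have al0 : 0 < al by rewrite invr_gt0 !mulr_gt0// ltr_pwDl.
pose q := (2 * D - 2) / (2 * D - 1).
have q0 : 0 <= q by apply: divr_ge0; lra.
have q1 : q < 1 by rewrite ltr_pdivrMr; lra.
pose w d a x := expR (- al * ld d a x).
have cw d a : 0 < d -> continuous (w d a).
  by move=> d0; apply: cont_expR; apply: contM; [exact: cont_cst|exact: ld_cont].
have w0 d a x : 0 < w d a x by exact: expR_gt0.
have w_le d a x (k : R) : 0 < k -> k <= Num.max d (ch a x) -> w d a x <= expR (- al * ln k).
  move=> k0 kd; rewrite ler_expR !mulNr lerN2 ler_pM2l// ler_ln ?posrE//.
  exact: lt_le_trans kd.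
pose Br := expR (- al * ln r) / (1 - q) + expR (- al * ln r1).
have e0 t : 0 < expR t :> R by exact: expR_gt0.
have B0 : 0 < Br by apply: addr_gt0 => //; rewrite divr_gt0// subr_gt0.
(* [Br] is chosen so that [q * Br + r^(- al) <= Br], hence it survives each step from [a] to [G a],
   while the a priori bound [d^(- al)] is damped by [q^n]. *)
have step d a n : 0 < d -> I_ nu (w d a) <= Br + q ^+ n * expR (- al * ln d).
  move=> d0; elim: n a => [|n IH] a.
    rewrite mul1r; apply: (@le_trans _ _ (expR (- al * ln d))); last by rewrite lerDr ltW.
    rewrite -[leRHS](I_cst nu); apply: I_le; [exact/cont_bmf/cw|exact: bmf_cst|].
    by move=> x; apply: w_le => //; rewrite le_max lexx.
  have qn : 0 <= q ^+ n.+1 * expR (- al * ln d) by rewrite mulr_ge0 ?exprn_ge0 ?expR_ge0.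
  have [Ka|nKa] := pselect (K a); last first.
    apply: (@le_trans _ _ Br); last by rewrite lerDl.
    apply: (@le_trans _ _ (expR (- al * ln r1))); last by rewrite lerDr divr_ge0 ?(ltW (e0 _))// subr_ge0 ltW.
    pose N : set X := [set x | ch a x < r1].
    have mN : measurable (N : set bX) by apply: open_meas; exact: open_ball_ch.
    have bN : bmf (\1_N : bX -> R) by exact: bmf_indic.
    have -> : expR (- al * ln r1) = I_ nu (fun x => expR (- al * ln r1) + expR (- al * ln d) * \1_N x).
      rewrite I_D; [|exact: bmf_cst|exact: bmfM (bmf_cst _) bN].
      by rewrite I_Z// I_cst I_indic// HN// mulr0 addr0.
    apply: I_le; [exact/cont_bmf/cw|exact: bmfD (bmf_cst _) (bmfM (bmf_cst _) bN)|].
    move=> x; rewrite indicE; case: (boolP (x \in N)) => [_|].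
      rewrite mulr1; apply: (@le_trans _ _ (expR (- al * ln d))); last by rewrite lerDr ltW.
      by apply: w_le => //; rewrite le_max lexx.
    rewrite notin_setE /N /= => /negP; rewrite -leNgt => h.
    by rewrite mulr0 addr0; apply: w_le => //; rewrite le_max h orbT.
  rewrite -bG; last exact: cw.
  have cLw : continuous (Lr G (w d a)) by apply: Lr_continuous => //; exact: cw.
  have cwG := cw d (G a) d0.
  apply: (@le_trans _ _ (I_ nu (fun x => q * w d (G a) x + expR (- al * ln r)))).
    apply: I_le; [exact: cont_bmf|by apply: cont_bmf; apply: contD; [exact: contM (@cont_cst R _) cwG|exact: cont_cst]|].
    move=> y; have [x xy rx] := Hr a y Ka.
    have one : w d a x <= expR (- al * ln r) by apply: w_le => //; rewrite le_max rx orbT.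
    have other z : z \in fib G y -> w d a z <= expR (al * ln L) * w d (G a) y.
      rewrite fibP// => /eqP Gz; rewrite /w -expRD ler_expR.
      have M0 := max_gt0 (G a) y d0; have N0 := max_gt0 a z d0.
      have : ld d (G a) y <= ln L + ld d a z.
        rewrite /ld -lnM ?posrE// ler_ln ?posrE ?mulr_gt0// ge_max; apply/andP; split.
          by rewrite -[leLHS]mul1r ler_pM ?(ltW d0)// le_max lexx.
        rewrite -Gz; apply: le_trans (HL _ _) _; rewrite ler_pM2l// le_max lexx orbT.
        by [].
      move=> h; have := ler_wpM2l (ltW al0) h; rewrite mulrDr !mulNr; lra.
    have eL : expR (al * ln L) <= (1 - (2 * D)^-1)^-1.
      have t1 : al * ln L <= (2 * D)^-1.
        rewrite /al mulrC ler_pdivrMr ?mulr_gt0 ?ltr_pwDl// mulrA mulVf ?mul1r ?mulf_neq0 ?gt_eqF//.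
        by rewrite lerDr.
      have h2 : (2 * D)^-1 < 1 by rewrite invf_lt1 ?mulr_gt0//; lra.
      rewrite -[expR _]invrK -expRN lef_pV2 ?posrE ?subr_gt0//.
      by apply: le_trans (expR_ge1Dx _); rewrite lerD2l lerN2.
    rewrite /Lr (perm_big _ (perm_to_rem xy)) big_cons.
    have sz : (size (rem x (fib G y)))%:R = D - 1 :> R.
      by rewrite size_rem// (size_fib y rG) /D -[in RHS](prednK (rat_degree_gt0 rG)) -[in RHS]natr1 addrK.
    have sumle : \sum_(z <- rem x (fib G y)) w d a z <= (D - 1) * (expR (al * ln L) * w d (G a) y).
      rewrite -sz mulr_natl -sum_const_seq big_seq [leRHS]big_seq; apply: ler_sum => z /mem_rem; exact: other.
    apply: (@le_trans _ _ (D^-1 * (expR (- al * ln r) + (D - 1) * (expR (al * ln L) * w d (G a) y)))).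
      by rewrite ler_wpM2l ?invr_ge0 ?(ltW D0)// lerD.
    rewrite mulrDr addrC; apply: lerD; last by rewrite ler_piMl ?(ltW (e0 _))// invf_le1.
    rewrite !mulrA ler_pM2r//.
    apply: (@le_trans _ _ (D^-1 * (D - 1) * (1 - (2 * D)^-1)^-1)).
      by rewrite ler_wpM2l// mulr_ge0 ?invr_ge0 ?(ltW D0)// subr_ge0.
    rewrite le_eqVlt; apply/orP; left; apply/eqP; rewrite /q; field.
    by apply/andP; split; rewrite -/D gt_eqF//; lra.
  rewrite I_D; [|by apply: cont_bmf; exact: contM (@cont_cst R _) cwG|exact: bmf_cst].
  rewrite I_Z; last exact: cont_bmf.
  rewrite I_cst; have := ler_wpM2l q0 (IH (G a)).
  rewrite mulrDr mulrA -exprS => h.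
  have : q * Br + expR (- al * ln r) <= Br; last by move: h; lra.
  have q10 : 0 < 1 - q by rewrite subr_gt0.
  have : expR (- al * ln r) <= (1 - q) * Br; last lra.
  rewrite /Br mulrDr mulrCA mulfV ?mulr1 ?gt_eqF// lerDl.
  by rewrite mulr_ge0 ?(ltW q10) ?expR_ge0.
exists al, Br; split => // a d d0 d1.
have h : I_ nu (w d a) <= Br by apply: (le_geometric q0 q1) => n; exact: step.
have mN : measurable ([set x | ch a x <= d] : set bX) by apply: closed_meas; exact: closed_ball_ch.
rewrite -ler_pdivrMr// -expRN -mulNr; apply: le_trans h.
rewrite mulrC -I_indic// -I_Z; last exact: bmf_indic.
have bi := @bmf_indic _ bX R _ mN.
apply: I_le; [exact: bmfM (bmf_cst _) bi|exact/cont_bmf/cw|].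
move=> x; rewrite indicE; case: (boolP (x \in _)) => [|_]; last by rewrite mulr0 ltW.
rewrite inE /= => hx; rewrite mulr1 /w /ld (_ : Num.max d (ch a x) = d)//.
exact/max_idPl.
Qed.

Lemma iter_TR f a : rational_map f -> TR (f \o f \o f) a -> [/\ TR f a, TR f (f a) & TR f (f (f a))].
Proof.
move=> rf t.
have sur y : exists x, f x = y.
  have := size_fib y rf; have := rat_degree_gt0 rf; case E : (fib f y) => [|x s]; first by move=> /[swap] <-.
  by exists x; apply/eqP; rewrite -fibP// E mem_head.
split=> b.
- by move=> fb; apply: t; rewrite /= fb.
- by have [c <-] := sur b => fb; rewrite (t c)//= fb.
- by have [c <-] := sur b; have [c' <-] := sur c => fb; rewrite (t c').
Qed.

Section Holder.
Variables (f : X -> X) (nu : probability bX R).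
Hypotheses (rf : rational_map f) (d1 : (1 < rat_degree f)%N).
Hypotheses (bal : balanced f nu) (na : non_atomic nu).

Lemma exc_basin : exists es (r0 : R), [/\ forall x, exc f x <-> x \in es, 0 < r0,
  forall r, 0 < r -> r <= r0 -> near es r `<=` f @^-1` near es (r / 2) & prob nu (near es r0) = 0].
Proof.
have [es He] := exc_seq rf d1; have [r0 r00 H] := near_basin rf d1 He.
exists es, r0; split => //; apply: (@near_null _ f) => //; [exact: (rational_continuous rf)|exact: balanced_invariant].
Qed.

(** A fibre of [f] may reduce to one point at a nonexceptional point. For the third iterate this
    would make [a], [f a] and [f (f a)] totally ramified, which [TR_three] allows only if two of
    them coincide, that is for exceptional [a]; the basin of those points is null. *)
Lemma holder : exists al B : R, [/\ 0 < al, 0 < B & forall a d, 0 < d -> d <= 1 ->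
    prob nu [set x | ch a x <= d] <= B * expR (al * ln d)].
Proof.
have [es [r0 [He r00 _ N0]]] := exc_basin.
have rff := rational_comp rf rf; have rG := rational_comp rff rf.
have bG : balanced (f \o f \o f) nu.
  move=> phi cp; rewrite (_ : Lr _ phi = Lr f (Lr f (Lr f phi))).
    by rewrite !bal//; do ?apply: Lr_continuous.
  apply/funext => y; rewrite (Lr_comp _ _ rff rf) (Lr_comp _ _ rf rf).
  by [].
apply: (@holder_of_spread _ _ (~` near es (r0 / 2)) (r0 / 2) rG bG); rewrite ?divr_gt0//.
- by apply: open_closedC; exact: near_open.
- move=> a Ka; apply: contrapT => nb.
  have t : TR (f \o f \o f) a.
    by move=> b fb; apply/eqP/negPn/negP => ba; apply: nb; exists b.
  have [t0 t1 t2] := iter_TR rf t.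
  have ea : exc f a.
    have [e|n1] := eqVneq a (f a).
      by move=> n; have -> : iter n f a = a by elim: n => //= n ->.
    have [e|n3] := eqVneq (f (f a)) a.
      move=> n; have [->|->] : iter n f a = a \/ iter n f a = f a by elim: n => [|n IH] /=; [left|case: IH => ->; [right|left]].
        exact: t0.
      exact: t1.
    have [e|n2] := eqVneq (f a) (f (f a)).
      have fa : f a = a by apply: t0; rewrite -e.
      by rewrite fa eqxx in n1.
    by have := TR_three rf d1 t0 t1 t2 n1 n2 n3.
  by apply: Ka; exists a; [exact/He|rewrite chxx divr_gt0].
- move=> a /contrapT[e ee ae]; apply/eqP; rewrite eq_le prob_ge0 andbT -N0; apply: prob_le.
  + by apply: open_meas; exact: open_ball_ch.
  + by apply: open_meas; exact: near_open.
  + move=> x /= ax; exists e => //; have := ch_tri a x e; rewrite (chC x a); lra.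
Qed.
End Holder.
End SmallBalls.

(** * Logarithmic potentials of balanced measures *)

Section Potential.
Context {R : realType}.
Local Notation C := (Cx R).
Local Notation X := (sphere R).
Local Notation bX := (borel_sphere R).
Implicit Types (f g G : X -> X) (a b x y e : X) (nu mu : probability bX R) (phi : X -> R) (K : set X).

Lemma ln_prod_seq (I : eqType) (s : seq I) (F : I -> R) : (forall i, i \in s -> 0 < F i) ->
  ln (\prod_(i <- s) F i) = \sum_(i <- s) ln (F i).
Proof.
elim: s => [|i s IH] H; first by rewrite !big_nil ln1.
have Hs j : j \in s -> 0 < F j by move=> js; apply: H; rewrite inE js orbT.
rewrite !big_cons -IH// lnM// posrE; first by apply: H; rewrite mem_head.
by rewrite big_seq prodr_gt0.
Qed.

Lemma abs_ln_le (m t : R) : 0 < m -> m <= t -> t <= m^-1 -> `|ln t| <= - ln m.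
Proof.
move=> m0 mt tm; have t0 : 0 < t by apply: lt_le_trans mt.
rewrite ler_norml opprK -lnV ?posrE// !ler_ln ?posrE ?invr_gt0//.
by rewrite mt tm.
Qed.

Section Relation.
Variables (f : X -> X) (rf : rational_map f).

(* Logarithm of the factorization, with both sides truncated at scale [d]; only [y] with [ch (f a) y <= L d] contribute an error. *)
Lemma pot_rel : exists (tau gam : X -> R) (A L : R), [/\ 0 < A, 1 <= L & forall d a y, 0 < d -> d <= 1 ->
  `|\sum_(x <- fib f y) ld d a x - ld d (f a) y - (tau a - gam y)| <=
     A * (1 - ln d) * \1_[set y | ch (f a) y <= L * d] y].
Proof.
have [T [c [m H]]] := rational_factorizes rf; have [m0 HT Hc HF] := H.
have [L L1 HL] := rational_lip rf; have L0 : 0 < L by apply: lt_le_trans L1.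
have T0 a : 0 < T a by apply: lt_le_trans m0 _; case/andP: (HT a).
have c0 a : 0 < c a by apply: lt_le_trans m0 _; case/andP: (Hc a).
have lm : 0 <= - ln m.
  by apply: le_trans (normr_ge0 (ln (T None))) _; apply: abs_ln_le => //; case/andP: (HT None).
exists (fun a => ln (T a)), (fun y => ln (c y)), ((rat_degree f)%:R + 1 + 2 * (- ln m)), L.
split => //; first by rewrite ltr_pwDl ?mulr_ge0// ltr_wpDl.
move=> d a y d0 d1; have ld0 : 0 <= - ln d by rewrite oppr_ge0 ln_le0.
have lda b z : `|ld d b z| <= - ln d.
  by rewrite ler_norml opprK ld_ge//= (le_trans (ld_le0 _ _ d0 d1)).
rewrite indicE; case: (boolP (y \in _)) => [_|].
  rewrite mulr1; apply: (@le_trans _ _ ((rat_degree f)%:R * (- ln d) + (- ln d) + 2 * (- ln m))); last first.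
    have : 0 <= (rat_degree f)%:R :> R by rewrite ler0n.
    by move: (ln m) (ln d) lm ld0 ((rat_degree f)%:R) => u v u0 v0 D D0; nra.
  apply: le_trans (ler_normB _ _) _; apply: lerD.
    apply: le_trans (ler_normB _ _) _; apply: lerD; last exact: lda.
    apply: le_trans (ler_norm_sum _ _ _) _.
    rewrite -(size_fib y rf) mulr_natl -sum_const_seq; apply: ler_sum => x _; exact: lda.
  apply: le_trans (ler_normB _ _) _; rewrite mulrDl mul1r; apply: lerD.
    by case/andP: (HT a) => ? ?; exact: abs_ln_le.
  by case/andP: (Hc y) => ? ?; exact: abs_ln_le.
rewrite notin_setE /= => /negP; rewrite -ltNge => far; rewrite mulr0 normr_le0; apply/eqP.
have Ld : d <= L * d by rewrite ler_peMl// ltW.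
have maxE b z : d < ch b z -> ld d b z = ln (ch b z) by move=> h; rewrite /ld (max_idPr _)// ltW.
have close x : x \in fib f y -> d < ch a x.
  rewrite fibP// => /eqP fx; rewrite -(ltr_pM2l L0); apply: lt_le_trans far _.
  by rewrite -fx; exact: HL.
rewrite (maxE _ _ (le_lt_trans Ld far)).
have -> : \sum_(x <- fib f y) ld d a x = \sum_(x <- fib f y) ln (ch a x).
  by rewrite big_seq [RHS]big_seq; apply: eq_bigr => x xy; rewrite maxE// close.
have chp x : x \in fib f y -> 0 < ch a x by move=> /close; exact: lt_trans.
rewrite -ln_prod_seq//.
have f0 : 0 < ch (f a) y by apply: lt_trans far; rewrite mulr_gt0.
have p0 : 0 < \prod_(x <- fib f y) ch a x by rewrite big_seq prodr_gt0.
have e1 : ln (ch (f a) y * T a) = ln (ch (f a) y) + ln (T a) by rewrite lnM ?posrE.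
have e2 : ln (c y * \prod_(x <- fib f y) ch a x) = ln (c y) + ln (\prod_(x <- fib f y) ch a x).
  by rewrite lnM ?posrE.
by move: (congr1 (@ln R) (HF a y)); rewrite e1 e2 => h; lra.
Qed.
End Relation.

Section Two.
Variables (f : X -> X) (nu1 nu2 : probability bX R) (al B : R).
Hypotheses (rf : rational_map f) (d1 : (1 < rat_degree f)%N).
Hypotheses (b1 : balanced f nu1) (b2 : balanced f nu2).
Definition small_balls nu := forall a d, 0 < d -> d <= 1 -> prob nu [set x | ch a x <= d] <= B * expR (al * ln d).
Hypotheses (al0 : 0 < al) (B0 : 0 < B) (H1 : small_balls nu1) (H2 : small_balls nu2).

(** In the difference of the two potentials the term [tau] of the functional equation cancels; [gam]
    cancels once two points are compared. *)
Definition Vd d a : R := I_ nu1 (ld d a) - I_ nu2 (ld d a).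

(* Integrating [pot_rel] gives [V (f a) = deg f * V a] up to a constant and a small error, so the oscillation of [V] is small. *)
Lemma pot_osc : exists2 Ce : R, 0 < Ce & exists2 L : R, 1 <= L & forall d, 0 < d -> L * d <= 1 -> forall a a0,
  `|Vd d a - Vd d a0| <= Ce * ((1 - ln d) * expR (al * ln d)).
Proof.
have [tau [gam [A [L [A0 L1 HE]]]]] := pot_rel rf; have L0 : 0 < L by apply: lt_le_trans L1.
pose Ce := 4 * A * B * expR (al * ln L).
have Ce0 : 0 < Ce by rewrite !mulr_gt0 ?expR_gt0.
exists Ce => //; exists L => // d d0 Ld1.
have d1' : d <= 1 by apply: le_trans Ld1; rewrite ler_peMl// ltW.
have ld0 : 0 <= - ln d by rewrite oppr_ge0 ln_le0.
set D : R := (rat_degree f)%:R.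
have D2 : 2 <= D by rewrite ler_nat.
have bl a : bmf (ld d a : bX -> R) by apply: cont_bmf; exact: ld_cont.
have step nu a a0 : balanced f nu -> small_balls nu ->
  `|D * (I_ nu (ld d a) - I_ nu (ld d a0)) - (I_ nu (ld d (f a)) - I_ nu (ld d (f a0))) - (tau a - tau a0)|
    <= Ce / 2 * ((1 - ln d) * expR (al * ln d)).
  move=> bn Hn.
  pose S b y := D * Lr f (ld d b) y.
  have SE b y : S b y = \sum_(x <- fib f y) ld d b x by rewrite /S /Lr mulrA mulfV ?mul1r// gt_eqF// (lt_le_trans _ D2).
  have bS b : bmf (S b : bX -> R) by apply: bmfM; [exact: bmf_cst|apply: cont_bmf; apply: Lr_continuous => //; exact: ld_cont].
  have IS b : I_ nu (S b) = D * I_ nu (ld d b).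
    rewrite I_Z ?bn//; first exact: ld_cont.
    by apply: cont_bmf; apply: Lr_continuous => //; exact: ld_cont.
  pose h y := S a y - S a0 y - (ld d (f a) y - ld d (f a0) y) - (tau a - tau a0).
  have bh : bmf (h : bX -> R) by do !apply: bmfB => //; exact: bmf_cst.
  have -> : D * (I_ nu (ld d a) - I_ nu (ld d a0)) - (I_ nu (ld d (f a)) - I_ nu (ld d (f a0))) - (tau a - tau a0) = I_ nu h.
    rewrite /h !I_B ?IS ?I_cst//; do ?[exact: bmf_cst|exact: bmfB|by apply: bmfB; exact: bmfB].
    by rewrite mulrBr.
  pose N b : set X := [set y | ch b y <= L * d].
  have mN b : measurable (N b : set bX) by apply: closed_meas; exact: closed_ball_ch.
  have bN b : bmf (\1_(N b) : bX -> R) by exact: bmf_indic.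
  pose k y := A * (1 - ln d) * \1_(N (f a)) y + A * (1 - ln d) * \1_(N (f a0)) y.
  have bk : bmf (k : bX -> R) by apply: bmfD; apply: bmfM; do ?[exact: bmf_cst|exact: bN].
  have hk y : `|h y| <= k y.
    have := HE d a y d0 d1'; have := HE d a0 y d0 d1'; rewrite -!SE => h1 h2.
    have -> : h y = (S a y - ld d (f a) y - (tau a - gam y)) - (S a0 y - ld d (f a0) y - (tau a0 - gam y)) by rewrite /h; ring.
    by apply: le_trans (ler_normB _ _) _; exact: lerD.
  have Ik : I_ nu k <= Ce / 2 * ((1 - ln d) * expR (al * ln d)).
    have E b : prob nu (N b) <= B * expR (al * ln L) * expR (al * ln d).
      apply: le_trans (Hn b _ _ Ld1) _; first by rewrite mulr_gt0.
      by rewrite -mulrA -expRD -mulrDr lnM ?posrE.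
    rewrite /k I_D; [|by apply: bmfM; [exact: bmf_cst|exact: bN]|by apply: bmfM; [exact: bmf_cst|exact: bN]].
    rewrite !I_Z// !I_indic//.
    have A1 : 0 <= A * (1 - ln d) by rewrite mulr_ge0 ?(ltW A0)//; lra.
    have := ler_wpM2l A1 (E (f a)); have := ler_wpM2l A1 (E (f a0)); rewrite /Ce.
    move: (prob nu (N (f a))) (prob nu (N (f a0))) (expR (al * ln L)) (ln d) => p q u w h1 h2.
    move: (expR (al * w)) h1 h2 => v h1 h2.
    have -> : 4 * A * B * u / 2 * ((1 - w) * v) = A * (1 - w) * (B * u * v) + A * (1 - w) * (B * u * v) by field.
    exact: lerD.
  rewrite ler_norml; apply/andP; split.
    rewrite lerNl -I_N//; apply: le_trans Ik; apply: I_le => //; first exact: bmfN.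
    by move=> y; apply: le_trans (ler_norm _) _; rewrite normrN.
  by apply: le_trans Ik; apply: I_le => // y; apply: le_trans (ler_norm _) _.
have l1 : 0 <= 1 - ln d by rewrite subr_ge0 (le_trans (ln_le0 d1')).
set eps := Ce * _; have eps0 : 0 <= eps by rewrite mulr_ge0 ?(ltW Ce0)// mulr_ge0// expR_ge0.
(* Since [D >= 2], the oscillation over a pair of points is at most half of that over the image pair
   plus an error; iterating leaves only [eps]. *)
have bal2 a a0 : `|Vd d a - Vd d a0| <= 2^-1 * (`|Vd d (f a) - Vd d (f a0)| + eps).
  have := step nu1 a a0 b1 H1; have := step nu2 a a0 b2 H2.
  have -> : Ce / 2 * ((1 - ln d) * expR (al * ln d)) = eps / 2 by rewrite /eps; field.
  move=> h2 h1; have h3 := le_trans (ler_normB _ _) (lerD h1 h2).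
  have E : D * (Vd d a - Vd d a0) = (Vd d (f a) - Vd d (f a0)) +
   (D * (I_ nu1 (ld d a) - I_ nu1 (ld d a0)) - (I_ nu1 (ld d (f a)) - I_ nu1 (ld d (f a0))) - (tau a - tau a0) -
    (D * (I_ nu2 (ld d a) - I_ nu2 (ld d a0)) - (I_ nu2 (ld d (f a)) - I_ nu2 (ld d (f a0))) - (tau a - tau a0))).
    rewrite /Vd; move: (I_ nu1 (ld d a)) (I_ nu1 (ld d a0)) (I_ nu2 (ld d a)) (I_ nu2 (ld d a0))
      (I_ nu1 (ld d (f a))) (I_ nu1 (ld d (f a0))) (I_ nu2 (ld d (f a))) (I_ nu2 (ld d (f a0))) (tau a) (tau a0).
    by clearbody D; clear => *; ring.
  have h4 : D * `|Vd d a - Vd d a0| <= `|Vd d (f a) - Vd d (f a0)| + eps.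
    rewrite -{1}(ger0_norm (le_trans (ler0n _ 2) D2)) -normrM E.
    apply: le_trans (ler_normD _ _) _; rewrite lerD2l; apply: le_trans h3 _; by rewrite -splitr.
  rewrite ler_pdivlMl//; apply: le_trans h4; rewrite ler_wpM2r//.
move=> a a0; apply: (@le_geometric _ _ eps 2^-1 (4 * (- ln d))) => //; first by rewrite invf_lt1// ltr1n.
move=> n; elim: n a a0 => [|n IH] a a0.
  rewrite expr0 mul1r; have lda nu b : `|I_ nu (ld d b)| <= - ln d.
    apply: I_abs_le => // z; by rewrite ler_norml opprK ld_ge//= (le_trans (ld_le0 _ _ d0 d1')).
  apply: ler_wpDl => //; rewrite /Vd; apply: le_trans (ler_normB _ _) _.
  have := ler_normB (I_ nu1 (ld d a)) (I_ nu2 (ld d a)); have := ler_normB (I_ nu1 (ld d a0)) (I_ nu2 (ld d a0)).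
  move: (lda nu1 a) (lda nu2 a) (lda nu1 a0) (lda nu2 a0).
  move: (I_ nu1 (ld d a)) (I_ nu1 (ld d a0)) (I_ nu2 (ld d a)) (I_ nu2 (ld d a0)) (ln d) => p q r s t.
  move=> hp hr hq hs h5 h6; have -> : 4 * - t = (- t + - t) + (- t + - t) by ring.
  by apply: (le_trans (lerD h6 h5)); apply: lerD; exact: lerD.
apply: le_trans (bal2 a a0) _; have := IH (f a) (f a0); rewrite exprS -mulrA.
by set q := _ * (4 * _); lra.
Qed.
End Two.
End Potential.

(** * Averages of logarithmic kernels over circles *)

Section CircleAverage.
Context {R : realType}.
Local Notation C := (Cx R).
Local Notation X := (sphere R).
Local Notation bX := (borel_sphere R).
Implicit Types (x y : X) (p z w : C) (nu : probability bX R).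

Lemma horner_deriv_prod (s : seq C) w : (forall c, c \in s -> w != c) ->
  ((\prod_(c <- s) ('X - c%:P))^`()).[w] = (\prod_(c <- s) (w - c)) * \sum_(c <- s) (w - c)^-1.
Proof.
elim: s => [|c s IH] H; first by rewrite !big_nil -polyC1 derivC horner0 mulr0.
have wc : w - c != 0 by rewrite subr_eq0 H ?mem_head.
rewrite !big_cons derivM derivXsubC mul1r hornerD hornerM hornerXsubC IH; last first.
  by move=> c' cs; apply: H; rewrite inE cs orbT.
rewrite horner_prod; under eq_bigr do rewrite hornerXsubC.
by rewrite mulrDr mulrAC mulfV// mul1r mulrA.
Qed.

(* The lower bound comes from the logarithmic derivative of [w^n - r^n]: with [z_j] its roots,
   [n w^(n-1) / (w^n - r^n)] is [sum_j 1/(w - z_j)], and [n r^n / (w^n - r^n)] is [sum_j z_j/(w - z_j)]. *)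
Lemma circle_roots (n : nat) (r : R) : (0 < n)%N -> 0 < r -> exists cs : seq C,
  [/\ size cs = n, forall c, c \in cs -> modulus c = r,
    forall w, w ^+ n - ofR r ^+ n = \prod_(c <- cs) (w - c) &
    forall w s, 0 < s -> (forall c, c \in cs -> s <= modulus (w - c)) ->
      s * Num.max r (modulus w) ^+ n.-1 <= modulus (w ^+ n - ofR r ^+ n)].
Proof.
move=> n0 r0; pose P : {poly C} := 'X^n - (ofR r ^+ n)%:P.
have P0 : P != 0 by rewrite -size_poly_gt0 size_XnsubC.
have PE : P = \prod_(c <- roots P) ('X - c%:P).
  by rewrite {1}[P]rootsE lead_coefXnsubC// scale1r.
have sz : size (roots P) = n by apply/eqP; rewrite -eqSS size_roots// size_XnsubC.
have val w : w ^+ n - ofR r ^+ n = \prod_(c <- roots P) (w - c).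
  transitivity P.[w]; first by rewrite /P !hornerE.
  by rewrite {1}PE horner_prod; apply: eq_bigr => c _; rewrite hornerXsubC.
have rm : modulus (ofR r : C) = r by rewrite mod_ofR gtr0_norm.
have rt c : c \in roots P -> modulus c = r.
  move=> cs; apply/eqP; rewrite -(eqrXn2 n0) ?mod_ge0 ?(ltW r0)// -modX.
  have : c ^+ n - ofR r ^+ n = 0.
    by rewrite val; apply/eqP; rewrite prodf_seq_eq0; apply/hasP; exists c; rewrite //= subrr.
  by move/eqP; rewrite subr_eq0 => /eqP ->; rewrite modX rm.
exists (roots P); split => // w s s0 far.
have nz c : c \in roots P -> w != c.
  by move=> cs; apply: contraTneq (far c cs) => ->; rewrite subrr mod0 -ltNge.
set Q := w ^+ n - _.
pose S : C := \sum_(c <- roots P) (w - c)^-1.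
have E1 : w ^+ n.-1 *+ n = Q * S.
  rewrite /Q val /S -horner_deriv_prod// -PE /P derivB derivC subr0 derivXn hornerMn hornerXn.
  by [].
have E2 : (ofR r ^+ n) *+ n = Q * \sum_(c <- roots P) c * (w - c)^-1.
  have -> : \sum_(c <- roots P) c * (w - c)^-1 = w * S - n%:R.
    rewrite /S mulr_sumr -sz -[X in _ - X]mulr_natl mulr1 -[X in _ - X](_ : \sum_(c <- roots P) 1 = _); last first.
      by rewrite -sum1_size natr_sum.
    rewrite -sumrB big_seq [RHS]big_seq; apply: eq_bigr => c cs.
    have wc : w - c != 0 by rewrite subr_eq0 nz.
    by apply: (mulIf wc); rewrite mulrBl !mulfVK// mul1r subKr.
  rewrite mulrBr mulrCA -E1 mulrnAr -exprS prednK// /Q mulrBl mulr_natr [_ * n%:R]mulr_natr.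
  by rewrite opprB addrC subrK.
have nR : 0 < n%:R :> R by rewrite ltr0n.
have mn : modulus (n%:R : C) = n%:R by rewrite natr_ofR mod_ofR ger0_norm.
have Sle : modulus S <= n%:R / s.
  apply: le_trans (mod_sum _ _ _) _; rewrite mulr_natl -sz -sum_const_seq big_seq [leRHS]big_seq.
  by apply: ler_sum => c cs; rewrite modV lef_pV2 ?posrE ?far// (lt_le_trans s0)// far.
have h1 : s * modulus w ^+ n.-1 <= modulus Q.
  have e : modulus w ^+ n.-1 * n%:R = modulus Q * modulus S.
    by move: (congr1 (@modulus R) E1); rewrite -mulr_natr !modM modX mn.
  have : modulus w ^+ n.-1 * n%:R <= modulus Q / s * n%:R.
    by rewrite e -mulrA [s^-1 * _]mulrC ler_wpM2l ?mod_ge0.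
  by rewrite ler_pM2r// ler_pdivlMr// mulrC.
have h2 : s * r ^+ n.-1 <= modulus Q.
  have : modulus ((ofR r ^+ n) *+ n : C) <= modulus Q * (n%:R * (r / s)).
    rewrite E2 modM ler_wpM2l ?mod_ge0//; apply: le_trans (mod_sum _ _ _) _.
    rewrite mulr_natl -sz -sum_const_seq big_seq [leRHS]big_seq; apply: ler_sum => c cs.
    by rewrite modM modV rt// ler_pM2l// lef_pV2 ?posrE ?far// (lt_le_trans s0)// far.
  rewrite -mulr_natr modM modX rm mn mulrC mulrCA ler_pM2l// -[in X in X -> _](prednK n0) exprS.
  by rewrite mulrCA ler_pM2l// ler_pdivlMr// mulrC.
by rewrite maxEle; case: ifP.
Qed.

(** On [Some z] this is [max r |z - p|] divided by [|(z, 1)|]. Its logarithm is the mean of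
    [ln |z - c|] over the circle of centre [p] and radius [r], normalized to be regular at
    infinity. *)
Definition uk p (r : R) x : R := Num.max (r * ch None x) (nrm (p, 1) * ch (Some p) x).
Definition gk p (r : R) x : R := ln (uk p r x).

Lemma nrmS_gt0 p : 0 < nrm (p, 1).
Proof. exact: (nrm_vec_gt0 (Some p)). Qed.

Lemma nrm_ch_Some p z : nrm (p, 1) * ch (Some p) (Some z) = modulus (p - z) / nrm (z, 1).
Proof.
rewrite ch_Some; have := gt_eqF (nrmS_gt0 p); have := gt_eqF (nrmS_gt0 z).
move: (nrm (p, 1)) (nrm (z, 1)) (modulus _) => a b m /negbT b0 /negbT a0; field.
by rewrite b0 a0.
Qed.

Lemma ukS p r z : 0 < r -> uk p r (Some z) = Num.max r (modulus (z - p)) / nrm (z, 1).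
Proof.
move=> r0; by rewrite /uk ch_None nrm_ch_Some modBC maxr_pMl ?invr_ge0 ?nrm_ge0.
Qed.

Lemma nrm_ch_None p : nrm (p, 1) * ch (Some p) None = 1.
Proof. by rewrite chC ch_None mulfV// gt_eqF// nrmS_gt0. Qed.

Lemma ukN p r : uk p r None = 1.
Proof. by rewrite /uk chxx mulr0 nrm_ch_None; apply/max_idPr; exact: ler01. Qed.

Lemma uk_gt0 p r x : 0 < r -> 0 < uk p r x.
Proof.
move=> r0; case: x => [z|]; last by rewrite ukN.
by rewrite ukS// divr_gt0 ?nrmS_gt0// lt_max r0.
Qed.

Lemma gk_cont p r : 0 < r -> continuous (gk p r).
Proof.
move=> r0; apply: cont_comp; last by move=> x; apply: continuous_ln; exact: uk_gt0.
apply: cont_max; apply: contM; do ?[exact: cont_cst|exact: continuous_ch].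
Qed.

(** The nodes are the translates by [p] of the roots of [w^n = r^n]. After taking logarithms and
    dividing by [n], the two bounds form a mean value property valid away from the nodes, with an
    error of order [(1 - ln d) / n]. *)
Lemma circle_prod (n : nat) p (r : R) : (0 < n)%N -> 0 < r -> exists cs : seq C,
  [/\ size cs = n, forall c, c \in cs -> nrm (p + c, 1) <= modulus p + r + 1 &
    forall x (d : R), 0 < d -> (forall c, c \in cs -> d < ch (Some (p + c)) x) ->
    d * uk p r x ^+ n.-1 <= \prod_(c <- cs) (nrm (p + c, 1) * ch (Some (p + c)) x) <= 2 * uk p r x ^+ n].
Proof.
move=> n0 r0; have [cs [sz rt val low]] := circle_roots n0 r0; exists cs; split => //.
  move=> c /rt mc; apply: le_trans (nrmS_le _) _; rewrite lerD2r -mc; exact: modD.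
move=> [z|] d d0 far; last first.
  rewrite ukN !expr1n !mulr1; under eq_bigr do rewrite nrm_ch_None.
  rewrite big1_eq ler1n andbT; case: cs sz far {rt val low} => [/esym/eqP|c s _ far]; first by rewrite gtn_eqF.
  by apply: ltW; apply: lt_le_trans (far c (mem_head _ _)) _; exact: ch_le1.
have N0 := nrmS_gt0 z; have N0' : nrm (z, 1) != 0 by rewrite gt_eqF.
have fE c : nrm (p + c, 1) * ch (Some (p + c)) (Some z) = modulus (z - p - c) / nrm (z, 1).
  by rewrite nrm_ch_Some modBC opprD addrA.
have -> : \prod_(c <- cs) (nrm (p + c, 1) * ch (Some (p + c)) (Some z)) =
    modulus ((z - p) ^+ n - ofR r ^+ n) / nrm (z, 1) ^+ n.
  by under eq_bigr do rewrite fE; rewrite big_split /= val mod_prod prod_const_seq sz exprVn.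
rewrite ukS// !expr_div_n mulrA mulrA; set u := Num.max _ _.
have u0 : 0 < u by rewrite lt_max r0.
apply/andP; split; last first.
  rewrite ler_pM2r ?invr_gt0 ?exprn_gt0//; apply: le_trans (modD _ _) _.
  rewrite mulrDl mul1r; apply: lerD.
    by rewrite modX ler_pXn2r ?nnegrE ?mod_ge0 ?(ltW u0)// le_max lexx orbT.
  by rewrite modN modX mod_ofR gtr0_norm// ler_pXn2r ?nnegrE ?(ltW r0) ?(ltW u0)// le_max lexx.
have far' c : c \in cs -> d * nrm (z, 1) <= modulus (z - p - c).
  move=> cin; rewrite -ler_pdivlMr// -fE; apply: (le_trans (ltW (far c cin))).
  by rewrite ler_peMl ?ch_ge0//; exact: (nrm_vec_ge1 (Some _)).
have := low (z - p) _ (mulr_gt0 d0 N0) far'; rewrite -/u => h.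
rewrite ler_pdivlMr ?exprn_gt0//; apply: le_trans h.
have e : nrm (z, 1) ^+ n = nrm (z, 1) * nrm (z, 1) ^+ n.-1 by rewrite -exprS prednK.
have := expf_neq0 n.-1 N0'; rewrite e; move: (nrm (z, 1) ^+ n.-1) (u ^+ n.-1) (nrm (z, 1)) => M v N M0.
by rewrite le_eqVlt; apply/orP; left; apply/eqP; field.
Qed.
End CircleAverage.

Section CircleLimit.
Context {R : realType}.
Local Notation C := (Cx R).
Local Notation X := (sphere R).
Local Notation bX := (borel_sphere R).
Implicit Types (x y a : X) (p : C) (nu : probability bX R).
Variables (al B : R).
Hypotheses (al0 : 0 < al) (B0 : 0 < B).

(** Chosen so that balls of radius [scale j] have mass at most [B / 16^j]: the [4^j] nodes of a
    circle then spoil a set of mass at most [B / 4^j], small even against the logarithm of the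
    scale, which is linear in [j]. *)
Definition rate : R := ln 16 / al.
Definition scale (j : nat) : R := expR (- (rate * j%:R)).

Lemma rate_gt0 : 0 < rate.
Proof. by apply: divr_gt0 => //; apply: ln_gt0; rewrite (ltr_nat R 1 16). Qed.
Lemma scale_gt0 j : 0 < scale j. Proof. exact: expR_gt0. Qed.
Lemma ln_scale j : ln (scale j) = - (rate * j%:R). Proof. exact: expRK. Qed.
Lemma scale_le1 j : scale j <= 1.
Proof. by rewrite /scale -expR0 ler_expR oppr_le0 mulr_ge0// ltW// rate_gt0. Qed.
Lemma scale_al j : expR (al * ln (scale j)) = 16 ^- j.
Proof.
have a0 : al != 0 by rewrite gt_eqF.
have -> : al * ln (scale j) = - (ln 16 * j%:R) by rewrite ln_scale /rate; field.
by rewrite expRN expRM_natr lnK// posrE.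
Qed.

Lemma decay (u : nat) (j : nat) : (4 <= u)%N -> (j.+1%:R : R) / u%:R ^+ j <= j.+1%:R^-1.
Proof.
move=> u4; have u0 : 0 < u%:R ^+ j :> R by rewrite exprn_gt0// ltr0n (leq_trans _ u4).
rewrite ler_pdivrMr// mulrC ler_pdivlMr// -natrX -natrM ler_nat.
apply: (@leq_trans (4 ^ j)); last by case: (j) => // k; rewrite leq_exp2r.
have -> : (4 ^ j = 2 ^ j * 2 ^ j)%N by rewrite -expnMn.
by apply: leq_mul; exact: ltn_expl.
Qed.

(** The nodes and the normalization [K] do not depend on the measure, so [K] cancels when two
    measures are compared. Off the balls about the nodes the error is of order [(j + 1) / 4^j]; on
    them a trivial bound linear in [j] meets a mass of order [4^(- j)]. *)
Lemma circle_avg p (r : R) : 0 < r -> exists2 A : R, 0 < A & forall j, exists cs : seq C, exists K : R,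
  size cs = (4 ^ j)%N /\ forall nu, small_balls al B nu ->
  `|4 ^- j * \sum_(c <- cs) I_ nu (ld (scale j) (Some (p + c))) + K - I_ nu (gk p r)| <= A / j.+1%:R.
Proof.
move=> r0; have [M0 M00 HM] := sup_norm_bounded (@gk_cont R p r r0).
pose N := ln (modulus p + r + 1).
have pr1 : 1 <= modulus p + r + 1 by rewrite lerDr addr_ge0 ?mod_ge0 ?(ltW r0).
have N0 : 0 <= N by rewrite ln_ge0.
have k0 := rate_gt0; have l2 : 0 <= ln 2 :> R by rewrite ln_ge0// ler1n.
pose A := rate + M0 + ln 2 + (rate + N + M0) * B.
have A0 : 0 < A by rewrite ltr_wpDr ?mulr_ge0 ?addr_ge0 ?(ltW B0) ?(ltW k0)// ltr_wpDr// ltr_wpDr.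
exists A => // j; set d := scale j.
have n0 : (0 < 4 ^ j)%N by rewrite expn_gt0.
have [cs [sz Nc HQ]] := circle_prod p n0 r0.
pose K : R := 4 ^- j * \sum_(c <- cs) ln (nrm (p + c, 1)); exists cs, K; split => // nu Hnu.
have d0 : 0 < d := scale_gt0 j.
pose q : R := 4 ^- j; have q0 : 0 < q by rewrite invr_gt0 exprn_gt0.
have qE : q * (4 ^ j)%:R = 1 by rewrite /q natrX mulVf// expf_neq0// pnatr_eq0.
have bl a : bmf (ld d a : bX -> R) by apply: cont_bmf; exact: ld_cont.
have bg : bmf (gk p r : bX -> R) by apply: cont_bmf; exact: gk_cont.
pose S x := \sum_(c <- cs) (ld d (Some (p + c)) x + ln (nrm (p + c, 1))).
have bS : bmf (S : bX -> R) by apply: bmf_sum => c; apply: bmfD => //; exact: bmf_cst.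
have bD : bmf ((fun x => q * S x) : bX -> R) by apply: bmfM => //; exact: bmf_cst.
have -> : q * \sum_(c <- cs) I_ nu (ld d (Some (p + c))) + K - I_ nu (gk p r) = I_ nu (fun x => q * S x - gk p r x).
  rewrite I_B// I_Z// I_sum; last by move=> c; apply: bmfD => //; exact: bmf_cst.
  congr (_ - _); rewrite /K -mulrDr -big_split /=; congr (_ * _); apply: eq_bigr => c _.
  by rewrite I_D ?I_cst//; exact: bmf_cst.
pose Nb c : set X := [set x | ch (Some (p + c)) x <= d].
have mN c : measurable (Nb c : set bX) by apply: closed_meas; exact: closed_ball_ch.
have bN c : bmf (\1_(Nb c) : bX -> R) by exact: bmf_indic.
pose kj := rate * j%:R; have kj0 : 0 <= kj by rewrite mulr_ge0// ltW.
pose h x := q * (kj + M0 + ln 2) + (kj + N + M0) * \sum_(c <- cs) \1_(Nb c) x.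
have bh : bmf (h : bX -> R).
  apply: bmfD; first exact: bmf_cst.
  by apply: bmfM; [exact: bmf_cst|exact: bmf_sum].
have Ih : I_ nu h <= A / j.+1%:R.
  rewrite I_D; [|exact: bmf_cst|by apply: bmfM; [exact: bmf_cst|exact: bmf_sum]].
  have bsum : bmf ((fun x => \sum_(c <- cs) \1_(Nb c) x) : bX -> R) by exact: bmf_sum.
  rewrite I_cst I_Z// I_sum//.
  have s1 : \sum_(c <- cs) I_ nu \1_(Nb c) <= (4 ^ j)%:R * (B / 16 ^+ j).
    rewrite -sz mulr_natl -sum_const_seq; apply: ler_sum => c _.
    by rewrite I_indic// -scale_al; apply: Hnu => //; exact: scale_le1.
  have s2 : (4 ^ j)%:R * (B / 16 ^+ j) = q * B.
    have e16 : 16 ^+ j = (4 ^ j)%:R * (4 ^ j)%:R :> R by rewrite -natrX -natrM -expnMn.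
    have F0 : (4 ^ j)%:R != 0 :> R by rewrite pnatr_eq0 -lt0n.
    by rewrite e16 (_ : q = (4 ^ j)%:R^-1) ?/q ?natrX//; rewrite natrX in F0; field.
  have s3 : kj <= rate * j.+1%:R by rewrite ler_pM2l// ler_nat.
  have j1 : 1 <= j.+1%:R :> R by rewrite ler1n.
  have dec : q * j.+1%:R <= j.+1%:R^-1 by rewrite mulrC; exact: (@decay 4).
  have m3 (c : R) : 0 <= c -> kj + c <= (rate + c) * j.+1%:R.
    by move=> c0; rewrite mulrDl; apply: lerD => //; rewrite ler_peMr.
  have t1 : q * (kj + M0 + ln 2) <= (rate + M0 + ln 2) * j.+1%:R^-1.
    rewrite -!addrA; apply: (@le_trans _ _ (q * ((rate + (M0 + ln 2)) * j.+1%:R))).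
      by rewrite ler_pM2l// m3// addr_ge0.
    by rewrite mulrCA ler_wpM2l// addr_ge0 ?addr_ge0 ?(ltW k0).
  have t2 : (kj + N + M0) * \sum_(c <- cs) I_ nu \1_(Nb c) <= (rate + N + M0) * B * j.+1%:R^-1.
    apply: (@le_trans _ _ ((kj + N + M0) * (q * B))).
      by rewrite ler_wpM2l ?addr_ge0// -s2.
    rewrite -!addrA; apply: (@le_trans _ _ ((rate + (N + M0)) * j.+1%:R * (q * B))).
      by rewrite ler_wpM2r ?mulr_ge0 ?(ltW q0) ?(ltW B0)// m3// addr_ge0.
    rewrite -!mulrA ler_wpM2l ?addr_ge0 ?(ltW k0)// mulrA mulrC ler_pM2l// mulrC.
    by [].
  by rewrite /A [leRHS]mulrDl; exact: lerD.
have key x : `|q * S x - gk p r x| <= h x.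
  have lnd : ln d = - kj by exact: ln_scale.
  have lnN c : c \in cs -> 0 <= ln (nrm (p + c, 1)) <= N.
    move=> cin; rewrite ln_ge0 ?(nrm_vec_ge1 (Some _))//= ler_ln ?posrE ?nrmS_gt0//; first exact: Nc.
    exact: lt_le_trans pr1.
  have sum0 : 0 <= \sum_(c <- cs) \1_(Nb c) x :> R by apply: sumr_ge0 => c _; rewrite indicE ler0n.
  have [far|/existsNP[c /not_implyP[cin /negP nfar]]] := pselect (forall c, c \in cs -> d < ch (Some (p + c)) x).
    apply: (@le_trans _ _ (q * (kj + M0 + ln 2))); last by rewrite lerDl mulr_ge0// !addr_ge0.
    have SE : S x = ln (\prod_(c <- cs) (nrm (p + c, 1) * ch (Some (p + c)) x)).
      rewrite ln_prod_seq => [|c cin]; last by rewrite mulr_gt0 ?nrmS_gt0// (lt_trans d0)// far.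
      rewrite /S big_seq [RHS]big_seq; apply: eq_bigr => c cin.
      have c0 : 0 < ch (Some (p + c)) x by rewrite (lt_trans d0)// far.
      have -> : ln (nrm (p + c, 1) * ch (Some (p + c)) x) = ln (nrm (p + c, 1)) + ln (ch (Some (p + c)) x).
        by rewrite lnM ?posrE ?nrmS_gt0.
      by rewrite addrC /ld (max_idPr _)// ltW// far.
    have /andP[q1 q2] := HQ x d d0 far; have u0 := uk_gt0 p x r0.
    have P0 : 0 < d * uk p r x ^+ (4 ^ j).-1 by rewrite mulr_gt0// exprn_gt0.
    have gE : gk p r x = q * (gk p r x *+ (4 ^ j)) by rewrite -mulr_natl mulrA qE mul1r.
    rewrite {1}gE -mulrBr normrM gtr0_norm// ler_pM2l//.
    have l1 : ln (d * uk p r x ^+ (4 ^ j).-1) <= S x.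
      by rewrite SE ler_ln ?posrE//; exact: lt_le_trans q1.
    have l2' : S x <= ln (2 * uk p r x ^+ (4 ^ j)).
      rewrite SE ler_ln ?posrE//; first exact: lt_le_trans q1.
      by rewrite mulr_gt0// exprn_gt0.
    have e1 : ln (d * uk p r x ^+ (4 ^ j).-1) = - kj + gk p r x *+ (4 ^ j).-1.
      by rewrite lnM ?posrE ?exprn_gt0// lnXn// lnd.
    have e2 : ln (2 * uk p r x ^+ (4 ^ j)) = ln 2 + gk p r x *+ (4 ^ j).
      by rewrite lnM ?posrE ?exprn_gt0// lnXn.
    have e3 : gk p r x *+ (4 ^ j) = gk p r x + gk p r x *+ (4 ^ j).-1 by rewrite -mulrS prednK.
    rewrite e1 in l1; rewrite e2 in l2'; have := HM x; rewrite !ler_norml => /andP[g1 g2].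
    move: l1 l2'; rewrite e3; move: (gk p r x *+ (4 ^ j).-1) (S x) (gk p r x) g1 g2 => G s g g1 g2 l1 l2'.
    by apply/andP; split; lra.
  apply: (@le_trans _ _ (kj + N + M0)); last first.
    apply: (@le_trans _ _ ((kj + N + M0) * \sum_(c <- cs) \1_(Nb c) x)).
      rewrite ler_peMr ?addr_ge0// (perm_big _ (perm_to_rem cin)) big_cons.
      have Nx : Nb c x by rewrite /Nb /= leNgt.
      have -> : \1_(Nb c) x = 1 :> R by rewrite indicE mem_set.
      by rewrite lerDl; apply: sumr_ge0 => c' _; rewrite indicE ler0n.
    by rewrite lerDr mulr_ge0 ?(ltW q0)// !addr_ge0.
  apply: le_trans (ler_normB _ _) _; apply: lerD; last exact: HM.
  rewrite normrM gtr0_norm// -ler_pdivlMl// /q invrK.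
  apply: le_trans (ler_norm_sum _ _ _) _.
  rewrite -natrX -sz mulr_natl -sum_const_seq big_seq [leRHS]big_seq; apply: ler_sum => c' c'in.
  have /andP[n1 n2] := lnN c' c'in.
  have := ld_ge (Some (p + c')) x d0; have := ld_le0 (Some (p + c')) x d0 (scale_le1 j).
  rewrite lnd ler_norml; move: (ld _ _ _) (ln _) n1 n2 => u v n1 n2 h1 h2.
  by apply/andP; split; lra.
have bDg : bmf ((fun x => q * S x - gk p r x) : bX -> R) by exact: bmfB.
rewrite ler_norml; apply/andP; split.
  rewrite lerNl -I_N//; apply: le_trans Ih; apply: I_le => //; first exact: bmfN.
  by move=> x; apply: le_trans (ler_norm _) _; rewrite normrN.
by apply: le_trans Ih; apply: I_le => // x; apply: le_trans (ler_norm _) _.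
Qed.
End CircleLimit.

Section SameKernels.
Context {R : realType}.
Local Notation C := (Cx R).
Local Notation X := (sphere R).
Local Notation bX := (borel_sphere R).
Variables (f : X -> X) (nu1 nu2 : probability bX R) (al B : R).
Hypotheses (rf : rational_map f) (d1 : (1 < rat_degree f)%N).
Hypotheses (b1 : balanced f nu1) (b2 : balanced f nu2).
Hypotheses (al0 : 0 < al) (B0 : 0 < B) (H1 : small_balls al B nu1) (H2 : small_balls al B nu2).

Lemma small_eventually (e A : R) (j0 : nat) : 0 <= A -> (forall j, (j0 <= j)%N -> e <= A / j.+1%:R) -> e <= 0.
Proof.
move=> A0 H; rewrite leNgt; apply/negP => e0.
have A1 : 0 < A + 1 by rewrite ltr_wpDl.
have [n hn] := ltr_add_invr (divr_gt0 e0 A1); rewrite add0r in hn.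
have := H (maxn n j0) (leq_maxr _ _); apply/negP; rewrite -ltNge.
apply: (@le_lt_trans _ _ ((A + 1) / n.+1%:R)); last by rewrite mulrC -ltr_pdivlMr.
apply: ler_pM => //; first by rewrite lerDl.
by rewrite lef_pV2 ?posrE// ler_nat ltnS leq_maxl.
Qed.

(** The average of [Vd] over the nodes is close to the difference of the integrals of [gk p r] by
    [circle_avg], and close to [Vd] at infinity because [Vd] has small oscillation. *)
Lemma kernel_diff (p : C) (r : R) : 0 < r -> exists2 A : R, 0 <= A & exists j0, forall j, (j0 <= j)%N ->
  `|I_ nu1 (gk p r) - I_ nu2 (gk p r) - Vd nu1 nu2 (scale al j) None| <= A / j.+1%:R.
Proof.
move=> r0; have [A A0 HA] := circle_avg al0 B0 p r0.
have [Ce Ce0 [L L1 HV]] := pot_osc rf d1 b1 b2 B0 H1 H2.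
have L0 : 0 < L by apply: lt_le_trans L1.
have k0 := rate_gt0 al0.
exists (2 * A + Ce * (1 + rate al)); first by rewrite addr_ge0 ?mulr_ge0 ?addr_ge0 ?(ltW A0) ?(ltW Ce0) ?(ltW k0).
exists `|Num.ceil (ln L / rate al)|%N => j jj.
have Ld : L * scale al j <= 1.
  rewrite -[L]lnK ?posrE// /scale -expRD -[leRHS]expR0 ler_expR subr_le0 mulrC -ler_pdivrMr//.
  apply: le_trans (Num.Theory.ceil_ge _) _.
  apply: (@le_trans _ _ (`|Num.ceil (ln L / rate al)|%N%:R)); last by rewrite ler_nat.
  by rewrite natr_absz ler_int ler_norm.
have [cs [K [sz Hcs]]] := HA j; have c1 := Hcs _ H1; have c2 := Hcs _ H2.
have HVj c : `|Vd nu1 nu2 (scale al j) c - Vd nu1 nu2 (scale al j) None| <= Ce * (1 + rate al) / j.+1%:R.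
  apply: le_trans (HV _ (scale_gt0 al j) Ld c None) _.
  rewrite scale_al// ln_scale opprK -mulrA ler_pM2l//.
  apply: (@le_trans _ _ ((1 + rate al) * (j.+1%:R * 16 ^- j))).
    rewrite mulrA ler_wpM2r ?invr_ge0 ?exprn_ge0// mulrDl mul1r lerD ?ler1n//.
    by rewrite ler_pM2l// ler_nat.
  by rewrite ler_wpM2l ?addr_ge0 ?(ltW k0)//; exact: (@decay R 16).
have avg : `|4 ^- j * \sum_(c <- cs) Vd nu1 nu2 (scale al j) (Some (p + c)) - Vd nu1 nu2 (scale al j) None|
    <= Ce * (1 + rate al) / j.+1%:R.
  have q0 : 0 < 4 ^- j :> R by rewrite invr_gt0 exprn_gt0.
  have -> : Vd nu1 nu2 (scale al j) None = 4 ^- j * \sum_(c <- cs) Vd nu1 nu2 (scale al j) None.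
    rewrite sum_const_seq sz -[_ *+ (4 ^ j)]mulr_natl natrX mulrA mulVf ?mul1r// expf_neq0// pnatr_eq0.
  rewrite -mulrBr -sumrB normrM gtr0_norm// ler_pdivrMl ?exprn_gt0//.
  apply: le_trans (ler_norm_sum _ _ _) _; rewrite -natrX -sz mulr_natl -sum_const_seq.
  by apply: ler_sum => c _; exact: HVj.
have VE : 4 ^- j * \sum_(c <- cs) Vd nu1 nu2 (scale al j) (Some (p + c)) =
   4 ^- j * \sum_(c <- cs) I_ nu1 (ld (scale al j) (Some (p + c))) -
   4 ^- j * \sum_(c <- cs) I_ nu2 (ld (scale al j) (Some (p + c))).
  by rewrite -mulrBr -sumrB.
rewrite VE in avg; move: c1 c2 avg; move: (_ * \sum_(c <- cs) I_ nu1 _) (_ * \sum_(c <- cs) I_ nu2 _).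
move: (I_ nu1 _) (I_ nu2 _) (Vd _ _ _ _) => g1 g2 V s1 s2.
have -> : (2 * A + Ce * (1 + rate al)) / j.+1%:R = 2 * (A / j.+1%:R) + Ce * (1 + rate al) / j.+1%:R.
  by rewrite mulrDl -mulrA.
move: (A / _) (Ce * _ / _) => u v; rewrite !ler_norml.
move=> /andP[? ?] /andP[? ?] /andP[? ?]; apply/andP; split; lra.
Qed.

(** Both differences follow the sequence [Vd nu1 nu2 (scale al j) None] with vanishing error, so
    they agree; its limit is never computed. *)
Lemma kernel_same (p p' : C) (r r' : R) : 0 < r -> 0 < r' ->
  I_ nu1 (gk p r) - I_ nu2 (gk p r) = I_ nu1 (gk p' r') - I_ nu2 (gk p' r').
Proof.
move=> r0 r0'; have [A A0 [j H]] := kernel_diff p r0; have [A' A0' [j' H']] := kernel_diff p' r0'.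
apply/eqP; rewrite -subr_eq0 -normr_le0; apply: (@small_eventually _ (A + A') (maxn j j')); first exact: addr_ge0.
move=> k; rewrite geq_max => /andP[jk jk']; have := H _ jk; have := H' _ jk'.
rewrite mulrDl; move: (I_ _ _ - _) (I_ _ _ - _) (Vd _ _ _ _) (A / _) (A' / _) => a b V u v.
by rewrite !ler_norml => /andP[? ?] /andP[? ?]; apply/andP; split; lra.
Qed.
End SameKernels.

(** * Riemann sums of a radial bump over a lattice *)

Section Lattice.
Context {R : realType}.
Local Notation C := (Cx R).
Local Notation X := (sphere R).
Local Notation bX := (borel_sphere R).
Implicit Types (x y : X) (p z w : C).

Lemma sum_window (u : nat -> R) s L M : (s + L <= M)%N ->
  (forall j, (j < s)%N || (s + L <= j)%N -> u j = 0) -> \sum_(j < M) u j = \sum_(a < L) u (s + a)%N.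
Proof.
move=> LM u0; rewrite -(big_mkord xpredT u) (@big_cat_nat _ _ _ s) ?(leq_trans (leq_addr _ _) LM)//=.
rewrite big_nat big1 ?add0r; last by move=> j /= js; apply: u0; rewrite js.
rewrite (@big_cat_nat _ _ _ (s + L)) ?leq_addr//= [X in _ + X]big_nat [X in _ + X]big1 ?addr0; last first.
  by move=> j /= /andP[js _]; apply: u0; rewrite js orbT.
by rewrite -{1}[s]add0n big_addn addKn big_mkord; apply: eq_bigr => i _; rewrite addnC.
Qed.

(** At [t = |z - p|] this is the difference of the kernels [gk] of radii [2 r] and [r] about [p]: a
    plateau [ln 2] up to [r], zero from [2 r] on. The constant difference between the two measures
    disappears in it. *)
Definition psi (r t : R) : R := ln (Num.max (2 * r) t) - ln (Num.max r t).

Section Psi.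
Variable r : R.
Hypothesis r0 : 0 < r.
Let r20 : 0 < 2 * r. Proof. by rewrite mulr_gt0. Qed.
Let rr2 : r <= 2 * r. Proof. by rewrite ler_peMl ?ler1n// ltW. Qed.

Lemma ln_lip (s t u : R) : 0 < s -> s <= t -> s <= u -> t <= u -> 0 <= ln u - ln t <= (u - t) / s.
Proof.
move=> s0 st su tu; have t0 : 0 < t by apply: lt_le_trans st.
have u0 : 0 < u by apply: lt_le_trans tu.
rewrite subr_ge0 ler_ln ?posrE// tu /=.
have -> : ln u - ln t = ln (1 + (u - t) / t).
  by rewrite mulrBl mulfV ?gt_eqF// addrCA subrr addr0 ln_div ?posrE.
apply: le_trans (le_ln1Dx _) _; first by rewrite (lt_le_trans (ltrN10 R))// divr_ge0 ?subr_ge0 ?(ltW t0).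
by rewrite ler_wpM2l ?subr_ge0// lef_pV2 ?posrE.
Qed.

Lemma psi_ge0 t : 0 <= psi r t.
Proof.
by rewrite subr_ge0 ler_ln ?posrE ?lt_max ?r0 ?r20// ge_max !le_max rr2 lexx orbT.
Qed.

Lemma psi_near t : t <= r -> psi r t = ln 2.
Proof.
move=> tr; rewrite /psi (max_idPl tr) (max_idPl (le_trans tr rr2)).
by rewrite lnM ?posrE// addrK.
Qed.

Lemma psi_far t : 2 * r <= t -> psi r t = 0.
Proof. by move=> tr; rewrite /psi (max_idPr tr) (max_idPr (le_trans rr2 tr)) subrr. Qed.

Lemma max_lip (s t u : R) : `|Num.max s t - Num.max s u| <= `|t - u|.
Proof.
rewrite !maxEle; case: (leP s t) => st; case: (leP s u) => su; rewrite ?subrr ?normr0//.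
- rewrite ger0_norm ?subr_ge0// ger0_norm; last by rewrite subr_ge0 ltW// (lt_le_trans su).
  by rewrite lerD2l lerN2 ltW.
- rewrite ler0_norm ?subr_le0// opprB distrC ger0_norm ?lerD2l ?lerN2 1?ltW//.
  by rewrite subr_gt0 (lt_le_trans st).
Qed.

Lemma ln_max_lip (s t u : R) : r <= s -> `|ln (Num.max s t) - ln (Num.max s u)| <= `|t - u| / r.
Proof.
move=> rs; have H v : r <= Num.max s v by rewrite le_max rs.
apply: (@le_trans _ _ (`|Num.max s t - Num.max s u| / r)); last by rewrite ler_pM2r ?invr_gt0// max_lip.
wlog h : t u / Num.max s t <= Num.max s u.
  move=> W; case: (leP (Num.max s t) (Num.max s u)) => [|/ltW] h; first exact: W.
  by rewrite distrC [X in X / _]distrC; exact: W.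
have /andP[h0 h1] := ln_lip r0 (H t) (H u) h.
by rewrite distrC ger0_norm// [X in X / _]distrC ger0_norm// subr_ge0.
Qed.

Lemma psi_lip t u : `|psi r t - psi r u| <= 2 * (`|t - u| / r).
Proof.
have -> : psi r t - psi r u = (ln (Num.max (2 * r) t) - ln (Num.max (2 * r) u)) - (ln (Num.max r t) - ln (Num.max r u)).
  by rewrite /psi; ring.
apply: le_trans (ler_normB _ _) _.
by rewrite [leRHS]mulrDl mul1r; apply: lerD; exact: ln_max_lip.
Qed.
End Psi.

Lemma bump_kernelS p (r : R) z : 0 < r -> gk p (2 * r) (Some z) - gk p r (Some z) = psi r (modulus (z - p)).
Proof.
move=> r0; have r20 : 0 < 2 * r by rewrite mulr_gt0.
have m0 s : 0 < s -> 0 < Num.max s (modulus (z - p)) by move=> s0; rewrite lt_max s0.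
rewrite /gk !ukS// !ln_div ?posrE ?nrmS_gt0 ?m0// /psi.
by rewrite opprB addrA subrK.
Qed.

Lemma bump_kernelN p (r : R) : gk p (2 * r) None - gk p r None = 0.
Proof. by rewrite /gk !ukN subrr. Qed.

Lemma mod_dist z w : `|modulus z - modulus w| <= modulus (z - w).
Proof. by rewrite ler_norml modB_ge andbT lerNl opprB modBC; exact: modB_ge. Qed.

Lemma nat_shift (i J k : nat) : (J <= i)%N -> i%:R - (i - J + k)%N%:R = J%:R - k%:R :> R.
Proof. by move=> Ji; rewrite natrD natrB// opprD opprB addrA addrCA subrr addr0. Qed.

Lemma mkC_sub (a b c d : R) : mkC (a, b) - mkC (c, d) = mkC (a - c, b - d).
Proof. by []. Qed.

Section Grid.
Variables (r : R) (m : nat) (W : nat).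
Hypotheses (r0 : 0 < r) (m0 : (0 < m)%N).
Let n := (2 * m)%N.
Let h : R := r / n%:R.
Let J := (2 * n)%N.
Let nR : 0 < n%:R :> R. Proof. by rewrite ltr0n muln_gt0. Qed.
Let h0 : 0 < h. Proof. by rewrite divr_gt0. Qed.
Let hJ : h * J%:R = 2 * r.
Proof. by rewrite /h /J natrM mulrCA mulrA mulrA divfK ?gt_eqF// mulrC. Qed.

Definition gridpt (j k : nat) : C := mkC (h * (j%:R - W%:R), h * (k%:R - W%:R)).
Definition gsum z : R := \sum_(j < (2 * W).+1) \sum_(k < (2 * W).+1) psi r (modulus (z - gridpt j k)).
(** The common value of [gsum] at grid points far from the border of the grid: [J] steps of length
    [h] reach the support radius [2 r]. *)
Definition kappa : R := \sum_(a < (2 * J).+1) \sum_(b < (2 * J).+1)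
  psi r (modulus (mkC (h * (J%:R - a%:R), h * (J%:R - b%:R)))).

Lemma mkC_re (x y : R) : `|x| <= modulus (mkC (x, y)). Proof. exact: (Re_le_mod (mkC (x, y))). Qed.
Lemma mkC_im (x y : R) : `|y| <= modulus (mkC (x, y)). Proof. exact: (Im_le_mod (mkC (x, y))). Qed.

Lemma gsum_grid j0 k0 : (J <= j0)%N -> (j0 + J <= 2 * W)%N -> (J <= k0)%N -> (k0 + J <= 2 * W)%N ->
  gsum (gridpt j0 k0) = kappa.
Proof.
move=> j1 j2 k1 k2.
have psiE (x y x' y' : R) : x = x' -> y = y' -> psi r (modulus (mkC (h * x, h * y))) = psi r (modulus (mkC (h * x', h * y'))).
  by move=> -> ->.
have E j k : gridpt j0 k0 - gridpt j k = mkC (h * (j0%:R - j%:R), h * (k0%:R - k%:R)).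
  have e (u a b w : R) : u * (a - w) - u * (b - w) = u * (a - b) by ring.
  by rewrite /gridpt mkC_sub !e.
have far (a b : nat) : (a + J < b)%N || (b + J < a)%N -> 2 * r <= `|h * (a%:R - b%:R)|.
  move=> ab; rewrite normrM gtr0_norm// -hJ ler_pM2l//.
  case/orP: ab => ab; [rewrite distrC|]; rewrite ger0_norm ?subr_ge0 ?ler_nat; do ?lia.
    by rewrite lerBrDl -natrD ler_nat ltnW.
  by rewrite lerBrDl -natrD ler_nat ltnW.
rewrite /gsum (@sum_window (fun j => \sum_(k < (2 * W).+1) psi r (modulus (gridpt j0 k0 - gridpt j k))) (j0 - J)%N (2 * J).+1); [|lia|]; last first.
  move=> j hj; apply: big1 => k _; rewrite E psi_far//.
  apply: le_trans (mkC_re _ _); apply: far; lia.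
apply: eq_bigr => a _; rewrite (@sum_window (fun k => psi r (modulus (gridpt j0 k0 - gridpt (j0 - J + a) k))) (k0 - J)%N (2 * J).+1); [|lia|]; last first.
  move=> k hk; rewrite E psi_far//.
  apply: le_trans (mkC_im _ _); apply: far; lia.
by apply: eq_bigr => b _; rewrite E; apply: psiE; [exact: (nat_shift a j1)|exact: (nat_shift b k1)].
Qed.

(** The [(2 m + 1)^2] offsets of at most [m] steps in each coordinate have modulus at most
    [2 m h = r], hence lie on the plateau. *)
Lemma kappa_ge : n%:R ^+ 2 * ln 2 <= kappa.
Proof.
have wnd (u : nat -> R) : (forall a, 0 <= u a) -> \sum_(a < (2 * m).+1) u (J - m + a)%N <= \sum_(a < (2 * J).+1) u a.
  move=> u0; pose v (a : nat) := if (J - m <= a)%N && (a < J - m + (2 * m).+1)%N then u a else 0.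
  apply: (@le_trans _ _ (\sum_(a < (2 * J).+1) v a)).
    rewrite (@sum_window v (J - m)%N (2 * m).+1); [|rewrite /J /n; lia|].
      by apply: ler_sum => a _; rewrite /v leq_addr ltn_add2l ltn_ord.
    by move=> j hj; rewrite /v ifF//; apply/negbTE; lia.
  by apply: ler_sum => a _; rewrite /v; case: ifP.
apply: le_trans (wnd (fun a => \sum_(b < (2 * J).+1) psi r (modulus (mkC (h * (J%:R - a%:R), h * (J%:R - b%:R))))) _); last first.
  by move=> a; apply: sumr_ge0 => b _; exact: psi_ge0.
apply: (@le_trans _ _ (\sum_(a < (2 * m).+1) \sum_(b < (2 * m).+1) ln 2)); last first.
  apply: ler_sum => a _.
  apply: le_trans (wnd (fun b => psi r (modulus (mkC (h * (J%:R - (J - m + a)%N%:R), h * (J%:R - b%:R))))) _); last first.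
    by move=> b; exact: psi_ge0.
  apply: ler_sum => b _; rewrite psi_near//; apply: le_trans (mod_le_ReIm _) _ => /=.
  have le (c : 'I_(2 * m).+1) : `|h * (J%:R - (J - m + c)%N%:R)| <= h * m%:R.
    rewrite normrM gtr0_norm// ler_pM2l//; have := ltn_ord c; rewrite ltnS => hc.
    have mJ : (m <= J)%N by rewrite /J /n; lia.
    have -> : J%:R - (J - m + c)%N%:R = m%:R - c%:R :> R by exact: nat_shift.
    rewrite ler_norml.
    have h1 : c%:R <= m%:R + m%:R :> R by rewrite -natrD ler_nat addnn -mul2n.
    have h2 : 0 <= c%:R :> R by rewrite ler0n.
    by move: h1 h2; move: (c%:R : R) (m%:R : R) => u v h1 h2; apply/andP; split; lra.
  apply: le_trans (lerD (le a) (le b)) _.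
  by rewrite -mulrDr -natrD addnn -mul2n -/n /h divfK// gt_eqF.
rewrite !sumr_const !card_ord -mulrnA -[leRHS]mulr_natl ler_wpM2r ?ln_ge0 ?ler1n//.
by rewrite -natrX ler_nat /n -mulnn leq_mul.
Qed.

(** Moving [z] to a neighbouring grid point changes each term by [O (1 / n)], and [O (n^2)] terms
    are affected; the total [O (n)] is negligible against [kappa], which is at least of order
    [n^2]. *)
Lemma gsum_near z : `|complex.Re z| <= h * (W%:R - J%:R - 2) -> `|complex.Im z| <= h * (W%:R - J%:R - 2) ->
  `|gsum z - kappa| <= 200 * n%:R.
Proof.
have nat_near (t : R) : `|t| <= h * (W%:R - J%:R - 2) -> exists j0 : nat,
   [/\ (J.+1 <= j0)%N, (j0 + J.+1 <= 2 * W)%N & `|t - h * (j0%:R - W%:R)| <= h].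
  move=> ht; pose q := t / h + W%:R; pose j0 := `|Num.floor q|%N.
  have th : `|t / h| <= W%:R - J%:R - 2 by rewrite normrM normfV (gtr0_norm h0) ler_pdivrMr// mulrC.
  move: th; rewrite ler_norml => /andP[t1 t2].
  have q0 : 0 <= q.
    rewrite /q; move: t1; move: (t / h) => u t1.
    have : 0 <= J%:R :> R by rewrite ler0n. 
    lra.
  have jE : j0%:R = (Num.floor q)%:~R :> R.
    by rewrite /j0 natr_absz ger0_norm// floor_ge0.
  have f1 : j0%:R <= q by rewrite jE Num.Theory.floor_le_tmp.
  have f2 : q < j0%:R + 1 by rewrite jE -[X in _ + X]/(1%:~R) -intrD floorD1_gt.
  exists j0; split.
  - rewrite -ltnS -(ltr_nat R) -[j0.+1%:R]natr1; apply: le_lt_trans f2; rewrite -natr1 /q.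
    by move: t1; move: (t / h) => u t1; lra.
  - rewrite -(ler_nat R) natrD mul2n -addnn natrD -natr1.
    by move: f1; rewrite /q; move: t2; move: (t / h) => u t2 f1; lra.
  - have -> : t - h * (j0%:R - W%:R) = h * (q - j0%:R).
      have e2 : h * (t / h) = t by rewrite mulrCA mulfV ?mulr1// gt_eqF.
      by rewrite /q -[X in X - _ = _]e2 -mulrBr opprB addrA.
    by rewrite normrM (gtr0_norm h0) ler_piMr ?(ltW h0)// ger0_norm ?subr_ge0//; lra.
move=> /nat_near[j0 [j1 j2 j3]] /nat_near[k0 [k1 k2 k3]].
have dz : modulus (z - gridpt j0 k0) <= 2 * h.
  apply: le_trans (mod_le_ReIm _) _; rewrite mulrDl mul1r; apply: lerD.
    by case: (z) j3.
  by case: (z) k3.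
rewrite -(@gsum_grid j0 k0); [|lia|lia|lia|lia].
pose v j k := `|psi r (modulus (z - gridpt j k)) - psi r (modulus (gridpt j0 k0 - gridpt j k))|.
apply: (@le_trans _ _ (\sum_(j < (2 * W).+1) \sum_(k < (2 * W).+1) v j k)).
  rewrite /gsum -sumrB; apply: le_trans (ler_norm_sum _ _ _) _; apply: ler_sum => j _.
  by rewrite -sumrB; apply: le_trans (ler_norm_sum _ _ _) _; apply: ler_sum.
have vle j k : v j k <= 4 / n%:R.
  apply: le_trans (psi_lip r0 _ _) _.
  have : `|modulus (z - gridpt j k) - modulus (gridpt j0 k0 - gridpt j k)| <= 2 * h.
    apply: le_trans dz; apply: le_trans (mod_dist _ _) _.
    by rewrite opprB addrA subrK.
  move=> /(ler_wpM2r (ltW (divr_gt0 ltr01 r0))); rewrite mul1r => le1.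
  apply: le_trans (ler_wpM2l (ler0n _ 2) le1) _.
  rewrite /h; have rn := gt_eqF r0; have nn := gt_eqF nR.
  by rewrite le_eqVlt; apply/orP; left; apply/eqP; field; rewrite rn nn.
have far (a b : nat) (t : R) : `|t - h * (b%:R - W%:R)| <= h -> (a + J.+1 <= b)%N || (b + J.+1 <= a)%N ->
    2 * r <= `|t - h * (a%:R - W%:R)| /\ 2 * r <= `|h * (b%:R - W%:R) - h * (a%:R - W%:R)|.
  move=> tb ab; have d1 : h * (J%:R + 1) <= `|h * (b%:R - W%:R) - h * (a%:R - W%:R)|.
    rewrite -mulrBr opprB addrA subrK normrM gtr0_norm// ler_pM2l//.
    case/orP: ab => ab; [|rewrite distrC]; rewrite ger0_norm ?subr_ge0 ?ler_nat ?(leq_trans (leq_addr _ _) ab)//.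
      by rewrite lerBrDl natr1 -natrD ler_nat.
    by rewrite lerBrDl natr1 -natrD ler_nat.
  rewrite mulrDr mulr1 hJ in d1; split; last by move: d1; have := h0; lra.
  have := ler_distD t (h * (b%:R - W%:R)) (h * (a%:R - W%:R)); rewrite distrC in tb.
  move: d1 tb; move: (`|_ - h * (a%:R - W%:R)|) (`|_|) => u w; lra.
have v0 j k : ((j < j0 - J)%N || (j0 - J + (2 * J).+1 <= j)%N) || ((k < k0 - J)%N || (k0 - J + (2 * J).+1 <= k)%N) -> v j k = 0.
  case/orP => H.
    have [|f1 f2] := far j j0 (complex.Re z) j3; first by lia.
    rewrite /v !psi_far ?subrr ?normr0//.
      by apply: le_trans f2 _; apply: le_trans (Re_le_mod _).
    by apply: le_trans f1 _; case: (z) => ? ?; apply: le_trans (Re_le_mod _).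
  have [|f1 f2] := far k k0 (complex.Im z) k3; first by lia.
  rewrite /v !psi_far ?subrr ?normr0//.
    by apply: le_trans f2 _; apply: le_trans (Im_le_mod _).
  by apply: le_trans f1 _; case: (z) => ? ?; apply: le_trans (Im_le_mod _).
rewrite (@sum_window (fun j => \sum_(k < (2 * W).+1) v j k) (j0 - J)%N (2 * J).+1); [|lia|]; last first.
  by move=> j hj; apply: big1 => k _; apply: v0; rewrite hj.
apply: (@le_trans _ _ (\sum_(a < (2 * J).+1) \sum_(b < (2 * J).+1) (4 / n%:R))).
  apply: ler_sum => a _; rewrite (@sum_window (fun k => v (j0 - J + a)%N k) (k0 - J)%N (2 * J).+1); [|lia|].
    by apply: ler_sum => b _; exact: vle.
  by move=> k hk; apply: v0; rewrite hk orbT.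
rewrite !sumr_const !card_ord -mulrnA -[_ *+ (_ * _)]mulr_natl.
have n1 : (1 <= n)%N by rewrite /n; lia.
have : ((2 * J).+1 * (2 * J).+1 <= 25 * (n * n))%N by rewrite /J; nia.
rewrite -(ler_nat R) => /(ler_wpM2r (ltW (divr_gt0 (ltr0n R 4) nR))) H; apply: le_trans H _.
rewrite (natrM _ 25) (natrM _ n); move: (n%:R : R) nR => N N0; have NN := gt_eqF N0.
have -> : 25 * (N * N) * (4 / N) = 100 * N by field; rewrite NN.
by rewrite ler_pM2r// ler_nat.
Qed.
End Grid.
End Lattice.

Section Uniqueness.
Context {R : realType}.
Local Notation C := (Cx R).
Local Notation X := (sphere R).
Local Notation bX := (borel_sphere R).
Implicit Types (x y : X) (p z w : C) (phi : X -> R).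

Section SameIntegrals.
Variables (nu1 nu2 : probability bX R).
Hypothesis same : forall p (r : R), 0 < r ->
  I_ nu1 (fun x => gk p (2 * r) x - gk p r x) = I_ nu2 (fun x => gk p (2 * r) x - gk p r x).

(* A compactly supported function is a limit of Riemann sums of translates of [psi r]. *)
Lemma same_compact phi (M : R) : continuous phi -> phi None = 0 -> 0 <= M ->
  (forall z, M <= modulus z -> phi (Some z) = 0) -> I_ nu1 phi = I_ nu2 phi.
Proof.
move=> cp pN M0 pM; have [B B0 HB] := sup_norm_bounded cp.
suff key (e : R) : 0 < e -> `|I_ nu1 phi - I_ nu2 phi| <= 2 * e.
  apply/eqP; rewrite -subr_eq0 -normr_le0; apply/ler_addgt0Pr => e e0; rewrite add0r.
  by have := key (e / 2) (divr_gt0 e0 (ltr0n _ 2)); rewrite mulrCA mulfV// mulr1.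
move=> e0; have e30 : 0 < e / 3 by rewrite divr_gt0.
have [d d0 Hd] := unif_continuousR cp e30.
pose r := d / 2; have r0 : 0 < r by rewrite divr_gt0.
have l2 : 0 < ln 2 :> R by rewrite ln_gt0// ltr1n.
have [b b0 bE] : exists2 b : R, 0 < b & b = 200 / ln 2 by exists (200 / ln 2); [apply: divr_gt0; [rewrite ltr0n|exact: l2]|].
(* [m] makes the relative oscillation [b / (2 m)] of the grid sum small. *)
have [m [m0 m1 m2]] : exists m : nat, [/\ (0 < m)%N, b / (2 * m)%:R <= 1 & b / (2 * m)%:R * B <= e / 3].
  have [k hk] := ltr_add_invr (divr_gt0 ltr01 b0).
  have B1 : 0 < B + 1 by rewrite ltr_wpDl.
  have [k' hk'] := ltr_add_invr (divr_gt0 e30 (mulr_gt0 b0 B1)).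
  rewrite add0r in hk; rewrite add0r in hk'; exists (maxn k k').+1; split => //.
    rewrite ler_pdivrMr ?ltr0n ?muln_gt0// mul1r.
    have kk : k.+1%:R <= (2 * (maxn k k').+1)%:R :> R by rewrite ler_nat (leq_trans _ (leq_pmull _ _))// ltnS leq_maxl.
    by apply: le_trans kk; rewrite div1r ltf_pV2 ?posrE// in hk; exact: ltW.
  have kk : k'.+1%:R <= (2 * (maxn k k').+1)%:R :> R by rewrite ler_nat (leq_trans _ (leq_pmull _ _))// ltnS leq_maxr.
  have N0 : 0 < (2 * (maxn k k').+1)%:R :> R by rewrite ltr0n muln_gt0.
  apply: (@le_trans _ _ (b / k'.+1%:R * (B + 1))).
    apply: ler_pM; rewrite ?divr_ge0 ?(ltW b0)// ?lerDl//.
    by rewrite ler_pM2l// lef_pV2 ?posrE.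
  rewrite ltr_pdivlMr ?mulr_gt0// in hk'.
  by rewrite mulrAC mulrC ltW.
pose n := (2 * m)%N; have nR : 0 < n%:R :> R by rewrite ltr0n muln_gt0.
pose h := r / n%:R; have h0 : 0 < h by rewrite divr_gt0.
pose W := (2 * n + 2 + `|Num.ceil ((M + 2 * r) / h)|)%N.
have HW : M + 2 * r <= h * (W%:R - (2 * n)%N%:R - 2).
  have -> : W%:R - (2 * n)%N%:R - 2 = `|Num.ceil ((M + 2 * r) / h)|%N%:R :> R.
    by rewrite /W !natrD; ring.
  rewrite [leRHS]mulrC -ler_pdivrMr//; apply: le_trans (Num.Theory.ceil_ge _) _.
  by rewrite natr_absz ler_int ler_norm.
pose kap := kappa r m; pose pt := gridpt r m W.
have kge : n%:R ^+ 2 * ln 2 <= kap by exact: kappa_ge.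
have k0 : 0 < kap by apply: lt_le_trans kge; rewrite mulr_gt0 ?exprn_gt0.
pose F (j k : nat) x := gk (pt j k) (2 * r) x - gk (pt j k) r x.
pose T x := kap^-1 * \sum_(j <- index_enum 'I_(2 * W).+1) \sum_(k <- index_enum 'I_(2 * W).+1) phi (Some (pt j k)) * F j k x.
have cF j k : continuous (F j k) by apply: contB; apply: gk_cont; rewrite ?mulr_gt0.
have bF j k : bmf (F j k : bX -> R) by exact: cont_bmf.
have bT1 j k : bmf ((fun x => phi (Some (pt j k)) * F j k x) : bX -> R) by apply: bmfM => //; exact: bmf_cst.
have bT2 j : bmf ((fun x => \sum_(k <- index_enum 'I_(2 * W).+1) phi (Some (pt j k)) * F j k x) : bX -> R) by exact: bmf_sum.
have bT3 : bmf ((fun x => \sum_(j <- index_enum 'I_(2 * W).+1) \sum_(k <- index_enum 'I_(2 * W).+1) phi (Some (pt j k)) * F j k x) : bX -> R) by exact: bmf_sum.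
have bT : bmf (T : bX -> R) by apply: bmfM => //; exact: bmf_cst.
have IT : I_ nu1 T = I_ nu2 T.
  have E (nu : probability bX R) : I_ nu T = kap^-1 * \sum_(j <- index_enum 'I_(2 * W).+1) \sum_(k <- index_enum 'I_(2 * W).+1) phi (Some (pt j k)) * I_ nu (F j k).
    rewrite I_Z// I_sum//; congr (_ * _); apply: eq_bigr => j _.
    by rewrite I_sum//; apply: eq_bigr => k _; rewrite I_Z.
  rewrite !E; congr (_ * _); apply: eq_bigr => j _; apply: eq_bigr => k _; congr (_ * _).
  exact: same.
have FS j k z : F j k (Some z) = psi r (modulus (z - pt j k)) by exact: bump_kernelS.
have gE z : gsum r m W z = \sum_(j <- index_enum 'I_(2 * W).+1) \sum_(k <- index_enum 'I_(2 * W).+1) F j k (Some z).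
  by rewrite /gsum; apply: eq_bigr => j _; apply: eq_bigr => k _; rewrite FS.
have close x : `|T x - phi x| <= e.
  case: x => [z|]; last first.
    rewrite /T big1 ?mulr0 ?pN ?subr0 ?normr0 ?(ltW e0)// => j _; apply: big1 => k _.
    by rewrite /F bump_kernelN mulr0.
  have [zM|zM] := leP (modulus z) (M + 2 * r); last first.
    rewrite pM; last by rewrite ltW// (le_lt_trans _ zM)// lerDl mulr_ge0// ltW.
    rewrite /T big1 ?mulr0 ?subr0 ?normr0 ?(ltW e0)// => j _; apply: big1 => k _.
    have [far|near] := leP (2 * r) (modulus (z - pt j k)); first by rewrite FS psi_far// mulr0.
    rewrite pM ?mul0r//; have := modB_ge z (z - pt j k); rewrite opprB addrCA subrr addr0 => h1.
    by move: zM near h1; move: (modulus z) (modulus (z - _)) (modulus _) => u v w; lra.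
  have gn : `|gsum r m W z - kap| <= 200 * n%:R.
    apply: gsum_near => //; apply: le_trans HW; apply: le_trans zM; [exact: Re_le_mod|exact: Im_le_mod].
  pose q := gsum r m W z / kap.
  have q1 : `|q - 1| <= b / n%:R.
    have -> : q - 1 = (gsum r m W z - kap) / kap by rewrite mulrBl mulfV// gt_eqF.
    rewrite normrM normfV (gtr0_norm k0) ler_pdivrMr//; apply: le_trans gn _.
    apply: (@le_trans _ _ (b / n%:R * (n%:R ^+ 2 * ln 2))); last by rewrite ler_wpM2l// divr_ge0 ?(ltW b0)// ltW.
    rewrite bE le_eqVlt; apply/orP; left; apply/eqP.
    move: (n%:R : R) nR (ln 2 : R) l2 => N N0 l l0.
    by have NN := gt_eqF N0; have ll := gt_eqF l0; field; rewrite NN ll.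
  have q2 : q <= 2.
    have := le_trans q1 m1; rewrite ler_norml; lra.
  (* A weighted sum of increments of [phi] over grid points within [2 r = d] of [z], plus the defect
     of the total weight [q] from 1. *)
  have -> : T (Some z) - phi (Some z) = kap^-1 * \sum_(j <- index_enum 'I_(2 * W).+1) \sum_(k <- index_enum 'I_(2 * W).+1)
      (phi (Some (pt j k)) - phi (Some z)) * F j k (Some z) + phi (Some z) * (q - 1).
    rewrite /T /q gE; under [in RHS]eq_bigr do under eq_bigr do rewrite mulrBl.
    under [in RHS]eq_bigr do rewrite sumrB -mulr_sumr; rewrite sumrB -mulr_sumr.
    by have kn := gt_eqF k0; move: (\sum_(_ <- _) _) (\sum_(_ <- _) _) => u v; field; rewrite kn.
  apply: (@le_trans _ _ (e / 3 * q + B * (b / n%:R))); last first.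
    have : e / 3 * q <= e / 3 * 2 by rewrite ler_pM2l.
    by move: m2; rewrite mulrC -/n; lra.
  apply: le_trans (ler_normD _ _) _; apply: lerD; last by rewrite normrM ler_pM.
  rewrite /q gE normrM normfV (gtr0_norm k0) [leRHS]mulrA [leRHS]mulrC ler_pM2l ?invr_gt0//.
  rewrite mulr_sumr; apply: le_trans (ler_norm_sum _ _ _) _; apply: ler_sum => j _.
  rewrite mulr_sumr; apply: le_trans (ler_norm_sum _ _ _) _; apply: ler_sum => k _.
  rewrite normrM FS (ger0_norm (psi_ge0 r0 _)).
  have [far|near] := leP (2 * r) (modulus (z - pt j k)); first by rewrite psi_far// !mulr0.
  rewrite ler_wpM2r ?psi_ge0//; apply: ltW; rewrite distrC; apply: Hd.
  apply: le_lt_trans (ch_Some_le _ _) _; apply: lt_le_trans near _.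
  by rewrite /r mulrCA mulfV// mulr1.
have bp : bmf (phi : bX -> R) by exact: cont_bmf.
have D (nu : probability bX R) : `|I_ nu T - I_ nu phi| <= e.
  by rewrite -I_B//; apply: I_abs_le => //; exact: bmfB.
have := D nu1; rewrite IT distrC => h1; apply: le_trans (ler_distD (I_ nu2 T) _ _) _.
by rewrite (_ : 2 * e = e + e) ?mulr_natl ?mulr2n// lerD.
Qed.

Lemma same_of_kernels : same_measure nu1 nu2.
Proof.
apply: cont_same_measure => phi cp.
suff key (e : R) : 0 < e -> `|I_ nu1 phi - I_ nu2 phi| <= 2 * e.
  apply/eqP; rewrite -subr_eq0 -normr_le0; apply/ler_addgt0Pr => e e0; rewrite add0r.
  by have := key (e / 2) (divr_gt0 e0 (ltr0n _ 2)); rewrite mulrCA mulfV// mulr1.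
move=> e0; pose c := phi None.
have c1 : continuous (fun x => phi x - c - e) by apply: contB; [apply: contB => //|]; exact: cont_cst.
have c2 : continuous (fun x => c - phi x - e) by apply: contB; [apply: contB => //|]; exact: cont_cst.
(* Soft thresholding of [phi - c]: within [e] of it, and zero near infinity, hence covered by the
   compactly supported case. *)
pose g x := Num.max 0 (phi x - c - e) - Num.max 0 (c - phi x - e).
have cg : continuous g by apply: contB; apply: cont_max => //; exact: cont_cst.
have small x : `|phi x - c| <= e -> g x = 0.
  rewrite ler_norml => /andP[h1 h2]; rewrite /g (max_idPl _); last lra.
  by rewrite (max_idPl _) ?subrr//; lra.
have gp x : `|g x - (phi x - c)| <= e.
  rewrite /g; case: (ltP 0 (phi x - c - e)) => h1; case: (ltP 0 (c - phi x - e)) => h2.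
  - by exfalso; lra.
  - by rewrite subr0 addrAC subrr add0r normrN ger0_norm// ltW.
  - by rewrite ler_norml; apply/andP; split; lra.
  - by rewrite ler_norml; apply/andP; split; lra.
have [d d0 Hd] := unif_continuousR cp e0.
have gs : I_ nu1 g = I_ nu2 g.
  apply: (@same_compact g d^-1) => //; first by apply: small; rewrite subrr normr0 ltW.
    by rewrite invr_ge0 ltW.
  move=> z dz; apply: small; apply: ltW; rewrite distrC; apply: Hd.
  rewrite ch_None -[ltRHS]invrK ltf_pV2 ?posrE ?invr_gt0 ?nrmS_gt0//.
  apply: le_lt_trans dz _; rewrite nrmSE -ltr_sqr ?nnegrE ?mod_ge0 ?sqrtr_ge0//.
  by rewrite sqr_sqrtr ?ltrDl// addr_ge0// exprn_ge0// mod_ge0.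
have bg : bmf (g : bX -> R) by exact: cont_bmf.
have bpc : bmf ((fun x => phi x - c) : bX -> R) by apply: cont_bmf; apply: contB => //; exact: cont_cst.
have bp : bmf (phi : bX -> R) by exact: cont_bmf.
have D (nu : probability bX R) : `|I_ nu g - (I_ nu phi - c)| <= e.
  rewrite -[X in _ - (_ - X)](I_cst nu) -I_B//; last exact: bmf_cst.
  by rewrite -I_B//; apply: I_abs_le => //; exact: bmfB.
have := D nu1; have := D nu2; rewrite gs; move: (I_ nu2 g) (I_ nu1 phi) (I_ nu2 phi) => t u v.
by rewrite !ler_norml => /andP[? ?] /andP[? ?]; apply/andP; split; lra.
Qed.
End SameIntegrals.

Theorem balanced_unique (f : X -> X) (nu1 nu2 : probability bX R) : rational_map f -> (1 < rat_degree f)%N ->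
  balanced f nu1 -> balanced f nu2 -> non_atomic nu1 -> non_atomic nu2 -> same_measure nu1 nu2.
Proof.
move=> rf d1 b1 b2 n1 n2.
have [al1 [B1 [al10 B10 H1]]] := holder rf d1 b1 n1.
have [al2 [B2 [al20 B20 H2]]] := holder rf d1 b2 n2.
pose al := Num.min al1 al2; pose B := Num.max B1 B2.
have al0 : 0 < al by rewrite lt_min al10.
have B0 : 0 < B by rewrite lt_max B10.
have weak a b (d : R) : 0 < a -> al <= a -> b <= B -> d <= 1 -> b * expR (a * ln d) <= B * expR (al * ln d).
  move=> a0 ala bB d1'; apply: (@le_trans _ _ (B * expR (a * ln d))).
    by rewrite ler_wpM2r// expR_ge0.
  rewrite ler_pM2l// ler_expR -subr_ge0 -mulrBl mulr_le0 ?subr_le0// ln_le0//.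
have S1 : small_balls al B nu1.
  move=> a d d0 d1'; apply: le_trans (H1 a d d0 d1') _; apply: weak => //; first by rewrite ge_min lexx.
  by rewrite le_max lexx.
have S2 : small_balls al B nu2.
  move=> a d d0 d1'; apply: le_trans (H2 a d d0 d1') _; apply: weak => //; first by rewrite ge_min lexx orbT.
  by rewrite le_max lexx orbT.
apply: same_of_kernels => p r r0.
have r20 : 0 < 2 * r by rewrite mulr_gt0.
have := kernel_same rf d1 b1 b2 al0 B0 S1 S2 p p r20 r0.
have bg s : 0 < s -> bmf (gk p s : bX -> R) by move=> s0; apply: cont_bmf; exact: gk_cont.
rewrite !I_B; do ?exact: bg.
by move: (I_ _ _) (I_ _ _) (I_ _ _) (I_ _ _) => s t u v; lra.
Qed.
End Uniqueness.

(** * Iterates of the transfer operator *)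

Section Transfer.
Context {R : realType}.
Local Notation C := (Cx R).
Local Notation X := (sphere R).
Local Notation bX := (borel_sphere R).
Implicit Types (x y : X) (phi psi : X -> R) (K : set X).

Definition bsum (f : X -> X) phi n x : R := \sum_(i < n) phi (iter i f x).

Lemma bsumD f phi a b x : bsum f phi (a + b) x = bsum f phi a x + bsum f phi b (iter a f x).
Proof.
rewrite /bsum big_split_ord /=; congr (_ + _); apply: eq_bigr => i _.
by rewrite addnC iterD.
Qed.

Lemma bsum_abs f phi (B : R) n x : (forall x, `|phi x| <= B) -> `|bsum f phi n x| <= n%:R * B.
Proof.
move=> HB; apply: le_trans (ler_norm_sum _ _ _) _.
apply: (@le_trans _ _ (\sum_(i < n) B)); first by apply: ler_sum => i _.
by rewrite sumr_const card_ord mulr_natl.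
Qed.

Lemma iter_continuous (f : X -> X) n : continuous f -> continuous (iter n f).
Proof.
move=> cf; elim: n => [|n IH]; first by move=> x; exact: cvg_id.
by move=> x; apply: (@continuous_comp _ _ _ (iter n f) f); [exact: IH|exact: cf].
Qed.

Lemma expR_le_sqr (t : R) : t <= 1 / 2 -> expR t <= 1 + t + 2 * t ^+ 2.
Proof.
move=> t2; have t1 : 0 < 1 - t by lra.
have h : expR t <= (1 - t)^-1.
  rewrite -[leLHS]invrK lef_pV2 ?posrE ?invr_gt0 ?expR_gt0// -expRN.
  exact: expR_ge1Dx.
apply: le_trans h _; rewrite -div1r ler_pdivrMr//.
have := mulr_ge0 (sqr_ge0 t) (_ : 0 <= 1 - 2 * t); rewrite !expr2; nra.
Qed.

Section Iterates.
Variables (f : X -> X) (rf : rational_map f).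
Local Notation L := (Lr f).
Let cf : continuous f. Proof. exact: (rational_continuous rf). Qed.

Fixpoint ifib j y : seq X := if j is k.+1 then flatten [seq ifib k x | x <- fib f y] else [:: y].

Lemma ifibP a j y : (a \in ifib j y) = (iter j f a == y).
Proof.
elim: j y => [|j IH] y /=; first by rewrite inE.
apply/flatten_mapP/eqP => [[x xy]|fa].
  by rewrite IH => /eqP ->; apply/eqP; rewrite -fibP.
by exists (iter j f a); rewrite ?IH// fibP// fa.
Qed.

Lemma sum_ifib phi j y : \sum_(x <- ifib j y) phi x = (rat_degree f)%:R ^+ j * iter j L phi y.
Proof.
elim: j y => [|j IH] y /=; first by rewrite big_seq1 mul1r.
rewrite big_flatten big_map /=; under eq_bigr do rewrite IH.
rewrite -mulr_sumr /Lr exprSr -[RHS]mulrA; congr (_ * _).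
by rewrite mulrA mulfV ?mul1r ?degR_neq0.
Qed.

Lemma Lit_le phi psi k y : (forall x, iter k f x = y -> phi x <= psi x) -> iter k L phi y <= iter k L psi y.
Proof.
elim: k y => [|k IH] y H /=; first exact: H.
by apply: Lr_le => x; rewrite fibP// => /eqP xy; apply: IH => z zx; apply: H; rewrite /= zx.
Qed.

Lemma Lit_cst k (c : R) y : iter k L (fun=> c) y = c.
Proof. by elim: k y => //= k IH y; rewrite -[RHS](Lr_cst c y rf); apply: Lr_eq => x _; exact: IH. Qed.

Lemma LitD k phi psi : iter k L (fun x => phi x + psi x) = fun y => iter k L phi y + iter k L psi y.
Proof. by elim: k => //= k ->; apply/funext => y; exact: LrD. Qed.

Lemma LitZ k (c : R) phi : iter k L (fun x => c * phi x) = fun y => c * iter k L phi y.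
Proof. by elim: k => //= k ->; apply/funext => y; exact: LrZ. Qed.

Lemma Lit_abs k phi (B : R) y : (forall x, `|phi x| <= B) -> `|iter k L phi y| <= B.
Proof. by move=> H; elim: k y => //= k IH y; exact: Lr_abs_le. Qed.

Lemma Lit_sum (n : nat) k (F : nat -> X -> R) y : iter k L (fun x => \sum_(i < n) F i x) y = \sum_(i < n) iter k L (F i) y.
Proof.
elim: n => [|n IH].
  rewrite big_ord0 -[RHS](Lit_cst k 0 y); congr (iter k L _ y); apply/funext => x; by rewrite big_ord0.
rewrite big_ord_recr /= -IH (_ : (fun x => _) = fun x => \sum_(i < n) F i x + F n x) ?LitD//.
by apply/funext => x; rewrite big_ord_recr.
Qed.

Lemma Lit_pull k phi psi y : iter k L (fun x => phi (iter k f x) * psi x) y = phi y * iter k L psi y.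
Proof.
elim: k phi y => [|k IH] phi y //=.
rewrite -Lr_pull//; apply: Lr_eq => x _.
exact: (IH (fun z => phi (f z))).
Qed.

(** Of the [m] transfers, [i] undo the composition with [f^i]; reversing the order of summation
    gives the Cesaro sum. *)
Lemma Lit_bsum m phi y : iter m L (bsum f phi m) y = \sum_(k < m) iter k.+1 L phi y.
Proof.
rewrite (_ : bsum f phi m = fun x => \sum_(i < m) (fun (j : nat) z => phi (iter j f z)) i x)//.
rewrite (Lit_sum m m (fun (j : nat) z => phi (iter j f z))) [RHS](reindex_inj rev_ord_inj) /=; apply: eq_bigr => i _.
rewrite -iterS subnSK// -[X in iter X L _ y = _](subnK (ltnW (ltn_ord i))) iterD; congr (iter _ L _ y); apply/funext => x.
rewrite -[LHS](_ : iter i L (fun z => phi (iter i f z) * 1) x = _); last by congr (iter i L _ x); apply/funext => z; rewrite mulr1.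
by rewrite Lit_pull Lit_cst mulr1.
Qed.

(** The Birkhoff sum of length [a + b] is the one of length [a] plus the one of length [b] after
    [f^a], and the latter passes through [L^a]: weights of consecutive blocks multiply. *)
Lemma Lit_exp (th : R) phi a b y (M : R) : (forall x, iter b f x = y -> iter a L (fun z => expR (th * bsum f phi a z)) x <= M) ->
  iter (b + a) L (fun z => expR (th * bsum f phi (b + a) z)) y <= M * iter b L (fun z => expR (th * bsum f phi b z)) y.
Proof.
move=> H; rewrite iterD (addnC b a).
have -> : iter a L (fun z => expR (th * bsum f phi (a + b) z)) =
    fun x => expR (th * bsum f phi b x) * iter a L (fun z => expR (th * bsum f phi a z)) x.
  apply/funext => x; rewrite -(Lit_pull a (fun z => expR (th * bsum f phi b z))); congr (iter a L _ x); apply/funext => z.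
  by rewrite bsumD mulrDr expRD mulrC.
rewrite -[leRHS](congr1 (fun h => h y) (LitZ b M _)); apply: Lit_le => x /H h.
by rewrite mulrC ler_wpM2r ?expR_ge0.
Qed.
End Iterates.

Lemma I_same (mu nu : probability bX R) (h : bX -> R) : same_measure mu nu -> I_ mu h = I_ nu h.
Proof.
by move=> H; rewrite /I_ /Rintegral; congr fine; apply: eq_measure_integral => A mA _; exact: H.
Qed.

Section Cesaro.
Variables (f : X -> X) (nu : probability bX R) (K : set X).
Hypotheses (rf : rational_map f) (d1 : (1 < rat_degree f)%N).
Hypotheses (bal : balanced f nu) (na : non_atomic nu).
Hypotheses (cK : closed K) (backK : forall x, K (f x) -> K x) (excK : forall x, K x -> ~ exc f x).
Local Notation L := (Lr f).

Lemma backK_iter n x : K (iter n f x) -> K x.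
Proof. by elim: n x => //= n IH x /backK; exact: IH. Qed.

(* Otherwise the Cesaro means have a limit functional that exceeds [nu] at [phi] and is represented by a nonatomic balanced
   measure. *)
Lemma cesaro phi (e : R) : continuous phi -> 0 < e -> exists N : nat, forall n, (N <= n)%N -> forall y, K y ->
  \sum_(k < n) iter k.+1 L phi y <= n%:R * (I_ nu phi + e).
Proof.
move=> cp e0; apply: contrapT => H.
have /choice[s Hs] N : exists p : nat * X, [/\ (N.+1 <= p.1)%N, K p.2 &
    p.1%:R * (I_ nu phi + e) < \sum_(k < p.1) iter k.+1 L phi p.2].
  apply: contrapT => Hn; apply: H; exists N.+1 => n Nn y Ky; rewrite leNgt; apply/negP => h.
  by apply: Hn; exists (n, y).
have [F [UF FF]] := @ultraFilterLemma nat \oo _.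
have n0 N : 0 < (s N).1%:R :> R by rewrite ltr0n; have [h _ _] := Hs N; exact: leq_trans h.
pose a psi N := (s N).1%:R^-1 * \sum_(k < (s N).1) iter k.+1 L psi (s N).2.
have a_le psi (B : R) N : (forall x, `|psi x| <= B) -> `|a psi N| <= B.
  move=> HB; rewrite normrM normfV (gtr0_norm (n0 N)) ler_pdivrMl//.
  apply: le_trans (ler_norm_sum _ _ _) _; rewrite mulr_natl -[X in _ *+ X]card_ord -sumr_const.
  by apply: ler_sum => k _; exact: Lit_abs.
have Hc psi : exists l : R, continuous psi -> a psi @ F --> l.
  have [c|nc] := pselect (continuous psi); last by exists 0 => /nc.
  have [B _ HB] := sup_norm_bounded c.
  by have [l Hl] := ultra_bounded_cvg (u := a psi) UF (fun t => a_le psi B t HB); exists l.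
have /choice[Lam HLam] := Hc.
have uniq psi (l : R) : continuous psi -> a psi @ F --> l -> Lam psi = l.
  by move=> c h; apply: (@cvg_unique _ (@Rhausdorff R) _ _ _ _ (HLam _ c) h).
have LamD (p q : X -> R) : continuous p -> continuous q -> Lam (fun x => p x + q x) = Lam p + Lam q.
  move=> c c'; apply: uniq; first exact: contD.
  rewrite (_ : a _ = fun N => a p N + a q N); first by apply: cvgD; exact: HLam.
  apply/funext => N; rewrite /a -mulrDr -big_split /=; congr (_ * _); apply: eq_bigr => k _.
  by rewrite -!iterS LitD.
have LamZ (c : R) (p : X -> R) : continuous p -> Lam (fun x => c * p x) = c * Lam p.
  move=> cc; apply: uniq; first by apply: contM => //; exact: cont_cst.
  rewrite (_ : a _ = fun N => c * a p N); first by apply: cvgM; [exact: cvg_cst|exact: HLam].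
  apply/funext => N; rewrite /a mulrCA; congr GRing.mul; rewrite mulr_sumr; apply: eq_bigr => k _.
  by rewrite LitZ.
have a_le2 (p q : X -> R) N : (forall x, K x -> p x <= q x) -> a p N <= a q N.
  move=> pq; rewrite ler_wpM2l ?invr_ge0 ?(ltW (n0 N))//; apply: ler_sum => k _.
  apply: Lit_le => // x xy; apply: pq; apply: (@backK_iter k.+1); rewrite xy.
  by have [] := Hs N.
have a_cst (c : R) N : a (fun=> c) N = c.
  rewrite /a; under eq_bigr do rewrite Lit_cst//.
  by rewrite sumr_const card_ord -[X in _ * X]mulr_natl mulrA mulVf ?mul1r// gt_eqF.
have Lam_ge0 (p : X -> R) : continuous p -> (forall x, 0 <= p x) -> 0 <= Lam p.
  move=> c p0; apply: (cvgr_to_ge (HLam _ c)); apply: nearW => N.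
  by rewrite -(a_cst 0 N); exact: a_le2.
have Lam1 : Lam (fun=> 1) = 1.
  apply: uniq; first exact: cont_cst.
  by rewrite (_ : a _ = fun=> 1); [exact: cvg_cst|apply/funext => N; exact: a_cst].
have [la Hla] := riesz_representation LamD LamZ Lam_ge0 Lam1.
have bla : balanced f la.
  move=> psi c; have cL : continuous (L psi) by exact: Lr_continuous.
  rewrite !Hla//; apply: uniq => //.
  have [B B0 HB] := sup_norm_bounded c.
  (* Replacing [psi] by [L psi] shifts the Cesaro sum by one index, so the difference telescopes to
     two boundary terms divided by a length that tends to infinity. *)
  have d0 : (fun N => a (L psi) N - a psi N) @ F --> (0 : R).
    apply: (@cvg_trans _ ((fun N => a (L psi) N - a psi N) @ \oo)); first exact: cvg_app FF.
    apply/cvgrPdist_le => r r0.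
    have [k hk] := ltr_add_invr (divr_gt0 r0 (ltr_pwDr ltr01 (mulr_ge0 (ler0n _ 2) B0))).
    rewrite add0r in hk; near=> N; rewrite sub0r normrN.
    have -> : a (L psi) N - a psi N = (s N).1%:R^-1 * (iter (s N).1.+1 L psi (s N).2 - L psi (s N).2).
      rewrite /a -mulrBr -sumrB; congr (_ * _).
      rewrite -(big_mkord xpredT (fun k => L (iter k L (L psi)) (s N).2 - L (iter k L psi) (s N).2)).
      rewrite (_ : iter (s N).1.+1 L psi = L (iter (s N).1 L psi))// -[X in _ = _ - X (s N).2]/(L (iter 0 L psi)).
      rewrite -(telescope_sumr (fun k => L (iter k L psi) (s N).2) (leq0n _)); apply: eq_bigr => i _.
      by rewrite -iterSr.
    rewrite normrM normfV (gtr0_norm (n0 N)) ler_pdivrMl//.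
    apply: (@le_trans _ _ (B + B)).
      apply: le_trans (ler_normB _ _) _; apply: lerD; first exact: Lit_abs.
      exact: Lr_abs_le.
    rewrite ltr_pdivlMr ?ltr_pwDr// ?mulr_ge0// ltr_pdivrMl ?ltr0n// in hk; last first.
    have kN : k.+1%:R <= (s N).1%:R :> R.
      rewrite ler_nat; have [h _ _] := Hs N; apply: leq_trans h; rewrite ltnS.
      by near: N; exact: nbhs_infty_ge.
    have : k.+1%:R * r <= (s N).1%:R * r by rewrite ler_pM2r.
    by move: hk; lra.
  rewrite (_ : a (L psi) = fun N => (a (L psi) N - a psi N) + a psi N); last by apply/funext => N; rewrite subrK.
  by rewrite -[X in _ --> X]add0r; apply: cvgD => //; exact: HLam.
(* An atom would be exceptional, hence off [K]; but the limit functional only sees values on [K],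
   since iterated fibres of points of [K] stay in [K]. *)
have nla : non_atomic la.
  move=> x; rewrite (probE la (point_meas x)); congr EFin; apply/eqP; rewrite eq_le prob_ge0 andbT leNgt.
  apply/negP => px; have ex := atom_exc rf bla px.
  have Kx : ~ K x by move=> /excK.
  have c := @dset_cont R K.
  have I0 : I_ la (dset K) = 0.
    rewrite Hla//; apply: uniq => //.
    rewrite (_ : a (dset K) = fun=> 0); first exact: cvg_cst.
    apply/funext => N; apply/eqP; rewrite eq_le -{1}(a_cst 0 N) -{2}(a_cst 0 N).
    by apply/andP; split; apply: a_le2 => z Kz; rewrite dset_mem.
  have p0 : 0 < dset K x by rewrite lt_def dset_ge0 andbT; apply/eqP => /(dset_eq0 cK).
  have : dset K x * prob la [set x] <= I_ la (dset K).
    rewrite -I_indic; last exact: point_meas.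
    have bi : bmf (\1_[set x] : bX -> R) by apply: bmf_indic; exact: point_meas.
    rewrite -I_Z//; apply: I_le; [exact: bmfM (bmf_cst _) bi|exact: cont_bmf|].
    move=> y; rewrite indic1; case: eqP => [->|_]; first by rewrite mulr1.
    by rewrite mulr0 dset_ge0.
  by rewrite I0 leNgt mulr_gt0.
have Es := balanced_unique rf d1 bla bal nla na.
have : I_ nu phi + e <= I_ nu phi.
  rewrite -{2}(I_same phi Es) Hla//; apply: (cvgr_to_ge (HLam _ cp)); apply: nearW => N.
  by have [_ _ h] := Hs N; rewrite /a ler_pdivlMl// ltW.
by rewrite gerDl leNgt e0.
Unshelve. all: end_near.
Qed.

(* Expand [exp] to second order over one block of length [m], then iterate over blocks. *)
Lemma exp_bound phi (e : R) : continuous phi -> 0 < e -> exists2 th0 : R, 0 < th0 & forall th, 0 < th -> th <= th0 ->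
  exists2 Ce : R, 1 <= Ce & forall n y, K y ->
    iter n L (fun x => expR (th * bsum f phi n x)) y <= Ce * expR (th * (n%:R * (I_ nu phi + e))).
Proof.
move=> cp e0; have e20 : 0 < e / 2 by rewrite divr_gt0.
have [B' B'0 HB'] := sup_norm_bounded cp; pose B := B' + 1.
have B0 : 0 < B by rewrite ltr_wpDl.
have HB x : `|phi x| <= B by apply: le_trans (HB' x) _; rewrite lerDl.
have [m0 Hm] := cesaro cp e20; pose m := m0.+1; set c := I_ nu phi in Hm *.
have m_gt0 : 0 < m%:R :> R by rewrite ltr0n.
have mB : 0 < m%:R * B by rewrite mulr_gt0.
have mBB : 0 < 2 * (m%:R * B ^+ 2) by rewrite !mulr_gt0// exprn_gt0.
(* The first bound makes the second order expansion of the exponential valid on a block of length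
   [m]; the second makes its quadratic term cost at most the spare [e / 2] per step. *)
exists (Num.min (1 / 2 / (m%:R * B)) (e / 2 / (2 * (m%:R * B ^+ 2)))).
  by rewrite lt_min !divr_gt0.
move=> th th0; rewrite le_min => /andP[t1 t2]; rewrite ler_pdivlMr// in t1; rewrite ler_pdivlMr// in t2.
pose W n x := expR (th * bsum f phi n x).
have one y : K y -> iter m L (W m) y <= expR (th * (m%:R * (c + e))).
  move=> Ky; apply: (@le_trans _ _ (iter m L (fun x => (1 + 2 * (th * (m%:R * B)) ^+ 2) + th * bsum f phi m x) y)).
    apply: Lit_le => // x _; have sb := @bsum_abs f phi B m x HB.
    have tb : `|th * bsum f phi m x| <= th * (m%:R * B) by rewrite normrM gtr0_norm// ler_pM2l.
    apply: le_trans (expR_le_sqr _) _; first by apply: le_trans (ler_norm _) _; exact: le_trans t1.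
    rewrite addrAC lerD2r lerD2l ler_pM2l// -[leLHS]real_normK ?num_real//.
    by rewrite ler_sqr ?nnegrE ?normr_ge0// (le_trans _ tb).
  rewrite (LitD f m (fun=> 1 + 2 * (th * (m%:R * B)) ^+ 2) (fun x => th * bsum f phi m x)) (LitZ f m th (bsum f phi m)) Lit_cst// Lit_bsum//.
  have h : \sum_(k < m) iter k.+1 L phi y <= m%:R * (c + e / 2) by apply: Hm.
  apply: le_trans (expR_ge1Dx _); rewrite -addrA lerD2l.
  have h2 : th * \sum_(k < m) iter k.+1 L phi y <= th * (m%:R * (c + e / 2)) by rewrite ler_pM2l.
  apply: le_trans (lerD (lexx _) h2) _.
  have h3 : 2 * (th * (m%:R * B)) ^+ 2 <= th * m%:R * (e / 2).
    have -> : 2 * (th * (m%:R * B)) ^+ 2 = th * m%:R * (th * (2 * (m%:R * B ^+ 2))) by rewrite !expr2; ring.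
    by rewrite ler_pM2l ?mulr_gt0.
  apply: le_trans (lerD h3 (lexx _)) _.
  by rewrite le_eqVlt; apply/orP; left; apply/eqP; field.
pose M := expR (th * (m%:R * (c + e))).
have many q y : K y -> iter (m * q) L (W (m * q)%N) y <= M ^+ q.
  elim: q y => [|q IH] y Ky; first by rewrite muln0 /W /= /bsum big_ord0 mulr0 expR0 expr0.
  rewrite mulnS; apply: le_trans (@Lit_exp f rf th phi (m * q)%N m y (M ^+ q) _) _.
    by move=> x xy; apply: IH; apply: (@backK_iter m); rewrite xy.
  by rewrite exprSr ler_pM2l ?exprn_gt0 ?expR_gt0//; exact: one.
have trivial r y : iter r L (W r) y <= expR (th * (r%:R * B)).
  rewrite -[leRHS](Lit_cst rf r _ y); apply: Lit_le => // x _; rewrite ler_expR ler_pM2l//.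
  by apply: le_trans (ler_norm _) _; exact: bsum_abs.
exists (expR (th * (m%:R * (B + `|c + e|)))); first by rewrite -[leLHS]expR0 ler_expR !mulr_ge0// ?addr_ge0// ltW.
move=> n y Ky; pose q := (n %/ m)%N; pose r := (n %% m)%N.
have nE : n = (r + m * q)%N by rewrite mulnC addnC -divn_eq.
rewrite [in leLHS]nE.
apply: le_trans (@Lit_exp f rf th phi (m * q)%N r y (M ^+ q) _) _.
  by move=> x xy; apply: many; apply: (@backK_iter r); rewrite xy.
apply: (@le_trans _ _ (M ^+ q * expR (th * (r%:R * B)))).
  by rewrite ler_pM2l ?exprn_gt0 ?expR_gt0//; exact: trivial.
rewrite /M -expRM_natr -!expRD ler_expR.
have rm : r%:R <= m%:R :> R by rewrite ler_nat ltnW// ltn_pmod.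
have nR : n%:R = r%:R + m%:R * q%:R :> R by rewrite {1}nE natrD natrM.
rewrite nR; have ab := ler_norm (- (c + e)); rewrite normrN in ab.
have r0 : 0 <= r%:R :> R by rewrite ler0n.
have BB : 0 <= B + `|c + e| by rewrite addr_ge0// ltW.
have h1 : r%:R * (B - (c + e)) <= m%:R * (B + `|c + e|).
  apply: (@le_trans _ _ (r%:R * (B + `|c + e|))); first by rewrite ler_wpM2l// lerD2l.
  by rewrite ler_wpM2r.
have := ler_wpM2l (ltW th0) h1; move: (m%:R : R) (r%:R : R) (q%:R : R) (`|c + e|) (c + e) => m' r' q' u v; nra.
Qed.
End Cesaro.
End Transfer.

(** * Discrete energy *)

Section TentSums.
Context {R : realType}.
Implicit Types (v w : nat -> R).

(** Tent weights [n - |l - (n - 1)|], written as a sum over nested intervals so that summation by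
    parts telescopes. *)
Definition tsum (n : nat) w : R := \sum_(j < n) \sum_(n.-1 - j <= l < n + j) w l.

Lemma tsumD n w w' : tsum n (fun l => w l + w' l) = tsum n w + tsum n w'.
Proof. by rewrite /tsum -big_split; apply: eq_bigr => j _; rewrite -big_split. Qed.

Lemma tsumZ n (c : R) w : tsum n (fun l => c * w l) = c * tsum n w.
Proof. by rewrite /tsum mulr_sumr; apply: eq_bigr => j _; rewrite mulr_sumr. Qed.

Lemma tsum_cst n (c : R) : tsum n (fun=> c) = n%:R ^+ 2 * c.
Proof.
rewrite /tsum -natrX mulr_natl; under eq_bigr do rewrite sumr_const_nat.
rewrite sumrMnr; congr (_ *+ _); case: n => [|n]; first by rewrite big_ord0.
have E (m : nat) : (\sum_(j < m) (2 * j + 1) = m ^ 2)%N.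
  by elim: m => [|m IH]; [rewrite big_ord0|rewrite big_ord_recr /= IH; lia].
by rewrite -(E n.+1); apply: eq_bigr => j _ /=; have := ltn_ord j; lia.
Qed.

Lemma tsum_le n w w' : (forall l, (l < 2 * n)%N -> w l <= w' l) -> tsum n w <= tsum n w'.
Proof.
move=> H; apply: ler_sum => j _; rewrite !big_nat; apply: ler_sum => l /andP[_ ln].
by apply: H; have := ltn_ord j; lia.
Qed.

Lemma tsum_laplace n v : tsum n (fun l => v l.+2 + v l - 2 * v l.+1) = v (2 * n)%N + v 0%N - 2 * v n.
Proof.
pose g l := v l.+1 - v l.
have E (j : 'I_n) : \sum_(n.-1 - j <= l < n + j) (v l.+2 + v l - 2 * v l.+1) = g (n + j)%N - g (n.-1 - j)%N.
  rewrite -(telescope_sumr g); last by lia.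
  by apply: eq_bigr => l _; rewrite /g; lra.
rewrite /tsum (eq_bigr _ (fun j _ => E j)) big_split /= sumrN.
have -> : \sum_(j < n) g (n + j)%N = v (2 * n)%N - v n.
  rewrite -(big_mkord xpredT (fun j => g (n + j)%N)) (eq_bigr (fun j => v (n + j.+1)%N - v (n + j)%N)).
    by rewrite (telescope_sumr (fun j => v (n + j)%N))// addn0 mul2n addnn.
  by move=> j _; rewrite addnS.
have -> : \sum_(j < n) g (n.-1 - j)%N = v n - v 0%N.
  rewrite -(telescope_sumr v (leq0n n)) big_mkord [RHS](reindex_inj rev_ord_inj) /=.
  by apply: eq_bigr => j _; rewrite /g (_ : (n.-1 - j)%N = (n - j.+1)%N)//; lia.
by lra.
Qed.

(** The [N] largest of the [2 N] nested intervals all contain the middle half. *)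
Lemma tsum_ge N w : (forall l, 0 <= w l) -> N%:R * \sum_(N <= l < 3 * N) w l <= tsum (2 * N) w.
Proof.
move=> w0; have le (a b a' b' : nat) : (a' <= a)%N -> (b <= b')%N -> \sum_(a <= l < b) w l <= \sum_(a' <= l < b') w l.
  move=> h1 h2; have [ab|ba] := leqP a b; last by rewrite big_geq 1?ltnW//; exact: sumr_ge0.
  rewrite (big_cat_nat h1) ?(leq_trans ab)//= [X in _ <= _ + X](big_cat_nat ab)//=.
  by rewrite addrCA lerDl addr_ge0// sumr_ge0.
rewrite /tsum -(big_mkord xpredT (fun j => \sum_((2 * N).-1 - j <= l < 2 * N + j) w l)).
have N2 : (N <= 2 * N)%N by lia.
rewrite (big_cat_nat (leq0n N) N2) /= ler_wpDl//; first by apply: sumr_ge0 => j _; exact: sumr_ge0.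
rewrite mulr_natl; have -> : N = (2 * N - N)%N by lia.
rewrite -sumr_const_nat (_ : (2 * N - N)%N = N); last by lia.
apply: ler_sum_nat => j /andP[j1 j2]; apply: le; lia.
Qed.

(* Summation by parts against tent weights: the second difference of a tent is supported at three points. *)
Lemma tent_bound (N : nat) (v a : nat -> nat -> R) (M c : R) :
  (forall l l', (l <= 4 * N)%N -> (l' <= 4 * N)%N -> `|v l l'| <= M) -> (forall l l', 0 <= a l l') ->
  (forall l l', (l < 4 * N)%N -> (l' < 4 * N)%N -> a l l' <= 2 * (v l.+2 l'.+1 + v l l'.+1 + v l.+1 l'.+2 + v l.+1 l' - 4 * v l.+1 l'.+1) + c) ->
  \sum_(N <= l < 3 * N) \sum_(N <= l' < 3 * N) a l l' <= 64 * M + 16 * (c * N%:R ^+ 2).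
Proof.
have [->|N0] := posnP N.
  by move=> H _ _; rewrite muln0 big_geq// expr0n /= !mulr0 addr0 mulr_ge0//; apply: le_trans (H 0%N 0%N _ _).
move=> vM a0 H; pose n := (2 * N)%N; have n2 : (2 * n = 4 * N)%N by rewrite /n; lia.
have n4 : (n <= 4 * N)%N by rewrite /n; lia.
have M0 : 0 <= M by apply: le_trans (vM 0%N 0%N _ _).
have hv l l' : (l <= 4 * N)%N -> (l' <= 4 * N)%N -> - M <= v l l' <= M.
  by move=> h h'; rewrite -ler_norml; exact: vM.
pose V l := tsum n (fun l' => v l l'.+1).
have VM l : (l <= 4 * N)%N -> - (n%:R ^+ 2 * M) <= V l <= n%:R ^+ 2 * M.
  move=> ll; rewrite -mulrN -!tsum_cst; apply/andP; split; apply: tsum_le => l' l'n.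
    by have /andP[] := hv l l'.+1 ll ltac:(lia).
  by have /andP[] := hv l l'.+1 ll ltac:(lia).
have step l : (l < 4 * N)%N -> tsum n (a l) <= 2 * (V l.+2 + V l - 2 * V l.+1) + (8 * M + n%:R ^+ 2 * c).
  move=> ll; apply: (@le_trans _ _ (tsum n (fun l' => 2 * (v l.+2 l'.+1 + v l l'.+1 + -2 * v l.+1 l'.+1) +
      (2 * (v l.+1 l'.+2 + v l.+1 l' - 2 * v l.+1 l'.+1) + c)))).
    by apply: tsum_le => l' l'n; apply: le_trans (H l l' ll _) _; [lia|lra].
  rewrite tsumD tsumZ (tsumD n (fun l' => v l.+2 l'.+1 + v l l'.+1)) (tsumD n (fun l' => v l.+2 l'.+1)) tsumZ.
  rewrite (tsumD n (fun l' => 2 * _)) tsumZ (tsum_laplace n (v l.+1)) tsum_cst -/(V _) -/(V _) -/(V _).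
  have /andP[h1 h2] := hv l.+1 (2 * n)%N ltac:(lia) ltac:(lia).
  have /andP[h3 h4] := hv l.+1 0%N ltac:(lia) ltac:(lia).
  have /andP[h5 h6] := hv l.+1 n ltac:(lia) ltac:(lia).
  move: (n%:R ^+ 2 * c) h1 h2 h3 h4 h5 h6 => t; move: (V _) (V _) (V _) (v _ _) (v _ _) (v _ _) => *; lra.
(* Each variable gains a factor [N] from the tent weights on the middle half, and [n = 2 * N] in the
   upper bound; dividing by [N^2] gives the constants 64 and 16. *)
have tot : N%:R ^+ 2 * \sum_(N <= l < 3 * N) \sum_(N <= l' < 3 * N) a l l' <= tsum n (fun l => tsum n (a l)).
  apply: (@le_trans _ _ (N%:R * \sum_(N <= l < 3 * N) tsum n (a l))).
    rewrite expr2 -mulrA ler_wpM2l ?ler0n// mulr_sumr; apply: ler_sum => l _; exact: tsum_ge.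
  by apply: tsum_ge => l; apply: sumr_ge0 => j _; exact: sumr_ge0.
have fin : tsum n (fun l => tsum n (a l)) <= 2 * (4 * (n%:R ^+ 2 * M)) + n%:R ^+ 2 * (8 * M + n%:R ^+ 2 * c).
  apply: (@le_trans _ _ (tsum n (fun l => 2 * (V l.+2 + V l - 2 * V l.+1) + (8 * M + n%:R ^+ 2 * c)))).
    by apply: tsum_le => l ln; apply: step; lia.
  rewrite tsumD tsumZ tsum_laplace tsum_cst lerD2r.
  have /andP[h1 h2] := VM (2 * n)%N ltac:(lia).
  have /andP[h3 h4] := VM 0%N ltac:(lia).
  have /andP[h5 h6] := VM n ltac:(lia).
  move: (n%:R ^+ 2 * M) h1 h2 h3 h4 h5 h6 => t; move: (V _) (V _) (V _) => *; lra.
have := le_trans tot fin; have NR : 0 < N%:R ^+ 2 :> R by rewrite exprn_gt0// ltr0n.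
rewrite (_ : n%:R = 2 * N%:R); last by rewrite natrM.
have -> : 2 * (4 * ((2 * N%:R) ^+ 2 * M)) + (2 * N%:R) ^+ 2 * (8 * M + (2 * N%:R) ^+ 2 * c) =
   N%:R ^+ 2 * (64 * M + 16 * (c * N%:R ^+ 2)).
  by move: (N%:R : R) => t; ring.
by rewrite ler_pM2l.
Qed.
End TentSums.

Section Energy.
Context {R : realType}.
Local Notation C := (Cx R).
Local Notation X := (sphere R).
Implicit Types (z w r : C) (h : R).

Definition iC : C := (0 +i* 1)%C.

(** The four neighbours cancel every term of order below four. An error [h^4] per grid point still
    tends to 0 after summation over the [h^(-2)] points of a grid. *)
Lemma quad_prod (a t : C) : (a + t) * (a - t) * (a + iC * t) * (a - iC * t) = a ^+ 4 - t ^+ 4.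
Proof.
have i2 : iC ^+ 2 = -1 :> C by rewrite expr2; apply/eqP; rewrite eq_complex /=; apply/andP; split; apply/eqP; ring.
have -> : (a + t) * (a - t) * (a + iC * t) * (a - iC * t) = (a ^+ 2 - t ^+ 2) * (a ^+ 2 - iC ^+ 2 * t ^+ 2) by ring.
by rewrite i2; ring.
Qed.

Lemma roots_quad (s : seq C) z h (L : R) : 0 < L -> 0 <= h -> (L * h) ^+ 4 <= 1 ->
  (forall r, r \in s -> 1 <= L * modulus (z - r)) ->
  (\prod_(r <- s) modulus (z - r)) ^+ 4 * (1 - (L * h) ^+ 4) ^+ size s <=
  (\prod_(r <- s) modulus (z + ofR h - r)) * (\prod_(r <- s) modulus (z - ofR h - r)) *
  (\prod_(r <- s) modulus (z + iC * ofR h - r)) * (\prod_(r <- s) modulus (z - iC * ofR h - r)).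
Proof.
move=> L0 h0 Lh; elim: s => [|r s IH] H; first by rewrite !big_nil expr1n !mulr1.
rewrite !big_cons /=.
set A := modulus (z - r); set B := \prod_(j <- s) modulus (z - j) in IH *.
have IHs : _ := IH (fun r' (h' : r' \in s) => H r' (mem_behead (s := r :: s) h')).
have A1 : A ^+ 4 * (1 - (L * h) ^+ 4) <= modulus (z + ofR h - r) * modulus (z - ofR h - r) * modulus (z + iC * ofR h - r) * modulus (z - iC * ofR h - r).
  have e (t : C) : z + t - r = (z - r) + t by ring.
  rewrite -!modM !e quad_prod; apply: le_trans (modB_ge _ _); rewrite !modX mod_ofR ger0_norm// -/A.
  have : 1 <= (L * A) ^+ 4 by rewrite exprn_ege1// H// mem_head.
  rewrite !exprMn mulrBr mulr1 => h1; rewrite lerB// mulrA [A ^+ 4 * _]mulrC -[leLHS]mul1r ler_wpM2r//.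
  exact: exprn_ge0.
have x1 : 0 <= 1 - (L * h) ^+ 4 by rewrite subr_ge0.
apply: le_trans (_ : _ <= (A ^+ 4 * (1 - (L * h) ^+ 4)) * (B ^+ 4 * (1 - (L * h) ^+ 4) ^+ size s)) _.
  by rewrite [X in _ * X <= _]exprS le_eqVlt; apply/orP; left; apply/eqP; ring.
have B0 : 0 <= B by apply: prodr_ge0 => j _; exact: mod_ge0.
apply: le_trans (ler_pM _ _ A1 IHs) _; first by rewrite mulr_ge0// exprn_ge0// mod_ge0.
  by rewrite mulr_ge0// exprn_ge0.
by rewrite le_eqVlt; apply/orP; left; apply/eqP; ring.
Qed.

Lemma poly_quad (q : {poly C}) z h (L : R) (D : nat) : 0 < L -> 0 <= h -> (L * h) ^+ 4 <= 1 -> q.[z] != 0 -> (size q <= D.+1)%N ->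
  (forall r, root q r -> 1 <= L * modulus (z - r)) ->
  modulus q.[z] ^+ 4 * (1 - (L * h) ^+ 4) ^+ D <=
  modulus q.[z + ofR h] * modulus q.[z - ofR h] * modulus q.[z + iC * ofR h] * modulus q.[z - iC * ofR h].
Proof.
move=> L0 h0 Lh qz sq H; have q0 : q != 0 by apply: contraNneq qz => ->; rewrite horner0.
have hE w : modulus q.[w] = modulus (lead_coef q) * \prod_(r <- roots q) modulus (w - r).
  rewrite {1}(rootsE q) hornerZ modM; congr (_ * _); rewrite horner_prod mod_prod; apply: eq_bigr => r _.
  by rewrite hornerXsubC.
have Hr r : r \in roots q -> 1 <= L * modulus (z - r).
  by move=> rq; apply: H; rewrite (rootsE q) rootZ ?lead_coef_eq0// root_prod_XsubC.
have := roots_quad L0 h0 Lh Hr; have x1 : 0 <= 1 - (L * h) ^+ 4 by rewrite subr_ge0.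
rewrite !hE; have l0 : 0 <= modulus (lead_coef q) ^+ 4 by rewrite exprn_ge0// mod_ge0.
move=> /(ler_wpM2l l0) P; apply: le_trans (_ : _ <= _) (le_trans P _).
  rewrite exprMn -mulrA ler_wpM2l// ler_wpM2l//.
    by apply: exprn_ge0; apply: prodr_ge0 => r _; exact: mod_ge0.
  have sr : (size (roots q) <= D)%N by rewrite -ltnS size_roots.
  by apply: ler_wiXn2l => //; rewrite gerBl exprn_even_ge0.
by rewrite le_eqVlt; apply/orP; left; apply/eqP; ring.
Qed.

Lemma expR_half (x : R) : 0 <= x -> x <= 1 / 2 -> expR (- (2 * x)) <= 1 - x.
Proof.
move=> x0 x1; have p : 0 < 1 + 2 * x by lra.
rewrite expRN; apply: (@le_trans _ _ (1 + 2 * x)^-1).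
  by rewrite lef_pV2 ?posrE ?expR_gt0// expR_ge1Dx.
rewrite -div1r ler_pdivrMr//; nra.
Qed.

Section Step.
Variables (pq : {poly C} * {poly C}) (L : R).
Hypotheses (gp : good pq) (L1 : 1 <= L) (lip : forall a b, ch (pmap pq a) (pmap pq b) <= L * ch a b).
Local Notation Fv w := (Fhat pq (vec (Some w))).

Definition upot w : R := ln (nrm (Fv w)).

Lemma herm_sigma z w : modulus (herm (Fv w) (Fv z)) ^+ 2 =
  (nrm (Fv w) * nrm (Fv z)) ^+ 2 * (1 - ch (pmap pq (Some w)) (pmap pq (Some z)) ^+ 2).
Proof.
have := lagrange_id (Fv w) (Fv z).
have [c c0 ew] := Fhat_vecE (Some w) gp; have [c' c0' ez] := Fhat_vecE (Some z) gp.
have -> : modulus (wedge (Fv w) (Fv z)) = nrm (Fv w) * nrm (Fv z) * ch (pmap pq (Some w)) (pmap pq (Some z)).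
  rewrite ew ez !nrm_scale; set a := pmap pq _; set b := pmap pq _.
  have -> : wedge (scalev c (vec a)) (scalev c' (vec b)) = c * c' * wedge (vec a) (vec b) by rewrite /wedge /=; ring.
  rewrite !modM wedge_ch; ring.
move=> h; rewrite -[LHS](addKr ((nrm (Fv w) * nrm (Fv z) * ch (pmap pq (Some w)) (pmap pq (Some z))) ^+ 2)) h.
by move: (nrm _) (nrm _) (ch _ _) => A B s; ring.
Qed.

(* [w |-> <F(w), F(z)>] is a polynomial whose roots are sent by [f] to the antipode of [f z], hence are at distance at least
   [1/L] from [z]; its product over the four neighbours of [z] is therefore close to its fourth power at [z], and
   [|<F(w), F(z)>|^2 = |F(w)|^2 |F(z)|^2 (1 - ch^2)]. *)
Lemma energy_step z h : 0 <= h -> (L * h) ^+ 4 <= 1 / 2 ->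
  ch (pmap pq (Some (z + ofR h))) (pmap pq (Some z)) ^+ 2 + ch (pmap pq (Some (z - ofR h))) (pmap pq (Some z)) ^+ 2 +
  ch (pmap pq (Some (z + iC * ofR h))) (pmap pq (Some z)) ^+ 2 + ch (pmap pq (Some (z - iC * ofR h))) (pmap pq (Some z)) ^+ 2 <=
  2 * (upot (z + ofR h) + upot (z - ofR h) + upot (z + iC * ofR h) + upot (z - iC * ofR h) - 4 * upot z) + 4 * ((deg pq)%:R * (L * h) ^+ 4).
Proof.
move=> h0 Lh; have L0 : 0 < L := lt_le_trans ltr01 L1.
have half_id (a b t : R) : (a + b - t / 2) * 2%:R = (a + b) * 2%:R + - t by field.
pose q : {poly C} := (((Fv z).1)^*)%C *: pq.1 + (((Fv z).2)^*)%C *: pq.2.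
have qE w : q.[w] = herm (Fv w) (Fv z).
  by rewrite /q hornerD !hornerZ /herm /Fhat /= !(@hom_Some _ _ _ w) ?size1_deg ?size2_deg// mulrC; congr (_ + _); exact: mulrC.
have N0 w : 0 < nrm (Fv w) by exact: nrm_Fhat_gt0.
have NE w : nrm (Fv w) = expR (upot w) by rewrite lnK ?posrE.
have qz : modulus q.[z] = nrm (Fv z) ^+ 2 by rewrite qE herm_self.
have qz0 : q.[z] != 0 by rewrite -mod_gt0 qz exprn_gt0.
have sq : (size q <= (deg pq).+1)%N.
  by rewrite (leq_trans (size_polyD _ _))// geq_max !(leq_trans (size_scale_leq _ _))// ?size1_deg ?size2_deg.
have Hr r : root q r -> 1 <= L * modulus (z - r).
  move=> /rootP; rewrite qE => e; have := herm_sigma z r; rewrite e mod0 (_ : 0 ^+ 2 = 0 :> R); last by rewrite expr0n.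
  move=> /esym/eqP; rewrite mulf_eq0 => /orP[|]; first by rewrite gt_eqF ?exprn_gt0 ?mulr_gt0.
  rewrite subr_eq0 eq_sym sqrf_eq1 => /orP[] /eqP s1; last first.
    by have := ch_ge0 (pmap pq (Some r)) (pmap pq (Some z)); rewrite s1; lra.
  have := lip (Some r) (Some z); rewrite s1 => h1; apply: le_trans h1 _.
  by rewrite ler_pM2l// modBC ch_Some_le.
have Lh1 : (L * h) ^+ 4 <= 1 by lra.
have P := poly_quad L0 h0 Lh1 qz0 sq Hr.
pose sg w := ch (pmap pq (Some w)) (pmap pq (Some z)).
(* From [sqrt (1 - s^2) <= exp (- s^2 / 2)]: chordal distances to the image of [z] become additive
   gains in the exponent. *)
have up w : modulus q.[w] <= expR (upot w + upot z - sg w ^+ 2 / 2).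
  rewrite -(@ler_pXn2r _ 2)// ?nnegrE ?mod_ge0 ?expR_ge0// qE herm_sigma -/(sg w) !NE -!expRM_natr -expRD -expRM_natr.
  rewrite half_id.
  rewrite (expRD _ (- sg w ^+ 2)) ler_pM2l ?expR_gt0//; exact: expR_ge1Dx.
have := le_trans P (ler_pM _ _ (ler_pM _ _ (ler_pM _ _ (up _) (up _)) (up _)) (up _)).
rewrite !mulr_ge0 ?mod_ge0// -!expRD qz NE -!expRM_natr => /(_ isT isT isT isT isT isT) P2.
have lo : expR (- (2 * (L * h) ^+ 4)) ^+ deg pq <= (1 - (L * h) ^+ 4) ^+ deg pq.
  by apply: lerXn2r; rewrite ?nnegrE ?expR_ge0 ?subr_ge0//; apply: expR_half => //; rewrite exprn_even_ge0.
have := le_trans (ler_wpM2l (expR_ge0 _) lo) P2; rewrite -expRM_natr -expRD ler_expR -/(sg _) -/(sg _) -/(sg _) -/(sg _).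
rewrite (_ : - (2 * (L * h) ^+ 4) * (deg pq)%:R = -2 * ((deg pq)%:R * (L * h) ^+ 4)); last by ring.
move: ((deg pq)%:R * (L * h) ^+ 4) => t; move: (sg _ ^+ 2) (sg _ ^+ 2) (sg _ ^+ 2) (sg _ ^+ 2) => s1 s2 s3 s4.
by move: (upot _) (upot _) (upot _) (upot _) (upot z); clear; move=> *; lra.
Qed.
End Step.
End Energy.

Section GridEnergy.
Context {R : realType}.
Local Notation C := (Cx R).
Local Notation X := (sphere R).
Variables (f : X -> X).
Hypotheses (rf : rational_map f) (d1 : (1 < rat_degree f)%N).
Local Notation d := (rat_degree f).

Lemma rational_iter n : (0 < n)%N -> rational_map (iter n f).
Proof.
case: n => // n _; elim: n => // n IH.
by rewrite (_ : iter n.+2 f = f \o iter n.+1 f)//; exact: rational_comp.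
Qed.

(** By the cocycle rule for [Tf], its logarithm for [f^(k + 1)] is [d] times the one for [f^k] plus
    a bounded term. The induction carries a spare [- ln b], which [d >= 2] reproduces. *)
Lemma iter_pair : exists2 B : R, 0 <= B & forall k, exists pq,
  [/\ good pq, pmap pq = iter k f, deg pq = (d ^ k)%N & forall x, `|ln (Tf pq x)| <= B * d%:R ^+ k].
Proof.
have fin (t u A : R) : 2 * t <= u -> t + (A - u) <= A - t by move=> *; lra.
have [g fE] := rational_spec rf; have [b b0 Hb] := Tf_bound g.
have gi : @good R ('X, 1).
  by split; rewrite ?coprimep1// /deg /frac_size size_polyX size_poly1.
have ln_bd (pq : {poly C} * {poly C}) (c : R) : good pq -> 0 < c -> (forall a, c <= Tf pq a <= c^-1) -> forall x, `|ln (Tf pq x)| <= - ln c.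
  move=> gp c0 H x; have /andP[h1 h2] := H x; have t0 := Tf_gt0 x gp.
  rewrite ler_norml opprK -(lnV c0) !ler_ln ?posrE ?invr_gt0// h1 h2//.
have [c c0 Hc] := Tf_bound gi.
have lb : 0 <= - ln b by apply: le_trans (ln_bd _ _ g b0 Hb None).
have lc : 0 <= - ln c by apply: le_trans (ln_bd _ _ gi c0 Hc None).
exists (- ln c + - ln b); first by rewrite addr_ge0.
suff S k : exists pq, [/\ good pq, pmap pq = iter k f, deg pq = (d ^ k)%N & forall x, `|ln (Tf pq x)| <= (- ln c + - ln b) * d%:R ^+ k - - ln b].
  by move=> k; have [pq [h1 h2 h3 h4]] := S k; exists pq; split => // x; apply: le_trans (h4 x) _; rewrite gerBl.
elim: k => [|k [pq [h1 h2 h3 h4]]].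
  exists ('X, 1); split => //; last by move=> x; rewrite mulr1 addrK; exact: ln_bd.
    apply/funext => -[z|]; rewrite /pmap /frac_map /=.
      by rewrite hornerC oner_eq0 hornerX divr1.
    by rewrite /frac_size size_polyX size_poly1 coefC eqxx.
  by rewrite /deg /frac_size size_polyX size_poly1.
exists (cpair (fraction_of f) pq); split; first exact: good_cpair.
- by rewrite pmap_cpair// -fE h2.
- by rewrite deg_cpair// h3 expnS.
move=> x; rewrite Tf_cpair// lnM ?posrE ?exprn_gt0 ?Tf_gt0// lnXn ?Tf_gt0//.
apply: le_trans (ler_normD _ _) _.
have e1 := ln_bd _ _ g b0 Hb (pmap pq x); rewrite -[ln _ *+ _]mulr_natl normrM ger0_norm ?ler0n//.
apply: le_trans (lerD e1 (ler_wpM2l (ler0n _ _) (h4 x))) _.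
rewrite (_ : deg (fraction_of f) = d)// exprS mulrBr; have d2 : 2 <= d%:R :> R by rewrite (ler_nat R 2).
have : 2 * - ln b <= d%:R * - ln b by rewrite ler_wpM2r.
by rewrite [d%:R * (_ * _ ^+ _)]mulrCA; exact: fin.
Qed.

Definition grid (h x0 y0 : R) (l l' : nat) : X := Some (mkC (x0 + l%:R * h, y0 + l'%:R * h)).

(** A discrete Dirichlet energy, standing for the area of the image of the square counted with
    multiplicity, hence of order [d^k]. The mesh threshold depends on [k], the constant [K] does
    not. *)
Lemma grid_energy (M : R) : 0 < M -> exists2 K : R, 0 < K & forall k, exists2 h0 : R, 0 < h0 & forall h x0 y0 N,
  0 < h -> h <= h0 -> N%:R * h <= M -> `|x0| <= M -> `|y0| <= M ->
  \sum_(0 <= l < 2 * N) \sum_(0 <= l' < 2 * N)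
    (ch (iter k f (grid h x0 y0 l.+1 l')) (iter k f (grid h x0 y0 l l')) ^+ 2 +
     ch (iter k f (grid h x0 y0 l l'.+1)) (iter k f (grid h x0 y0 l l')) ^+ 2) <= K * d%:R ^+ k.
Proof.
have N3 n : (3 * n - n = 2 * n)%N by lia.
have aux (S l : R) : 0 <= S -> 0 < l -> l <= 1 / 2 * (S + 2 * l + 1) by move=> *; lra.
move=> M0; have [B B0 HB] := iter_pair.
pose M' := 8 * M + 3; pose U := B + ln M'.
have M'1 : 1 <= M' by rewrite /M'; lra.
have lM : 0 <= ln M' by apply: ln_ge0.
have d1R : 1 <= d%:R :> R by rewrite (ler_nat R 1); exact: ltnW.
exists (64 * U + 1); first by rewrite ltr_wpDl// mulr_ge0// addr_ge0.
move=> k; have [pq [gp pE dE hT]] := HB k.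
have [L L1 lip] : exists2 L : R, 1 <= L & forall a b, ch (pmap pq a) (pmap pq b) <= L * ch a b.
  rewrite pE; case: (k) => [|k']; first by exists 1 => // a b /=; rewrite mul1r.
  by apply: rational_lip; exact: rational_iter.
have L0 : 0 < L := lt_le_trans ltr01 L1.
have D0 : 0 < d%:R ^+ k :> R by rewrite exprn_gt0// (lt_le_trans ltr01).
(* The last condition makes the fourth order errors sum to at most 1 over the grid; this is the
   [+ 1] of the constant. *)
have [h0 h00 [h01 h02 h03]] : exists2 h0 : R, 0 < h0 & [/\ h0 <= 1, (L * h0) ^+ 4 <= 1 / 2 & 64 * (d%:R ^+ k * L ^+ 4) * h0 ^+ 2 * M ^+ 2 <= 1].
  have c0 : 0 < 64 * (d%:R ^+ k * L ^+ 4) * M ^+ 2 + 2 * L + 1.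
    by rewrite ltr_wpDl// addr_ge0// ?mulr_ge0 ?exprn_ge0// ltW.
  have b0 : 0 <= 64 * (d%:R ^+ k * L ^+ 4) * M ^+ 2 by rewrite !mulr_ge0 ?exprn_ge0// ltW.
  set c := _ + 1 in c0; exists c^-1; first by rewrite invr_gt0.
  have c1 : 1 <= c by rewrite /c lerDr addr_ge0// mulr_ge0// ltW.
  have ci : c^-1 <= 1 by rewrite invf_le1.
  have ci0 : 0 <= c^-1 by rewrite invr_ge0 ltW.
  split => //.
    have Lc : L * c^-1 <= 1 / 2 by rewrite ler_pdivrMr//; exact: aux.
    apply: (@le_trans _ _ ((1 / 2) ^+ 4)); last by rewrite !exprS expr0; lra.
    by apply: lerXn2r Lc; rewrite nnegrE ?mulr_ge0 ?divr_ge0// ltW.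
  have -> : 64 * (d%:R ^+ k * L ^+ 4) * c^-1 ^+ 2 * M ^+ 2 = (64 * (d%:R ^+ k * L ^+ 4) * M ^+ 2 * c^-1) * c^-1.
    by move: (d%:R ^+ k) c^-1 => u v; ring.
  rewrite -[leRHS]mulr1; apply: ler_pM => //; first by rewrite !mulr_ge0 ?exprn_ge0// ltW.
  by rewrite ler_pdivrMr// mul1r /c -addrA lerDl addr_ge0// mulr_ge0// ltW.
exists h0 => // h x0 y0 N hp hh Nh x0M y0M.
(* The grid is extended by [N] steps on every side, so that the square of interest is the middle
   half, where tent weights are large; the shift by 1 centres the stencil of [a l l']. *)
pose Z (l l' : nat) : C := mkC (x0 + (l%:R - 1 - N%:R) * h, y0 + (l'%:R - 1 - N%:R) * h).
pose v l l' := upot pq (Z l l').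
have uB z : modulus z <= M' - 1 -> `|upot pq z| <= U * d%:R ^+ k.
  move=> zM; have n1 : 1 <= nrm (z, 1) := nrm_vec_ge1 (Some z).
  have n0 : 0 < nrm (z, 1) := lt_le_trans ltr01 n1.
  have -> : upot pq z = ln (Tf pq (Some z)) + ln (nrm (z, 1)) * d%:R ^+ k.
    rewrite mulrC -natrX -dE mulr_natl -lnXn// -lnM ?posrE ?exprn_gt0 ?Tf_gt0//.
    by rewrite /Tf /upot divfK// expf_neq0// gt_eqF.
  apply: le_trans (ler_normD _ _) _; rewrite mulrDl; apply: lerD; first exact: hT.
  rewrite normrM (ger0_norm (ltW D0)) ler_wpM2r ?(ltW D0)// ger0_norm ?ln_ge0//.
  rewrite ler_ln ?posrE ?(lt_le_trans ltr01 M'1)//; apply: le_trans (nrmS_le z) _.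
  by rewrite -lerBrDr.
have h1 : h <= 1 by exact: le_trans h01.
have coord (a0 : R) (l : nat) : `|a0| <= M -> (l <= 4 * N)%N -> `|a0 + (l%:R - 1 - N%:R) * h| <= 4 * M + 1.
  move=> aM lN; apply: le_trans (ler_normD _ _) _.
  have lR : l%:R <= 4 * N%:R :> R by rewrite -natrM ler_nat.
  have : `|(l%:R - 1 - N%:R) * h| <= 3 * M + 1.
    rewrite normrM (gtr0_norm hp); apply: (@le_trans _ _ ((3 * N%:R + 1) * h)).
      rewrite ler_pM2r// ler_norml; have := ler0n R l; have := ler0n R N.
      by move: (N%:R : R) (l%:R : R) lR; clear; move=> *; apply/andP; split; lra.
    by rewrite mulrDl -mulrA mul1r lerD// ler_pM2l.
  by move: (`|a0|) aM => t ?; lra.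
have vB l l' : (l <= 4 * N)%N -> (l' <= 4 * N)%N -> `|v l l'| <= U * d%:R ^+ k.
  move=> hl hl'; apply: uB; apply: le_trans (mod_le_ReIm _) _; rewrite /Z /mkC /=.
  apply: le_trans (lerD (coord x0 l x0M hl) (coord y0 l' y0M hl')) _.
  by rewrite /M'; lra.
have Lh : (L * h) ^+ 4 <= 1 / 2.
  apply: le_trans h02; apply: lerXn2r; rewrite ?nnegrE ?mulr_ge0// ?(ltW L0) ?(ltW hp) ?(ltW h00)//.
  by rewrite ler_pM2l.
pose a l l' : R := ch (iter k f (Some (Z l.+2 l'.+1))) (iter k f (Some (Z l.+1 l'.+1))) ^+ 2 +
  ch (iter k f (Some (Z l.+1 l'.+2))) (iter k f (Some (Z l.+1 l'.+1))) ^+ 2.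
have a0 l l' : 0 <= a l l' by rewrite addr_ge0// sqr_ge0.
have aE l l' : (l < 4 * N)%N -> (l' < 4 * N)%N ->
  a l l' <= 2 * (v l.+2 l'.+1 + v l l'.+1 + v l.+1 l'.+2 + v l.+1 l' - 4 * v l.+1 l'.+1) + 4 * ((deg pq)%:R * (L * h) ^+ 4).
  move=> _ _; have := energy_step gp L1 lip (Z l.+1 l'.+1) (ltW hp) Lh.
  have nb l1 l1' (z : C) : complex.Re z = complex.Re (Z l1 l1') -> complex.Im z = complex.Im (Z l1 l1') -> z = Z l1 l1'.
    by case: z => ? ?; rewrite /Z /mkC /= => -> ->.
  rewrite (nb l.+2 l'.+1 (Z l.+1 l'.+1 + ofR h)); first last.
  - by rewrite /= addr0.
  - by rewrite /= -[l.+2%:R]natr1; move: (l.+1%:R : R) (N%:R : R); clear; move=> *; ring.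
  rewrite (nb l l'.+1 (Z l.+1 l'.+1 - ofR h)); first last.
  - by rewrite /= subr0.
  - by rewrite /= -[l.+1%:R]natr1; move: (l%:R : R) (N%:R : R); clear; move=> *; ring.
  rewrite (nb l.+1 l'.+2 (Z l.+1 l'.+1 + iC * ofR h)); first last.
  - by rewrite /= -[l'.+2%:R]natr1; move: (l'.+1%:R : R) (N%:R : R); clear; move=> *; ring.
  - by rewrite /=; move: (l.+1%:R : R) (N%:R : R); clear; move=> *; ring.
  rewrite (nb l.+1 l' (Z l.+1 l'.+1 - iC * ofR h)); first last.
  - by rewrite /= -[l'.+1%:R]natr1; move: (l'%:R : R) (N%:R : R); clear; move=> *; ring.
  - by rewrite /=; move: (l.+1%:R : R) (N%:R : R); clear; move=> *; ring.
  rewrite -!/(v _ _) pE; apply: le_trans; rewrite /a.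
  by rewrite -addrA -[leRHS]addrA lerD2l addrCA lerDl addr_ge0// sqr_ge0.
have := tent_bound vB a0 aE.
have -> : \sum_(N <= l < 3 * N) \sum_(N <= l' < 3 * N) a l l' =
  \sum_(0 <= l < 2 * N) \sum_(0 <= l' < 2 * N)
    (ch (iter k f (grid h x0 y0 l.+1 l')) (iter k f (grid h x0 y0 l l')) ^+ 2 +
     ch (iter k f (grid h x0 y0 l l'.+1)) (iter k f (grid h x0 y0 l l')) ^+ 2).
  have gE l l' : Some (Z (l + N).+1 (l' + N).+1) = grid h x0 y0 l l' :> X.
    by rewrite /Z /grid -![(_ + N).+1%:R]natr1 !natrD !addrK.
  rewrite -{1}[N]add0n big_addn (N3 N); apply: eq_bigr => l _.
  rewrite -{1}[N]add0n big_addn (N3 N); apply: eq_bigr => l' _.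
  by rewrite -!gE !addSn.
move=> H; apply: le_trans H _; rewrite [leRHS]mulrDl -[64 * U * _]mulrA mul1r lerD2l dE natrX.
have -> : 16 * (4 * (d%:R ^+ k * (L * h) ^+ 4) * N%:R ^+ 2) = 64 * (d%:R ^+ k * L ^+ 4) * h ^+ 2 * (N%:R * h) ^+ 2.
  by move: (d%:R ^+ k) (N%:R : R) => u w; ring.
apply: (@le_trans _ _ 1); last by rewrite exprn_ege1.
apply: le_trans h03; apply: ler_pM; first by rewrite !mulr_ge0 ?(ltW D0) ?exprn_ge0 ?(ltW L0) ?(ltW hp).
- by rewrite sqr_ge0.
- apply: ler_wpM2l; first by rewrite !mulr_ge0 ?(ltW D0) ?exprn_ge0 ?(ltW L0).
  by apply: lerXn2r; rewrite ?nnegrE ?(ltW hp) ?(ltW h00).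
by apply: lerXn2r; rewrite ?nnegrE ?mulr_ge0 ?(ltW hp) ?(ltW M0).
Qed.
End GridEnergy.

(** * Shadowing *)

Section Shadow.
Context {R : realType}.
Local Notation C := (Cx R).
Local Notation X := (sphere R).
Implicit Types (x y q : X).

(** If [y] is within [m^2 r^d] of [f a], the product of the [d] distances from [a] to the fibre over
    [y] is below [r^d], so one of them is below [r]. *)
Lemma rational_open_map f : rational_map f -> forall U : set X, open U -> open (f @` U).
Proof.
move=> rf U oU; have [T [c [m H]]] := rational_factorizes rf; have [m0 _ _ _] := H.
apply/open_chP => _ [a Ua <-]; have [r r0 Hr] := (open_chP U).1 oU a Ua.
have s0 : 0 < m ^+ 2 * r ^+ rat_degree f by rewrite mulr_gt0 ?exprn_gt0.
exists (m ^+ 2 * r ^+ rat_degree f) => // y fy; apply: contrapT => Hn.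
have far x : x \in fib f y -> r <= ch a x.
  move=> xy; rewrite leNgt; apply/negP => ax; apply: Hn; exists x; first exact: Hr.
  by apply/eqP; rewrite -fibP.
have /andP[h _] := factorizes_bounds H a y.
have := le_lt_trans h fy; rewrite ltNge ler_pM2l ?exprn_gt0// -(size_fib y rf).
by rewrite prod_ch_ge// ltW.
Qed.

Lemma iter_open_map f n : rational_map f -> forall U : set X, open U -> open (iter n f @` U).
Proof.
move=> rf; elim: n => [|n IH] U oU; first by rewrite /= image_id.
rewrite (_ : iter n.+1 f @` U = f @` (iter n f @` U)); first exact: rational_open_map rf _ (IH _ oU).
by apply/seteqP; split => [_ [x Ux <-]|_ [_ [x Ux <-] <-]]; [exists (iter n f x) => //; exists x|exists x].
Qed.

(* [CD.2] plays the role of the closure of [CD.1], whose boundary lies in [Gam]. *)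
Definition cell (e : R) (Gam : set X) y (CD : set X * set X) : Prop :=
  [/\ open CD.1, closed CD.2, CD.1 y, CD.1 `<=` CD.2 &
      (forall a b, CD.2 a -> CD.2 b -> ch a b <= e) /\ (forall z, CD.2 z -> CD.1 z \/ Gam z)].

(* The drift of the shadowing point: a geometric series whose sum stays below 11 e. *)
Definition drift (e : R) (m : nat) : R := e * (11 - 12 * (5 / 6) ^+ m).

(** Because [12 - 2 = 12 * 5 / 6], a displacement [2 e (5 / 6)^m] raises [drift e m] exactly to
    [drift e (m + 1)]; and [drift e 1 = e] is the bound on the diameter of a cell. *)
Lemma drift_step (e : R) n i j : 0 < e -> (i < j)%N -> (j < n)%N ->
  drift e (n - j) + 2 * (e * (5 / 6) ^+ (n - j)) <= drift e (n - i).
Proof.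
move=> e0 ij jn; rewrite (_ : (n - i = (n - j).+1 + (j - i.+1))%N); last by lia.
rewrite /drift exprD exprS; set t := (5 / 6) ^+ (n - j); have t0 : 0 <= t by rewrite exprn_ge0.
set s := (5 / 6) ^+ (j - i.+1); have s0 : 0 <= s by rewrite exprn_ge0.
have s1 : s <= 1 by rewrite exprn_ile1//; lra.
have h : t * s <= t by rewrite -[leRHS]mulr1 ler_wpM2l.
have -> : e * (11 - 12 * t) + 2 * (e * t) = e * (11 - 10 * t) by ring.
by rewrite ler_pM2l// -[5 / 6 * t * s]mulrA; lra.
Qed.

Lemma drift_ge (e : R) m : 0 < e -> e <= drift e m.+1.
Proof.
move=> e0; rewrite /drift -[leLHS]mulr1 ler_pM2l//.
have : (5 / 6 : R) ^+ m <= 1 by rewrite exprn_ile1//; lra.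
by rewrite exprS; lra.
Qed.

Lemma drift_le (e : R) m : 0 < e -> drift e m + e * (5 / 6) ^+ m <= 11 * e.
Proof.
have t0 : 0 <= (5 / 6 : R) ^+ m by rewrite exprn_ge0.
by move=> e0; have := mulr_ge0 (ltW e0) t0; rewrite /drift; move: (_ ^+ m) => t; lra.
Qed.

Section Shadowing.
Variables (f : X -> X) (e : R) (Gam : nat -> set X) (E : nat -> seq X).
Hypotheses (rf : rational_map f) (e0 : 0 < e) (e1 : e < 1).
Hypothesis cells : forall m y, ~ Gam m.+1 y -> exists CD, cell e (Gam m.+1) y CD.
Hypothesis arcs : forall m y, Gam m.+1 y -> exists A a, [/\ connected A, A y, A a, a \in E m.+1 &
  forall b k, A b -> (k < m.+1)%N -> ch (iter k f b) (iter k f a) <= e * (5 / 6) ^+ m.+1].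

Lemma iter_rational_continuous n : continuous (iter n f).
Proof. exact/iter_continuous/(rational_continuous rf). Qed.

Section Orbit.
Variables (x : X) (n : nat) (CD : nat -> set X * set X).

Local Notation sh j := (drift e (n - j)).

(* Slide the boundary point along an arc of [Gam (n - j)]: the points of the arc reached by orbits staying in the closed cells
   form a closed subset, which is also open, hence contains the net point, unless an orbit meets a boundary at an earlier time. *)
Lemma shadow_event j q : (j < n)%N ->
  (forall i, (i < j)%N -> cell e (Gam (n - i)) (iter i f x) (CD i)) ->
  Gam (n - j) (iter j f q) -> (forall i, (i < j)%N -> (CD i).2 (iter i f q)) ->
  (forall i, (j <= i)%N -> (i < n)%N -> ch (iter i f q) (iter i f x) <= sh j) ->
  exists p l, [/\ (l < n)%N, iter l f p \in E (n - l) & forall i, (i < n)%N -> ch (iter i f p) (iter i f x) <= 11 * e].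
Proof.
(* The induction is on the time of the boundary hit: each change of shadowing point makes the hit
   strictly earlier. *)
elim/ltn_ind: j q => j IH q jn cE Gq Dq Sq.
have nj : (n - j = (n - j.+1).+1)%N by lia.
have sh_ge k : (k < n)%N -> e <= sh k by move=> kn; rewrite (_ : (n - k = (n - k.+1).+1)%N); [exact: drift_ge|lia].
have [A [a [cA Aq Aa aE Ha]]] : exists A a, [/\ connected A, A (iter j f q), A a, a \in E (n - j) &
  forall b k, A b -> (k < n - j)%N -> ch (iter k f b) (iter k f a) <= e * (5 / 6) ^+ (n - j)].
  by rewrite nj in Gq *; exact: arcs.
have shift i (p p' : X) : (j <= i)%N -> ch (iter i f p) (iter i f p') = ch (iter (i - j) f (iter j f p)) (iter (i - j) f (iter j f p')).
  by move=> ji; rewrite -!iterD subnK.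
have nearx p i : (forall k, (k < j)%N -> (CD k).2 (iter k f p)) -> (i < j)%N -> ch (iter i f p) (iter i f x) <= e.
  move=> Dp ij; have [_ _ Cx sub [dm _]] := cE _ ij; apply: dm; first exact: Dp.
  exact: sub.
have [[p [Dp Ap [i [ij Gp]]]]|none] := pselect (exists p, [/\ (forall i, (i < j)%N -> (CD i).2 (iter i f p)), A (iter j f p) &
    exists i, (i < j)%N /\ Gam (n - i) (iter i f p)]).
  apply: (IH i ij p) => //; first by exact: ltn_trans jn.
  - by move=> k ki; apply: cE; exact: ltn_trans ij.
  - by move=> k ki; apply: Dp; exact: ltn_trans ij.
  move=> k ik kn; have [kj|jk] := ltnP k j.
    by apply: le_trans (nearx _ _ Dp kj) _; apply: sh_ge; exact: ltn_trans jn.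
  apply: le_trans (drift_step e0 ij jn); apply: le_trans (ch_tri (iter k f q) _ _) _.
  rewrite addrC; apply: lerD; first exact: Sq.
  rewrite shift//; apply: le_trans (ch_tri (iter (k - j) f a) _ _) _.
  rewrite (_ : 2 * (e * _) = e * (5 / 6) ^+ (n - j) + e * (5 / 6) ^+ (n - j)); last by rewrite mulr_natl.
  by apply: lerD; [|rewrite chC]; apply: Ha => //; rewrite ltn_sub2r.
(* With earlier hits excluded, points of [A] reached through closed cells are reached through open
   ones, so they form a relatively clopen part of the connected arc: closed as the image of a
   compact set, open because iterates are open maps. *)
pose Q : set X := [set p | forall i, (i < j)%N -> (CD i).2 (iter i f p)].
pose Qo : set X := [set p | forall i, (i < j)%N -> (CD i).1 (iter i f p)].
have clQ : closed Q.
  rewrite (_ : Q = \bigcap_(i in [set i | (i < j)%N]) (iter i f @^-1` (CD i).2)).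
    apply: closed_bigI => i /cE[_ c _ _ _]; apply: closed_comp => // y _; exact: iter_rational_continuous.
  by apply/seteqP; split.
have opQ : open Qo.
  suff H k : (k <= j)%N -> open [set p | forall i, (i < k)%N -> (CD i).1 (iter i f p)] by exact: H.
  elim: k => [_|k IHk kj].
    by rewrite (_ : [set p | _] = setT); [exact: openT|apply/seteqP; split].
  rewrite (_ : [set p | _] = [set p | forall i, (i < k)%N -> (CD i).1 (iter i f p)] `&` (iter k f @^-1` (CD k).1)).
    apply: openI; first by apply: IHk; exact: ltnW.
    by apply: open_comp; [move=> y _; exact: iter_rational_continuous|have [] := cE _ kj].
  apply/seteqP; split => [p Hp|p [Hp Hk] i]; first by split => [i ik|]; apply: Hp => //; exact: ltnW.
  by rewrite ltnS leq_eqVlt => /orP[/eqP ->//|]; exact: Hp.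
have closedfQ : closed (iter j f @` Q).
  apply: compact_closed; first exact: sphere_hausdorff.
  by apply: continuous_compact; [apply: continuous_subspaceT; exact: iter_rational_continuous|exact: closed_sphere_compact].
have openfQ : open (iter j f @` Qo) by exact: iter_open_map.
have eqA : A `&` (iter j f @` Q) = A.
  apply: cA; first by exists (iter j f q); split => //; exists q.
    exists (iter j f @` Qo) => //; apply/seteqP; split => z [Az [p Hp pz]]; split => //; exists p => // i ij.
      have [_ _ _ _ [_ /(_ _ (Hp i ij))]] := cE _ ij; case=> // G; exfalso; apply: none; exists p.
      by split => //; [rewrite pz|exists i].
    by have [_ _ _ sub _] := cE _ ij; apply: sub; exact: Hp.
  by exists (iter j f @` Q).
have [_ [p Hp pa]] : (A `&` (iter j f @` Q)) a by rewrite eqA.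
exists p, j; split => //; first by rewrite pa.
move=> i i_n; have [ij|ji] := ltnP i j.
  by apply: le_trans (nearx _ _ Hp ij) _; move: e0; lra.
apply: le_trans (drift_le _ e0); apply: le_trans (ch_tri (iter i f q) _ _) _.
rewrite addrC; apply: lerD; first exact: Sq.
by rewrite shift// pa chC; apply: Ha => //; rewrite ltn_sub2r.
Qed.

End Orbit.

(** Either the orbit of [x] meets a boundary, or some orbit inside the closed cells does, and
    [shadow_event] applies at that time. Otherwise the points following the open cells form a clopen
    set, hence the whole sphere, whose diameter 1 exceeds that of a cell. *)
Lemma shadowing x n : (0 < n)%N -> exists p l, [/\ (l < n)%N, iter l f p \in E (n - l) &
  forall i, (i < n)%N -> ch (iter i f p) (iter i f x) <= 11 * e].
Proof.
move=> n0.
have sh_ge k : (k < n)%N -> e <= drift e (n - k) by move=> kn; rewrite (_ : (n - k = (n - k.+1).+1)%N); [exact: drift_ge|lia].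
have /choice[CD HCD] i : exists CD, (i < n)%N -> ~ Gam (n - i) (iter i f x) -> cell e (Gam (n - i)) (iter i f x) CD.
  have [i_n|] := ltnP i n; last by exists (set0, set0).
  have [G|/[dup] nG] := pselect (Gam (n - i) (iter i f x)); first by exists (set0, set0).
  by rewrite (_ : (n - i = (n - i.+1).+1)%N)//; [move=> /cells[CD H]; exists CD|lia].
have [[i0 [i0n G0]]|none] := pselect (exists i, (i < n)%N /\ Gam (n - i) (iter i f x)).
  have exi : exists i, `[< (i < n)%N /\ Gam (n - i) (iter i f x) >] by exists i0; apply/asboolP.
  have [i /asboolP[i_n Gi] imin] := ex_minnP exi.
  have nG k : (k < i)%N -> ~ Gam (n - k) (iter k f x).
    move=> ki G; have : (i <= k)%N by apply: imin; apply/asboolP; split => //; exact: ltn_trans i_n.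
    by rewrite leqNgt ki.
  have cE k : (k < i)%N -> cell e (Gam (n - k)) (iter k f x) (CD k).
    by move=> ki; apply: HCD; [exact: ltn_trans i_n|exact: nG].
  apply: (shadow_event i_n cE Gi); first by move=> k /cE[_ _ h sub _]; exact: sub.
  by move=> k _ _; rewrite chxx; apply: le_trans (sh_ge _ i_n); exact: ltW.
have cE k : (k < n)%N -> cell e (Gam (n - k)) (iter k f x) (CD k).
  by move=> kn; apply: HCD => // G; apply: none; exists k.
have [[p [Dp [i [i_n Gp]]]]|noe] := pselect (exists p, (forall k, (k < n)%N -> (CD k).2 (iter k f p)) /\ exists i, (i < n)%N /\ Gam (n - i) (iter i f p)).
  apply: (shadow_event i_n _ Gp) => [k ki|k ki|k ik kn].
  - by apply: cE; exact: ltn_trans i_n.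
  - by apply: Dp; exact: ltn_trans i_n.
  apply: le_trans (sh_ge _ i_n); have [_ _ Cx sub [dm _]] := cE _ kn; apply: dm; first exact: Dp.
  exact: sub.
have op k : (k <= n)%N -> open [set p | forall i, (i < k)%N -> (CD i).1 (iter i f p)].
  elim: k => [_|k IHk kj].
    by rewrite (_ : [set p | _] = setT); [exact: openT|apply/seteqP; split].
  rewrite (_ : [set p | _] = [set p | forall i, (i < k)%N -> (CD i).1 (iter i f p)] `&` (iter k f @^-1` (CD k).1)).
    apply: openI; first by apply: IHk; exact: ltnW.
    by apply: open_comp; [move=> y _; exact: iter_rational_continuous|have [] := cE _ kj].
  apply/seteqP; split => [p Hp|p [Hp Hk] i]; first by split => [i ik|]; apply: Hp => //; exact: ltnW.
  by rewrite ltnS leq_eqVlt => /orP[/eqP ->//|]; exact: Hp.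
have cl : closed [set p | forall i, (i < n)%N -> (CD i).1 (iter i f p)].
  rewrite (_ : [set p | _] = \bigcap_(i in [set i | (i < n)%N]) (iter i f @^-1` (CD i).2)).
    apply: closed_bigI => i /cE[_ c _ _ _]; apply: closed_comp => // y _; exact: iter_rational_continuous.
  apply/seteqP; split => [p Hp i i_n|p Hp i i_n]; first by have [_ _ _ sub _] := cE _ i_n; apply: sub; exact: Hp.
  have [_ _ _ _ [_ /(_ _ (Hp i i_n))]] := cE _ i_n; case=> // G; exfalso; apply: noe; exists p.
  by split => //; exists i.
have W := sphere_clopen (op n (leqnn n)) cl.
have : [set p | forall i, (i < n)%N -> (CD i).1 (iter i f p)] = setT.
  by apply: W; exists x => i /cE[].
move=> /seteqP[_ T]; have [_ _ _ sub [dm _]] := cE _ n0.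
have := dm None (Some 0) (sub _ (T None I 0%N n0)) (sub _ (T (Some 0) I 0%N n0)).
have : 1 <= ch None (Some (0 : C)).
  rewrite ch_None; have h : nrm ((0 : C), 1) <= 1 by apply: le_trans (nrmS_le _) _; rewrite mod0 add0r.
  by rewrite invf_ge1// (lt_le_trans ltr01)// (nrm_vec_ge1 (Some 0)).
by move=> h1 h2; have := le_lt_trans (le_trans h1 h2) e1; rewrite ltxx.
Qed.
End Shadowing.
End Shadow.

(** * Nets on grid lines *)

Section Selection.
Context {R : realType}.

(* AM-GM with weight n / s^k turns the square sums into length sums: a <= (n a^2 / s^k + s^k / n) / 2. *)
Lemma row_select (a : nat -> nat -> nat -> R) (s K P : R) (m n N : nat) : 1 <= s -> 0 <= K -> (0 < n)%N -> N%:R <= P * n%:R ->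
  (forall k, (k < m)%N -> \sum_(r < n) \sum_(c < N) a k r c ^+ 2 <= K * (s ^+ 2) ^+ k) ->
  exists2 r, (r < n)%N & \sum_(k < m) \sum_(c < N) a k r c <= m%:R * (m%:R * K + P) * s ^+ m.
Proof.
move=> s1 K0 n0 NP H; have s0 : 0 < s := lt_le_trans ltr01 s1.
have nR : 0 < n%:R :> R by rewrite ltr0n.
have sk k : 0 < s ^+ k by rewrite exprn_gt0.
pose b r := \sum_(k < m) (s ^+ 2) ^- k * \sum_(c < N) a k r c ^+ 2.
have w0 k : 0 <= (s ^+ 2) ^- k by rewrite invr_ge0 !exprn_ge0// ltW.
have S0 k r : 0 <= \sum_(c < N) a k r c ^+ 2 by apply: sumr_ge0 => c _; exact: sqr_ge0.
have b0 r : 0 <= b r by apply: sumr_ge0 => k _; rewrite mulr_ge0.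
(* Some row has at most the average weighted energy; the weights [(s^2)^(- k)] let one row serve all
   times [k < m] at once. *)
have [r rn br] : exists2 r, (r < n)%N & n%:R * b r <= m%:R * K.
  apply: contrapT => Hn; have lt r : (r < n)%N -> m%:R * K < n%:R * b r.
    by move=> rn; rewrite ltNge; apply/negP => h; apply: Hn; exists r.
  have h1 : \sum_(r < n) (m%:R * K) < \sum_(r < n) n%:R * b r.
    by apply: ltr_sum => [|r _]; [apply/hasP; exists (Ordinal n0); rewrite ?mem_index_enum|exact: lt].
  have h2 : \sum_(r < n) b r <= m%:R * K.
    rewrite exchange_big /= mulr_natl -[X in _ *+ X]card_ord -sumr_const; apply: ler_sum => k _.
    rewrite -mulr_sumr ler_pdivrMl ?exprn_gt0// mulrC; exact: H.
  move: h1; rewrite sumr_const card_ord -mulr_sumr -[ltLHS]mulr_natl ltNge ler_pM2l//.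
  by rewrite h2.
exists r => //; rewrite -mulrA mulr_natl -[X in _ *+ X]card_ord -sumr_const; apply: ler_sum => k _.
have bk : n%:R * \sum_(c < N) a k r c ^+ 2 <= m%:R * K * (s ^+ k * s ^+ k).
  apply: (@le_trans _ _ (n%:R * (b r * (s ^+ 2) ^+ k))).
    rewrite ler_pM2l// -ler_pdivrMr ?exprn_gt0// mulrC /b (bigD1 k)//= lerDl sumr_ge0// => k' _.
    by rewrite mulr_ge0.
  by rewrite mulrA -exprM mulnC exprM expr2 ler_wpM2r// mulr_ge0// ltW.
have am (x : R) : x <= 2^-1 * (s ^- k * (n%:R * x ^+ 2) + s ^+ k / n%:R).
  have ns : 0 < s ^+ k / n%:R by rewrite divr_gt0.
  have -> : s ^- k * (n%:R * x ^+ 2) = x ^+ 2 / (s ^+ k / n%:R) by rewrite invf_div; ring.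
  move: (s ^+ k / n%:R) ns => u u0; rewrite ler_pdivlMl// -lerBlDr ler_pdivlMr//.
  by have := sqr_ge0 (x - u); rewrite !expr2; lra.
apply: (@le_trans _ _ (2^-1 * (s ^- k * (m%:R * K * (s ^+ k * s ^+ k)) + P * n%:R * (s ^+ k / n%:R)))).
  apply: (@le_trans _ _ (\sum_(c < N) 2^-1 * (s ^- k * (n%:R * a k r c ^+ 2) + s ^+ k / n%:R))).
    by apply: ler_sum => c _; exact: am.
  rewrite -mulr_sumr ler_pM2l ?invr_gt0// big_split /=; apply: lerD.
    by rewrite -mulr_sumr -mulr_sumr ler_pM2l ?invr_gt0.
  by rewrite sumr_const card_ord -[_ *+ N]mulr_natl ler_pM2r// divr_gt0.
have -> : s ^- k * (m%:R * K * (s ^+ k * s ^+ k)) + P * n%:R * (s ^+ k / n%:R) = (m%:R * K + P) * s ^+ k.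
  have := lt0r_neq0 (sk k); have := lt0r_neq0 nR.
  by move: (s ^+ k) (n%:R : R) (m%:R : R) => u v w v0 u0; field; rewrite u0 v0.
have P0 : 0 <= P by rewrite -(pmulr_lge0 _ nR); apply: le_trans NP; rewrite ler0n.
have c0 : 0 <= m%:R * K + P by rewrite addr_ge0// mulr_ge0.
have : (m%:R * K + P) * s ^+ k <= (m%:R * K + P) * s ^+ m.
  by rewrite ler_wpM2l// ler_weXn2l// ltnW.
have : 0 <= (m%:R * K + P) * s ^+ k by rewrite mulr_ge0// ltW.
by move: (_ * s ^+ k) (_ * s ^+ m) => *; lra.
Qed.

Lemma cell_index (h t : R) (a c : nat) : (a <= c)%N -> a%:R * h <= t -> t <= c.+1%:R * h ->
  exists c', [/\ (a <= c')%N, (c' <= c)%N, c'%:R * h <= t & t <= c'.+1%:R * h].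
Proof.
elim: c => [|c IH] ac at_ tc; first by exists 0%N; split => //; move: ac at_; rewrite leqn0 => /eqP ->.
have [ct|ct] := leP (c.+1%:R * h) t; first by exists c.+1.
move: ac; rewrite leq_eqVlt => /orP[/eqP e|ac]; first by move: ct; rewrite -e ltNge at_.
by have [|c' [h1 h2 h3 h4]] := IH _ at_ (ltW ct) => //; exists c'; split => //; exact: leq_trans (leqnSn c).
Qed.
End Selection.

Section Nets.
Context {R : realType}.
Local Notation C := (Cx R).
Local Notation X := (sphere R).
Implicit Types (f : X -> X).

Definition small_arc f (m : nat) (e : R) x p : Prop :=
  exists A : set X, [/\ connected A, A x, A p & forall b k, A b -> (k < m)%N -> ch (iter k f b) (iter k f p) <= e].

(** [T c] is the length, summed over all times [k < m], of the images of the first [c] steps. The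
    net takes the first grid point in each class [j e <= T < (j + 1) e]: within a class every image
    moves by at most [e], and the fine mesh accounts for the other [e]. *)
Lemma path_net f (g : R -> X) (m N : nat) (h e Lm T0 : R) : 0 < h -> 0 < e -> (0 < N)%N ->
  (forall t t', ch (g t) (g t') <= `|t - t'|) ->
  (forall k a b, (k < m)%N -> ch (iter k f a) (iter k f b) <= Lm * ch a b) -> 0 <= Lm -> Lm * h <= e ->
  \sum_(k < m) \sum_(c < N) ch (iter k f (g (c.+1%:R * h))) (iter k f (g (c%:R * h))) <= T0 ->
  exists E : seq X, [/\ (size E)%:R <= T0 / e + 1,
    (forall p, p \in E -> exists2 t, 0 <= t <= N%:R * h & p = g t) &
    forall t, 0 <= t -> t <= N%:R * h -> exists2 p, p \in E & small_arc f m (2 * e) (g t) p].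
Proof.
move=> h0 e0 N0 lg lf L0 Lh.
have cap (p A B D : R) : D <= A -> A < p + e -> p <= B -> D - B <= e by move=> *; lra.
have add3 (x y A B D : R) : y <= A - D -> x <= B -> x + y <= A + B - D by move=> *; lra.
pose st k c := ch (iter k f (g (c.+1%:R * h))) (iter k f (g (c%:R * h))).
pose T c := \sum_(i < c) \sum_(k < m) st k i.
have st0 k c : 0 <= st k c by exact: ch_ge0.
have TS c : T c.+1 = T c + \sum_(k < m) st k c by rewrite /T big_ord_recr.
have Tmono a b : (a <= b)%N -> T a <= T b.
  by move=> /subnK <-; elim: (b - a)%N => // i IH; apply: le_trans IH _; rewrite addSn TS lerDl sumr_ge0.
have T_ge0 c : 0 <= T c by apply: sumr_ge0 => i _; exact: sumr_ge0.
rewrite exchange_big /= -/(T N) => TN.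
have dist k a b : (k < m)%N -> (a <= b)%N -> ch (iter k f (g (b%:R * h))) (iter k f (g (a%:R * h))) <= T b - T a.
  move=> km /subnK <-; elim: (b - a)%N => [|i IH]; first by rewrite add0n chxx subrr.
  rewrite addSn TS; apply: le_trans (ch_tri (iter k f (g ((i + a)%:R * h))) _ _) _.
  apply: add3 IH _; rewrite -/(st k (i + a)%N).
  by rewrite (bigD1 (Ordinal km))//= lerDl sumr_ge0.
pose cl c := Num.truncn (T c / e).
have clP c : (cl c)%:R * e <= T c < (cl c).+1%:R * e.
  by rewrite -ler_pdivlMr// -ltr_pdivrMr//; apply: Num.Theory.truncn_itv; rewrite divr_ge0// ltW.
pose fst j := find (fun c => cl c == j) (iota 0 N).
have T00 : 0 <= T0 by apply: le_trans TN.
exists [seq g ((fst j)%:R * h) | j <- iota 0 (Num.truncn (T0 / e)).+1]; split.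
- rewrite size_map size_iota -natr1 lerD2r.
  by have /andP[] := Num.Theory.truncn_itv (divr_ge0 T00 (ltW e0)).
- move=> p /mapP[j _ ->]; exists ((fst j)%:R * h) => //; rewrite mulr_ge0 ?(ltW h0)//= ler_pM2r// ler_nat.
  by rewrite -[leqRHS](size_iota 0 N); exact: find_size.
move=> t t0 tN; have [||c [_ cN ct tc]] := @cell_index _ h t 0 N.-1 (leq0n _); first by rewrite mul0r.
  by rewrite prednK.
have c_N : (c < N)%N by rewrite -(prednK N0).
have hasc : has (fun c' => cl c' == cl c) (iota 0 N) by apply/hasP; exists c; rewrite // mem_iota.
have fc : (fst (cl c) <= c)%N.
  rewrite leqNgt; apply/negP => /(before_find 0%N); rewrite nth_iota// add0n eqxx//.
have fE : cl (fst (cl c)) = cl c.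
  have := nth_find 0%N hasc; rewrite nth_iota -?has_find ?add0n; last by rewrite has_find size_iota in hasc.
  by move/eqP.
set c0 := fst (cl c) in fc fE *.
exists (g (c0%:R * h)).
  apply/mapP; exists (cl c) => //; rewrite mem_iota add0n /= ltnS.
  apply: Num.Theory.le_truncn; rewrite ler_pM2r ?invr_gt0//; apply: le_trans TN; apply: Tmono; exact: ltnW.
have ct0 : c0%:R * h <= t by apply: le_trans ct; rewrite ler_pM2r// ler_nat.
exists (g @` `[c0%:R * h, t]%classic); split.
- apply: connected_continuous_connected; first exact: segment_connected.
  apply: continuous_subspaceT => u A /nbhs_chP[r r0 rA]; apply/nbhs_ballP; exists r => // v uv.
  by apply: rA; apply: le_lt_trans (lg _ _) _.
- by exists t => //=; rewrite in_itv /= ct0 lexx.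
- by exists (c0%:R * h) => //=; rewrite in_itv /= ct0 lexx.
move=> _ k [u /= + <-] km; rewrite in_itv /= => /andP[u1 u2].
have [c' [h1 h2 h3 h4]] := cell_index fc u1 (le_trans u2 tc).
apply: le_trans (ch_tri (iter k f (g (c'%:R * h))) _ _) _.
have a1 : ch (iter k f (g u)) (iter k f (g (c'%:R * h))) <= e.
  apply: le_trans (lf k _ _ km) _; apply: le_trans Lh; rewrite ler_wpM2l//.
  apply: le_trans (lg _ _) _; rewrite ger0_norm ?subr_ge0// lerBlDl.
  by move: h4; rewrite -natr1 mulrDl mul1r.
have a2 : ch (iter k f (g (c'%:R * h))) (iter k f (g (c0%:R * h))) <= e.
  apply: le_trans (dist k _ _ km h1) _; have /andP[b1 b2] := clP c; have /andP[b3 _] := clP c0.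
  have b4 := Tmono _ _ h2; rewrite fE in b3; rewrite -natr1 mulrDl mul1r in b2.
  exact: cap b4 b2 b3.
by move: a1 a2; move: (ch _ _) (ch _ _) => *; lra.
Qed.

Definition gpt (o : bool) (t u : R) : X := if o then Some (mkC (t, u)) else Some (mkC (u, t)).

Lemma gpt_lip o u t t' : ch (gpt o t u) (gpt o t' u) <= `|t - t'|.
Proof.
case: o; apply: le_trans (ch_Some_le _ _) _; rewrite mkC_sub; apply: le_trans (mod_le_ReIm _) _; rewrite /= subrr normr0.
  by rewrite addr0.
by rewrite add0r.
Qed.

(** Averaging the energy over the rows of a strip produces a line whose images under [f^k],
    [k <= m], have total length of order [sqrt d^(m + 1)] up to a polynomial factor. Cutting it at
    size [(5 / 6)^(m + 1)] multiplies the count by [(6 / 5)^(m + 1)]. *)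
Lemma line_net f (M b w e : R) o : rational_map f -> (1 < rat_degree f)%N -> 0 < M -> 0 < w -> `|b| <= M -> 0 < e ->
  exists2 K : R, 0 <= K & forall m : nat, exists u (E : seq X),
  [/\ b <= u <= b + w, (size E)%:R <= K * m.+1%:R ^+ 2 * (6 / 5 * Num.sqrt (rat_degree f)%:R) ^+ m.+1,
   (forall p, p \in E -> exists2 t, `|t| <= M & p = gpt o t u) &
   forall t, `|t| <= M -> exists2 p, p \in E & small_arc f m.+1 (e * (5 / 6) ^+ m.+1) (gpt o t u) p].
Proof.
move=> rf d1 M0 w0' bM e0; set d := rat_degree f.
have sb (A B P m Q : R) : 0 <= A -> 0 <= B -> 0 <= P -> 1 <= m -> 1 <= Q -> A * (m * (m * B + P)) * Q + 1 <= (A * (B + P) + 1) * m ^+ 2 * Q.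
  move=> A0 B0 P0 m1 Q1; rewrite -subr_ge0 (_ : _ - _ = A * m * P * (m - 1) * Q + (m ^+ 2 * Q - 1)); last by ring.
  have m0 : 0 <= m by apply: le_trans m1.
  rewrite addr_ge0 ?mulr_ge0 ?subr_ge0//; first by apply: le_trans Q1.
  by rewrite mulr_ege1 ?exprn_ege1.
have shift1 (t : R) : 0 <= t -> t <= 2 * M -> `|- M + t| <= M by move=> *; rewrite ler_norml; apply/andP; split; lra.
have q65 (x : R) : 1 <= x -> 1 <= 6 / 5 * x by move=> *; lra.
have scl (t s : R) i : 0 < t -> t = 5 / 6 -> s ^+ i / (e * t ^+ i / 2) = 2 / e * (6 / 5 * s) ^+ i.
  move=> t0 tE; rewrite (_ : 6 / 5 = t^-1); last by rewrite tE invf_div.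
  rewrite exprMn exprVn; move: (t ^+ i) (exprn_gt0 i t0) (s ^+ i) => u u0 v; field.
  by rewrite !gt_eqF.
(* The mesh will be [M / (p n)], so that [n] rows fill a strip of width [M / p <= w] while [2 p n]
   columns cover the line. Since [p] is fixed before [m], the constant does not depend on [m]. *)
have [p [p0 pw]] : exists p, (0 < p)%N /\ M / p%:R <= w.
  have [k hk] := ltr_add_invr (divr_gt0 w0' M0); exists k.+1; split => //.
  by rewrite add0r ltr_pdivlMr// in hk; rewrite mulrC ltW.
have pR : 0 < p%:R :> R by rewrite ltr0n.
have [K K0 HK] := grid_energy rf d1 M0.
have [L L1 lip] := rational_lip rf; have L0 : 0 < L := lt_le_trans ltr01 L1.
pose s := Num.sqrt (d%:R : R).
have s2 : s ^+ 2 = d%:R by rewrite sqr_sqrtr.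
have s1 : 1 <= s by rewrite -[leLHS]sqrtr1 ler_wsqrtr// (ler_nat R 1) ltnW.
exists (2 / e * (K + 2 * p%:R) + 1); first by rewrite addr_ge0// mulr_ge0 ?divr_ge0 ?(ltW e0)// addr_ge0 ?(ltW K0)// mulr_ge0.
have small i : exists2 h0 : R, 0 < h0 & forall k, (k < i)%N -> forall h x0 y0 N,
  0 < h -> h <= h0 -> N%:R * h <= M -> `|x0| <= M -> `|y0| <= M ->
  \sum_(0 <= l < 2 * N) \sum_(0 <= l' < 2 * N)
    (ch (iter k f (grid h x0 y0 l.+1 l')) (iter k f (grid h x0 y0 l l')) ^+ 2 +
     ch (iter k f (grid h x0 y0 l l'.+1)) (iter k f (grid h x0 y0 l l')) ^+ 2) <= K * d%:R ^+ k.
  elim: i => [|i [h0 h00 IH]]; first by exists 1.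
  have [h1 h10 H1] := HK i; exists (Num.min h0 h1); first by rewrite lt_min h00.
  move=> k; rewrite ltnS leq_eqVlt => /orP[/eqP ->|ki] h x0 y0 N hp; rewrite le_min => /andP[a1 a2].
    exact: H1.
  exact: IH.
move=> m; set m1 := m.+1.
pose dl := e * (5 / 6) ^+ m1 / 2.
have dl0 : 0 < dl by rewrite divr_gt0// mulr_gt0// exprn_gt0.
have lipk k a c : (k < m1)%N -> ch (iter k f a) (iter k f c) <= L ^+ m1 * ch a c.
  move=> km; apply: (@le_trans _ _ (L ^+ k * ch a c)); last first.
    by rewrite ler_wpM2r ?ch_ge0// ler_weXn2l// ltnW.
  elim: k {km} => [|k IH] /=; first by rewrite mul1r.
  by apply: le_trans (lip _ _) _; rewrite exprS -mulrA ler_pM2l.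
have [h0 h00 Hh0] := small m1.
have [n [n0 nh nL]] : exists n, [/\ (0 < n)%N, M / p%:R / n%:R <= h0 & L ^+ m1 * (M / p%:R / n%:R) <= dl].
  have Lm0 : 0 < L ^+ m1 by rewrite exprn_gt0.
  have Mp0 : 0 < M / p%:R by rewrite divr_gt0.
  have q0 : 0 < Num.min h0 (dl / L ^+ m1) / (M / p%:R) by rewrite divr_gt0// lt_min h00 divr_gt0.
  have [k hk] := ltr_add_invr q0; exists k.+1.
  rewrite add0r ltr_pdivlMr// mulrC lt_min in hk; move/andP: hk => [k1 k2].
  by split => //; [exact: ltW|rewrite mulrC -ler_pdivlMr// ltW].
have sE2 : s ^+ m1 / dl = 2 / e * (6 / 5 * s) ^+ m1 by exact: scl.
have nR : 0 < n%:R :> R by rewrite ltr0n.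
have [h hp hE] : exists2 h : R, 0 < h & h = M / p%:R / n%:R by exists (M / p%:R / n%:R); rewrite // !divr_gt0.
rewrite -hE in nh nL.
have Nh : (p * n)%:R * h = M.
  by rewrite hE natrM; move: (lt0r_neq0 pR) (lt0r_neq0 nR); move: (p%:R : R) (n%:R : R) => u v u0 v0; field; rewrite u0 v0.
have nw : n%:R * h <= w.
  by apply: le_trans pw; rewrite hE mulrC divfK// gt_eqF.
pose pt (r c : nat) := gpt o (- M + c%:R * h) (b + r%:R * h).
pose a k r c := ch (iter k f (pt r c.+1)) (iter k f (pt r c)).
have Ea k : (k < m1)%N -> \sum_(r < n) \sum_(c < 2 * (p * n)) a k r c ^+ 2 <= K * (s ^+ 2) ^+ k.
  move=> km; rewrite s2; pose big := \sum_(r < 2 * (p * n)) \sum_(c < 2 * (p * n)) a k r c ^+ 2.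
  apply: (@le_trans _ _ big).
    have nN : (n <= 2 * (p * n))%N by rewrite mulnA leq_pmull// muln_gt0.
    rewrite /big -(big_mkord xpredT (fun r => \sum_(c < 2 * (p * n)) a k r c ^+ 2)).
    rewrite -(big_mkord xpredT (fun r => \sum_(c < 2 * (p * n)) a k r c ^+ 2)) (big_cat_nat (leq0n n) nN) /=.
    by rewrite lerDl; apply: sumr_ge0 => r _; apply: sumr_ge0 => c _; exact: sqr_ge0.
  have MM : `|- M| <= M by rewrite normrN gtr0_norm.
  have NM : (p * n)%:R * h <= M by rewrite Nh.
  rewrite /big /a /pt; case: o {pt a big}.
    apply: le_trans (Hh0 k km h (- M) b (p * n)%N hp nh NM MM bM).
    rewrite exchange_big big_mkord; apply: ler_sum => c _; rewrite big_mkord; apply: ler_sum => r _.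
    by rewrite /grid /gpt lerDl sqr_ge0.
  apply: le_trans (Hh0 k km h b (- M) (p * n)%N hp nh NM bM MM).
  rewrite big_mkord; apply: ler_sum => c _; rewrite big_mkord; apply: ler_sum => r _.
  by rewrite /grid /gpt lerDr sqr_ge0.
have NP : (2 * (p * n))%:R <= 2 * p%:R * n%:R :> R by rewrite !natrM mulrA.
have [r rn Hr] := row_select s1 (ltW K0) n0 NP Ea.
pose u := b + r%:R * h; pose g t := gpt o (- M + t) u.
have gl t t' : ch (g t) (g t') <= `|t - t'|.
  by apply: le_trans (gpt_lip _ _ _ _) _; rewrite opprD addrACA subrr add0r.
have N0 : (0 < 2 * (p * n))%N by rewrite !muln_gt0 p0.
have Lm0 : 0 <= L ^+ m1 by rewrite exprn_ge0// ltW.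
have [E [sE pE aE]] := path_net hp dl0 N0 gl lipk Lm0 nL Hr.
have N2 : (2 * (p * n))%:R * h = 2 * M by rewrite natrM -mulrA Nh.
exists u, E; split.
- rewrite lerDl mulr_ge0 ?(ltW hp)//= lerD2l; apply: le_trans nw; rewrite ler_pM2r// ler_nat; exact: ltnW.
- apply: le_trans sE _; have m0 : 1 <= m1%:R :> R by rewrite (ler_nat R 1).
  have q1 : 1 <= 6 / 5 * s by exact: q65.
  have -> : m1%:R * (m1%:R * K + 2 * p%:R) * s ^+ m1 / dl = 2 / e * (m1%:R * (m1%:R * K + 2 * p%:R)) * (6 / 5 * s) ^+ m1.
    by rewrite -[LHS]mulrA sE2 [RHS]mulrAC [LHS]mulrC.
  by apply: sb; rewrite ?divr_ge0 ?(ltW e0) ?(ltW K0) ?mulr_ge0 ?exprn_ege1.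
- move=> q /pE[t /andP[t1 t2] ->]; exists (- M + t) => //; rewrite N2 in t2.
  exact: shift1.
move=> t; rewrite ler_norml => /andP[t1 t2].
have [||q qE arc] := aE (t + M); first by rewrite -lerBlDr sub0r.
  by rewrite N2 mulr_natl mulr2n lerD2r.
exists q => //; move: arc; rewrite /g (_ : - M + (t + M) = t); last by rewrite addrC addrK.
by rewrite (_ : 2 * dl = e * (5 / 6) ^+ m1)// /dl mulrC divfK.
Qed.
End Nets.

Section Cells.
Context {R : realType}.
Local Notation C := (Cx R).
Local Notation X := (sphere R).
Implicit Types (f : X -> X) (a b : R).

Definition rect a a' b b' : set X :=
  [set x | if x is Some z then (a < complex.Re z < a') && (b < complex.Im z < b') else false].
Definition crect a a' b b' : set X :=
  [set x | if x is Some z then (a <= complex.Re z <= a') && (b <= complex.Im z <= b') else false].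

Lemma Re_sub_le (z w : C) : `|complex.Re z - complex.Re w| <= modulus (z - w).
Proof. by apply: le_trans (Re_le_mod (z - w)); case: z w => [? ?] [? ?]. Qed.
Lemma Im_sub_le (z w : C) : `|complex.Im z - complex.Im w| <= modulus (z - w).
Proof. by apply: le_trans (Im_le_mod (z - w)); case: z w => [? ?] [? ?]. Qed.

Lemma rect_open a a' b b' : open (rect a a' b b').
Proof.
rewrite openE => -[z|//] /= /andP[/andP[h1 h2] /andP[h3 h4]]; rewrite /interior /nbhs /=; apply/nbhs_modP.
exists (Num.min (Num.min (complex.Re z - a) (a' - complex.Re z)) (Num.min (complex.Im z - b) (b' - complex.Im z))).
  by rewrite !lt_min !subr_gt0 h1 h2 h3 h4.
move=> w; rewrite !lt_min => /andP[/andP[k1 k2] /andP[k3 k4]] /=.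
have := Re_sub_le w z; have := Im_sub_le w z; rewrite !ler_norml => /andP[i1 i2] /andP[r1 r2].
by apply/andP; split; apply/andP; split; lra.
Qed.

Lemma crect_closed a a' b b' : closed (crect a a' b b').
Proof.
rewrite -openC openE => -[z|_] /=.
  move=> nz; rewrite /interior /nbhs /=; apply/nbhs_modP.
  have sep (g : C -> R) (h : R -> R) : (forall w, `|g w - g z| <= modulus (w - z)) -> g z < 0 ->
      (forall w, g w < 0 -> ~ crect a a' b b' (Some w)) -> exists2 r : R, 0 < r & forall w, modulus (w - z) < r -> ~ crect a a' b b' (Some w).
    move=> lip gz H; exists (- g z); first by rewrite oppr_gt0.
    by move=> w wz; apply: H; have := lip w; rewrite ler_norml => /andP[_]; lra.
  have [h|h1] := ltP (complex.Re z) a.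
    apply: (sep (fun w => complex.Re w - a) id); [|by lra|].
      by move=> w; rewrite opprB addrA subrK; exact: Re_sub_le.
    by move=> w h' /= /andP[/andP[+ _] _]; lra.
  have [h|h2] := ltP a' (complex.Re z).
    apply: (sep (fun w => a' - complex.Re w) id); [|by lra|].
      by move=> w; rewrite opprB addrC addrA subrK distrC; exact: Re_sub_le.
    by move=> w h' /= /andP[/andP[_ +] _]; lra.
  have [h|h3] := ltP (complex.Im z) b.
    apply: (sep (fun w => complex.Im w - b) id); [|by lra|].
      by move=> w; rewrite opprB addrA subrK; exact: Im_sub_le.
    by move=> w h' /= /andP[_ /andP[+ _]]; lra.
  have [h|h4] := ltP b' (complex.Im z).
    apply: (sep (fun w => b' - complex.Im w) id); [|by lra|].
      by move=> w; rewrite opprB addrC addrA subrK distrC; exact: Im_sub_le.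
    by move=> w h' /= /andP[_ /andP[_ +]]; lra.
  by exfalso; apply: nz; rewrite h1 h2 h3 h4.
pose B := (`|a| + `|a'|) + (`|b| + `|b'|); have B0 : 0 <= B by rewrite !addr_ge0.
apply/nbhs_chP; exists (B + 1)^-1; first by rewrite invr_gt0; lra.
case=> [w|_ //] wr /= /andP[/andP[h1 h2] /andP[h3 h4]].
move: wr; rewrite ch_None ltNge => /negP; apply; rewrite lef_pV2 ?posrE ?(nrm_vec_gt0 (Some w))//; last by lra.
apply: le_trans (nrmS_le w) _; rewrite lerD2r; apply: le_trans (mod_le_ReIm w) _.
have bd (u v t : R) : u <= t -> t <= v -> `|t| <= `|u| + `|v|.
  move=> ut tv; have := ler_norm (- u); have := ler_norm v; have := normr_ge0 u; have := normr_ge0 v; rewrite normrN.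
  by move=> *; rewrite ler_norml; apply/andP; split; lra.
by apply: lerD; exact: bd.
Qed.

Lemma bracket (a : nat -> R) (p : nat) t : a 0%N <= t -> t <= a p ->
  (exists2 s, (s <= p)%N & t = a s) \/ exists2 s, (s < p)%N & a s < t < a s.+1.
Proof.
move=> a0; elim: p => [|p IH] tp; first by left; exists 0%N => //; apply/le_anti; rewrite a0 tp.
have [h|h] := ltP (a p) t; last first.
  by have [[s sp e]|[s sp e]] := IH h; [left; exists s => //; exact: ltnW|right; exists s => //; exact: ltnW].
move: tp; rewrite le_eqVlt => /orP[/eqP e|tp]; first by left; exists p.+1.
by right; exists p => //; rewrite h tp.
Qed.

(** Each [u] is avoided by keeping the last or the first third of the current interval, whichever is
    farther from it. This keeps grid lines away from the exceptional points. *)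
Lemma trim (U : seq R) b (w : R) : 0 < w -> exists b' w' r : R, [/\ 0 < w', 0 < r, b <= b', b' + w' <= b + w &
  forall u x, u \in U -> b' <= x -> x <= b' + w' -> r <= `|x - u|].
Proof.
elim: U b w => [|u U IH] b w w0; first by exists b, w, 1.
have w3 : 0 < w / 3 by rewrite divr_gt0.
have [ub|bu] := leP u (b + w / 3 + w / 6).
  have [b' [w' [r [h1 h2 h3 h4 h5]]]] := IH (b + 2 * (w / 3)) (w / 3) w3.
  exists b', w', (Num.min r (w / 6)); split => //; [by rewrite lt_min h2 divr_gt0|lra|lra|].
  move=> v x; rewrite inE => /orP[/eqP ->|vU] x1 x2; rewrite ge_min; last by rewrite (h5 v x).
  by apply/orP; right; rewrite ger0_norm; lra.
have [b' [w' [r [h1 h2 h3 h4 h5]]]] := IH b (w / 3) w3.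
exists b', w', (Num.min r (w / 6)); split => //; [by rewrite lt_min h2 divr_gt0|lra|].
move=> v x; rewrite inE => /orP[/eqP ->|vU] x1 x2; rewrite ge_min; last by rewrite (h5 v x).
by apply/orP; right; rewrite distrC ger0_norm; lra.
Qed.

Lemma size_flatten_map (I T : Type) (F : I -> seq T) (s : seq I) (B : I -> R) :
  (forall i, (size (F i))%:R <= B i) -> (size (flatten [seq F i | i <- s]))%:R <= \sum_(i <- s) B i.
Proof.
move=> H; elim: s => [|i s IH] /=; first by rewrite big_nil.
by rewrite size_cat natrD big_cons lerD.
Qed.

Lemma positive_lower_bound (I : eqType) (s : seq I) (r : I -> R) : (forall i, i \in s -> 0 < r i) ->
  exists2 r0 : R, 0 < r0 & forall i, i \in s -> r0 <= r i.
Proof.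
elim: s => [|i s IH] H; first by exists 1.
have [j js|r0 r00 Hr] := IH; first by apply: H; rewrite inE js orbT.
exists (Num.min r0 (r i)); first by rewrite lt_min r00 H ?mem_head.
by move=> j; rewrite inE ge_min => /orP[/eqP ->|/Hr ->//]; rewrite lexx orbT.
Qed.

Lemma gpt_mod o (t u M : R) (w : C) : `|t| <= M -> `|u| <= M -> gpt o t u = Some w -> nrm (w, 1) <= 2 * M + 1.
Proof.
move=> tM uM; case: o => -[<-]; apply: le_trans (nrmS_le _) _; rewrite lerD2r; apply: le_trans (mod_le_ReIm _) _; rewrite /=; lra.
Qed.

(** The strips are fixed and the lines inside them depend on the level: [line_net] chooses each
    line, and the trimmed strips give a distance [rho] to [es] that is uniform in the level. Cells
    are the rectangles cut out by the lines and one neighbourhood of infinity. *)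
Lemma grid_net f (es : seq X) (e : R) : rational_map f -> (1 < rat_degree f)%N -> 0 < e ->
  exists (rho K : R) (Gam : nat -> set X) (E : nat -> seq X), [/\ 0 < rho, 0 <= K,
    forall m y, ~ Gam m.+1 y -> exists CD, cell e (Gam m.+1) y CD,
    forall m y, Gam m.+1 y -> exists2 p, p \in E m.+1 & small_arc f m.+1 (e * (5 / 6) ^+ m.+1) y p &
    forall m, (size (E m.+1))%:R <= K * m.+1%:R ^+ 2 * (6 / 5 * Num.sqrt (rat_degree f)%:R) ^+ m.+1 /\
      forall p x, p \in E m.+1 -> x \in es -> rho <= ch x p].
Proof.
move=> rf d1 e0; set kap := 6 / 5 * _.
(* Points of modulus at least [M / 2] are within [2 / M] of infinity, so the unbounded cell has
   diameter at most [e]. *)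
have [M M0 Me] : exists2 M : R, 0 < M & 2 / M <= e / 2.
  exists (4 / e); first by rewrite divr_gt0.
  by rewrite invf_div mulrCA mulrA; lra.
have inM (a b x : R) : - M <= a -> b <= M -> a <= x -> x <= b -> `|x| <= M.
  by move=> h1 h2 h3 h4; rewrite ler_norml (le_trans h1 h3) (le_trans h4 h2).
have absM (x : R) : `|x| <= M -> (- M <= x) * (x <= M) by rewrite ler_norml => /andP[-> ->].
have cd2 (B e1 u1 u2 x y : R) : B <= u1 -> u2 <= B + e1 + e1 -> u1 <= x -> x <= u2 -> u1 <= y -> y <= u2 -> `|x - y| <= 2 * e1.
  by move=> *; rewrite ler_norml; apply/andP; split; lra.
have [p pM] : exists p : nat, 2 * M / p.+1%:R < Num.min (M / 2) (e / 4).
  have q0 : 0 < Num.min (M / 2) (e / 4) / (2 * M) by rewrite divr_gt0 ?mulr_gt0// lt_min !divr_gt0.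
  have [k hk] := ltr_add_invr q0; exists k.
  by rewrite add0r ltr_pdivlMr ?mulr_gt0// mulrC in hk.
have [et et0 etE] : exists2 et : R, 0 < et & et = 2 * M / p.+1%:R by exists (2 * M / p.+1%:R); rewrite // divr_gt0// mulr_gt0.
rewrite -etE lt_min in pM; move/andP: pM => [etM ete].
have pet : p.+1%:R * et = 2 * M by rewrite etE mulrC divfK.
pose base (s : nat) : R := - M + s%:R * et.
have base_le (s : nat) : (s <= p)%N -> - M <= base s /\ base s + et <= M.
  move=> sp; split; first by rewrite lerDl mulr_ge0// ltW.
  have : s.+1%:R * et <= 2 * M by rewrite -pet ler_pM2r// ler_nat.
  by rewrite /base -[s.+1%:R]natr1 mulrDl mul1r; lra.
pose cd (o : bool) (x : X) : R := if x is Some z then (if o then complex.Im z else complex.Re z) else 0.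
have sum4 (x y : R) : x <= 2 * et -> y <= 2 * et -> et < e / 4 -> x + y <= e by move=> *; lra.
have outL (x u m : R) : u <= - M + et -> `|x| <= m -> m < M / 2 -> u < x by rewrite ler_norml => ? /andP[]; lra.
have outR (x u m : R) : M - et <= u -> `|x| <= m -> m < M / 2 -> x < u by rewrite ler_norml => ? /andP[]; lra.
have M21 : 0 < 2 * M + 1 by lra.
have /choice[tr Htr] (i : nat * bool) : exists t : R * R * R, [/\ 0 < t.1.2, 0 < t.2, base i.1 <= t.1.1, t.1.1 + t.1.2 <= base i.1 + et &
    forall x y, x \in es -> t.1.1 <= y -> y <= t.1.1 + t.1.2 -> t.2 <= `|y - cd i.2 x|].
  have [b' [w' [r [h1 h2 h3 h4 h5]]]] := trim (map (cd i.2) es) (base i.1) et0.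
  by exists (b', w', r); split => // x y xe; apply: h5; exact: map_f.
pose II := ('I_p.+1 * bool)%type.
have bM (i : II) : `|(tr (val i.1, i.2)).1.1| <= M.
  have [h1 h2 h3 h4 _] := Htr (val i.1, i.2); have [k1 k2] := base_le i.1 (ltn_ord i.1).
  by apply: (inM _ _ _ k1 k2 h3); apply: le_trans h4; rewrite lerDl ltW.
have /choice[K HK] (i : II) : exists K : R, 0 <= K /\ forall m : nat, exists uE : R * seq X,
  [/\ (tr (val i.1, i.2)).1.1 <= uE.1 <= (tr (val i.1, i.2)).1.1 + (tr (val i.1, i.2)).1.2,
   (size uE.2)%:R <= K * m.+1%:R ^+ 2 * kap ^+ m.+1,
   (forall p, p \in uE.2 -> exists2 t, `|t| <= M & p = gpt i.2 t uE.1) &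
   forall t, `|t| <= M -> exists2 p, p \in uE.2 & small_arc f m.+1 (e * (5 / 6) ^+ m.+1) (gpt i.2 t uE.1) p].
  have [h1 _ _ _ _] := Htr (val i.1, i.2).
  have [K K0 HK] := line_net i.2 rf d1 M0 h1 (bM i) e0.
  by exists K; split => // m; have [u [E H]] := HK m; exists (u, E).
have /choice[uE HuE] (im : II * nat) : exists uE : R * seq X,
  [/\ (tr (val im.1.1, im.1.2)).1.1 <= uE.1 <= (tr (val im.1.1, im.1.2)).1.1 + (tr (val im.1.1, im.1.2)).1.2,
   (size uE.2)%:R <= K im.1 * im.2.+1%:R ^+ 2 * kap ^+ im.2.+1,
   (forall p, p \in uE.2 -> exists2 t, `|t| <= M & p = gpt im.1.2 t uE.1) &
   forall t, `|t| <= M -> exists2 p, p \in uE.2 & small_arc f im.2.+1 (e * (5 / 6) ^+ im.2.+1) (gpt im.1.2 t uE.1) p].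
  by have [_ H] := HK im.1; exact: H.
have [r0 r00 Hr0] := @positive_lower_bound II (enum {: II}) (fun i => (tr (val i.1, i.2)).2) (fun i _ => let: And5 _ h _ _ _ := Htr (val i.1, i.2) in h).
have q0 (x : X) : 0 < Num.min 1 r0 / (nrm (vec x) * (2 * M + 1)).
  rewrite divr_gt0 ?lt_min ?r00 ?ltr01 ?mulr_gt0 ?nrm_vec_gt0 ?M21//.
have [rho rho0 Hrho] := @positive_lower_bound X es (fun x => Num.min 1 r0 / (nrm (vec x) * (2 * M + 1))) (fun x _ => q0 x).
pose Gam (m : nat) : set X := [set y | exists (i : II) (t : R), `|t| <= M /\ y = gpt i.2 t (uE (i, m.-1)).1].
exists rho, (\sum_(i <- enum {: II}) K i), Gam, (fun m => flatten [seq (uE (i, m.-1)).2 | i <- enum {: II}]); split => //.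
- by apply: sumr_ge0 => i _; have [] := HK i.
- move=> m y nG; pose u o (s : nat) := (uE ((inord s, o), m)).1.
  have ub o s : (s <= p)%N -> base s <= u o s <= base s + et.
    move=> sp; have [/andP[h1 h2] _ _ _] := HuE ((inord s, o), m); have [_ _ h3 h4 _] := Htr (s, o).
    by move: h1 h2 h3 h4; rewrite /= inordK// => h1 h2 h3 h4; rewrite /u (le_trans h3 h1) (le_trans h2 h4).
  have uM o s : (s <= p)%N -> `|u o s| <= M.
    by move=> sp; have [k1 k2] := base_le s sp; have /andP[] := ub o s sp; exact: inM.
  have inG o s t : `|t| <= M -> (s <= p)%N -> Gam m.+1 (gpt o t (u o s)) by move=> tM sp; exists (inord s, o), t.
  have inGv s (z : C) : (s <= p)%N -> complex.Re z = u false s -> `|complex.Im z| <= M -> Gam m.+1 (Some z).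
    by move=> sp zs zM; have := inG false s _ zM sp; rewrite /gpt -zs /mkC /=; case: (z).
  have inGh s (z : C) : (s <= p)%N -> complex.Im z = u true s -> `|complex.Re z| <= M -> Gam m.+1 (Some z).
    by move=> sp zs zM; have := inG true s _ zM sp; rewrite /gpt -zs /mkC /=; case: (z).
  have bdr s s' t t' (z : C) : (s <= p)%N -> (s' <= p)%N -> (t <= p)%N -> (t' <= p)%N ->
      crect (u false s) (u false s') (u true t) (u true t') (Some z) ->
      ~ rect (u false s) (u false s') (u true t) (u true t') (Some z) -> Gam m.+1 (Some z).
    move=> sp sp' tp tp' /andP[/andP[h1 h2] /andP[h3 h4]] nr.
    have zR : `|complex.Re z| <= M by apply: inM h1 h2; rewrite absM ?uM.
    have zI : `|complex.Im z| <= M by apply: inM h3 h4; rewrite absM ?uM.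
    have [/esym k1|k1] := eqVneq (u false s) (complex.Re z); first exact: inGv k1 zI.
    have [k2|k2] := eqVneq (complex.Re z) (u false s'); first exact: inGv k2 zI.
    have [/esym k3|k3] := eqVneq (u true t) (complex.Im z); first exact: inGh k3 zR.
    have [k4|k4] := eqVneq (complex.Im z) (u true t'); first exact: inGh k4 zR.
    by exfalso; apply: nr; rewrite /rect /= !lt_neqAle k1 k2 k3 k4 h1 h2 h3 h4.
  have [yin|yout] := pselect (crect (u false 0%N) (u false p) (u true 0%N) (u true p) y).
    case: y yin nG => [z|//] /andP[/andP[h1 h2] /andP[h3 h4]] nG.
    have zR : `|complex.Re z| <= M by apply: inM h1 h2; rewrite absM ?uM.
    have zI : `|complex.Im z| <= M by apply: inM h3 h4; rewrite absM ?uM.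
    have [[s sp se]|[s sp /andP[s1 s2]]] := bracket h1 h2; first by exfalso; apply: nG; exact: inGv se zI.
    have [[t tp te]|[t tp /andP[t1 t2]]] := bracket h3 h4; first by exfalso; apply: nG; exact: inGh te zR.
    have sp' := ltnW sp; have tp' := ltnW tp.
    exists (rect (u false s) (u false s.+1) (u true t) (u true t.+1), crect (u false s) (u false s.+1) (u true t) (u true t.+1)).
    split => /=; [exact: rect_open|exact: crect_closed|by rewrite s1 s2 t1 t2| |split].
    - by case=> //= w /andP[/andP[? ?] /andP[? ?]]; apply/andP; split; apply/andP; split; exact: ltW.
    - move=> [v|//] [w|//] /= /andP[/andP[v1 v2] /andP[v3 v4]] /andP[/andP[w1 w2] /andP[w3 w4]].
      apply: le_trans (ch_Some_le _ _) _; apply: le_trans (mod_le_ReIm _) _.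
      have /andP[b1 _] := ub false s sp'; have /andP[_ b2] := ub false s.+1 sp.
      have /andP[b3 _] := ub true t tp'; have /andP[_ b4] := ub true t.+1 tp.
      have bS (i : nat) : base i.+1 = base i + et by rewrite /base -natr1 mulrDl mul1r addrA.
      rewrite bS in b2; rewrite bS in b4.
      have d1' : `|complex.Re v - complex.Re w| <= 2 * et by exact: cd2 b1 b2 v1 v2 w1 w2.
      have d2' : `|complex.Im v - complex.Im w| <= 2 * et by exact: cd2 b3 b4 v3 v4 w3 w4.
      have -> : complex.Re (v - w) = complex.Re v - complex.Re w by case: (v) (w) => [? ?] [? ?].
      have -> : complex.Im (v - w) = complex.Im v - complex.Im w by case: (v) (w) => [? ?] [? ?].
      exact: sum4 d1' d2' ete.
    - move=> [w|//] cw; have [|nr] := pselect (rect (u false s) (u false s.+1) (u true t) (u true t.+1) (Some w)); first by left.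
      by right; exact: bdr nr.
  exists (~` crect (u false 0%N) (u false p) (u true 0%N) (u true p), ~` rect (u false 0%N) (u false p) (u true 0%N) (u true p)).
  split => /=; [by rewrite openC; exact: crect_closed|by rewrite closedC; exact: rect_open|by []| |split].
  - move=> [w|] nc //=; apply: contra_not nc => /andP[/andP[? ?] /andP[? ?]]; apply/andP; split; apply/andP; split; exact: ltW.
  - have far (w : X) : ~ rect (u false 0%N) (u false p) (u true 0%N) (u true p) w -> ch None w <= e / 2.
      case: w => [w|] nr; last by rewrite chxx divr_ge0// ltW.
      apply: le_trans Me; rewrite ch_None invf_ple ?posrE ?divr_gt0 ?(nrm_vec_gt0 (Some w))// invf_div.
      apply: le_trans (mod_le_nrmS w).
      have /andP[_ b1] := ub false 0%N (leq0n p); have /andP[b2 _] := ub false p (leqnn p).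
      have /andP[_ b3] := ub true 0%N (leq0n p); have /andP[b4 _] := ub true p (leqnn p).
      have bp : base p = M - et by rewrite /base; move: pet; rewrite -natr1 mulrDl mul1r; lra.
      have b0' : base 0%N = - M by rewrite /base mul0r addr0.
      rewrite bp b0' in b1 b2 b3 b4; rewrite leNgt; apply/negP => wM; apply: nr.
      have iw := Im_le_mod w; have rw := Re_le_mod w.
      by rewrite /rect /= (outL _ _ _ b1 rw wM) (outR _ _ _ b2 rw wM) (outL _ _ _ b3 iw wM) (outR _ _ _ b4 iw wM).
    move=> v w /far hv /far hw; apply: le_trans (ch_tri None _ _) _; rewrite chC; lra.
  - move=> [w|] nr; last by left.
    have [cw|] := pselect (crect (u false 0%N) (u false p) (u true 0%N) (u true p) (Some w)); last by left.
    by right; exact: bdr nr.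
- move=> m y [i [t [tM ->]]]; have [_ _ _ H] := HuE (i, m); have [q qE arc] := H t tM.
  by exists q => //; apply/flatten_mapP; exists i; rewrite ?mem_enum.
move=> m; split.
  rewrite -mulrA mulr_suml; apply: size_flatten_map => i; rewrite mulrA.
  by have [] := HuE (i, m).
move=> q x /flatten_mapP[i _ /= qE] xe; apply: le_trans (Hrho x xe) _.
have [/andP[h1 h2] _ H _] := HuE (i, m); have [t tM /= qq] := H q qE.
have [_ _ h3 h4 h5] := Htr (val i.1, i.2); have := h5 x _ xe h1 h2; rewrite /= in h1 h2 h3 h4 *.
have [k1 k2] := base_le i.1 (ltn_ord i.1).
have uM : `|(uE (i, m)).1| <= M by exact: inM k1 k2 (le_trans h3 h1) (le_trans h2 h4).
have := Hr0 i; rewrite mem_enum => /(_ isT); move: (tr _).2 => r ri rx.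
have [w qw] : exists w, q = Some w by rewrite qq; case: (i.2); eexists.
have nw := gpt_mod tM uM (etrans (esym qq) qw).
have n0 : 0 < nrm (w, 1) by exact: (nrm_vec_gt0 (Some w)).
have nx := nrm_vec_gt0 x.
rewrite qw -[leRHS](mulfK (lt0r_neq0 (mulr_gt0 nx n0))) -(wedge_ch x (Some w)).
have wg : Num.min 1 r0 <= modulus (wedge (vec x) (vec (Some w))).
  case: x xe rx nx => [z|] xe rx nx; rewrite /wedge /= ?mul1r ?mulr1 ?mul0r ?subr0; last by rewrite mod1 ge_min lexx.
  rewrite ge_min; apply/orP; right; apply: le_trans ri (le_trans rx _); rewrite modBC.
  have wE : w = mkC (if i.2 then (t, (uE (i, m)).1) else ((uE (i, m)).1, t)).
    by move: qw; rewrite qq /gpt; case: (i.2) => -[<-].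
  rewrite /cd; case: (i.2) wE => wE.
    by apply: le_trans (Im_sub_le _ _); rewrite wE /=.
  by apply: le_trans (Re_sub_le _ _); rewrite wE /=.
apply: ler_pM => //; first by rewrite le_min ler01 ltW.
  by rewrite invr_ge0 ltW// mulr_gt0.
by rewrite lef_pV2 ?posrE ?mulr_gt0// ler_pM2l.
Qed.
End Cells.

(** * Entropy *)

Section Partitions.
Context {R : realType}.
Local Notation X := (sphere R).
Local Notation bX := (borel_sphere R).
Implicit Types (mu nu : probability bX R) (x : X).

Lemma I_invariant (f : X -> X) mu (h : X -> R) : continuous f -> invariant_measure f mu -> bmf (h : bX -> R) ->
  bmf ((h \o f) : bX -> R) /\ I_ mu (h \o f : bX -> R) = I_ mu (h : bX -> R).
Proof.
move=> cf inv bh; have mf : measurable_fun [set: bX] (f : bX -> bX) := contX_meas cf.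
have bhf : bmf ((h \o f) : bX -> R).
  split; last by have [_ [M HM]] := bh; exists M => x; exact: HM.
  by apply: (@measurableT_comp _ _ _ _ _ _ (h : bX -> R) _ (f : bX -> bX)) => //; case: bh.
split => //; apply: EFin_inj; rewrite -!I_EFin//.
rewrite -(@integral_pushforward _ _ bX bX R f mf mu setT (fun x => (h x)%:E))//.
- by apply: eq_measure_integral => A mA _; rewrite /pushforward; exact: inv.
- by apply/measurable_EFinP; case: bh.
- by rewrite preimage_setT; have := bmf_integrable mu bhf.
Qed.

Lemma bsum_bmf (f : X -> X) (h : X -> R) n mu : continuous f -> invariant_measure f mu -> bmf (h : bX -> R) ->
  bmf (bsum f h n : bX -> R) /\ I_ mu (bsum f h n : bX -> R) = n%:R * I_ mu (h : bX -> R).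
Proof.
move=> cf inv bh.
have it (i : nat) : bmf ((fun x => h (iter i f x)) : bX -> R) /\ I_ mu ((fun x => h (iter i f x)) : bX -> R) = I_ mu (h : bX -> R).
  elim: i => [|i [b IH]]; first by [].
  have [b' e'] := I_invariant cf inv b; rewrite IH in e'.
  have E : ((fun x => h (iter i f x)) \o f) = (fun x => h (iter i.+1 f x)) by apply/funext => x; rewrite /= -iterSr.
  by rewrite -E.
split; first by apply: (@bmf_sum _ bX R _ _ (fun (i : 'I_n) x => h (iter i f x))) => i; have [] := it i.
rewrite /bsum (@I_sum _ bX R mu _ _ (fun (i : 'I_n) x => h (iter i f x))); last by move=> i; have [] := it i.
rewrite (eq_bigr (fun=> I_ mu (h : bX -> R))); last by move=> i _; have [] := it i.
by rewrite sumr_const card_ord -[_ *+ n]mulr_natl.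
Qed.

Section Words.
Variables (f : X -> X) (cf : continuous f) (k : nat) (P : 'I_k -> set bX).
Hypothesis mP : measurable_partition P.

Lemma cylinder_meas n (w : {ffun 'I_n -> 'I_k}) : measurable (cylinder f P w).
Proof.
have mf (i : nat) : measurable_fun [set: bX] (iter i f : bX -> bX) by apply: contX_meas; exact: iter_continuous.
rewrite (_ : cylinder f P w = \bigcap_(i in [set: 'I_n]) (iter i f @^-1` P (w i))); last first.
  by apply/seteqP; split => [x Hx i _|x Hx i]; [exact: Hx|exact: (Hx i I)].
apply: fin_bigcap_measurable; first exact: finite_finset.
by move=> i _; have := mf i measurableT _ (let: And3 h _ _ := mP in h (w i)); rewrite setTI.
Qed.

Lemma word_ex n x : exists w : {ffun 'I_n -> 'I_k}, cylinder f P w x.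
Proof.
have [_ _ cov] := mP.
have /choice[c Hc] (y : X) : exists i, P i y.
  have : (\bigcup_i P i) y by rewrite cov.
  by case=> i _ Py; exists i.
by exists [ffun i : 'I_n => c (iter i f x)] => i; rewrite ffunE.
Qed.

Lemma part_uniq i j x : P i x -> P j x -> i = j.
Proof. by have [_ tr _] := mP => pi pj; apply: (tr i j) => //; exists x. Qed.

Lemma word_uniq n (w w' : {ffun 'I_n -> 'I_k}) x : cylinder f P w x -> cylinder f P w' x -> w = w'.
Proof. by move=> h h'; apply/ffunP => i; exact: part_uniq (h i) (h' i). Qed.

Lemma sum_cylinder n (c : {ffun 'I_n -> 'I_k} -> R) w x : cylinder f P w x ->
  \sum_(v : {ffun 'I_n -> 'I_k}) c v * \1_(cylinder f P v) x = c w.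
Proof.
move=> wx; rewrite (bigD1 w)//= big1 ?addr0 ?indicE ?mem_set ?mulr1//.
move=> v vw; rewrite indicE memNset ?mulr0// => vx.
by move: vw; rewrite (word_uniq vx wx) eqxx.
Qed.

Lemma sum_prob_cylinder mu n : \sum_(w : {ffun 'I_n -> 'I_k}) prob mu (cylinder f P w) = 1.
Proof.
rewrite -(I_cst mu 1); under eq_bigr do rewrite -(I_indic mu (cylinder_meas _)).
rewrite -I_sum; last by move=> w; apply: bmf_indic; exact: cylinder_meas.
congr I_; apply/funext => x; have [w wx] := word_ex n x.
by rewrite -[RHS](sum_cylinder (fun=> 1) wx); apply: eq_bigr => v _; rewrite mul1r.
Qed.

(** The inequality [- sum p ln p + sum p ln a <= ln (sum a)], a consequence of [ln t <= t - 1]. A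
    weight [a w] can vanish only on an empty cylinder, of mass zero. *)
Lemma gibbs mu n (a : {ffun 'I_n -> 'I_k} -> R) (A : R) (G : X -> R) : (forall w, 0 <= a w) -> 0 < A -> \sum_w a w <= A ->
  bmf (G : bX -> R) -> (forall w x, cylinder f P w x -> expR (G x) <= a w) ->
  join_entropy mu f P n + I_ mu (G : bX -> R) <= ln A.
Proof.
move=> a0 A0 aA bG Ga; pose p (w : {ffun 'I_n -> 'I_k}) := prob mu (cylinder f P w).
have G_le : I_ mu (G : bX -> R) <= \sum_w ln (a w) * p w.
  have bi w : bmf (\1_(cylinder f P w) : bX -> R) by apply: bmf_indic; exact: cylinder_meas.
  have bci w : bmf ((fun x => ln (a w) * \1_(cylinder f P w) x) : bX -> R) by apply: bmfM => //; exact: bmf_cst.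
  rewrite (eq_bigr (fun w => I_ mu (fun x : bX => ln (a w) * \1_(cylinder f P w) x))); last first.
    by move=> w _; rewrite I_Z// I_indic//; exact: cylinder_meas.
  rewrite -I_sum//; apply: I_le => //; first exact: bmf_sum.
  move=> x; have [w wx] := word_ex n x; rewrite (sum_cylinder (fun w => ln (a w)) wx).
  by rewrite -[leLHS]expRK ler_ln ?posrE ?expR_gt0//; [exact: Ga|apply: lt_le_trans (Ga w x wx); exact: expR_gt0].
apply: le_trans (lerD (lexx _) G_le) _; rewrite /join_entropy -/(p _).
rewrite -[leRHS]mulr1 -(sum_prob_cylinder mu n) mulr_sumr -subr_le0.
rewrite -sumrN -big_split /= -sumrB; apply: (@le_trans _ _ (\sum_(w : {ffun 'I_n -> 'I_k}) (a w / A - p w))); last first.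
  by rewrite sumrB sum_prob_cylinder -mulr_suml subr_le0 ler_pdivrMr// mul1r.
apply: ler_sum => w _; rewrite -/(prob mu _) -/(p w).
have p0 : 0 <= p w by exact: prob_ge0.
have [pw|pw] := eqVneq (p w) 0; first by rewrite pw !(mulr0, mul0r) oppr0 !addr0 divr_ge0// ltW.
have pp : 0 < p w by rewrite lt_def pw p0.
have aw : 0 < a w.
  have [[x wx]|/set0P/negP/negPn/eqP e] := pselect (cylinder f P w !=set0).
    by apply: lt_le_trans (Ga w x wx); exact: expR_gt0.
  by move: pp; rewrite /p e prob_set0 ltxx.
have -> : - (p w * ln (p w)) + ln (a w) * p w + - (ln A * p w) = p w * ln (a w / (p w * A)).
  have -> : ln (a w / (p w * A)) = ln (a w) - (ln (p w) + ln A).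
    by rewrite ln_div ?posrE ?mulr_gt0// lnM ?posrE.
  ring.
have t0 : 0 < a w / (p w * A) by rewrite divr_gt0 ?mulr_gt0.
have := expR_ge1Dx (ln (a w / (p w * A))); rewrite lnK ?posrE// => h.
have -> : a w / A - p w = p w * (a w / (p w * A) - 1) by field; rewrite pw gt_eqF.
by rewrite ler_pM2l// lerBrDl.
Qed.
End Words.
End Partitions.

Section Upper.
Context {R : realType}.
Local Notation X := (sphere R).
Local Notation bX := (borel_sphere R).

Lemma pos_continuous_min (h : X -> R) : continuous h -> (forall x, 0 < h x) -> exists2 m : R, 0 < m & forall x, m <= h x.
Proof.
move=> ch h0; have ci : continuous (fun x => (h x)^-1).
  by apply: (@cont_comp _ (fun t : R => t^-1)) => // x; apply: inv_continuous; rewrite gt_eqF.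
have [M M0 HM] := sup_norm_bounded ci; exists (M + 1)^-1; first by rewrite invr_gt0 ltr_wpDl.
move=> x; rewrite -[leRHS]invrK lef_pV2 ?posrE ?invr_gt0 ?ltr_wpDl//.
by apply: le_trans (le_trans (ler_norm _) (HM x)) _; rewrite lerDl.
Qed.

Lemma le_sum_mem (T : eqType) (s : seq T) (F : T -> R) x : x \in s -> (forall y, 0 <= F y) -> F x <= \sum_(y <- s) F y.
Proof.
move=> xs F0; rewrite (big_rem x)//= lerDl; exact: sumr_ge0.
Qed.

Lemma cubic_le_exp (A t : R) : 0 <= A -> 0 < t -> exists N : nat, forall n, (N <= n)%N -> A * n%:R ^+ 3 <= expR (t * n%:R).
Proof.
move=> A0 t0; have t4 : 0 < (t / 4) ^+ 4 by rewrite exprn_gt0// divr_gt0.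
have [k hk] := ltr_add_invr (divr_gt0 t4 (ltr_pwDr ltr01 A0)); exists k.+1 => n kn.
have n0 : 0 <= n%:R :> R by rewrite ler0n.
have h1 : A <= (t / 4) ^+ 4 * n%:R.
  rewrite add0r ltr_pdivlMr ?ltr_pwDr// ltr_pdivrMl ?ltr0n// in hk.
  have kn' : k.+1%:R <= n%:R :> R by rewrite ler_nat.
  have := ler_wpM2r (ltW t4) kn'; rewrite mulrC [n%:R * _]mulrC in hk *; lra.
have h2 : (t / 4 * n%:R) ^+ 4 <= expR (t * n%:R).
  rewrite (_ : t * n%:R = (t / 4 * n%:R) * 4%:R); last by field.
  rewrite expRM_natr; apply: lerXn2r; rewrite ?nnegrE ?expR_ge0 ?mulr_ge0 ?divr_ge0 ?(ltW t0)//.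
  by apply: le_trans (expR_ge1Dx _); rewrite lerDr.
apply: le_trans h2; rewrite exprMn (_ : (t / 4) ^+ 4 * n%:R ^+ 4 = (t / 4) ^+ 4 * n%:R * n%:R ^+ 3).
  by rewrite ler_wpM2r ?exprn_ge0.
by rewrite -mulrA -exprS.
Qed.

Section Entropy.
Variables (f : X -> X) (nu : probability bX R).
Hypotheses (rf : rational_map f) (d1 : (1 < rat_degree f)%N).
Hypotheses (bal : balanced f nu) (na : non_atomic nu).
Local Notation L := (Lr f).
Local Notation d := (rat_degree f).

(** [exp_bound] concerns points outside a whole basin, whereas net points are only known to be at
    distance [rho] from the exceptional points. A basin point comes closer than [rho] after [J]
    steps, so [J] backward steps from a net point lead out of the basin, at the cost of a constant
    factor. *)
Lemma exp_bound_far (phi : X -> R) (e : R) : continuous phi -> 0 < e ->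
  exists (es : seq X) (th0 : R), 0 < th0 /\ forall th rho, 0 < th -> th <= th0 -> 0 < rho ->
  exists2 Ce : R, 1 <= Ce & forall n y, (forall x, x \in es -> rho <= ch x y) ->
    iter n L (fun x => expR (th * bsum f phi n x)) y <= Ce * expR (th * (n%:R * (I_ nu phi + e))).
Proof.
move=> cp e0; have [es [r0 [He r00 Hb _]]] := exc_basin rf d1 bal na.
pose K := ~` near es r0.
have cK : closed K by apply: open_closedC; exact: near_open.
have fwd (j : nat) x : near es r0 x -> near es (r0 / 2 ^+ j) (iter j f x).
  move=> nx; elim: j => [|j IH]; first by rewrite divr1.
  have j0 : 0 < r0 / 2 ^+ j by rewrite divr_gt0// exprn_gt0.
  have jr : r0 / 2 ^+ j <= r0 by rewrite ler_pdivrMr ?exprn_gt0// ler_peMr ?(ltW r00)// exprn_ege1// ler1n.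
  by have := Hb _ j0 jr _ IH; rewrite /= exprSr invfM mulrA.
have backK x : K (f x) -> K x.
  by move=> Kf nx; apply: Kf; have := fwd 1%N x nx; apply: near_le; rewrite expr1; lra.
have excK x : K x -> ~ exc f x.
  by move=> Kx /He xe; apply: Kx; exists x => //; rewrite chxx.
have [th0 th00 Hth] := exp_bound rf d1 bal na cK backK excK cp e0.
exists es, th0; split => // th rho t0 tt rho0.
have [C1 C11 HC] := Hth th t0 tt; have [B B0 HB] := sup_norm_bounded cp.
set c := I_ nu phi + e in HC *.
have [J HJ] : exists J : nat, r0 / 2 ^+ J <= rho.
  have [k hk] := ltr_add_invr (divr_gt0 rho0 r00); exists k.
  rewrite add0r ltr_pdivlMr// mulrC in hk; apply: le_trans (ltW hk); rewrite ler_pM2l// lef_pV2 ?posrE ?exprn_gt0//.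
  by rewrite -natrX ler_nat; exact: ltn_expl.
have BJ y j : iter j L (fun x => expR (th * bsum f phi j x)) y <= expR (th * (j%:R * B)).
  rewrite -[leRHS](Lit_cst rf j _ y); apply: Lit_le => // x _; rewrite ler_expR ler_pM2l//.
  by apply: le_trans (ler_norm _) _; exact: bsum_abs.
exists (C1 * expR (th * (J%:R * (B + `|c|)))).
  by rewrite -[leLHS]mulr1 ler_pM// -[leLHS]expR0 ler_expR !mulr_ge0 ?addr_ge0// ltW.
move=> n y far; have cN : - c <= `|c| by rewrite -normrN ler_norm.
have [Jn|nJ] := leqP J n.
  have nE : n = (J + (n - J))%N by rewrite subnKC.
  have : iter (J + (n - J)) L (fun x => expR (th * bsum f phi (J + (n - J)) x)) y <=
      C1 * expR (th * ((n - J)%N%:R * c)) * iter J L (fun x => expR (th * bsum f phi J x)) y.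
    apply: Lit_exp => // x xy; apply: HC => nx; have [u ue] := fwd J x nx.
    rewrite xy => uy; have := far u ue; rewrite leNgt => /negP; apply.
    by rewrite chC; apply: lt_le_trans HJ.
  rewrite -nE => /le_trans; apply.
  apply: (@le_trans _ _ (C1 * expR (th * ((n - J)%N%:R * c)) * expR (th * (J%:R * B)))).
    by rewrite ler_pM2l ?mulr_gt0 ?expR_gt0 ?(lt_le_trans ltr01)//; exact: BJ.
  rewrite -!mulrA ler_pM2l ?(lt_le_trans ltr01)// -!expRD ler_expR -!mulrDr ler_pM2l// natrB//.
  have := ler_wpM2l (ler0n R J) cN; move: (J%:R : R) (n%:R : R) => u v; nra.
apply: le_trans (BJ y n) _; rewrite -[leLHS]mul1r -mulrA; apply: ler_pM => //.
rewrite -expRD ler_expR -mulrDr ler_pM2l//.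
have nJ' : n%:R <= J%:R :> R by rewrite ler_nat ltnW.
have h1 : n%:R * (B - c) <= J%:R * (B + `|c|).
  apply: (@le_trans _ _ (n%:R * (B + `|c|))); first by rewrite ler_wpM2l// lerD2l.
  by rewrite ler_wpM2r// addr_ge0.
by move: h1; rewrite mulrBr; lra.
Qed.

(* The weight [a n w] sums, over the shadowing points [q], a product of factors [exp (th phi) g]; [g] is at least 1 when the
   orbit of a point shadowed by [q] visits one of the well separated closed sets [Bs], and the small term [dl / k] pays for the
   other times. Net points of [E (n - j)] have [d ^ j] preimages, weighted by the transfer operator, and [sqrt d * 6 / 5 < d]
   makes the count exponentially [d ^ n]. *)
Lemma entropy_upper (phi : X -> R) (e : R) : continuous phi -> 0 < e -> exists2 th : R, 0 < th <= 1 &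
  forall (mu : probability bX R) k (P : 'I_k -> set bX) (dl : R), invariant_measure f mu -> measurable_partition P -> 0 < dl ->
  exists N : nat, forall n, (N <= n)%N -> join_entropy mu f P n <= n%:R * (ln d%:R + th * (I_ nu phi + e - I_ mu (phi : bX -> R)) + dl).
Proof.
have wgt (l u v t : R) : 0 <= u -> u * (v + 1) <= t -> - l * u <= v * u -> - t <= l * u by move=> *; nra.
have r5 (a x y z w b : R) : a * x * z * (b * y * w) = a * x * b * (y * (z * w)) by ring.
have r3 (u v w x t : R) : u * (x * u ^+ 2 * t * v * w) = x * t * u ^+ 3 * v * w by ring.
move=> cp e0; have cf := rational_continuous rf.
have [es [th0 [th00 Hth]]] := exp_bound_far cp e0.
have [B B0 HB] := sup_norm_bounded cp.
set c := I_ nu phi + e in Hth *.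
pose s := Num.sqrt (d%:R : R); pose kap := 6 / 5 * s.
have d0 : 0 < d%:R :> R by rewrite ltr0n ltnW.
have s2 : s ^+ 2 = d%:R by rewrite sqr_sqrtr// ltW.
have s0 : 0 < s by rewrite sqrtr_gt0.
have s65 : 6 / 5 < s.
  rewrite -(@ltr_pXn2r _ 2)// ?nnegrE ?(ltW s0)// s2; apply: (@lt_le_trans _ _ 2); first by rewrite expr2; lra.
  by rewrite (ler_nat R 2).
have kap0 : 0 < kap by rewrite mulr_gt0.
have dk : 1 < d%:R / kap by rewrite ltr_pdivlMr// mul1r -s2 expr2 ltr_pM2r.
have ldk : 0 < ln (d%:R / kap) by rewrite ln_gt0.
have BB0 : 0 < 2 * B + 1 by rewrite ltr_wpDl// mulr_ge0.
(* The last bound leaves room for the trivial estimate [th * B] per step after the net point: since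
   [c >= - B], it gives [kap * exp (th * B) <= d * exp (th * c)]. *)
pose th := Num.min 1 (Num.min th0 (ln (d%:R / kap) / (2 * B + 1))).
have th_gt0 : 0 < th by rewrite !lt_min ltr01 th00 divr_gt0.
have thth0 : th <= th0 by rewrite /th !ge_min lexx orbT.
have th1 : th <= 1 by rewrite /th ge_min lexx.
have thk : th * (2 * B + 1) <= ln (d%:R / kap) by rewrite -ler_pdivlMr// /th !ge_min lexx !orbT.
exists th; first by rewrite th_gt0.
clearbody th.
have cB : - B <= c.
  have h : `|I_ nu phi| <= B by apply: I_abs_le => //; exact: cont_bmf.
  by move: h; rewrite ler_norml /c => /andP[h _]; apply: le_trans h _; rewrite lerDl ltW.
have kapd : kap * expR (th * B) <= d%:R * expR (th * c).
  rewrite -ler_pdivrMr ?expR_gt0// -mulrA -expRN -expRD [leLHS]mulrC -ler_pdivlMr//.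
  rewrite -[leRHS]lnK ?posrE ?divr_gt0// ler_expR; apply: le_trans thk.
  by rewrite -mulrN -mulrDr ler_pM2l//; lra.
have kb0 : 0 <= kap * expR (th * B) by rewrite mulr_ge0 ?expR_ge0// ltW.
move=> mu k P dl0 inv mP dl00; have [mPm trP covP] := mP.
have [dl dl_gt0 [dl1 dl4]] : exists2 dl : R, 0 < dl & dl <= 1 /\ 5 * dl <= dl0.
  exists (Num.min 1 (dl0 / 5)); first by rewrite lt_min ltr01 divr_gt0.
  by split; rewrite ?ge_min ?lexx// mulrC -ler_pdivlMr// ge_min lexx orbT.
have k0 : (0 < k)%N.
  have : (\bigcup_i P i) None by rewrite covP.
  by case=> i _ _; exact: leq_ltn_trans (ltn_ord i).
have kR : 0 < k%:R :> R by rewrite ltr0n.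
(* The logarithm of the small term of [g], paid when the orbit is outside the closed sets [Bs];
   these miss mass at most [dl / l1] altogether, so the average cost is at most [dl]. *)
pose lk := ln (dl / k%:R).
have [l1 l10 l1E] : exists2 l1 : R, 0 < l1 & l1 = `|lk| + 1 by exists (`|lk| + 1); rewrite // ltr_wpDl.
pose tau := dl / (k%:R * l1).
have tau0 : 0 < tau by rewrite divr_gt0// mulr_gt0.
have /choice[Bs HBs] (i : 'I_k) : exists F : set X, closed F /\ (F `<=` P i /\ prob mu (P i) - prob mu F < tau).
  by have [F cF H] := prob_regular mu (mPm i) tau0; exists F.
have cB' i : closed (Bs i) by case: (HBs i).
have BP i : Bs i `<=` P i by case: (HBs i) => _ [].
pose chi x : R := \sum_i \1_(Bs i) x.
have bchi : bmf (chi : bX -> R) by apply: bmf_sum => i; apply: bmf_indic; exact: closed_meas.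
have chiE i x : P i x -> chi x = \1_(Bs i) x.
  move=> px; rewrite /chi (bigD1 i)//= big1 ?addr0// => j ji; rewrite indicE memNset// => bx.
  by move: ji; rewrite (part_uniq mP (BP _ _ bx) px) eqxx.
have Ichi : 1 - dl / l1 <= I_ mu (chi : bX -> R).
  rewrite /chi I_sum; last by move=> i; apply: bmf_indic; exact: closed_meas.
  have sP : \sum_i prob mu (P i) = 1.
    rewrite -(I_cst mu 1); under eq_bigr do rewrite -(I_indic mu (mPm _)).
    rewrite -I_sum; last by move=> i; exact: bmf_indic.
    congr I_; apply/funext => x; have : (\bigcup_i P i) x by rewrite covP.
    case=> i _ px; rewrite (bigD1 i)//= big1 ?addr0 ?indicE ?mem_set// => j ji.
    by rewrite indicE memNset// => pj; move: ji; rewrite (part_uniq mP pj px) eqxx.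
  rewrite -sP lerBlDr -lerBlDl -sumrB; apply: (@le_trans _ _ (\sum_(i < k) tau)).
    by apply: ler_sum => i _; rewrite I_indic; [have [_ [_ /ltW]] := HBs i|exact: closed_meas].
  rewrite sumr_const card_ord -mulr_natl /tau.
  by rewrite invfM mulrCA mulVKf// gt_eqF.
have [ep ep0 Hep] : exists2 ep : R, 0 < ep & forall i j z, i != j -> dset (Bs i) z <= ep -> dset (Bs j) z <= ep -> False.
  have Hm (ij : 'I_k * 'I_k) : exists m : R, 0 < m /\ (ij.1 != ij.2 -> forall z, m <= dset (Bs ij.1) z + dset (Bs ij.2) z).
    have [->|ne] := eqVneq ij.1 ij.2; first by exists 1.
    have [|z|m m0 hm] := @pos_continuous_min (fun z => dset (Bs ij.1) z + dset (Bs ij.2) z).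
    - by apply: contD; exact: dset_cont.
    - rewrite lt_def addr_ge0 ?dset_ge0// andbT; apply/eqP => h.
      have h1 : dset (Bs ij.1) z = 0 by apply/le_anti; rewrite dset_ge0 -h lerDl dset_ge0.
      have h2 : dset (Bs ij.2) z = 0 by apply/le_anti; rewrite dset_ge0 -h lerDr dset_ge0.
      move: ne; rewrite (part_uniq mP (BP _ _ (dset_eq0 (cB' _) h1)) (BP _ _ (dset_eq0 (cB' _) h2))) eqxx//.
    by exists m.
  have /choice[m Hm'] := Hm.
  have [ep ep0 Hep] := positive_lower_bound (s := enum {: 'I_k * 'I_k}) (fun ij _ => (Hm' ij).1).
  exists (ep / 3); first by rewrite divr_gt0.
  move=> i j z ij h1 h2; have := (Hm' (i, j)).2 ij z; have := Hep (i, j); rewrite mem_enum => /(_ isT) /=.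
  by lra.
have [et et0 Het] := unif_continuousR cp dl_gt0.
(* The shadowing distance is [11 * eg]: small enough to recognize which set [Bs] is visited and to
   change [phi] by less than [dl]. *)
have [eg eg0 [eg1 eg2 eg3]] : exists2 eg : R, 0 < eg & [/\ eg < 1, 11 * eg <= ep & 11 * eg < et].
  exists (Num.min (1 / 2) (Num.min (ep / 11) (et / 12))); first by rewrite !lt_min !divr_gt0.
  split; first by rewrite gt_min; apply/orP; left; lra.
    by rewrite mulrC -ler_pdivlMr// !ge_min lexx !orbT.
  by rewrite mulrC -ltr_pdivlMr// !gt_min; apply/orP; right; apply/orP; right; lra.
have [rho [K [Gam [E [rho0 K0 cells arcs HE]]]]] := grid_net es rf d1 eg0.
have [Ce Ce1 HCe] := Hth th rho th_gt0 thth0 rho0.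
have shad := @shadowing R f eg Gam E rf eg0 eg1 cells.
have {}shad x n : (0 < n)%N -> exists q j, [/\ (j < n)%N, iter j f q \in E (n - j)%N &
  forall i, (i < n)%N -> ch (iter i f q) (iter i f x) <= 11 * eg].
  move=> n0; apply: shad => // m y /arcs[p pE [A [cA Ay Ap HA]]].
  by exists A, p.
pose g q (b : 'I_k) : R := ((dset (Bs b) q <= ep)%R%:R : R) + dl / k%:R.
pose tm n q (w : {ffun 'I_n -> 'I_k}) : R := \prod_(i < n) (expR (th * phi (iter i f q) + dl) * g (iter i f q) (w i)).
pose a n (w : {ffun 'I_n -> 'I_k}) : R := \sum_(j < n) \sum_(p <- E (n - j)%N) \sum_(q <- ifib f j p) tm n q w.
have g0 q b : 0 <= g q b by rewrite addr_ge0// divr_ge0 ?(ltW dl_gt0).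
have tm0 n q w : 0 <= tm n q w by apply: prodr_ge0 => i _; rewrite mulr_ge0 ?expR_ge0.
have sg q : \sum_b g q b <= 1 + dl.
  rewrite big_split /= sumr_const card_ord -[_ *+ k]mulr_natl mulrC divfK ?gt_eqF// lerD2r.
  have [[b hb]|nb] := pselect (exists b, dset (Bs b) q <= ep).
    rewrite (bigD1 b)//= hb big1 ?addr0// => b' bb'.
    by case: (boolP (_ <= _)) => // h; case: (Hep _ _ _ bb' h hb).
  by rewrite big1// => b _; case: (boolP (_ <= _)) => // h; case: nb; exists b.
have suma n : \sum_w a n w <= \sum_(j < n) \sum_(p <- E (n - j)%N) \sum_(q <- ifib f j p) (expR (th * bsum f phi n q) * expR (2 * dl * n%:R)).
  rewrite /a exchange_big; apply: ler_sum => j _; rewrite exchange_big; apply: ler_sum => p _.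
  rewrite exchange_big; apply: ler_sum => q _.
  rewrite -(bigA_distr_bigA (fun (i : 'I_n) b => expR (th * phi (iter i f q) + dl) * g (iter i f q) b)) /=.
  apply: (@le_trans _ _ (\prod_(i < n) expR (th * phi (iter i f q) + 2 * dl))).
    apply: ler_prod => i _; rewrite sumr_ge0 => [|b _]; last by rewrite mulr_ge0// expR_ge0.
    rewrite -mulr_sumr /= (_ : _ + 2 * dl = (th * phi (iter i f q) + dl) + dl); last by ring.
    rewrite [leRHS]expRD ler_pM2l ?expR_gt0//.
    by apply: le_trans (sg _) _; exact: expR_ge1Dx.
  rewrite -expRD -expR_sum ler_expR big_split /= sumr_const card_ord /bsum mulr_sumr.
  by rewrite lerD2l -[_ *+ n]mulr_natr.
(* For net points met at time [j], preimages contribute [Q^j] through the transfer operator, and the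
   net with the trivial bound contributes [(kap * exp (th * B))^(n - j) <= Q^(n - j)]. The cube
   comes from the quadratic factor in the net size and the sum over [j]. *)
have key n : (0 < n)%N -> \sum_w a n w <= (K + 1) * Ce * n%:R ^+ 3 * (d%:R * expR (th * c)) ^+ n * expR (2 * dl * n%:R).
  move=> n0; apply: le_trans (suma n) _.
  pose Q := d%:R * expR (th * c).
  have Q0 : 0 < Q by rewrite mulr_gt0 ?expR_gt0.
  apply: (@le_trans _ _ (\sum_(j < n) ((K + 1) * n%:R ^+ 2 * Ce * Q ^+ n * expR (2 * dl * n%:R)))); last first.
    rewrite sumr_const card_ord -[_ *+ n]mulr_natl le_eqVlt; apply/orP; left; apply/eqP; exact: r3.
  apply: ler_sum => j _.
  have nj : (n - j = (n - j.+1).+1)%N by rewrite subnSK.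
  have [szE farE] := HE (n - j.+1)%N; rewrite -nj in szE farE.
  have inner p : p \in E (n - j)%N -> \sum_(q <- ifib f j p) (expR (th * bsum f phi n q) * expR (2 * dl * n%:R)) <=
     Ce * Q ^+ j * expR (th * B) ^+ (n - j) * expR (2 * dl * n%:R).
    move=> pE; rewrite -mulr_suml ler_pM2r ?expR_gt0//.
    apply: (@le_trans _ _ (\sum_(q <- ifib f j p) expR (th * B) ^+ (n - j) * expR (th * bsum f phi j q))).
      apply: ler_sum => q _; rewrite -expRM_natr -expRD ler_expR -{1}(subnKC (ltnW (ltn_ord j))) bsumD mulrDr addrC lerD2r.
      rewrite -mulrA ler_pM2l// mulrC; apply: le_trans (ler_norm _) _; exact: bsum_abs.
    rewrite -mulr_sumr sum_ifib// mulrC ler_pM2r ?exprn_gt0 ?expR_gt0//.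
    rewrite /Q exprMn -expRM_natr (_ : th * c * j%:R = th * (j%:R * c)); last by rewrite -mulrA [c * _]mulrC.
    rewrite [leRHS]mulrCA ler_pM2l ?exprn_gt0//; apply: HCe => x xe; exact: farE.
  apply: (@le_trans _ _ (\sum_(p <- E (n - j)%N) (Ce * Q ^+ j * expR (th * B) ^+ (n - j) * expR (2 * dl * n%:R)))).
    by rewrite big_seq [leRHS]big_seq; apply: ler_sum => p; exact: inner.
  rewrite sum_const_seq -[_ *+ _]mulr_natl mulrA ler_pM2r ?expR_gt0//.
  apply: (@le_trans _ _ ((K * (n - j)%N%:R ^+ 2 * kap ^+ (n - j)) * (Ce * Q ^+ j * expR (th * B) ^+ (n - j)))).
    by rewrite ler_wpM2r// !mulr_ge0 ?exprn_ge0 ?expR_ge0 ?(le_trans ler01 Ce1) ?(ltW Q0).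
  have -> : K * (n - j)%N%:R ^+ 2 * kap ^+ (n - j) * (Ce * Q ^+ j * expR (th * B) ^+ (n - j)) =
     K * (n - j)%N%:R ^+ 2 * Ce * (Q ^+ j * (kap * expR (th * B)) ^+ (n - j)).
    by rewrite [(kap * _) ^+ _]exprMn; exact: r5.
  have Qn : Q ^+ j * (kap * expR (th * B)) ^+ (n - j) <= Q ^+ n.
    rewrite (_ : Q ^+ n = Q ^+ j * Q ^+ (n - j)); last by rewrite -exprD subnKC// ltnW.
    rewrite ler_pM2l ?exprn_gt0//.
    by apply: lerXn2r; rewrite ?nnegrE ?(ltW Q0).
  apply: ler_pM => //; first by rewrite !mulr_ge0 ?exprn_ge0 ?(le_trans ler01 Ce1).
    by rewrite mulr_ge0 ?exprn_ge0 ?(ltW Q0).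
  rewrite ler_wpM2r ?(le_trans ler01 Ce1)//; apply: ler_pM; rewrite ?exprn_ge0 ?lerDl//.
  by apply: lerXn2r; rewrite ?nnegrE// ler_nat leq_subr.
(* A lower bound for the logarithm of one factor of [tm], expressed at the actual point instead of
   the shadowing one. *)
pose h x := th * phi x + lk * (1 - chi x).
have bphi : bmf (phi : bX -> R) := cont_bmf cp.
have bh : bmf (h : bX -> R).
  have b1 : bmf ((fun x => th * phi x) : bX -> R) by apply: bmfM => //; exact: bmf_cst.
  have b2 : bmf ((fun x => 1 - chi x) : bX -> R) by apply: bmfB => //; exact: bmf_cst.
  by apply: bmfD => //; apply: bmfM => //; exact: bmf_cst.
have Ih : th * I_ mu (phi : bX -> R) - dl <= I_ mu (h : bX -> R).
  rewrite /h I_D; last 2 first.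
  - by apply: bmfM => //; exact: bmf_cst.
  - by apply: bmfM; [exact: bmf_cst|apply: bmfB => //; exact: bmf_cst].
  have -> : I_ mu (fun x : bX => th * phi x) = th * I_ mu (phi : bX -> R) by exact: I_Z.
  have -> : I_ mu (fun x : bX => lk * (1 - chi x)) = lk * (1 - I_ mu (chi : bX -> R)).
    transitivity (lk * I_ mu (fun x : bX => 1 - chi x)); first by apply: I_Z; apply: bmfB => //; exact: bmf_cst.
    by congr (_ * _); rewrite -[in RHS](I_cst mu 1); apply: I_B => //; exact: bmf_cst.
  rewrite lerD2l; have c1 : 0 <= 1 - I_ mu (chi : bX -> R).
    rewrite subr_ge0 -(I_cst mu 1); apply: I_le => //; first exact: bmf_cst.
    move=> x; have : (\bigcup_i P i) x by rewrite covP.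
    by case=> i _ px; rewrite (chiE i x px) indicE; case: (_ \in _).
  have c2 : (1 - I_ mu (chi : bX -> R)) * (`|lk| + 1) <= dl by rewrite -l1E -ler_pdivlMr// lerBlDr -lerBlDl.
  by have := ler_wpM2r c1 (ler_norm (- lk)); rewrite normrN; exact: wgt c1 c2.
have point n w x : (0 < n)%N -> cylinder f P w x -> expR (bsum f h n x) <= a n w.
  move=> n0 wx; have [q [j [jn qE qx]]] := shad x n n0.
  apply: (@le_trans _ _ (tm n q w)); last first.
    have h3 : tm n q w <= \sum_(q' <- ifib f j (iter j f q)) tm n q' w.
      by apply: (@le_sum_mem _ _ (fun q' => tm n q' w) q) => //; rewrite ifibP.
    apply: le_trans h3 _; have h2 := le_sum_mem (F := fun p => \sum_(q' <- ifib f j p) tm n q' w) qE (fun p => sumr_ge0 _ (fun q' _ => tm0 n q' w)).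
    apply: le_trans h2 _; rewrite /a (bigD1 (Ordinal jn))//= lerDl; apply: sumr_ge0 => j' _.
    by apply: sumr_ge0 => p _; apply: sumr_ge0 => q' _.
  rewrite /bsum expR_sum; apply: ler_prod => i _; rewrite expR_ge0 /= /h expRD.
  have qi := qx i (ltn_ord i).
  apply: ler_pM; rewrite ?expR_ge0//.
    rewrite ler_expR -lerBlDl -mulrBr.
    have := Het _ _ (le_lt_trans qi eg3); rewrite distrC => hh.
    have := le_trans (ler_norm _) (ltW hh) => hh2.
    apply: le_trans (ler_wpM2l (ltW th_gt0) hh2) _.
    by rewrite -[leRHS]mul1r ler_wpM2r// ltW.
  rewrite (chiE (w i) _ (wx i)) indicE /g; case: (boolP (_ \in _)) => [|_].
    rewrite inE => bx; rewrite subrr mulr0 expR0.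
    have -> : dset (Bs (w i)) (iter i f q) <= ep by apply: le_trans (dset_le _ bx) (le_trans qi eg2).
    by rewrite lerDl divr_ge0// ltW.
  by rewrite subr0 mulr1 lnK ?posrE ?divr_gt0// lerDr.
have Kc0 : 0 <= (K + 1) * Ce by rewrite mulr_ge0 ?addr_ge0 ?(le_trans ler01 Ce1).
have [N HN] := cubic_le_exp Kc0 dl_gt0; exists N.+1 => n Nn.
have n0 : (0 < n)%N by exact: leq_trans Nn.
pose A := expR (n%:R * (ln d%:R + th * c + 3 * dl)).
have aA : \sum_w a n w <= A.
  apply: le_trans (key n n0) _.
  apply: (@le_trans _ _ (expR (dl * n%:R) * (d%:R * expR (th * c)) ^+ n * expR (2 * dl * n%:R))).
    rewrite ler_pM2r ?expR_gt0// ler_pM2r ?exprn_gt0 ?mulr_gt0 ?expR_gt0//; apply: HN; exact: ltnW.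
  rewrite -{1}[d%:R]lnK ?posrE// -expRD -expRM_natr -!expRD ler_expR.
  by rewrite le_eqVlt; apply/orP; left; apply/eqP; move: (n%:R : R) (ln _) => u v; ring.
have [bS IS] := bsum_bmf n cf inv bh.
have aw0 w : 0 <= a n w by apply: sumr_ge0 => j _; apply: sumr_ge0 => p _; apply: sumr_ge0 => q _.
have G' := gibbs cf mP mu aw0 (expR_gt0 _) aA bS (fun w x => @point n w x n0).
rewrite IS expRK in G'.
rewrite -lerBrDr -mulrBr in G'; apply: le_trans G' _; rewrite ler_wpM2l//.
by rewrite mulrBr; move: Ih dl4 dl_gt0; clear; move: (th * c) (th * I_ mu _) (I_ mu h) => *; lra.
Qed.
End Entropy.
End Upper.

(** * A Borel ranking of fibres and the lower entropy bound *)

Section Lexicographic.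
Context {R : realType}.
Local Notation C := (Cx R).
Local Notation X := (sphere R).
Implicit Types (x y : X).

(** The distance to infinity gives the modulus of a finite point; those to 1 and to [i] then give
    its real and imaginary parts. Being continuous and separating, these functions define a total
    order with manageable measurability. *)
Definition sep_fun (n : nat) : X -> R := match n with 0 => ch None | 1 => ch (Some 1) | _ => ch (Some iC) end.

Lemma sep_fun_cont n : continuous (sep_fun n).
Proof. by case: n => [|[|n]]; exact: continuous_ch. Qed.

Lemma sep_fun_inj x y : (forall n, sep_fun n x = sep_fun n y) -> x = y.
Proof.
have half (z w : X) : sep_fun 0%N z = sep_fun 0%N w -> z = None -> z = w.
  by move=> /= /[swap] ->; rewrite chxx => /esym/eqP; rewrite ch_eq0 => /eqP.
move=> H; case: x y H => [z|] [w|] H.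
- have n_eq : nrm (z, 1) = nrm (w, 1) by have := H 0%N; rewrite /= !ch_None => /invr_inj.
  have far (p : C) : ch (Some p) (Some z) = ch (Some p) (Some w) -> modulus (p - z) = modulus (p - w).
    rewrite !ch_Some n_eq => /divIf; apply.
    by rewrite mulf_neq0 ?gt_eqF ?(nrm_vec_gt0 (Some p)) ?(nrm_vec_gt0 (Some w)).
  have e0 : modulus z ^+ 2 = modulus w ^+ 2.
    by have := congr1 (fun t => t ^+ 2) n_eq; rewrite /= !sqr_nrm; cbn [fst snd]; move/addIr.
  have e1 : modulus (1 - z) ^+ 2 = modulus (1 - w) ^+ 2 by rewrite (far 1 (H 1%N)).
  have e2 : modulus (iC - z) ^+ 2 = modulus (iC - w) ^+ 2 by rewrite (far iC (H 2%N)).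
  move: e0 e1 e2; rewrite !sqr_mod; case: (z) (w) => [a b] [c d] /= e0 e1 e2.
  by congr (Some (_ +i* _)%C); move: e0 e1 e2; rewrite !expr2; lra.
- by apply/esym; apply: half => //; rewrite H.
- by apply: half => //; exact: H.
- by [].
Qed.

Definition lex y x : Prop := exists2 i, (forall j, (j < i)%N -> sep_fun j y = sep_fun j x) & sep_fun i y < sep_fun i x.

Lemma lex_irr x : ~ lex x x.
Proof. by case=> i _; rewrite ltxx. Qed.

Lemma lex_trans y x z : lex x y -> lex y z -> lex x z.
Proof.
move=> [i Hi xi] [j Hj yj]; have [ij|ji|e] := ltngtP i j.
- exists i; last by rewrite -(Hj i ij).
  by move=> k ki; rewrite Hi// Hj// (ltn_trans ki).
- exists j; last by rewrite (Hi j ji).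
  by move=> k kj; rewrite Hi ?Hj// (ltn_trans kj).
by subst j; exists i; [move=> k ki; rewrite Hi// Hj|exact: lt_trans yj].
Qed.

Lemma lex_total x y : x <> y -> lex x y \/ lex y x.
Proof.
move=> xy; have [n Hn] : exists n, sep_fun n x != sep_fun n y.
  apply: contrapT => H; apply: xy; apply: sep_fun_inj => n; apply/eqP/negPn/negP => h.
  by apply: H; exists n.
have [m Hm min] := ex_minnP (ex_intro (fun n => sep_fun n x != sep_fun n y) n Hn).
have eqm j : (j < m)%N -> sep_fun j x = sep_fun j y.
  by move=> jm; apply/eqP/negPn/negP => /min; rewrite leqNgt jm.
by move: Hm; rewrite neq_lt => /orP[h|h]; [left|right]; exists m => // j /eqm.
Qed.

(** Projections of Borel sets need not be Borel, but projections of closed subsets of a compact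
    square are closed; countable unions of closed sets are therefore stable under the operation that
    defines ranks. *)
Definition fsigma (A : set X) : Prop := exists2 K : nat -> set X, (forall n, closed (K n)) & A = \bigcup_n K n.

Lemma fsigma_countable (I : countType) (K : I -> set X) : (forall i, closed (K i)) -> fsigma (\bigcup_i K i).
Proof.
move=> cK; exists (fun n => if unpickle n is Some i then K i else set0).
  by move=> n; case: (unpickle n) => [i|] //; exact: closed0.
apply/seteqP; split => [x [i _ Kx]|x [n _]]; first by exists (pickle i) => //; rewrite pickleK.
by case: (unpickle n) => [i Kx|//]; exists i.
Qed.

(** The strict inequality of [lex] is replaced by a gap [1 / (m + 1)], so that the set of pairs is
    compact and its projection closed; the union over [i] and [m] recovers [lex]. *)
Lemma closed_shift (f : X -> X) (K : set X) i m : continuous f -> closed K ->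
  closed [set x | exists y, [/\ K y, f y = f x, (forall j, (j < i)%N -> sep_fun j y = sep_fun j x) & sep_fun i y + m.+1%:R^-1 <= sep_fun i x]].
Proof.
move=> cf cK.
have pre (A : set X) (g : (X * X)%type -> X) : continuous g -> closed A -> closed (g @^-1` A).
  by move=> cg cA; apply: closed_comp => // x _; exact: cg.
have c1 : continuous (fst : X * X -> X) by move=> p; exact: cvg_fst.
have c2 : continuous (snd : X * X -> X) by move=> p; exact: cvg_snd.
have cg (h : X -> R) (pr : (X * X)%type -> X) : continuous pr -> continuous h -> continuous (h \o pr : X * X -> R).
  by move=> cp ch p; apply: continuous_comp; [exact: cp|exact: ch].
have cle (u v : (X * X)%type -> R) : continuous u -> continuous v -> closed [set p | u p <= v p].
  move=> cu cv; rewrite (_ : [set p | _] = (fun p => v p - u p) @^-1` [set t | 0 <= t]).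
    apply: closed_comp; last exact: closed_ge.
    by move=> p _; apply: cvgB; [exact: cv|exact: cu].
  by apply/seteqP; split => p /=; rewrite subr_ge0.
pose D : set (X * X) := [set p | [/\ K p.2, f p.2 = f p.1, (forall j, (j < i)%N -> sep_fun j p.2 = sep_fun j p.1) & sep_fun i p.2 + m.+1%:R^-1 <= sep_fun i p.1]].
have ceq (h : X -> R) : continuous h -> closed [set p : X * X | h p.2 = h p.1].
  move=> ch; rewrite (_ : [set p | _] = [set p : X * X | (h \o snd) p <= (h \o fst) p] `&` [set p | (h \o fst) p <= (h \o snd) p]).
    by apply: closedI; apply: cle; exact: cg.
  by apply/seteqP; split => [p /= ->|p [/= h1 h2]]; [split|apply/le_anti/andP].
have cD : closed D.
  rewrite (_ : D = (snd @^-1` K) `&` (\bigcap_(n in [set: nat]) [set p : X * X | (sep_fun n \o f) p.2 = (sep_fun n \o f) p.1])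
     `&` (\bigcap_(j in [set j | (j < i)%N]) [set p : X * X | sep_fun j p.2 = sep_fun j p.1]) `&` [set p : X * X | sep_fun i p.2 + m.+1%:R^-1 <= sep_fun i p.1]).
    apply: closedI; first apply: closedI; first apply: closedI.
    - exact: pre.
    - by apply: closed_bigI => n _; apply: ceq; exact: (cont_pre cf (@sep_fun_cont n)).
    - by apply: closed_bigI => n _; apply: ceq; exact: sep_fun_cont.
    - apply: cle; last exact: (cg (sep_fun i) fst c1 (@sep_fun_cont i)).
      by move=> p; apply: cvgD; [exact: (cg (sep_fun i) snd c2 (@sep_fun_cont i))|exact: cvg_cst].
  apply/seteqP; split => [p [h1 h2 h3 h4]|p [[[h1 h2] h3] h4]]; first by split => //; split => //; split => // n _ /=; rewrite h2.
  by split => //; apply: sep_fun_inj => n; exact: (h2 n I).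
have cXX : compact [set: X * X].
  by rewrite -setXTT; apply: compact_setX; exact: sphere_compact.
have kD : compact D by exact: subclosed_compact cD cXX _.
have := continuous_compact (continuous_subspaceT c1) kD => /(compact_closed sphere_hausdorff).
congr closed; apply/seteqP; split => [_ [[x y] [? ? ? ?] <-]|x [y [? ? ? ?]]]; first by exists y.
by exists (x, y).
Qed.

Section Ranks.
Variables (f : X -> X) (rf : rational_map f).
Local Notation d := (rat_degree f).

(* The rank of a point in its fibre for the Borel total order [lex]; a rational map is injective on the points of a given rank,
   also near critical points. *)
Fixpoint rankset r : set X := if r is r'.+1 then [set x | exists y, [/\ lex y x, f y = f x & rankset r' y]] else setT.

Lemma rankset_fsigma r : fsigma (rankset r).
Proof.
elim: r => [|r [K cK E]] /=.
  by exists (fun=> setT) => //; apply/seteqP; split => // x _; exists 0%N.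
pose J := (nat * nat * nat)%type.
pose T (t : J) := [set x | exists y, [/\ K t.1.1 y, f y = f x, (forall j, (j < t.1.2)%N -> sep_fun j y = sep_fun j x) & sep_fun t.1.2 y + t.2.+1%:R^-1 <= sep_fun t.1.2 x]].
rewrite (_ : [set x | _] = \bigcup_t T t).
  by apply: fsigma_countable => t; apply: closed_shift; [exact: rational_continuous|exact: cK].
apply/seteqP; split => [x [y [[i Hi yx] fyx]]|x [[[n i] m] _ [y [Ky fyx Hi yx]]]].
  rewrite E => -[n _ Kny]; have [m] := ltr_add_invr yx => hm; exists ((n, i), m) => //.
  by exists y; split => //; exact: ltW.
exists y; split => //; last by rewrite E; exists n.
by exists i => //; apply: lt_le_trans yx; rewrite ltrDl invr_gt0.
Qed.

Lemma rankset_meas r : measurable (rankset r : set (borel_sphere R)).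
Proof.
have [K cK ->] := rankset_fsigma r; apply: bigcup_measurable => n _; exact: closed_meas.
Qed.

Lemma rankset_le r r' : (r <= r')%N -> rankset r' `<=` rankset r.
Proof.
have S k : rankset k.+1 `<=` rankset k.
  by elim: k => [|k IH] // x [y [yx fyx Sy]]; exists y; split => //; exact: IH.
by move=> /subnK <-; elim: (r' - r)%N => // k IH x /S/IH.
Qed.

Lemma rankset_chain r x : rankset r x -> exists s : seq X, [/\ size s = r.+1, uniq s & forall y, y \in s -> f y = f x /\ (y = x \/ lex y x)].
Proof.
elim: r x => [|r IH] x; first by move=> _; exists [:: x]; split => // y; rewrite inE => /eqP ->; split => //; left.
move=> [y [yx fyx /IH[s [ss us Hs]]]]; exists (x :: s); split; rewrite /= ?ss//.
  rewrite us andbT; apply/negP => /Hs[_ [xy|xy]]; first by apply: (@lex_irr x); rewrite {1}xy.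
  exact: (@lex_irr x) (lex_trans xy yx).
move=> z; rewrite inE => /orP[/eqP ->|/Hs[fz [->|zy]]]; first by split => //; left.
  by split => //; right.
by split; [rewrite fz|right; exact: lex_trans zy yx].
Qed.

Lemma rankset_empty x : ~ rankset d x.
Proof.
move=> /rankset_chain[s [ss us Hs]].
have : (size s <= size (fib f (f x)))%N.
  by apply: uniq_leq_size => // y /Hs[fy _]; rewrite fibP// fy.
by rewrite ss size_fib// ltnn.
Qed.

Definition rankpart (r : 'I_d) : set (borel_sphere R) := rankset r `\` rankset r.+1.

Lemma rankpart_partition : measurable_partition rankpart.
Proof.
split.
- by move=> r; apply: measurableD; exact: rankset_meas.
- move=> i j _ _ [x [ri rj]]; have [xi ni] := ri; have [xj nj] := rj.
  apply: ord_inj; apply/eqP; rewrite eqn_leq.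
  by apply/andP; split; rewrite leqNgt; apply/negP => h; [apply: nj; exact: rankset_le xi|apply: ni; exact: rankset_le xj].
apply/seteqP; split => // x _.
have [r Hr min] := ex_minnP (ex_intro (fun r => `[< ~ rankset r x >]) d (asboolT (@rankset_empty x))).
have r0 : (0 < r)%N by case: (r) Hr => // /asboolP; case.
have rd : (r <= d)%N by apply: min; apply/asboolP; exact: rankset_empty.
have rd' : (r.-1 < d)%N by rewrite prednK.
exists (Ordinal rd') => //; split; last by rewrite (_ : (Ordinal rd').+1 = r); [exact/asboolP|exact: prednK].
by apply: contrapT => h; have := min r.-1 (asboolT h); rewrite leqNgt prednK// leqnn.
Qed.

Lemma rankpart_inj r x y : rankpart r x -> rankpart r y -> f x = f y -> x = y.
Proof.
move=> [xr nx] [yr ny] fxy; apply: contrapT => /lex_total[h|h]; first by apply: ny; exists x.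
by apply: nx; exists y.
Qed.

Lemma deriv_eq0 (p : {poly C}) : (p^`())%R = 0 -> (size p <= 1)%N.
Proof.
move=> dp; apply/leq_sizeP => -[//|j] _; have := congr1 (fun q : {poly C} => q`_j) dp.
by rewrite coef_deriv coef0 => /eqP; rewrite mulrn_eq0 => /orP[//|/eqP].
Qed.

(** A multiple point of a fibre in the plane is a zero of the Wronskian of numerator and
    denominator, which does not vanish identically because the fraction is in lowest terms and not
    constant. Infinity is simply added to the list. *)
Lemma critical_points : exists cs : seq X, forall x, (2 <= count_mem x (fib f (f x)))%N -> x \in cs.
Proof.
have [[cop dg] fE] := rational_spec rf; move: cop dg fE; case E : (fraction_of f) => [p q] /= cop dg fE.
pose W : {poly C} := p^`() * q - p * q^`().
have W0 : W != 0.
  apply/eqP => /eqP; rewrite subr_eq0 => /eqP e.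
  have q' : q^`() = 0.
    apply/eqP/negPn/negP => nz; have : q %| q^`().
      by rewrite -(Gauss_dvdpr (q^`()) (_ : coprimep q p)) -?e ?dvdp_mull// coprimep_sym.
    by move=> /(dvdp_leq nz); rewrite leqNgt lt_size_deriv// (contraNneq _ nz)// => ->; rewrite deriv0.
  have qn : q != 0.
    apply/eqP => q0; move: cop; rewrite q0 coprimep0 => /eqp_size; rewrite size_poly1 => sp.
    by move: dg; rewrite /deg /frac_size /= q0 size_poly0 sp.
  have p' : p^`() = 0.
    by apply/eqP; move/eqP: e; rewrite q' mulr0 mulf_eq0 (negPf qn) orbF.
  have := deriv_eq0 p'; have := deriv_eq0 q'; move: dg; rewrite /deg /frac_size /=; lia.
exists (None :: [seq Some z | z <- roots W]) => -[z|] // cz; rewrite inE; apply/orP; right; apply: map_f.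
suff : root W z by rewrite [in root W z](rootsE W) rootZ ?lead_coef_eq0// root_prod_XsubC.
have dbl (h : {poly C}) : h != 0 -> (2 <= mup z h)%N -> h.[z] = 0 /\ h^`().[z] = 0.
  move=> h0; rewrite mup_geq// => /dvdpP[u ->]; rewrite expr2 mulrA.
  by split; rewrite ?derivM ?hornerE ?derivM ?derivXsubC ?hornerE subrr !(mulr0, mul0r, addr0).
have h0 := fibpoly_neq0 (f (Some z)) (rational_spec rf).1.
have := cz; rewrite -multiplicityE// /multiplicity.
have -> : fiber_poly f (f (Some z)) = fibpoly (fraction_of f) (f (Some z)) by rewrite /fiber_poly; case: (fraction_of f) => ? ?; case: (f _).
move=> /(dbl _ h0); rewrite E; rewrite /W; case: (f (Some z)) => [w|] /= [h1 h2].
  move: h1 h2; rewrite derivB derivZ !hornerD !hornerN !hornerZ => /eqP; rewrite subr_eq0 => /eqP h1 /eqP; rewrite subr_eq0 => /eqP h2.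
  by apply/rootP; rewrite !hornerE h1 h2; ring.
by apply/rootP; rewrite !hornerE h1 h2; ring.
Qed.

Section Jacobian.
Variable nu : probability (borel_sphere R) R.
Hypotheses (bal : balanced f nu) (na : non_atomic nu).
Local Notation bX := (borel_sphere R).

(** Over a noncritical value the fibre has [d] distinct points, at most one of them in [A], so
    [Lr f] of the indicator is at most [1 / d]; critical values are finitely many and carry no mass.
    Inner regularity reduces the claim to a closed set [F]. *)
Lemma injective_piece (A B : set bX) : measurable A -> measurable B -> (forall x y, A x -> A y -> f x = f y -> x = y) ->
  prob nu (A `&` f @^-1` B) <= d%:R^-1 * prob nu B.
Proof.
move=> mA mB injA; have cf := rational_continuous rf; have [cs Hcs] := critical_points.
have mAB : measurable (A `&` f @^-1` B).
  by apply: measurableI => //; have := contX_meas cf measurableT mB; rewrite setTI.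
have d0 : 0 < d%:R :> R by rewrite ltr0n rat_degree_gt0.
apply/ler_addgt0Pr => e e0; have [F cF [FA h]] := prob_regular nu mAB e0.
apply: (@le_trans _ _ (prob nu F + e)); first by rewrite -lerBlDl ltW.
rewrite lerD2r.
have cfF : closed (f @` F).
  apply: compact_closed; first exact: sphere_hausdorff.
  by apply: continuous_compact; [exact: continuous_subspaceT|exact: closed_sphere_compact].
pose g (y : bX) : R := d%:R^-1 * \1_(f @` F) y + \sum_(c <- cs) \1_[set f c] y.
have b1 : bmf (\1_(f @` F) : bX -> R) by apply: bmf_indic; exact: closed_meas.
have b1' : bmf ((fun y => d%:R^-1 * \1_(f @` F) y) : bX -> R) by apply: bmfM => //; exact: bmf_cst.
have b2 : bmf ((fun y => \sum_(c <- cs) \1_[set f c] y) : bX -> R).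
  by apply: (@bmf_sum _ bX R _ cs (fun c => \1_[set f c])) => c; apply: bmf_indic; exact: point_meas.
apply: (@le_trans _ _ (I_ nu g)); last first.
  rewrite /g (I_D nu b1' b2) (_ : I_ nu (fun y : bX => \sum_(c <- cs) \1_[set f c] y) = 0).
    rewrite addr0 (_ : I_ nu (fun y : bX => d%:R^-1 * \1_(f @` F) y) = d%:R^-1 * prob nu (f @` F)).
      rewrite ler_pM2l ?invr_gt0//; apply: prob_le => //; first exact: closed_meas.
      by move=> _ [x /FA[_ Bx] <-].
    by rewrite -(I_indic nu (closed_meas cfF)); exact: I_Z.
  rewrite (@I_sum _ bX R nu _ cs (fun c => \1_[set f c])); last by move=> c; apply: bmf_indic; exact: point_meas.
  apply: big1 => c _; rewrite I_indic; last exact: point_meas.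
  by rewrite /prob na.
apply: (balanced_closed_le rf bal cF); first exact: bmfD.
move=> y; have sum0 : 0 <= \sum_(c <- cs) \1_[set f c] y :> R by apply: sumr_ge0 => c _; rewrite indic1 ler0n.
have L_le1 : Lr f \1_F y <= 1.
  by rewrite -(Lr_cst 1 y rf); apply: Lr_le => x _; rewrite indicE; case: (_ \in _).
have [[c cc fc]|nc] := pselect (exists2 c, c \in cs & f c = y).
  apply: le_trans L_le1 _; rewrite /g; apply: ler_wpDl; first by rewrite mulr_ge0 ?invr_ge0 ?ler0n// indicE ler0n.
  have := @le_sum_mem R _ cs (fun c => \1_[set f c] y) c cc; rewrite indic1 fc eqxx; apply.
  by move=> c'; rewrite indic1 ler0n.
rewrite /g; apply: ler_wpDr => //; rewrite /Lr ler_pM2l ?invr_gt0//.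
have uf : uniq (fib f y).
  apply: count_mem_uniq => x; case: (boolP (x \in fib f y)) => xy; last by rewrite (count_memPn xy).
  have fx : f x = y by apply/eqP; rewrite -fibP.
  have : (count_mem x (fib f y) < 2)%N.
    by rewrite ltnNge; apply/negP => h2; apply: nc; exists x => //; apply: Hcs; rewrite fx.
  by move: xy; rewrite -has_pred1 has_count => + lt2; case: (count_mem x (fib f y)) lt2 => [|[|]].
have [[x Fx fx]|nF] := pselect (exists2 x, F x & f x = y).
  have xin : x \in fib f y by rewrite fibP// fx.
  rewrite (bigD1_seq x)//= big1_seq ?addr0; last first.
    move=> z /andP[zx zy]; rewrite indicE memNset// => Fz.
    have fz : f z = y by apply/eqP; rewrite -fibP.
    by move/eqP: zx; apply; apply: injA; [exact: (FA z Fz).1|exact: (FA x Fx).1|rewrite fz fx].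
  by rewrite !indicE !mem_set//; exists x.
rewrite big1_seq ?indicE ?ler0n// => z /andP[_ zy]; rewrite indicE memNset// => Fz.
by apply: nF; exists z => //; apply/eqP; rewrite -fibP.
Qed.

Lemma rank_cylinder n (w : {ffun 'I_n -> 'I_d}) : prob nu (cylinder f rankpart w) <= d%:R ^- n.
Proof.
have cf := rational_continuous rf; have mP := rankpart_partition.
elim: n w => [|n IH] w; first by rewrite invr1 prob_le1//; exact: (cylinder_meas cf mP).
pose w' : {ffun 'I_n -> 'I_d} := [ffun i => w (lift ord0 i)].
have mw := cylinder_meas cf mP w'; have mr : measurable (rankpart (w ord0)) by have [h _ _] := mP; exact: h.
have d0 : 0 < d%:R :> R by rewrite ltr0n rat_degree_gt0.
apply: (@le_trans _ _ (prob nu (rankpart (w ord0) `&` f @^-1` cylinder f rankpart w'))).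
  apply: prob_le; [exact: (cylinder_meas cf mP)| |].
    by apply: measurableI => //; have := contX_meas cf measurableT mw; rewrite setTI.
  move=> x wx; split; first exact: (wx ord0).
  by move=> i; rewrite ffunE -iterSr; exact: (wx (lift ord0 i)).
apply: le_trans (injective_piece mr mw _) _; first by move=> x y; exact: rankpart_inj.
by rewrite exprS invfM ler_pM2l ?invr_gt0.
Qed.

Lemma entropy_lower n : n%:R * ln d%:R <= join_entropy nu f rankpart n.
Proof.
have cf := rational_continuous rf; have mP := rankpart_partition.
have d0 : 0 < d%:R :> R by rewrite ltr0n rat_degree_gt0.
rewrite /join_entropy -sumrN -[leLHS]mul1r -[X in X * _](sum_prob_cylinder cf mP nu n) mulr_suml.
apply: ler_sum => w _; rewrite -/(prob nu _) -mulrN.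
have := prob_ge0 nu (cylinder f rankpart w); rewrite le_eqVlt => /orP[/eqP <-|p0]; first by rewrite !mul0r.
rewrite ler_pM2l// lerNr.
have h : ln (prob nu (cylinder f rankpart w)) <= ln (d%:R ^- n).
  by rewrite ler_ln ?posrE ?invr_gt0 ?exprn_gt0//; exact: rank_cylinder.
by apply: le_trans h _; rewrite lnV ?posrE ?exprn_gt0// lnXn// mulr_natl.
Qed.
End Jacobian.
End Ranks.
End Lexicographic.

Section MaximalEntropy.
Context {R : realType}.
Local Notation X := (sphere R).
Local Notation bX := (borel_sphere R).
Implicit Types (mu nu : probability bX R) (f : X -> X).

(* A divergent sequence has the junk limit [0], whence the maximum. *)
Lemma limn_le_max (u : nat -> R) (b : R) :
  (forall e : R, 0 < e -> exists N : nat, forall n, (N <= n)%N -> u n <= b + e) -> limn u <= Num.max 0 b.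
Proof.
move=> H; have [cu|ncu] := pselect (cvgn u); last first.
  by rewrite (dvgP ncu) le_max; apply/orP; left.
rewrite le_max; apply/orP; right; apply/ler_addgt0Pr => e e0; have [N HN] := H e e0.
by apply: limr_le => //; near=> n; apply: HN; near: n; exact: nbhs_infty_ge.
Unshelve. all: end_near.
Qed.

Lemma le_entropy mu f (b : R) : (forall k (P : 'I_k -> set bX), measurable_partition P -> partition_entropy mu f P <= b) ->
  (entropy mu f <= b%:E)%E.
Proof. by move=> H; apply: ge_ereal_sup => _ [k [P [mP ->]]]; rewrite lee_fin; exact: H. Qed.

Section Fixed.
Variables (f : X -> X) (nu : probability bX R).
Hypotheses (rf : rational_map f) (d1 : (1 < rat_degree f)%N).
Hypotheses (bal : balanced f nu) (na : non_atomic nu).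
Local Notation d := (rat_degree f).

Let ld_gt0 : 0 < ln d%:R :> R.
Proof. by rewrite ln_gt0// (ltr_nat R 1). Qed.

Lemma entropy_le (phi : X -> R) (e : R) : continuous phi -> 0 < e -> exists2 th : R, 0 < th <= 1 &
  forall mu, invariant_measure f mu ->
  (entropy mu f <= (Num.max 0 (ln d%:R + th * (I_ nu phi + e - I_ mu phi)))%:E)%E.
Proof.
move=> cp e0; have [th th01 H] := entropy_upper rf d1 bal na cp e0; exists th => // mu inv.
apply: le_entropy => k P mP; apply: limn_le_max => e' e'0; have [N HN] := H mu k P e' inv mP e'0.
exists N.+1 => n Nn; have n0 : 0 < n%:R :> R by rewrite ltr0n (leq_trans _ Nn).
by rewrite ler_pdivrMl//; apply: HN; exact: ltnW.
Qed.

Lemma invariant_entropy_le mu : invariant_measure f mu -> (entropy mu f <= (ln d%:R)%:E)%E.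
Proof.
move=> inv; apply: le_entropy => k P mP; rewrite -[leRHS](_ : Num.max 0 (ln d%:R) = _); last exact/max_idPr/ltW.
apply: limn_le_max => e e0; have e20 : 0 < e / 2 by rewrite divr_gt0.
have [th /andP[th0 th1] H] := entropy_upper rf d1 bal na (@cont_cst R 0) e20.
have [N HN] := H mu k P (e / 2) inv mP e20.
exists N.+1 => n Nn; have n0 : 0 < n%:R :> R by rewrite ltr0n (leq_trans _ Nn).
rewrite ler_pdivrMl//; apply: le_trans (HN n (ltnW Nn)) _; rewrite ler_pM2l// !I_cst add0r subr0.
rewrite -addrA lerD2l; have := ler_wpM2r (ltW e20) th1; rewrite mul1r.
by move: (th * _) => t ?; lra.
Qed.

(** The rank partition attains [ln d]. Its entropy is a [limn], so the lower bound alone does not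
    suffice: [entropy_upper] with [phi = 0] supplies the convergence. *)
Lemma balanced_entropy : entropy nu f = (ln d%:R)%:E.
Proof.
apply/le_anti; rewrite invariant_entropy_le /=; last exact: (balanced_invariant rf bal).
apply: ereal_sup_ubound; exists d, (@rankpart R f); split; first exact: (rankpart_partition rf).
congr EFin; rewrite /partition_entropy; apply/esym/cvg_lim; first exact: Rhausdorff.
apply/cvgrPdist_le => e e0; have e20 : 0 < e / 2 by rewrite divr_gt0.
have [th /andP[th0 th1] H] := entropy_upper rf d1 bal na (@cont_cst R 0) e20.
have [N HN] := H nu _ _ (e / 2) (balanced_invariant rf bal) (rankpart_partition rf) e20.
near=> n; have Nn : (N < n)%N by near: n; exact: nbhs_infty_gt.
have n0 : 0 < n%:R :> R by rewrite ltr0n (leq_trans _ Nn).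
have lo : ln d%:R <= n%:R^-1 * join_entropy nu f (@rankpart R f) n.
  by rewrite ler_pdivlMl//; exact: (entropy_lower rf bal na).
have up : n%:R^-1 * join_entropy nu f (@rankpart R f) n <= ln d%:R + e.
  rewrite ler_pdivrMl//; apply: le_trans (HN n (ltnW Nn)) _; rewrite ler_pM2l// !I_cst add0r subr0.
  rewrite -addrA lerD2l; have := ler_wpM2r (ltW e20) th1; rewrite mul1r.
  by move: (th * _) => t ?; lra.
by rewrite distrC ger0_norm ?subr_ge0// lerBlDl.
Unshelve. all: end_near.
Qed.

Theorem balanced_max_entropy : max_entropy_measure f nu.
Proof.
split.
  by split; [exact: (balanced_invariant rf bal)|move=> mu inv; rewrite balanced_entropy; exact: invariant_entropy_le].
move=> mu [inv Hmu]; have big : ((ln d%:R)%:E <= entropy mu f)%E.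
  by rewrite -balanced_entropy; apply: Hmu; exact: (balanced_invariant rf bal).
(* As [ln d > 0], the maximum with 0 is harmless, and dividing by [th > 0] leaves
   [I_ mu phi <= I_ nu phi + e]. *)
have le phi : continuous phi -> I_ mu (phi : bX -> R) <= I_ nu (phi : bX -> R).
  move=> cp; apply/ler_addgt0Pr => e e0; have [th /andP[th0 _] H] := entropy_le cp e0.
  have := le_trans big (H mu inv); rewrite lee_fin le_max leNgt ld_gt0 /= lerDl pmulr_rge0//.
  by rewrite subr_ge0.
apply: cont_same_measure => phi cp; apply/le_anti; rewrite le//=.
by have := le _ (contN cp); rewrite !I_N ?lerN2//; exact: cont_bmf.
Qed.
End Fixed.
End MaximalEntropy.

Theorem theorem19 (R : realType) (F : set (sphere R -> sphere R))
    (F_rational : F `<=` rational_map) (F_admissible : admissible F)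
    (F_amenable : right_amenable (@semigroup_mul R F) continuous_functions
                    (@lyubich_rep R F)) :
  exists mS : probability (borel_sphere R) R,
    [/\ non_atomic mS /\ lyubich_measure (generated F) mS,
        forall nu : probability (borel_sphere R) R,
          non_atomic nu -> lyubich_measure (generated F) nu ->
          same_measure nu mS &
        forall s, generated F s -> (1 < rat_degree s)%N ->
          max_entropy_measure s mS].
Proof.
have [g [nu [Fg dg na bal]]] := nonatomic_balanced F_rational F_admissible F_amenable.
have rS := generated_rational F_rational.
exists nu; split.
- by split => //; apply/lyubich_measureP.
- move=> mu nam /(lyubich_measureP _ rS) balm; have gg : generated F g by exact: generated_in.
  exact: balanced_unique (rS _ gg) dg (balm _ gg) (bal _ gg) nam na.
- by move=> s ss ds; apply: balanced_max_entropy => //; [exact: rS|exact: bal].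
Qed.
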